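(* $(L_{\mathcal{L}}(\ell_{123},0),\phi)$ is a unitary vertex operator algebra (with respect to the Hermitian form normalized by $(\mathbf{1},\mathbf{1})=1$ and contravariant for $\sigma$) if and only if one of the following holds: (1) $\ell_2=0$, $\ell_3=0$, and $\ell_1\in\mathbb{R}_{\ge1}$ or $\ell_1=c_m$ for some $m\in\mathbb{Z}_{\ge2}$; (2) $\ell_2=0$, $\ell_3\in\mathbb{R}_{>0}$, and $\ell_1\in\mathbb{R}_{\ge2}$ or $\ell_1=1+c_m$ for some $m\in\mathbb{Z}_{\ge2}$.
   Context: The rank one twisted Heisenberg–Virasoro algebra $\mathcal{L}$ is the complex Lie algebra with basis $\{L_n,I_n,c_1,c_2,c_3: n\in\mathbb{Z}\}$ and brackets $[L_m,L_n]=(m-n)L_{m+n}+\delta_{m+n,0}\frac{m^3-m}{12}c_1$, $[L_m,I_n]=-nI_{m+n}-\delta_{m+n,0}(m^2+m)c_2$, $[I_m,I_n]=m\delta_{m+n,0}c_3$, and $c_1,c_2,c_3$ central. $V_{\mathcal{L}}(\ell_{123},0)=U(\mathcal{L})\otimes_{U(\mathcal{L}_{(\le1)})}\mathbb{C}_{\ell_{123}}$, where $\mathcal{L}_{(\le 1)}=\mathrm{span}\{L_n: n\ge -1\}\oplus\mathrm{span}\{I_n:n\ge 0\}\oplus\sum_i\mathbb{C}c_i$ acts on $\mathbb{C}_{\ell_{123}}=\mathbb{C}$ by $L_n,I_n\mapsto0$, $c_i\mapsto\ell_i$; it is a VOA with vacuum $\mathbf{1}=1\otimes1$, conformal vector $\omega=L_{-2}\mathbf{1}$,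 $Y(L_{-2}\mathbf{1},x)=\sum L_nx^{-n-2}$, $Y(I_{-1}\mathbf{1},x)=\sum I_nx^{-n-1}$. $L_{\mathcal{L}}(\ell_{123},0)$ is its quotient by its maximal proper $\mathcal{L}$-submodule (a CFT-type VOA). $\phi$ is the anti-linear involution induced from $I_{-k_1}\cdots I_{-k_s}L_{-m_1}\cdots L_{-m_r}\mathbf{1}\mapsto(-1)^sI_{-k_1}\cdots I_{-k_s}L_{-m_1}\cdots L_{-m_r}\mathbf{1}$. $\sigma$ is the anti-linear anti-involution of $\mathcal{L}$ with $\sigma(L_n)=L_{-n}$, $\sigma(I_n)=I_{-n}-2\delta_{n,0}c_2$, $\sigma(c_1)=c_1$, $\sigma(c_3)=c_3$, $\sigma(c_2)=-c_2$; the Hermitian form $(\cdot,\cdot)$ on $L_{\mathcal{L}}(\ell_{123},0)$ is the unique one with $(\mathbf{1},\mathbf{1})=1$ and $(xu,v)=(u,\sigma(x)v)$ for $x\in\mathcal{L}$. A CFT-type VOA $V$ with anti-linear involution $\phi$ (anti-linear automorphism of order 2: $\phi(\mathbf{1})=\mathbf{1}$, $\phi(\omega)=\omega$, $\phi(u_nv)=\phi(u)_n\phi(v)$) is unitary if there is a positive definite Hermitian form, linear in the first and anti-linear in the second argument, with $(Y(e^{zL(1)}(-z^{-2})^{L(0)}a,z^{-1})u,v)=(u,Y(\phi(a),z)v)$ for all $a,u,v\in V$, where $Y(\omega,z)=\sum L(n)z^{-n-2}$. $c_m=1-\frac{6}{m(m+1)}$ for $m\in\mathbb{Z}_{\ge2}$.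 *)

(* Defs.v *)
(* mathcomp + mathcomp-analysis (reals) + mathcomp-real-closed (complex). *)
From HB Require Import structures.
From mathcomp Require Import all_boot all_order all_algebra.
From mathcomp Require Import reals.
From mathcomp Require Import complex.

Set Implicit Arguments.
Unset Strict Implicit.
Unset Printing Implicit Defensive.

Import Order.TTheory GRing.Theory Num.Theory.
Local Open Scope ring_scope.

(* Scalars: C := R[i] for a realType R (a complete archimedean ordered field, *)
(* i.e. a model of the reals), so C is (a model of) the complex numbers.      *)
(* A vertex algebra on V is encoded by its modes: Y u n v = u_n v, i.e.       *)
(* Y(u,x) = \sum_n u_n x^{-n-1}.                                              *)

Section VOA.
Variable R : realType.
Local Notation C := (R[i]).
Variable V : lmodType C.
Variable Y : V -> int -> V -> V.

(* generalized binomial coefficient  binom(r, i)  for r : int *)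
Definition binC (r : int) (i : nat) : C :=
  (\prod_(j < i) (r%:~R - j%:R)) / (i`!)%:R.

(* L(n) := omega_{n+1},  I_n := I_n (modes of the Heisenberg field) *)
Definition Lop (om : V) (n : int) : V -> V := Y om (n + 1).
Definition Iop (I : V) (n : int) : V -> V := Y I n.

Definition va_bilinear : Prop :=
  (forall n (a : C) u1 u2 v, Y (a *: u1 + u2) n v = a *: Y u1 n v + Y u2 n v) /\
  (forall n (a : C) u v1 v2, Y u n (a *: v1 + v2) = a *: Y u n v1 + Y u n v2).

Definition va_truncation : Prop :=
  forall u v, exists N : int, forall n : int, N <= n -> Y u n v = 0.

Definition va_vacuum (one : V) : Prop :=
  (forall n v, Y one n v = if n == -1 then v else 0) /\
  (forall u, Y u (-1) one = u) /\
  (forall u n, 0 <= n -> Y u n one = 0).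

(* Borcherds (Jacobi) identity, component form; the sums are finite thanks to  *)
(* truncation, and we require equality of the partial sums up to any N beyond  *)
(* which all the summands vanish.                                             *)
Definition va_borcherds : Prop :=
  forall (a b c : V) (p q r : int) (N : nat),
    (forall i : nat, (N <= i)%N ->
       [/\ Y a (r + i%:Z) b = 0, Y b (q + i%:Z) c = 0 & Y a (p + i%:Z) c = 0]) ->
    \sum_(i < N) binC p i *: Y (Y a (r + i%:Z) b) (p + q - i%:Z) c =
    \sum_(i < N) ((-1) ^+ i * binC r i) *:
        (Y a (p + r - i%:Z) (Y b (q + i%:Z) c)
         - (-1) ^+ `|r|%N *: Y b (q + r - i%:Z) (Y a (p + i%:Z) c)).

Definition virasoro (om : V) (c : C) : Prop :=
  forall (m n : int) v,
    Lop om m (Lop om n v) - Lop om n (Lop om m v) =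
    (m - n)%:~R *: Lop om (m + n) v
    + (if m + n == 0 then ((m ^+ 3 - m)%:~R / 12%:R) * c else 0) *: v.

(* L(-1)-derivative property: Y(L(-1)u,x) = d/dx Y(u,x) *)
Definition l_minus1_derivative (om : V) : Prop :=
  forall u (n : int) v, Y (Lop om (-1) u) n v = - (n%:~R) *: Y u (n - 1) v.

(* v has L(0)-weight k *)
Definition has_weight (om : V) (k : int) (v : V) : Prop :=
  Lop om 0 v = k%:~R *: v.

(* V = (+)_{k in Z} V_(k), V_(k) the L(0)-eigenspace of eigenvalue k,        *)
(* dim V_(k) < oo, V_(k) = 0 for k small enough                               *)
Definition l0_graded (om : V) : Prop :=
  [/\ (forall v, exists (s : nat) (k : 'I_s -> int) (w : 'I_s -> V),
          (forall i, has_weight om (k i) (w i)) /\ v = \sum_i w i),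
      (forall k : int, exists (s : nat) (b : 'I_s -> V),
          forall v, has_weight om k v -> exists a : 'I_s -> C, v = \sum_i a i *: b i)
    & (exists N : int, forall k v, k < N -> has_weight om k v -> v = 0)].

(* (V, Y, one, om) is a vertex operator algebra of central charge c *)
Definition is_VOA (one om : V) (c : C) : Prop :=
  [/\ va_bilinear, va_truncation, va_vacuum one & va_borcherds] /\
  [/\ virasoro om c, l_minus1_derivative om & l0_graded om].

(* CFT type: V_(k) = 0 for k < 0 and V_(0) = C one *)
Definition CFT_type (one om : V) : Prop :=
  (forall k v, k < 0 -> has_weight om k v -> v = 0) /\
  (forall v, has_weight om 0 v -> exists a : C, v = a *: one).

(* a (Prop-valued) subspace of V stable under all L(n) and I_n *)
Definition is_L_submodule (om I : V) (W : V -> Prop) : Prop :=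
  [/\ W 0,
      (forall (a : C) u v, W u -> W v -> W (a *: u + v)),
      (forall n v, W v -> W (Lop om n v))
    & (forall n v, W v -> W (Iop I n v))].

(* (V, Y, one, om, I) realizes L_cL(l1 l2 l3, 0): a nonzero CFT-type VOA of  *)
(* central charge l1 whose conformal vector om and weight-one vector I have   *)
(* modes L(n) = om_{n+1}, I_n = I_n satisfying the brackets of cL with c_i    *)
(* acting as l_i, and which is generated by one and irreducible as a cL-module *)
(* (i.e. V is V_cL(l123,0) modulo its maximal proper submodule).              *)
Definition is_LL (l1 l2 l3 : C) (one om I : V) : Prop :=
  [/\ is_VOA one om l1, CFT_type one om & one <> 0] /\
  [/\ (forall (m n : int) v,
         Lop om m (Iop I n v) - Iop I n (Lop om m v) =
         - (n%:~R) *: Iop I (m + n) v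
         - (if m + n == 0 then (m ^+ 2 + m)%:~R * l2 else 0) *: v),
      (forall (m n : int) v,
         Iop I m (Iop I n v) - Iop I n (Iop I m v) =
         (if m + n == 0 then m%:~R * l3 else 0) *: v),
      (forall W, is_L_submodule om I W -> W one -> forall v, W v)
    & (forall W, is_L_submodule om I W -> (exists w, W w /\ w <> 0) ->
         forall v, W v)].

(* I_{-k1} ... I_{-ks} L_{-m1} ... L_{-mr} one *)
Definition mono (one om I : V) (ks ms : seq nat) : V :=
  foldr (fun k w => Iop I (- (k%:Z)) w)
        (foldr (fun m w => Lop om (- (m%:Z)) w) one ms) ks.

Definition antilinear (f : V -> V) : Prop :=
  forall (a : C) u v, f (a *: u + v) = a^* *: f u + f v.

(* phi is the anti-linear map induced from                                    *)
(* I_{-k1}..I_{-ks} L_{-m1}..L_{-mr} one |-> (-1)^s I_{-k1}..L_{-mr} one       *)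
(* (PBW monomials: k1 >= .. >= ks >= 1, m1 >= .. >= mr >= 2)                   *)
Definition is_phi (one om I : V) (phi : V -> V) : Prop :=
  antilinear phi /\
  forall ks ms : seq nat,
    sorted geq ks -> all (fun k => 0 < k)%N ks ->
    sorted geq ms -> all (fun m => 1 < m)%N ms ->
    phi (mono one om I ks ms) = (-1) ^+ size ks *: mono one om I ks ms.

(* anti-linear involution of the VOA *)
Definition antilinear_involution (one om : V) (phi : V -> V) : Prop :=
  [/\ antilinear phi, phi one = one, phi om = om,
      (forall u n v, phi (Y u n v) = Y (phi u) n (phi v))
    & (forall v, phi (phi v) = v)].

(* Hermitian form: linear in the first, anti-linear in the second argument *)
Definition hermitian (h : V -> V -> C) : Prop :=
  (forall (a : C) u1 u2 v, h (a *: u1 + u2) v = a * h u1 v + h u2 v) /\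
  (forall u v, h v u = (h u v)^*).

Definition positive_definite (h : V -> V -> C) : Prop :=
  forall v, v <> 0 -> 0 < h v v.

(* (Y(e^{zL(1)}(-z^{-2})^{L(0)} a, z^{-1}) u, v) = (u, Y(phi a, z) v),          *)
(* written coefficientwise (coefficient of z^{-m-1}) for a of L(0)-weight k:    *)
(* (u, phi(a)_m v) = sum_{j>=0} (-1)^k / j! ((L(1)^j a)_{2k-j-m-2} u, v);       *)
(* general a are sums of homogeneous ones and both sides are linear in a.       *)
Definition invariant_form (om : V) (phi : V -> V) (h : V -> V -> C) : Prop :=
  forall (a : V) (k : int), has_weight om k a ->
  forall N : nat, iter N (Lop om 1) a = 0 ->
  forall (m : int) u v,
    h u (Y (phi a) m v) =
    \sum_(j < N) ((-1) ^+ `|k|%N / (j`!)%:R) *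
                 h (Y (iter j (Lop om 1) a) (2 * k - j%:Z - m - 2) u) v.

(* unitary VOA (V, phi), for V of CFT type *)
Definition unitary_VOA (one om : V) (phi : V -> V) : Prop :=
  antilinear_involution one om phi /\
  exists h, [/\ hermitian h, positive_definite h & invariant_form om phi h].

(* contravariance (x u, v) = (u, sigma(x) v) for x in cL, where               *)
(* sigma(L_n) = L_{-n}, sigma(I_n) = I_{-n} - 2 delta_{n,0} c_2,               *)
(* sigma(c_1) = c_1, sigma(c_2) = - c_2, sigma(c_3) = c_3, c_i acting as l_i.  *)
Definition sigma_contravariant (l1 l2 l3 : C) (om I : V) (h : V -> V -> C) : Prop :=
  [/\ (forall n u v, h (Lop om n u) v = h u (Lop om (- n) v)),
      (forall n u v, h (Iop I n u) v =
                     h u (Iop I (- n) v - (if n == 0 then 2%:R * l2 else 0) *: v)),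
      (forall u v, h (l1 *: u) v = h u (l1 *: v)),
      (forall u v, h (l2 *: u) v = h u ((- l2) *: v))
    & (forall u v, h (l3 *: u) v = h u (l3 *: v))].

(* (L, phi) is unitary with respect to the Hermitian form normalized by       *)
(* (one, one) = 1 and contravariant for sigma                                 *)
Definition unitary_wrt_sigma (l1 l2 l3 : C) (one om I : V) (phi : V -> V) : Prop :=
  antilinear_involution one om phi /\
  exists h, [/\ hermitian h, positive_definite h, invariant_form om phi h,
                h one one = 1 & sigma_contravariant l1 l2 l3 om I h].

End VOA.

(* c_m = 1 - 6 / (m (m+1)) *)
Definition cmin (R : realType) (m : nat) : R[i] := 1 - 6%:R / (m * m.+1)%:R.

Definition unitarity_condition (R : realType) (l1 l2 l3 : R[i]) : Prop :=
  (l2 = 0 /\ l3 = 0 /\ (1 <= l1 \/ exists m : nat, (2 <= m)%N /\ l1 = cmin R m)) \/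
  (l2 = 0 /\ 0 < l3 /\ (2%:R <= l1 \/ exists m : nat, (2 <= m)%N /\ l1 = 1 + cmin R m)).

(* Main.v *)
(* Since V is generated by the vacuum and irreducible, positivity of the contravariant
   form is a question about Gram matrices of words applied to the vacuum. Contravariance
   forces l2 = 0 and l3 = |I|^2 >= 0. If l3 = 0 then I acts by 0. If l3 > 0, subtracting
   the Sugawara operators of the Heisenberg field from the L_n leaves a Virasoro action of
   central charge l1 - 1 that commutes with all the I_n, and positivity reduces, one
   oscillator at a time, to that of the span of its words on the vacuum. It remains to see
   for which c all the vacuum Gram matrices of the Virasoro algebra are positive
   semidefinite: exactly for c >= 1 and for c = c_m.
   - For c > 1 and h > 0 the Kac determinant has no zero and the form is positive for large
     h; let c -> 1 and h -> 0.
   - For c = c_m, the Goddard-Kent-Olive coset of level m - 2 fermionic sl2 currents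
     realizes the vacuum module in a Fock space with a positive form.
   - For c strictly between c_M and c_(M+1), the determinant at h = 0 and level M(M+1),
     with the zeros due to L_(-1) divided out, differs from the one at c_(M+2) by the sign
     of exactly one factor of the Kac determinant.
   The Kac determinant comes from explicit singular vectors in bosonic Fock spaces at the
   central charges 1 - 6(k-1)^2/k, k large, and polynomial dependence on c.
   Invariance of the form under all vertex operators follows from contravariance by
   generating the states: the Borcherds identity passes it from a to x_r a. *)
Require Import Defs.
From HB Require Import structures.
From mathcomp Require Import all_boot all_order all_algebra.
From mathcomp Require Import perm boolp reals.
From mathcomp Require Import complex polyrcf polyorder mpoly.
From mathcomp Require Import ring lra zify.

Set Implicit Arguments.
Unset Strict Implicit.
Unset Printing Implicit Defensive.

Import Order.TTheory GRing.Theory Num.Theory.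
Local Open Scope ring_scope.

(** * Locally finite sums, words, linear identities *)

(** No Verma module is constructed. The contravariant form is the recursion [brk], which makes sense
    over every commutative ring, in particular with c and h as indeterminates. Any module with a
    highest weight vector [om] and a functional that is 1 on [om] and kills the images of the
    L_{-n}, n > 0, computes it, so its symmetry and its radical can be read off in Fock spaces. The
    central charges 1 - 6(k-1)^2/k come from the screening integrals behind the singular vectors:
    for an integer k the integrand is single-valued, a 2k-th power of the Vandermonde polynomial up
    to simpler factors, and the integral is the extraction of one coefficient. For k > 2N the roots
    h_{r,s} with r s <= N are pairwise distinct and, with the multiplicities that the descendants
    provide, they exhaust the degree of the determinant in h; infinitely many such k determine the
    dependence on c. In the gap argument c_(M+2) is a reference point: its form is already known to
    be semidefinite, so a determinant of opposite sign at c is a contradiction, and the sign itself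
    is never computed. *)

Lemma linear_packed (K : pzRingType) (U V : lmodType K) (f : U -> V) (fl : linear f) :
  {g : {linear U -> V} | g =1 f}.
Proof. by exists (HB.pack_for {linear U -> V} f (GRing.isLinear.Build K U V *:%R f fl)). Qed.

Definition linmk (K : pzRingType) (U V : lmodType K) (f : U -> V) (fl : linear f) :
  {linear U -> V} := sval (linear_packed fl).

Lemma linmkE (K : pzRingType) (U V : lmodType K) (f : U -> V) (fl : linear f) :
  linmk fl =1 f.
Proof. exact: svalP (linear_packed fl). Qed.

(** Differences of two half-infinite sums whose lower bounds differ by an integer of either sign are
    evaluated below by this induction: only the step from m to m + 1 has to be computed. *)
Lemma int_step_eq (V : zmodType) (X Y : int -> V) :
  X 0 = Y 0 -> (forall m, X (m + 1) - X m = Y (m + 1) - Y m) -> X =1 Y.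
Proof.
move=> h0 hs; elim/int_ind=> [//|n IH|n IH].
  have -> : n.+1%:Z = n%:Z + 1 by lia.
  by apply: (addIr (- X n%:Z)); rewrite hs IH.
apply: (can_inj (subrK (X (- n%:Z)))); rewrite {2}IH.
have := hs (- n.+1%:Z); have -> : - n.+1%:Z + 1 = - n%:Z :> int by lia.
by move=> /(congr1 -%R); rewrite !opprB => ->.
Qed.

Section FiniteSums.
Variable V : zmodType.
Implicit Types (G H : int -> V) (x m : int).

Definition evz G := exists N : int, forall i, N <= i -> G i = 0.

(* Junk value 0 when G has infinitely many nonzero values to the right. *)
Definition nsum (g : nat -> V) : V :=
  if pselect (exists N : nat, forall i, (N <= i)%N -> g i = 0) is left h
  then \sum_(i < projT1 (cid h)) g i else 0.

Definition fsum G x : V := nsum (fun i => G (x + i%:Z)).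

Lemma fsumE N G x : (forall i : nat, (N <= i)%N -> G (x + i%:Z) = 0) ->
  fsum G x = \sum_(i < N) G (x + i%:Z).
Proof.
move=> hN; rewrite /fsum /nsum; case: pselect => [h|[]]; last by exists N.
case: (cid h) => M hM /=.
wlog le_MN : M N hM hN / (M <= N)%N => [hw|].
  by case/orP: (leq_total M N) => le; [|symmetry]; exact: hw.
rewrite -(big_mkord xpredT (fun i => G (x + i%:Z))).
rewrite -(big_mkord xpredT (fun i => G (x + i%:Z))).
rewrite [RHS](big_cat_nat (n := M)) //= [X in _ + X]big_nat_cond [X in _ + X]big1 ?addr0 //.
by move=> i /andP[/andP[le _] _]; exact: hM.
Qed.

Lemma evz_nat G x : evz G -> exists N, forall i : nat, (N <= i)%N -> G (x + i%:Z) = 0.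
Proof. by case=> N hN; exists `|N - x|%N => i le; apply: hN; lia. Qed.

Lemma evz_shift G m : evz G -> evz (fun i => G (i + m)).
Proof. by case=> N hN; exists (N - m) => i le; apply: hN; lia. Qed.

Lemma evzD G H : evz G -> evz H -> evz (fun i => G i + H i).
Proof.
move=> [N hN] [M hM]; exists (Num.max N M) => i le.
by rewrite hN ?hM ?addr0 //; lia.
Qed.

Lemma evzN G : evz G -> evz (fun i => - G i).
Proof. by move=> [N hN]; exists N => i le; rewrite hN ?oppr0. Qed.

Lemma evz_sum (I : finType) (G : I -> int -> V) :
  (forall a, evz (G a)) -> evz (fun i => \sum_a G a i).
Proof.
move=> h; have /choice [N hN] : forall a, exists N : int, forall i, N <= i -> G a i = 0 by [].
exists (\sum_a `|N a|%N%:Z) => i le; apply: big1 => a _; apply: hN.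
apply: le_trans le; rewrite (bigD1 a) //=.
by rewrite -[N a]addr0 lerD ?sumr_ge0 //; lia.
Qed.

Lemma eq_fsum G H x : (forall i, x <= i -> G i = H i) -> fsum G x = fsum H x.
Proof.
by move=> e; rewrite /fsum; congr nsum; apply/funext => i; apply: e; lia.
Qed.

Lemma fsum_step G x : evz G -> fsum G x = G x + fsum G (x + 1).
Proof.
move=> /(evz_nat x) [N hN].
rewrite (@fsumE N.+1) ?(@fsumE N) ?big_ord_recl ?addr0 //.
- by congr (_ + _); apply: eq_bigr => i _; congr G; rewrite /= /bump leq0n; lia.
- move=> i le; have h : (N <= i.+1)%N by lia.
  by rewrite -[RHS](hN _ h); congr (G _); lia.
- by move=> i le; apply: hN; lia.
Qed.

Lemma fsum_shift G m x : fsum (fun i => G (i + m)) x = fsum G (x + m).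
Proof.
by rewrite /fsum; congr nsum; apply/funext => i; congr G; lia.
Qed.

Lemma fsumD G H x : evz G -> evz H -> fsum (fun i => G i + H i) x = fsum G x + fsum H x.
Proof.
move=> /(evz_nat x) [N hN] /(evz_nat x) [M hM].
rewrite !(@fsumE (N + M)) ?big_split //= => i le; rewrite ?hN ?hM ?addr0 //; lia.
Qed.

Lemma fsum0 x : fsum (fun=> 0) x = 0.
Proof. by rewrite (@fsumE 0) ?big_ord0. Qed.

Lemma fsumN G x : evz G -> fsum (fun i => - G i) x = - fsum G x.
Proof.
move=> hG; apply/eqP; rewrite -addr_eq0 -fsumD //; last exact: evzN.
by rewrite (eq_fsum (H := fun=> 0)) ?fsum0 // => i _; rewrite addNr.
Qed.

Lemma fsumB G H x : evz G -> evz H -> fsum (fun i => G i - H i) x = fsum G x - fsum H x.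
Proof. by move=> hG hH; rewrite fsumD ?fsumN //; exact: evzN. Qed.

Lemma fsum_delta (w : V) y x :
  fsum (fun i => if i == y then w else 0) x = if x <= y then w else 0.
Proof.
rewrite (@fsumE (`|y - x|.+1)%N); last by move=> i le; case: eqP => // ?; exfalso; lia.
case: ifP => le; last by apply: big1 => i _; case: eqP => // ?; exfalso; lia.
rewrite big_ord_recr big1 /= ?add0r; last by move=> i _; case: eqP => // ?; have := ltn_ord i; lia.
by case: eqP => // -[]; lia.
Qed.

End FiniteSums.

Lemma evz_additive (U V : zmodType) (f : {additive U -> V}) (G : int -> U) :
  evz G -> evz (fun i => f (G i)).
Proof. by case=> N hN; exists N => i le; rewrite hN ?raddf0. Qed.

Lemma fsum_additive (U V : zmodType) (f : {additive U -> V}) (G : int -> U) x :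
  evz G -> f (fsum G x) = fsum (fun i => f (G i)) x.
Proof.
move=> /(evz_nat x) [N hN]; rewrite !(@fsumE _ N) ?raddf_sum //.
by move=> i le; rewrite hN ?raddf0.
Qed.

Lemma fsumZ (K : pzRingType) (V : lmodType K) (a : K) (G : int -> V) x :
  evz G -> fsum (fun i => a *: G i) x = a *: fsum G x.
Proof. by move=> hG; rewrite (fsum_additive (GRing.scale a) x hG).
Qed.

Lemma evzZ (K : pzRingType) (V : lmodType K) (a : int -> K) (G : int -> V) :
  evz G -> evz (fun i => a i *: G i).
Proof. by case=> N hN; exists N => i le; rewrite hN ?scaler0. Qed.

Section WordInduction.
Variables (A : eqType) (good : seq A -> Prop).
Hypothesis swap : forall w1 a b w2,
  (forall w, (size w < size (w1 ++ a :: b :: w2))%N -> good w) ->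
  good (w1 ++ a :: b :: w2) -> good (w1 ++ b :: a :: w2).

Lemma good_perm u w w' : (forall z, (size z < size (u ++ w))%N -> good z) ->
  perm_eq w w' -> good (u ++ w) -> good (u ++ w').
Proof.
elim: w' u w => [|x t IH] u w short; first by move=> /perm_nilP ->.
move=> pw; have : x \in w by rewrite (perm_mem pw) mem_head.
move=> xw; case/splitPr: xw short pw => p1 p2 short pw.
have {}pw : perm_eq (p1 ++ p2) t.
  by rewrite -(perm_cons x) -(permPl (permEl (perm_catCA p1 [:: x] p2))).
move=> g; rewrite -cat_rcons; apply: (IH _ (p1 ++ p2)) => //.
  by move=> z lz; apply: short; move: lz; rewrite !size_cat size_rcons /=; lia.
(* [x] travels to the left through [p1] by adjacent swaps; the induction on the target word then
   treats it as part of the prefix. *)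
rewrite cat_rcons; elim/last_ind: p1 p2 short g {pw} => [|p1 y IHp] p2 short; first by [].
rewrite !cat_rcons => g.
apply: IHp; first by move=> z lz; apply: short; move: lz; rewrite !size_cat size_rcons /=; lia.
rewrite catA; apply: swap; last by rewrite -catA.
by move=> z lz; apply: short; move: lz; rewrite !size_cat size_rcons /=; lia.
Qed.

(* A property of words that is insensitive, modulo shorter words, to swapping
   adjacent letters only needs to be checked up to permutation. *)
Lemma word_ind :
  (forall w, (forall z, (size z < size w)%N -> good z) -> exists2 w', perm_eq w w' & good w') ->
  forall w, good w.
Proof.
move=> base w; have [n] := ubnP (size w); elim: n w => // n IH w lt_n.
have short z : (size z < size w)%N -> good z by move=> lz; apply: IH; lia.
have [w' pw gw'] := base w short.
apply: (@good_perm [::] w') => //; last by rewrite perm_sym.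
by move=> z lz; apply: short; rewrite (perm_size pw).
Qed.
End WordInduction.

(* Reflexive decision of linear identities in a module, reduced to identities
   between scalar coefficients. *)
Inductive lexp (K : Type) := LAtom of nat | LZero | LAdd of lexp K & lexp K
  | LOpp of lexp K | LScale of K & lexp K.
Arguments LZero {K}. Arguments LAtom {K}.

Section LinearReflection.
Variables (K : nzRingType) (V : lmodType K).

Fixpoint lden (env : seq V) (e : lexp K) : V :=
  match e with
  | LAtom n => nth 0 env n
  | LZero => 0
  | LAdd a b => lden env a + lden env b
  | LOpp a => - lden env a
  | LScale c a => c *: lden env a
  end.

Fixpoint lcoef (e : lexp K) (i : nat) : K :=
  match e with
  | LAtom n => if eqn n i then 1 else 0
  | LZero => 0
  | LAdd a b => lcoef a i + lcoef b i
  | LOpp a => - lcoef a i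
  | LScale c a => c * lcoef a i
  end.

Lemma ldenE env e : lden env e = \sum_(i < size env) lcoef e i *: nth 0 env i.
Proof.
elim: e => [n||a IHa b IHb|a IHa|c a IHa] /=.
- under eq_bigr do rewrite eqnE; case: (ltnP n (size env)) => [lt|ge].
    rewrite (bigD1 (Ordinal lt)) //= eqxx scale1r big1 ?addr0 // => i ni.
    by case: eqP => [e|_]; [case/eqP: ni; apply: val_inj|rewrite scale0r].
  rewrite nth_default // big1 // => i _; case: eqP => [e|_]; last by rewrite scale0r.
  by have := ltn_ord i; rewrite -e ltnNge ge.
- by rewrite big1 // => i _; rewrite scale0r.
- by rewrite IHa IHb -big_split; apply: eq_bigr => i _; rewrite scalerDl.
- by rewrite IHa -sumrN; apply: eq_bigr => i _; rewrite scaleNr.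
- by rewrite IHa scaler_sumr; apply: eq_bigr => i _; rewrite scalerA.
Qed.

Fixpoint lcoefs_eq (n : nat) (a b : lexp K) : Prop :=
  if n is m.+1 then lcoef a m = lcoef b m /\ lcoefs_eq m a b else True.

Lemma lden_eq env a b : lcoefs_eq (size env) a b -> lden env a = lden env b.
Proof.
rewrite !ldenE => h; apply: eq_bigr => i _; congr (_ *: _).
elim: (size env) h i => [_ []//|n IH] /= [h1 h2] i.
by case: (unliftP ord_max i) => [j|] ->; rewrite ?lift_max //=; exact: IH.
Qed.
End LinearReflection.

Ltac latom_in x l :=
  lazymatch l with
  | nil => constr:(false)
  | cons x _ => constr:(true)
  | cons _ ?t => latom_in x t
  end.
Ltac latoms e l :=
  lazymatch e with
  | @Algebra.add _ ?a ?b => let l := latoms a l in latoms b l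
  | @Algebra.opp _ ?a => latoms a l
  | @Algebra.zero _ => l
  | @GRing.scale _ _ _ ?a => latoms a l
  | _ => let b := latom_in e l in
         lazymatch b with true => l | false => constr:(cons e l) end
  end.
Ltac lindex x l :=
  lazymatch l with
  | cons x _ => constr:(0%N)
  | cons _ ?t => let n := lindex x t in constr:(S n)
  end.
Ltac lquote K e l :=
  lazymatch e with
  | @Algebra.add _ ?a ?b => let a := lquote K a l in let b := lquote K b l in constr:(@LAdd K a b)
  | @Algebra.opp _ ?a => let a := lquote K a l in constr:(@LOpp K a)
  | @Algebra.zero _ => constr:(@LZero K)
  | @GRing.scale _ _ ?c ?a => let a := lquote K a l in constr:(@LScale K c a)
  | _ => let n := lindex e l in constr:(@LAtom K n)
  end.
Ltac lmodule K :=
  lazymatch goal with |- @eq ?T ?a ?b =>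
    let l := latoms a (@nil T) in let l := latoms b l in
    let qa := lquote K a l in let qb := lquote K b l in
    refine (@lden_eq _ _ l qa qb _);
    cbn [lcoefs_eq lcoef size eqn]; repeat split; try ring
  end.

(** * The Sugawara construction *)

Definition is_vir (F : numFieldType) (V : lmodType F) (c : F) (L : int -> {linear V -> V}) :=
  forall m n v, L m (L n v) - L n (L m v) = (m - n)%:~R *: L (m + n) v
    + (if m + n == 0 then ((m ^+ 3 - m)%:~R / 12%:R) * c else 0) *: v.

Definition truncated (F : numFieldType) (V : lmodType F) (J : int -> {linear V -> V}) :=
  forall v, evz (fun n => J n v).

Section Sugawara.
Variables (F : numFieldType) (V : lmodType F) (I : finType).
Variables (J : I -> int -> {linear V -> V}) (f : I -> I -> I -> F) (k g : F).
Hypothesis Jtr : forall a, truncated (J a).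
Hypothesis JJ : forall a b m n v, J a m (J b n v) - J b n (J a m v) =
  (\sum_c f a b c *: J c (m + n) v) + (if (m + n == 0) && (a == b) then m%:~R * k else 0) *: v.
Hypothesis fC : forall a b c, f a b c = - f b a c.
Hypothesis fA : forall a b c, f a b c = - f a c b.
Hypothesis fK : forall b d, \sum_a \sum_c f a c b * f a c d = if b == d then - (2%:R * g) else 0.

Definition sug_term n v (q : int) : V := \sum_a J a (n - q) (J a q v).

Lemma evz_J a n (G : int -> V) : evz G -> evz (fun q => J a (n - q) (G q)).
Proof. by case=> N hN; exists N => i le; rewrite hN ?linear0. Qed.

Lemma evz_sug n v : evz (sug_term n v).
Proof. by apply: evz_sum => a; apply: evz_J; apply: Jtr. Qed.

(** Normal ordering: in the sum of J_{n-q} J_q over all q, the half q <= 0 has its factors exchanged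
    and is reindexed by q -> n - q. Both halves then have the same shape and a lower bound on q,
    which makes them locally finite. *)
Definition sug_fun n v : V := fsum (sug_term n v) 1 + fsum (sug_term n v) n.

Lemma sug_linear n : linear (sug_fun n).
Proof.
move=> a u v; have e x : fsum (sug_term n (a *: u + v)) x =
    a *: fsum (sug_term n u) x + fsum (sug_term n v) x.
  rewrite -fsumZ; last exact: evz_sug.
  rewrite -fsumD; [|exact: evzZ (evz_sug n u)|exact: evz_sug].
  apply: eq_fsum => i _; rewrite /sug_term scaler_sumr -big_split /=.
  by apply: eq_bigr => b _; rewrite !linearP.
by rewrite /sug_fun !e scalerDr !addrA; congr (_ + _); rewrite -!addrA; congr (_ + _); rewrite addrC.
Qed.

Definition sug n : {linear V -> V} := linmk (@sug_linear n).

Lemma sugE n v : sug n v = fsum (sug_term n v) 1 + fsum (sug_term n v) n.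
Proof. exact: linmkE. Qed.

Let quad b v (x y : int) : V := \sum_a \sum_c f a b c *: J a x (J c y v).

(** Antisymmetry of [f] turns the sum into commutators [J_a, J_c] contracted with [f]; the Killing
    form [fK] collects them into 2 g J_b, and the central terms drop out since f a b a = 0. *)
Lemma quad_sym b v x y : quad b v x y + quad b v y x = (2%:R * g) *: J b (x + y) v.
Proof.
rewrite /quad [X in _ + X]exchange_big -big_split /=.
transitivity (\sum_a \sum_c f a b c *: (J a x (J c y v) - J c y (J a x v))).
  apply: eq_bigr => a _; rewrite -big_split /=; apply: eq_bigr => c _.
  by rewrite scalerBr [f c b a]fC [f b c a]fA [f b a c]fC scaleNr opprK.
transitivity (\sum_d (\sum_a \sum_c f a b c * f a c d) *: J d (x + y) v).
  under [RHS]eq_bigr do rewrite scaler_suml.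
  rewrite [RHS]exchange_big; apply: eq_bigr => a _.
  under [RHS]eq_bigr do rewrite scaler_suml.
  rewrite [RHS]exchange_big; apply: eq_bigr => c _.
  rewrite JJ scalerDr scaler_sumr.
  under [RHS]eq_bigr do rewrite -scalerA.
  case: (eqVneq a c) => [<-|_]; last by rewrite andbF scale0r scaler0 addr0.
  have -> : f a b a = 0; last by rewrite scale0r addr0.
  have := fC a b a; rewrite [f b a a]fA opprK [f b a a]fC => /eqP.
  by rewrite -subr_eq0 opprK -mulr2n mulrn_eq0 /= => /eqP.
have e d : \sum_a \sum_c f a b c * f a c d = if b == d then 2%:R * g else 0.
  transitivity (- \sum_a \sum_c f a c b * f a c d); last by rewrite fK; case: ifP; rewrite ?opprK ?oppr0.
  rewrite -sumrN; apply: eq_bigr => a _; rewrite -sumrN; apply: eq_bigr => c _.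
  by rewrite fA mulNr.
rewrite (bigD1 b) //= e eqxx big1 ?addr0 // => d nd.
by rewrite e eq_sym (negPf nd) scale0r.
Qed.

Lemma evz_quad b v s : evz (fun q => quad b v (s - q) q).
Proof.
apply: evz_sum => a; apply: evz_sum => c; apply: (evzZ (fun=> f a b c)).
by apply: evz_J; apply: Jtr.
Qed.

(** Commuting J_b through the term of index q leaves two quadratic expressions of the same shape
    whose indices differ by m, so that the sum over q telescopes. The level contributes only at the
    two indices where a mode meets its opposite. *)
Lemma sug_term_J n b m v q : sug_term n (J b m v) q - J b m (sug_term n v q) =
  quad b v (n + m - (q + m)) (q + m) - quad b v (n + m - q) q
  + ((if q == - m then - (m%:~R * k) *: J b (n + m) v else 0) +
     (if q == n + m then - (m%:~R * k) *: J b (n + m) v else 0)).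
Proof.
rewrite /sug_term linear_sum -sumrB.
have e a : J a (n - q) (J a q (J b m v)) - J b m (J a (n - q) (J a q v)) =
  (\sum_c f a b c *: J a (n - q) (J c (q + m) v) + \sum_c f a b c *: J c (n - q + m) (J a q v))
  + ((if (q + m == 0) && (a == b) then q%:~R * k else 0) *: J a (n - q) v
  + (if (n - q + m == 0) && (a == b) then (n - q)%:~R * k else 0) *: J a q v).
  have -> : J a (n - q) (J a q (J b m v)) - J b m (J a (n - q) (J a q v)) =
    J a (n - q) (J a q (J b m v) - J b m (J a q v)) +
    (J a (n - q) (J b m (J a q v)) - J b m (J a (n - q) (J a q v))).
    by rewrite linearB addrA subrK.
  rewrite !JJ linearD linear_sum linearZ /=.
  by under eq_bigr do rewrite linearZ /=; rewrite addrACA.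
rewrite (eq_bigr _ (fun a _ => e a)) big_split /=; congr (_ + _).
  rewrite big_split /=; congr (_ + _).
    by rewrite /quad; apply: eq_bigr => a _; apply: eq_bigr => c _; congr (_ *: J a _ _); ring.
  rewrite /quad -sumrN exchange_big; apply: eq_bigr => a _; rewrite -sumrN.
  apply: eq_bigr => c _; rewrite -scaleNr; congr (_ *: J _ _ _); last by ring.
  by rewrite [f c b a]fC [f b c a]fA [f b a c]fC opprK.
rewrite big_split /=; congr (_ + _); rewrite (bigD1 b) //= eqxx andbT.
  rewrite big1 ?addr0; last by move=> a /negPf ->; rewrite andbF scale0r.
  rewrite addr_eq0; case: eqP => [->|_]; last by rewrite scale0r.
  by rewrite rmorphN mulNr; congr (_ *: J b _ _); ring.
rewrite big1 ?addr0; last by move=> a /negPf ->; rewrite andbF scale0r.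
have -> : (n - q + m == 0) = (q == n + m) by lia.
case: eqP => [->|_]; last by rewrite scale0r.
by congr (_ *: _); rewrite -mulNr -rmorphN; congr (_%:~R * _); ring.
Qed.

Lemma sug_J n b m v :
  sug n (J b m v) - J b m (sug n v) = - (2%:R * (k + g) * m%:~R) *: J b (n + m) v.
Proof.
set s := n + m; set w := - (m%:~R * k) *: J b s v.
have e x : fsum (sug_term n (J b m v)) x - J b m (fsum (sug_term n v) x) =
    fsum (fun q => quad b v (s - q) q) (x + m) - fsum (fun q => quad b v (s - q) q) x
    + ((if x <= - m then w else 0) + (if x <= s then w else 0)).
  rewrite (fsum_additive (J b m)); last exact: evz_sug.
  rewrite -fsumB; [|exact: evz_sug|exact: evz_additive (evz_sug n v)].
  rewrite (eq_fsum (fun q _ => sug_term_J n b m v q)).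
  have ed y : evz (fun q : int => if q == y then w else 0).
    by exists (y + 1) => i le; case: eqP => // ?; exfalso; lia.
  rewrite fsumD; last by apply: evzD; apply: ed.
    rewrite fsumB; [|exact: (evz_shift m (evz_quad b v s))|exact: evz_quad].
    by rewrite (fsum_shift (fun q => quad b v (s - q) q)) fsumD ?fsum_delta.
  by apply: evzD; [exact: (evz_shift m (evz_quad b v s))|apply: evzN; exact: evz_quad].
rewrite !sugE linearD /= opprD addrACA !e addrACA.
(* The condition n <= - m is the negation of 1 <= s, and n <= s that of 1 <= - m: exactly two of the
   four deltas survive, whatever the signs. *)
have -> : (if 1 <= - m then w else 0) + (if 1 <= s then w else 0) +
   ((if n <= - m then w else 0) + (if n <= s then w else 0)) = w + w.
  have -> : (n <= - m) = ~~ (1 <= s) by lia.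
  have -> : (n <= s) = ~~ (1 <= - m) by lia.
  by case: ifP; case: ifP; rewrite /= ?addr0 ?add0r.
(* The boundary terms left by the shift pair up as [quad x y + quad y x]. Each of the m pairs adds 2
   g, which is what shifts the level from k to k + g. *)
have -> : fsum (fun q => quad b v (s - q) q) (1 + m) - fsum (fun q => quad b v (s - q) q) 1 +
  (fsum (fun q => quad b v (s - q) q) (n + m) - fsum (fun q => quad b v (s - q) q) n) =
  - (m%:~R * (2%:R * g)) *: J b s v.
  rewrite -[n + m]/s; have -> : n = s - m by rewrite /s; ring.
  move: s {e w} => s; set Q := fsum _; move: m; apply: int_step_eq.
    by rewrite subr0 addr0 !subrr mul0r oppr0 scale0r addr0.
  move=> m; have -> : s - m = s - (m + 1) + 1 by ring.
  rewrite addrA /Q (fsum_step (1 + m)) ?(fsum_step (s - (m + 1))); try exact: evz_quad.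
  rewrite -/Q -scalerBl.
  have -> : - ((m + 1)%:~R * (2%:R * g)) - - (m%:~R * (2%:R * g)) = - (2%:R * g) :> F.
    by rewrite rmorphD /=; ring.
  have := quad_sym b v (s - (1 + m)) (1 + m); rewrite subrK scaleNr => <-.
  have -> : s - (s - (m + 1)) = 1 + m by ring.
  have -> : s - (m + 1) = s - (1 + m) by ring.
  rewrite !addrA; move: (quad _ _ _ _) (quad _ _ _ _) (Q _) (Q _) (Q _) (Q _) => A B X Y Z T.
  lmodule F.
by rewrite /w -mulr2n -scaler_nat scalerA -scalerDl; congr (_ *: _); ring.
Qed.

Hypothesis kg : k + g != 0.

Lemma sugL_linear n : linear (fun v => (2%:R * (k + g))^-1 *: sug n v).
Proof. by move=> a u v; rewrite linearP scalerDr !scalerA mulrC. Qed.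

Definition sugL n : {linear V -> V} := linmk (@sugL_linear n).

Lemma sugLE n v : sugL n v = (2%:R * (k + g))^-1 *: sug n v.
Proof. exact: linmkE. Qed.

Let kg2 : 2%:R * (k + g) != 0.
Proof. by rewrite mulf_neq0 // pnatr_eq0. Qed.

Lemma sugL_J n b m v : sugL n (J b m v) - J b m (sugL n v) = - m%:~R *: J b (n + m) v.
Proof.
rewrite !sugLE linearZ -scalerBr sug_J scalerA; congr (_ *: _).
by rewrite mulrN; congr (- _); rewrite mulrA mulVf // mul1r.
Qed.

Lemma sugL_sug_term m n v q :
  sugL m (sug_term n v q) - sug_term n (sugL m v) q =
  q%:~R *: sug_term (m + n) v q - n%:~R *: sug_term (m + n) v q
  - ((q + m)%:~R *: sug_term (m + n) v (q + m) - m%:~R *: sug_term (m + n) v (q + m)).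
Proof.
rewrite -!scalerBl /sug_term linear_sum -sumrB !scaler_sumr -sumrB.
apply: eq_bigr => a _.
have -> : sugL m (J a (n - q) (J a q v)) - J a (n - q) (J a q (sugL m v)) =
  (sugL m (J a (n - q) (J a q v)) - J a (n - q) (sugL m (J a q v))) +
  J a (n - q) (sugL m (J a q v) - J a q (sugL m v)).
  by rewrite linearB addrA subrK.
rewrite !sugL_J linearZ /=; congr (_ + _).
  by congr (_ *: J a _ _); [rewrite rmorphB opprB | ring].
by rewrite -scaleNr; congr (_ *: J a _ (J a _ _)); [rewrite rmorphD /= addrK | ring | ring].
Qed.

Let JC a m n v : J a m (J a n v) - J a n (J a m v) =
  (if m + n == 0 then m%:~R * k else 0) *: v.
Proof.
rewrite JJ eqxx andbT big1 ?add0r // => c _; have -> : f a a c = 0; last by rewrite scale0r.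
have := fC a a c => /eqP; rewrite -subr_eq0 opprK -mulr2n mulrn_eq0 /= => /eqP //.
Qed.

Lemma sug_term_sym m s v : sug_term s v (s - m) - sug_term s v m =
  (if s == 0 then m%:~R * k * #|I|%:R else 0) *: v.
Proof.
rewrite /sug_term (_ : s - (s - m) = m); last by ring.
rewrite -sumrB; under eq_bigr do rewrite JC.
rewrite [m + _]addrC subrK.
rewrite sumr_const -scaler_nat scalerA; case: eqP => _; congr (_ *: _); ring.
Qed.

(** L_m acts on the currents as a derivation, so its commutator with the n-th operator is a
    combination of half-infinite sums over q of [sug_term (m + n)], with bounds shifted by m and
    weights linear in q. What remains after comparison with [sug (m + n)] are finite boundary sums,
    made central by [sug_term_sym]. They are summed twice: [d] gives (m^2 + m) / 2, and the
    increments of [D] are the values of [d], whence (m^3 - m) / 6. *)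
Lemma sugL_vir : is_vir (k * #|I|%:R / (k + g)) sugL.
Proof.
move=> m n v; rewrite [sugL n v]sugLE [sugL n (sugL m v)]sugLE [sugL (m + n) v]sugLE linearZ -scalerBr.
set s := m + n; set K := sug_term s v; pose P (q : int) := q%:~R *: K q.
have hK : evz K by apply: evz_sug.
have hP : evz P by apply: evzZ.
pose FK := fsum K; pose FP := fsum P.
have e x : sugL m (fsum (sug_term n v) x) - fsum (sug_term n (sugL m v)) x =
   FP x - n%:~R *: FK x - (FP (x + m) - m%:~R *: FK (x + m)).
  rewrite (fsum_additive (sugL m)); last exact: evz_sug.
  rewrite -fsumB; [|exact: evz_additive (evz_sug n v)|exact: evz_sug].
  rewrite (eq_fsum (fun q _ => sugL_sug_term m n v q)) -/s -/K.
  rewrite fsumB; last 1 [apply: (evz_shift m (G := fun q => q%:~R *: K q - m%:~R *: K q))].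
  - rewrite fsumB ?fsumZ //; last exact: (evzZ (fun=> n%:~R)).
    rewrite (fsum_shift (fun q => q%:~R *: K q - m%:~R *: K q)) fsumB //; last exact: (evzZ (fun=> m%:~R)).
    by rewrite fsumZ.
  - by apply: evzD => //; apply: evzN; apply: (evzZ (fun=> n%:~R)).
  - by apply: evzD => //; apply: evzN; apply: (evzZ (fun=> m%:~R)).
pose kd := k * #|I|%:R.
have d : forall m : int, FK (1 + m) - FK 1 + (FK (s - m) - FK s) =
    (if s == 0 then ((m ^+ 2 + m)%:~R / 2%:R) * kd else 0) *: v.
  apply: int_step_eq.
    rewrite addr0 subr0 !subrr add0r.
    by case: eqP => _; rewrite ?mul0r scale0r.
  move=> p; have := sug_term_sym (1 + p) s v.
  rewrite -scalerBl /FK (fsum_step (1 + p) hK).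
  have -> : s - p = s - (1 + p) + 1 by ring.
  rewrite (_ : s - (p + 1) = s - (1 + p)); last by ring.
  rewrite (fsum_step (s - (1 + p)) hK) -/K (_ : 1 + (p + 1) = 1 + p + 1); last by ring.
  move=> /(canRL (subrK _)) ->.
  have -> : (if s == 0 then ((p + 1) ^+ 2 + (p + 1))%:~R / 2%:R * kd else 0) -
    (if s == 0 then (p ^+ 2 + p)%:~R / 2%:R * kd else 0) =
    (if s == 0 then (1 + p)%:~R * k * #|I|%:R else 0).
    case: eqP => _; last by rewrite subr0.
    by rewrite /kd !rmorphD !rmorphXn /= rmorphD /=; field.
  move: (fsum _ _) (fsum _ _) (fsum _ _) (fsum _ _) (K _) (_ *: v) => A B C D E G.
  lmodule F.
have D : forall m : int, FP 1 - FP (1 + m) + m%:~R *: (FK (1 + m) - FK 1)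
    + (FP (s - m) - FP s - (s - m)%:~R *: (FK (s - m) - FK s)) =
    (if s == 0 then ((m ^+ 3 - m)%:~R / 6%:R) * kd else 0) *: v.
  apply: int_step_eq.
    rewrite addr0 subr0 !subrr !scaler0 !addr0 ?subr0.
    by rewrite addr0; case: eqP => _; rewrite ?mul0r scale0r.
  move=> p; have := d p; rewrite -scalerBl.
  have -> : (if s == 0 then ((p + 1) ^+ 3 - (p + 1))%:~R / 6%:R * kd else 0) -
    (if s == 0 then (p ^+ 3 - p)%:~R / 6%:R * kd else 0) =
    (if s == 0 then (p ^+ 2 + p)%:~R / 2%:R * kd else 0).
    case: eqP => _; last by rewrite subr0.
    by rewrite /kd !rmorphB !rmorphD !rmorphXn /= rmorphD /=; field.
  move=> <-; rewrite /FK /FP (fsum_step (1 + p) hK) (fsum_step (1 + p) hP).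
  have -> : s - p = s - (1 + p) + 1 by ring.
  rewrite (_ : s - (p + 1) = s - (1 + p)); last by ring.
  rewrite (fsum_step (s - (1 + p)) hK) (fsum_step (s - (1 + p)) hP) (_ : 1 + (p + 1) = 1 + p + 1); last by ring.
  rewrite /P.
  have -> : (s - (1 + p) + 1)%:~R = (s - (1 + p))%:~R + 1 :> F by rewrite rmorphD.
  have -> : (p + 1)%:~R = (1 + p)%:~R :> F by rewrite addrC.
  have -> : p%:~R = (1 + p)%:~R - 1 :> F by rewrite rmorphD /= addrC addKr.
  move: (fsum _ _) (fsum _ _) (fsum _ _) (fsum _ _) (fsum _ _) (fsum _ _) (fsum _ _) (fsum _ _).
  move: (K _) (K _) (_%:~R) (_%:~R) => k1 k2 x1 x2 A1 A2 A3 A4 A5 A6 A7 A8.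
  lmodule F.
have en : n = s - m by rewrite /s; ring.
have := D m; rewrite -en => {}D.
have -> : sugL m (sug n v) - sug n (sugL m v) =
   (m - n)%:~R *: sug s v + (if s == 0 then ((m ^+ 3 - m)%:~R / 6%:R) * kd else 0) *: v.
  rewrite !sugE linearD opprD addrACA !e -D -/FK [n + m]addrC -/s rmorphB /=.
  rewrite -/K -/(FK 1) -/(FK s).
  move: (FP _) (FP _) (FP _) (FP _) (FK _) (FK _) (FK _) (FK _) => A1 A2 A3 A4 A5 A6 A7 A8.
  lmodule F.
rewrite scalerDr !scalerA mulrC; congr (_ + _ *: _); case: eqP => _; last by rewrite mulr0.
by rewrite /kd; field; rewrite kg.
Qed.

Lemma sug_adj (h : V -> V -> F) (e : F) n u v :
  (forall x y z, h (x + y) z = h x z + h y z) -> (forall x y z, h x (y + z) = h x y + h x z) ->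
  e * e = 1 -> (forall a p x y, h (J a p x) y = e * h x (J a (- p) y)) ->
  h (sug n u) v = h u (sug (- n) v).
Proof.
move=> hDl hDr ee hJ.
have h0l z : h 0 z = 0 by apply: (addrI (h 0 z)); rewrite -hDl !addr0.
have h0r z : h z 0 = 0 by apply: (addrI (h z 0)); rewrite -hDr !addr0.
have hsl (T : finType) (G : T -> V) z : h (\sum_i G i) z = \sum_i h (G i) z.
  by apply: (big_morph (h^~ z)).
have hsr (T : finType) (G : T -> V) z : h z (\sum_i G i) = \sum_i h z (G i).
  by apply: (big_morph (h z)).
pose G := sug_term (- n) v.
have hG q : h (sug_term n u q) v = h u (G (q - n)).
  rewrite hsl hsr; apply: eq_bigr => a _; rewrite !hJ mulrA ee mul1r.
  by congr (h u (J _ _ (J _ _ _))); ring.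
have evG : evz G by apply: evz_sug.
have hs x : h (fsum (sug_term n u) x) v = h u (fsum G (x - n)).
  have [N hN] := evz_nat x (evz_sug n u); have [M hM] := evz_nat (x - n) evG.
  rewrite !(@fsumE _ (maxn N M)) => [|i|i]; rewrite ?geq_max; last 2 first.
  - by case/andP=> ? ?; rewrite hM.
  - by case/andP=> ? ?; rewrite hN.
  by rewrite hsl hsr; apply: eq_bigr => i _; rewrite hG; congr (h u (G _)); ring.
rewrite !sugE hDl !hs -hDr subrr (fsum_step 0 evG) (fsum_step (- n) evG) !add0r -/G.
(* The adjoint moves the lower bounds 1 and n to 1 - n and 0, while [sug (- n)] starts at 1 and - n.
   The discrepancy is J_0 J_{-n} against J_{-n} J_0, equal for each fixed generator. *)
have -> : G 0 = G (- n).
  rewrite /G /sug_term; apply: eq_bigr => a _; rewrite subrr subr0; apply/eqP.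
  by rewrite -subr_eq0 JC addr0 oppr_eq0; case: (eqVneq n 0) => [->|_]; rewrite ?oppr0 ?mul0r scale0r.
congr (h u _); rewrite addrCA [RHS]addrCA; congr (_ + _); rewrite addrC.
by congr (_ + fsum G _); ring.
Qed.

End Sugawara.

(** * Fermionic Fock space *)

(* Fermionic Fock space as {poly F}: the binary digits of n are the occupation
   numbers of the state 'X^n, so the zeroth mode is seen by splitting into even
   and odd parts, and the mode j.+1 is the mode j of the two halves. *)
Section Fock.
Variable F : numClosedFieldType.
Implicit Types p q : {poly F}.

Definition mix p q : {poly F} := (p \Po 'X^2) + 'X * (q \Po 'X^2).

Lemma coef_mix p q i : (mix p q)`_i = if odd i then q`_i./2 else p`_i./2.
Proof.
rewrite /mix coefD coefXM !coef_comp_poly_Xn //.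
case: i => [|i] /=; first by rewrite addr0.
by rewrite !dvdn2 !divn2 /=; case e: (odd i) => /=; rewrite ?addr0 ?add0r // uphalf_half e.
Qed.

Lemma mixK p : mix (even_poly p) (odd_poly p) = p.
Proof.
apply/polyP => i; rewrite coef_mix coef_even_poly coef_odd_poly.
by have := odd_double_half i; case: (odd i) => /= e; congr (nth 0 p _); lia.
Qed.

Lemma even_mix p q : even_poly (mix p q) = p.
Proof. by apply/polyP => i; rewrite coef_even_poly coef_mix odd_double doubleK. Qed.

Lemma odd_mix p q : odd_poly (mix p q) = q.
Proof. by apply/polyP => i; rewrite coef_odd_poly coef_mix /= odd_double /= uphalf_double. Qed.

Lemma mixD p q p' q' : mix p q + mix p' q' = mix (p + p') (q + q').
Proof. by apply/polyP => i; rewrite coefD !coef_mix !coefD; case: ifP. Qed.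

Lemma mixZ a p q : a *: mix p q = mix (a *: p) (a *: q).
Proof. by apply/polyP => i; rewrite coefZ !coef_mix !coefZ; case: ifP. Qed.

Lemma mix00 : mix 0 0 = 0.
Proof. by apply/polyP => i; rewrite coef_mix !coef0 if_same. Qed.

(** [b] is true for creation. The sign on the odd half is the Jordan-Wigner sign: a higher mode
    anticommutes past the occupied zeroth mode. *)
Fixpoint ferm_fun (b : bool) (j : nat) p : {poly F} :=
  match j with
  | 0 => if b then mix 0 (even_poly p) else mix (odd_poly p) 0
  | j.+1 => mix (ferm_fun b j (even_poly p)) (- ferm_fun b j (odd_poly p))
  end.

Lemma ferm_linear b j : linear (ferm_fun b j).
Proof.
elim: j => [|j IH] a p q /=.
  by case: b; rewrite linearP mixZ mixD scaler0 addr0.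
by rewrite [even_poly _]linearP [odd_poly _]linearP /= !IH mixZ mixD scalerN opprD.
Qed.

Definition ferm b j : {linear {poly F} -> {poly F}} := linmk (ferm_linear b j).

Lemma ferm0 b p : ferm b 0 p = if b then mix 0 (even_poly p) else mix (odd_poly p) 0.
Proof. by rewrite /ferm !linmkE. Qed.

Lemma fermS b j p : ferm b j.+1 p = mix (ferm b j (even_poly p)) (- ferm b j (odd_poly p)).
Proof. by rewrite /ferm !linmkE. Qed.

Lemma ferm_car b j b' j' p : ferm b j (ferm b' j' p) + ferm b' j' (ferm b j p) =
  if (j == j') && (b != b') then p else 0.
Proof.
elim: j j' p => [|j IH] [|j'] p.
- rewrite !ferm0; case: b; case: b'; rewrite ?even_mix ?odd_mix ?mixD ?addr0 ?add0r ?mixK //;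
  by rewrite ?linear0 ?addr0 ?mix00.
- rewrite !fermS !ferm0; case: b; rewrite !even_mix !odd_mix !linear0 mixD ?oppr0 ?addr0 ?add0r ?addNr ?subrr mix00 //.
- rewrite !fermS !ferm0; clear IH; case: b'; rewrite !even_mix !odd_mix !linear0 mixD ?oppr0 ?addr0 ?add0r ?addNr ?subrr mix00 //.
rewrite !fermS !even_mix !odd_mix mixD !linearN !opprK !IH eqSS.
by case: ifP => _; rewrite ?mixK ?mix00.
Qed.

(** The binary digit of weight 2^j vanishes in every exponent up to j, because j < 2^j. The crude
    linear bound suffices for local finiteness. *)
Lemma ferm_annihil j p : (size p <= j.+1)%N -> ferm false j p = 0.
Proof.
elim: j p => [|j IH] p sp.
  rewrite ferm0 (_ : odd_poly p = 0) ?mix00 //; apply/polyP => i.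
  by rewrite coef_odd_poly coef0 nth_default // (leq_trans sp).
rewrite fermS !IH ?oppr0 ?mix00 //; apply/leq_sizeP => i hi.
  by rewrite coef_odd_poly; apply: nth_default; apply: leq_trans sp _; lia.
by rewrite coef_even_poly; apply: nth_default; apply: leq_trans sp _; lia.
Qed.

Lemma size_ferm j p : (size (ferm false j p) <= size p)%N.
Proof.
have h n : (forall i, (n <= i)%N -> p`_i = 0) -> forall i, (n <= i)%N -> (ferm false j p)`_i = 0.
  elim: j n p => [|j IH] n p hp i hi.
    rewrite ferm0 coef_mix coef0 coef_odd_poly; case: ifP => // /negbT ei.
    by rewrite hp //; lia.
  rewrite fermS coef_mix coefN; case: ifP => /= oi.
    rewrite (IH n./2) ?oppr0 //; last by lia.
    by move=> k hk; rewrite coef_odd_poly hp //; lia.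
  apply: (IH (uphalf n)); last by lia.
  by move=> k hk; rewrite coef_even_poly hp //; lia.
by apply/leq_sizeP => i hi; apply: (h (size p)) => // k hk; rewrite nth_default.
Qed.

Definition ip p q := \sum_(i < size p) p`_i * (q`_i)^*.

Lemma ipE N p q : (size p <= N)%N -> ip p q = \sum_(i < N) p`_i * (q`_i)^*.
Proof.
move=> le; rewrite /ip -!(big_mkord xpredT (fun i => p`_i * (q`_i)^*)).
rewrite [RHS](big_cat_nat (n := size p)) //= [X in _ + X]big_nat_cond [X in _ + X]big1 ?addr0 //.
by move=> i /andP[/andP[hi _] _]; rewrite nth_default ?mul0r.
Qed.

Lemma ip_lin (a : F) p p' q : ip (a *: p + p') q = a * ip p q + ip p' q.
Proof.
pose N := maxn (size (a *: p + p')) (maxn (size p) (size p')).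
rewrite !(@ipE N) ?leq_max ?leqnn ?orbT // mulr_sumr -big_split.
by apply: eq_bigr => i _; rewrite /= coefD coefZ; ring.
Qed.

Lemma ip_conj p q : ip q p = (ip p q)^*.
Proof.
rewrite !(@ipE (maxn (size p) (size q))) ?leq_max ?leqnn ?orbT // rmorph_sum.
by apply: eq_bigr => i _; rewrite /= rmorphM /= conjCK mulrC.
Qed.

Lemma ip_ge0 p : 0 <= ip p p.
Proof. by apply: sumr_ge0 => i _; rewrite mul_conjC_ge0. Qed.

Lemma ip1r p : ip p 1 = p`_0.
Proof.
rewrite (@ipE (size p).+1) // big_ord_recl coef1 rmorph1 mulr1 big1 ?addr0 // => i _.
by rewrite coef1 rmorph0 mulr0.
Qed.

Lemma ip_mix p q p' q' : ip (mix p q) (mix p' q') = ip p p' + ip q q'.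
Proof.
pose N := maxn (size p) (size q).
rewrite (@ipE (N.*2)) ?(@ipE N p) ?(@ipE N q) ?leq_max ?leqnn ?orbT //; last first.
  have h1 : (size p <= N)%N by rewrite leq_maxl.
  have h2 : (size q <= N)%N by rewrite leq_maxr.
  apply/leq_sizeP => i hi; rewrite coef_mix; case: ifP => oi; apply: nth_default; [apply: leq_trans h2 _|apply: leq_trans h1 _]; move: (N) hi => ? ?; lia.
elim: N => [|N IH]; first by rewrite !big_ord0 addr0.
rewrite doubleS !big_ord_recr /= IH !coef_mix /= odd_double /= uphalf_double doubleK.
by ring.
Qed.

Lemma ferm_adj b j p q : ip (ferm b j p) q = ip p (ferm (~~ b) j q).
Proof.
have ipr0 r : ip r 0 = 0 by rewrite /ip big1 // => i _; rewrite coef0 rmorph0 mulr0.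
have ip0r r : ip 0 r = 0 by rewrite ip_conj ipr0 rmorph0.
have ipN r s : ip (- r) s = - ip r s by rewrite -scaleN1r -[_ *: r]addr0 ip_lin ip0r addr0 mulN1r.
have ipNr r s : ip r (- s) = - ip r s by rewrite ip_conj ipN rmorphN /= -ip_conj.
elim: j p q => [|j IH] p q.
  by rewrite -{1}[q]mixK -{2}[p]mixK !ferm0; case: b => /=; rewrite !ip_mix ?ip0r ?ipr0 ?addr0 ?add0r.
by rewrite -{1}[q]mixK -{2}[p]mixK !fermS !ip_mix !ipN !ipNr !IH.
Qed.

End Fock.

(** * Currents bilinear in real fermions *)

Section Currents.
Variables (F : numClosedFieldType) (X : finType).
Implicit Types (a b : X) (i s : int) (v : {poly F}) (M : X -> X -> F).

Definition flav (a : X) (n : nat) := (n * #|X| + enum_rank a)%N.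

Lemma flav_inj a b n m : flav a n = flav b m -> a = b /\ n = m.
Proof.
move=> e; have lt c : (enum_rank c < #|X|)%N := ltn_ord _.
have nm : n = m.
  have := congr1 (fun x => x %/ #|X|)%N e.
  by rewrite /flav !divnMDl ?(leq_ltn_trans _ (lt a)) // !divn_small ?lt // !addn0.
split=> //; apply: enum_rank_inj; apply: val_inj; move: e; rewrite /flav nm.
by move/addnI.
Qed.

Lemma flav_ge a n : (n <= flav a n)%N.
Proof. by rewrite /flav (leq_trans _ (leq_addr _ _)) // leq_pmulr // (leq_ltn_trans _ (ltn_ord (enum_rank a))). Qed.

(* The mode chi a i is the Fourier mode of degree i + 1/2 of the a-th real fermion. *)
Definition chi a i : {linear {poly F} -> {poly F}} :=
  match i with Posz n => ferm F false (flav a n) | Negz n => ferm F true (flav a n) end.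

Lemma chi_car a i b j v :
  chi a i (chi b j v) + chi b j (chi a i v) = if (a == b) && (i + j + 1 == 0) then v else 0.
Proof.
have ef n m : (flav a n == flav b m) = (a == b) && (n == m).
  by apply/eqP/andP => [/flav_inj [-> ->]|[/eqP -> /eqP ->]].
case: i j => [n|n] [m|m]; rewrite /chi ferm_car ef -andbA; congr (if _ && _ then _ else _);
  by rewrite ?NegzE /= ?andbT ?andbF; lia.
Qed.

Lemma chi_annihil a (n : nat) v : (size v <= n.+1)%N -> chi a n v = 0.
Proof. by move=> sv; apply: ferm_annihil; apply: leq_trans sv _; rewrite ltnS flav_ge. Qed.

Lemma chi_adj a i u v : ip (chi a i u) v = ip u (chi a (- 1 - i) v).
Proof.
case: i => n; rewrite /chi; last by have -> : -1 - Negz n = n :> int by [rewrite NegzE; lia]; rewrite ferm_adj.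
by rewrite (_ : -1 - n%:Z = Negz n :> int) ?ferm_adj // NegzE; lia.
Qed.

Definition cur_term M s v i : {poly F} := \sum_a \sum_b M a b *: chi a (s - 1 - i) (chi b i v).

Lemma evz_cur M s v : evz (cur_term M s v).
Proof.
apply: evz_sum => a; apply: evz_sum => b; apply: (evzZ (fun=> M a b)).
exists (size v)%:Z => i hi; have -> : i = `|i|%N%:Z by lia.
by rewrite chi_annihil ?linear0 //; lia.
Qed.

(** Half of the normally ordered bilinear form. For antisymmetric [M] the second sum is the part i <
    0 of the first with its two factors exchanged and i replaced by s - 1 - i. *)
Definition cur_fun M s v : {poly F} :=
  2%:R^-1 *: (fsum (cur_term M s v) 0 + fsum (cur_term M s v) s).

Lemma cur_linear M s : linear (cur_fun M s).
Proof.
move=> a u v; have e x : fsum (cur_term M s (a *: u + v)) x =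
    a *: fsum (cur_term M s u) x + fsum (cur_term M s v) x.
  rewrite -fsumZ; last exact: evz_cur.
  rewrite -fsumD; [|exact: evzZ (evz_cur M s u)|exact: evz_cur].
  apply: eq_fsum => i _; rewrite /cur_term scaler_sumr -big_split /=.
  apply: eq_bigr => b _; rewrite scaler_sumr -big_split /=.
  by apply: eq_bigr => c _; rewrite !linearP.
rewrite /cur_fun !e; move: (fsum _ _) (fsum _ _) (fsum _ _) (fsum _ _) => A B C D.
by lmodule F.
Qed.

Definition cur M s : {linear {poly F} -> {poly F}} := linmk (@cur_linear M s).

Lemma curE M s v : cur M s v = 2%:R^-1 *: (fsum (cur_term M s v) 0 + fsum (cur_term M s v) s).
Proof. exact: linmkE. Qed.

Lemma cur_lin (c : F) M M' s v :
  cur (fun a b => c * M a b + M' a b) s v = c *: cur M s v + cur M' s v.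
Proof.
have e x : fsum (cur_term (fun a b => c * M a b + M' a b) s v) x =
    c *: fsum (cur_term M s v) x + fsum (cur_term M' s v) x.
  rewrite -fsumZ; last exact: evz_cur.
  rewrite -fsumD; [|exact: evzZ (evz_cur M s v)|exact: evz_cur].
  apply: eq_fsum => i _; rewrite /cur_term scaler_sumr -big_split /=.
  apply: eq_bigr => a _; rewrite scaler_sumr -big_split /=.
  by apply: eq_bigr => b _; rewrite scalerDl scalerA.
rewrite !curE !e; move: (fsum _ _) (fsum _ _) (fsum _ _) (fsum _ _) => A B C D.
by lmodule F.
Qed.

Lemma eq_cur M M' s v : (forall a b, M a b = M' a b) -> cur M s v = cur M' s v.
Proof. by move=> e; have -> : M = M' by apply/funext => a; apply/funext => b. Qed.

Lemma cur_zero M s v : (forall a b, M a b = 0) -> cur M s v = 0.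
Proof.
move=> M0; rewrite curE !(eq_fsum (H := fun=> 0)) ?fsum0 ?addr0 ?scaler0 // => q _;
  by apply: big1 => a _; apply: big1 => b _; rewrite M0 scale0r.
Qed.

Lemma cur_vac M (n : nat) : (forall a, M a a = 0) -> cur M n 1 = 0.
Proof.
move=> M0; have z (i : nat) x a : chi a (x%:Z + i%:Z) 1 = 0.
  by apply: chi_annihil; rewrite size_poly1.
by rewrite curE !(@fsumE _ 0) ?big_ord0 ?addr0 ?scaler0 // => i _; apply: big1 => a _;
  apply: big1 => b _; rewrite ?(z _ 0) ?z linear0 scaler0.
Qed.

Lemma cur_truncated M : truncated (cur M).
Proof.
move=> v; exists (2 * size v + 1)%N%:Z => p hp; have -> : p = `|p|%N%:Z by lia.
set n := `|p|%N; rewrite curE (@fsumE _ (size v)); last first.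
  by move=> i hi; apply: big1 => a _; apply: big1 => b _; rewrite add0r chi_annihil ?linear0 ?scaler0 // leqW.
rewrite (@fsumE _ 0); last first.
  by move=> i hi; apply: big1 => a _; apply: big1 => b _; rewrite (_ : n%:Z + i%:Z = (n + i)%N) // chi_annihil ?linear0 ?scaler0 //;
    move: (size v) hp => z hp; lia.
rewrite big_ord0 addr0 big1 ?scaler0 // => i _; apply: big1 => a _; apply: big1 => b _.
have := ltn_ord i => hi.
have nv : (2 * size v < n)%N by move: (size v) hp @n => z hp n; rewrite /n; lia.
have -> : n%:Z - 1 - (0 + i%:Z) = (n - 1 - i)%N%:Z by rewrite add0r; move: (nat_of_ord i) hi => k hi; move: (n) (size v) hi nv => ? ? ? ?; lia.
rewrite chi_annihil ?scaler0 // add0r.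
by apply: leq_trans (size_ferm _ _) _; move: (nat_of_ord i) hi => k hi; move: (size v) hi nv => ? ? ?; lia.
Qed.

Definition antisym M := forall a b, M a b = - M b a.

Lemma cur_chi M p c s v : antisym M ->
  cur M p (chi c s v) - chi c s (cur M p v) = \sum_a M a c *: chi a (p + s) v.
Proof.
move=> Ma; set w := \sum_a _.
have t i : cur_term M p (chi c s v) i - chi c s (cur_term M p v i) =
    (if i == - 1 - s then w else 0) + (if i == p + s then w else 0).
  rewrite /cur_term linear_sum -sumrB.
  have e a b : M a b *: chi a (p - 1 - i) (chi b i (chi c s v)) -
      chi c s (M a b *: chi a (p - 1 - i) (chi b i v)) =
      (if (b == c) && (i + s + 1 == 0) then M a b *: chi a (p - 1 - i) v else 0)
      - (if (a == c) && (p - 1 - i + s + 1 == 0) then M a b *: chi b i v else 0).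
    rewrite linearZ /= -scalerBr.
    have -> : chi a (p - 1 - i) (chi b i (chi c s v)) - chi c s (chi a (p - 1 - i) (chi b i v)) =
      chi a (p - 1 - i) (chi b i (chi c s v) + chi c s (chi b i v)) -
      (chi a (p - 1 - i) (chi c s (chi b i v)) + chi c s (chi a (p - 1 - i) (chi b i v))).
      by rewrite linearD opprD addrA addrK.
    by rewrite !chi_car scalerBr; case: ifP => _; case: ifP => _; rewrite ?linear0 ?scaler0.
  transitivity (\sum_a (if i + s + 1 == 0 then M a c *: chi a (p - 1 - i) v else 0)
     - \sum_b (if p - 1 - i + s + 1 == 0 then M c b *: chi b i v else 0)).
    transitivity (\sum_a (if i + s + 1 == 0 then M a c *: chi a (p - 1 - i) v else 0)
      - \sum_a (if a == c then \sum_b (if p - 1 - i + s + 1 == 0 then M a b *: chi b i v else 0)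
                 else 0)); last by rewrite -[X in _ - X]big_mkcond big_pred1_eq.
    rewrite -sumrB; apply: eq_bigr => a _.
    rewrite linear_sum -sumrB (eq_bigr _ (fun b _ => e a b)) sumrB; congr (_ - _).
      rewrite (bigD1 c) //= eqxx big1 ?addr0 // => b /negPf ->; by [].
    by case: (a == c) => //=; rewrite big1.
  congr (_ + _).
    have -> : (i + s + 1 == 0) = (i == - 1 - s) by lia.
    case: eqP => [->|_]; last by rewrite big1.
    by apply: eq_bigr => a _; congr (_ *: chi a _ _); ring.
  have -> : (p - 1 - i + s + 1 == 0) = (i == p + s) by lia.
  case: eqP => [->|_]; last by rewrite big1 ?oppr0.
  by rewrite -sumrN; apply: eq_bigr => a _; rewrite [M c a]Ma scaleNr opprK.
have e x : fsum (cur_term M p (chi c s v)) x - chi c s (fsum (cur_term M p v) x) =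
    (if x <= - 1 - s then w else 0) + (if x <= p + s then w else 0).
  rewrite (fsum_additive (chi c s)); last exact: evz_cur.
  rewrite -fsumB; [|exact: evz_cur|exact: evz_additive (evz_cur M p v)].
  rewrite (eq_fsum (fun q _ => t q)).
  have ed y : evz (fun q : int => if q == y then w else 0).
    by exists (y + 1) => i le; case: eqP => // ?; exfalso; lia.
  by rewrite fsumD ?fsum_delta.
rewrite !curE [chi c s (_ *: _)]linearZ [chi c s (_ + _)]linearD /= -scalerBr opprD addrACA !e.
have -> : (p <= - 1 - s) = ~~ (0 <= p + s) by lia.
have -> : (p <= p + s) = ~~ (0 <= - 1 - s) by lia.
have -> (b b' : bool) : (if b then w else 0) + (if b' then w else 0) +
   ((if ~~ b' then w else 0) + (if ~~ b then w else 0)) = w + w.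
  by case: b; case: b'; rewrite /= ?addr0 ?add0r.
by rewrite -mulr2n -scaler_nat scalerA mulVf ?scale1r ?pnatr_eq0.
Qed.

Definition mxm M M' : X -> X -> F := fun a b => \sum_c M a c * M' c b.

(** M -> cur M is the spin representation of the orthogonal Lie algebra. The trace measures a
    mismatch of normal orderings: the products M M' and M' M arise with summation bounds shifted by
    p, and each of the p boundary terms is an anticommutator contributing the trace of M M'. *)
Lemma cur_cur M M' p q v : antisym M -> antisym M' ->
  cur M p (cur M' q v) - cur M' q (cur M p v) =
  cur (fun a b => mxm M M' a b - mxm M' M a b) (p + q) v +
  (if p + q == 0 then p%:~R / 2%:R * \sum_a mxm M M' a a else 0) *: v.
Proof.
move=> Ma Ma'; set s := p + q; set A := mxm M M'; set B := mxm M' M.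
have AB a b : B a b = A b a.
  by apply: eq_bigr => c _; rewrite Ma Ma' mulrNN mulrC.
have t i : cur M p (cur_term M' q v i) - cur_term M' q (cur M p v) i =
    cur_term A s v i - cur_term B s v (i + p).
  rewrite /cur_term linear_sum -sumrB.
  have e a b : cur M p (M' a b *: chi a (q - 1 - i) (chi b i v)) -
      M' a b *: chi a (q - 1 - i) (chi b i (cur M p v)) =
      \sum_c ((M c a * M' a b) *: chi c (s - 1 - i) (chi b i v) -
      (M' a b * M b c) *: chi a (s - 1 - (i + p)) (chi c (i + p) v)).
    rewrite linearZ /= -scalerBr.
    have -> : cur M p (chi a (q - 1 - i) (chi b i v)) - chi a (q - 1 - i) (chi b i (cur M p v)) =
      (cur M p (chi a (q - 1 - i) (chi b i v)) - chi a (q - 1 - i) (cur M p (chi b i v))) +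
      chi a (q - 1 - i) (cur M p (chi b i v) - chi b i (cur M p v)).
      by rewrite linearB addrA subrK.
    rewrite !cur_chi // linear_sum -big_split scaler_sumr; apply: eq_bigr => c _ /=.
    rewrite linearZ scalerDr !scalerA /= mulrC; congr (_ *: chi c _ _ + _); first by rewrite /s; ring.
    rewrite [M c b]Ma mulrN scaleNr; congr (- (_ *: chi a _ (chi c _ _))); last by ring.
    by rewrite /s; ring.
  transitivity (\sum_a \sum_b \sum_c ((M c a * M' a b) *: chi c (s - 1 - i) (chi b i v) -
      (M' a b * M b c) *: chi a (s - 1 - (i + p)) (chi c (i + p) v))).
    by apply: eq_bigr => a _; rewrite linear_sum -sumrB; apply: eq_bigr => b _; rewrite e.
  under eq_bigr => a _ do (under eq_bigr => b _ do rewrite sumrB; rewrite sumrB).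
  rewrite sumrB; congr (_ - _).
    under eq_bigr do rewrite exchange_big.
    rewrite exchange_big; apply: eq_bigr => c _; rewrite exchange_big.
    by apply: eq_bigr => b _; rewrite -scaler_suml.
  apply: eq_bigr => a _; rewrite exchange_big; apply: eq_bigr => c _.
  by rewrite -scaler_suml.
have e x : cur M p (fsum (cur_term M' q v) x) - fsum (cur_term M' q (cur M p v)) x =
    fsum (cur_term A s v) x - fsum (cur_term B s v) (x + p).
  rewrite (fsum_additive (cur M p)); last exact: evz_cur.
  rewrite -fsumB; [|exact: evz_additive (evz_cur M' q v)|exact: evz_cur].
  rewrite (eq_fsum (fun q _ => t q)) fsumB ?fsum_shift //; first exact: evz_cur.
  exact: (evz_shift p (evz_cur B s v)).
rewrite (curE M' q) (curE M' q (cur M p v)) linearZ linearD -scalerBr /= opprD addrACA !e.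
have -> : cur (fun a b => A a b - B a b) s v = cur A s v - cur B s v.
  rewrite (eq_cur (M' := fun a b => (-1) * B a b + A a b)); last by move=> a b; ring.
  by rewrite cur_lin scaleN1r addrC.
have d : fsum (cur_term B s v) 0 - fsum (cur_term B s v) p +
   (fsum (cur_term A s v) (s - p) - fsum (cur_term A s v) s) =
   (if s == 0 then p%:~R * \sum_a A a a else 0) *: v.
  clear t e; clearbody s; move: p; apply: int_step_eq.
    by rewrite !subrr subr0 subrr addr0 mul0r if_same scale0r.
  move=> p; rewrite (_ : s - p = s - (p + 1) + 1); last by ring.
  rewrite (fsum_step p (evz_cur B s v)) (fsum_step (s - (p + 1)) (evz_cur A s v)) -scalerBl.
  have -> : (if s == 0 then (p + 1)%:~R * \sum_a A a a else 0) -
    (if s == 0 then p%:~R * \sum_a A a a else 0) = if s == 0 then \sum_a A a a else 0.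
    by case: eqP => _; rewrite ?subr0 // rmorphD /=; ring.
  transitivity (cur_term A s v (s - (p + 1)) + cur_term B s v p).
    move: (fsum _ _) (fsum _ _) (fsum _ _) (fsum _ _) (cur_term _ _ _ _) (cur_term _ _ _ _).
    by move=> x1 x2 x3 x4 x5 x6; lmodule F.
  rewrite /cur_term [X in _ + X]exchange_big -big_split /=.
  transitivity (\sum_a \sum_b (if (a == b) && (s == 0) then A a b *: v else 0)).
    apply: eq_bigr => a _; rewrite -big_split; apply: eq_bigr => b _ /=.
    rewrite AB -scalerDr (_ : s - 1 - (s - (p + 1)) = p); last by ring.
    rewrite (_ : s - (p + 1) = s - 1 - p); last by ring.
    rewrite chi_car (_ : p + (s - 1 - p) + 1 = s); last by ring.
    by case: ifP => _; rewrite ?scaler0.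
  case: (s == 0); last by rewrite scale0r big1 // => a _; rewrite big1 // => b _; rewrite andbF.
  rewrite scaler_suml; apply: eq_bigr => a _; rewrite (bigD1 a) //= eqxx big1 ?addr0 //.
  by move=> b; rewrite andbT eq_sym => /negPf ->.
have -> : (if s == 0 then p%:~R / 2%:R * \sum_a A a a else 0) *: v =
   2%:R^-1 *: ((if s == 0 then p%:~R * \sum_a A a a else 0) *: v).
  by rewrite scalerA; congr (_ *: _); case: eqP => _; rewrite ?mulr0 //; ring.
rewrite -d !curE add0r [q + p]addrC -/s (_ : s - p = q); last by rewrite /s; ring.
move: (fsum _ _) (fsum _ _) (fsum _ _) (fsum _ _) (fsum _ _) (fsum _ _) => x1 x2 x3 x4 x5 x6.
by lmodule F.
Qed.

Lemma cur_adj M p u v : antisym M -> (forall a b, (M a b)^* = M a b) ->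
  ip (cur M p u) v = - ip u (cur M (- p) v).
Proof.
move=> Ma Mr.
have ipD x y z : ip (x + y) z = ip x z + ip y z by rewrite -{1}[x]scale1r ip_lin mul1r.
have ipZ c x z : ip (c *: x) z = c * ip x z.
  have ip0 : ip 0 z = 0 by rewrite /ip size_poly0 big_ord0.
  by rewrite -[c *: x]addr0 ip_lin ip0 addr0.
have ipDr x y z : ip z (x + y) = ip z x + ip z y by rewrite ip_conj ipD rmorphD /= -!ip_conj.
have ipZr c x z : ip z (c *: x) = c^* * ip z x by rewrite ip_conj ipZ rmorphM /= -ip_conj.
have ipsl (T : finType) (G : T -> {poly F}) z : ip (\sum_i G i) z = \sum_i ip (G i) z.
  by apply: (big_morph (fun x => ip x z)) => //; rewrite -(scale0r 0) ipZ mul0r.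
have ipsr (T : finType) (G : T -> {poly F}) z : ip z (\sum_i G i) = \sum_i ip z (G i).
  by apply: (big_morph (ip z)) => //; rewrite -(scale0r 0) ipZr rmorph0 mul0r.
have t i : ip (cur_term M p u i) v = - ip u (cur_term M (- p) v (i - p)).
  rewrite ipsl; under eq_bigr do rewrite ipsl.
  rewrite exchange_big ipsr -sumrN; apply: eq_bigr => a _; rewrite ipsr -sumrN.
  apply: eq_bigr => b _; rewrite ipZ ipZr Mr [M b a]Ma mulNr; congr (- (_ * _)).
  by rewrite !chi_adj; congr (ip u (chi _ _ (chi _ _ _))); ring.
have hs x : ip (fsum (cur_term M p u) x) v = - ip u (fsum (cur_term M (- p) v) (x - p)).
  have [N hN] := evz_nat x (evz_cur M p u).
  have [N' hN'] := evz_nat (x - p) (evz_cur M (- p) v).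
  rewrite !(@fsumE _ (maxn N N')) => [|i|i]; rewrite ?geq_max; last 2 first.
  - by case/andP=> ? ?; rewrite hN'.
  - by case/andP=> ? ?; rewrite hN.
  rewrite ipsl ipsr -sumrN; apply: eq_bigr => i _; rewrite t; congr (- ip u (cur_term _ _ _ _)).
  by ring.
rewrite !curE ipZ ipZr ipD ipDr !hs subrr sub0r rmorphV ?unitfE ?pnatr_eq0 //= rmorph_nat.
by ring.
Qed.

End Currents.

(** * The coset construction of the discrete series *)

Lemma sugL_commute (F : numFieldType) (V : lmodType F) (I : finType)
    (J : I -> int -> {linear V -> V}) (Jtr : forall a, truncated (J a)) k g
    (D : {linear V -> V}) n v :
  (forall a m v, D (J a m v) = J a m (D v)) -> D (sugL k g Jtr n v) = sugL k g Jtr n (D v).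
Proof.
move=> h; rewrite !sugLE linearZ /=; congr (_ *: _).
rewrite !sugE linearD /= !(fsum_additive D); try exact: evz_sug.
by congr (_ + _); apply: eq_fsum => q _; rewrite /sug_term /= linear_sum; apply: eq_bigr => a _;
  rewrite !h.
Qed.

Section Coset.
Variables (F : numFieldType) (V : lmodType F) (I : finType) (f : I -> I -> I -> F) (g : F).
Hypothesis fC : forall a b c, f a b c = - f b a c.
Hypothesis fA : forall a b c, f a b c = - f a c b.
Hypothesis fK : forall b d, \sum_a \sum_c f a c b * f a c d = if b == d then - (2%:R * g) else 0.

Definition affine (J : I -> int -> {linear V -> V}) (k : F) :=
  forall a b m n v, J a m (J b n v) - J b n (J a m v) =
  (\sum_c f a b c *: J c (m + n) v) + (if (m + n == 0) && (a == b) then m%:~R * k else 0) *: v.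

Variables (J1 J2 J : I -> int -> {linear V -> V}) (k1 k2 k : F).
Hypotheses (tr1 : forall a, truncated (J1 a)) (tr2 : forall a, truncated (J2 a))
  (tr : forall a, truncated (J a)).
Hypotheses (JJ1 : affine J1 k1) (JJ2 : affine J2 k2) (JJ : affine J k).
Hypotheses (kg1 : k1 + g != 0) (kg2 : k2 + g != 0) (kg : k + g != 0).
Hypothesis J12 : forall a b m n v, J1 a m (J2 b n v) = J2 b n (J1 a m v).
Hypothesis JE : forall a n v, J a n v = J1 a n v + J2 a n v.

Lemma coset_linear n :
  linear (fun v => sugL k1 g tr1 n v + sugL k2 g tr2 n v - sugL k g tr n v).
Proof.
move=> a u v; rewrite [sugL k1 g tr1 n _]linearP [sugL k2 g tr2 n _]linearP [sugL k g tr n _]linearP.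
move: (sugL _ _ _ _ _) (sugL _ _ _ _ _) (sugL _ _ _ _ _) (sugL _ _ _ _ _) (sugL _ _ _ _ _) (sugL _ _ _ _ _).
by move=> x1 x2 x3 x4 x5 x6; lmodule F.
Qed.

Definition cosetL n : {linear V -> V} := linmk (@coset_linear n).

Lemma cosetLE n v : cosetL n v = sugL k1 g tr1 n v + sugL k2 g tr2 n v - sugL k g tr n v.
Proof. exact: linmkE. Qed.

Let L1_J2 n a m v : sugL k1 g tr1 n (J2 a m v) = J2 a m (sugL k1 g tr1 n v).
Proof. by rewrite (sugL_commute tr1 k1 g (D := J2 a m)) // => b p w; rewrite J12. Qed.

Let L2_J1 n a m v : sugL k2 g tr2 n (J1 a m v) = J1 a m (sugL k2 g tr2 n v).
Proof. by rewrite (sugL_commute tr2 k2 g (D := J1 a m)) // => b p w; rewrite J12. Qed.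

Let L1_L2 n m v : sugL k1 g tr1 n (sugL k2 g tr2 m v) = sugL k2 g tr2 m (sugL k1 g tr1 n v).
Proof. by apply: sugL_commute => a p w; exact: L1_J2. Qed.

(** The sum of the two partial Sugawara operators and the total one have the same commutators with
    the total currents. *)
Lemma coset_J n a m v : cosetL n (J a m v) = J a m (cosetL n v).
Proof.
have e1 := sugL_J tr1 JJ1 fC fA fK kg1 n a m v.
have e2 := sugL_J tr2 JJ2 fC fA fK kg2 n a m v.
have e := sugL_J tr JJ fC fA fK kg n a m v.
apply/eqP; rewrite -subr_eq0; apply/eqP.
rewrite !cosetLE linearB linearD /= {1 2}JE !linearD /= L1_J2 L2_J1.
transitivity ((sugL k1 g tr1 n (J1 a m v) - J1 a m (sugL k1 g tr1 n v)) +
   (sugL k2 g tr2 n (J2 a m v) - J2 a m (sugL k2 g tr2 n v)) -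
   (sugL k g tr n (J a m v) - J a m (sugL k g tr n v))).
  rewrite [J a m (sugL _ _ tr1 _ _)]JE [J a m (sugL _ _ tr2 _ _)]JE.
  move: (sugL k1 g tr1 n (J1 a m v)) (sugL k2 g tr2 n (J2 a m v)) (sugL k g tr n (J a m v))
    (J a m (sugL k g tr n v)) (J1 a m (sugL k1 g tr1 n v)) (J2 a m (sugL k1 g tr1 n v))
    (J1 a m (sugL k2 g tr2 n v)) (J2 a m (sugL k2 g tr2 n v)) => x1 x2 x3 x4 x5 x6 x7 x8.
  by lmodule F.
by rewrite e1 e2 e JE scalerDr subrr.
Qed.

(** Commuting with the total currents, the difference commutes with the Sugawara operators built
    from them. The sum of the partial operators is thus a commuting sum of [cosetL] and the total
    ones, and central charges subtract. *)
Lemma coset_vir : is_vir (k1 * #|I|%:R / (k1 + g) + k2 * #|I|%:R / (k2 + g) - k * #|I|%:R / (k + g))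
  cosetL.
Proof.
move=> m n v.
have e1 := sugL_vir tr1 JJ1 fC fA fK kg1 m n v.
have e2 := sugL_vir tr2 JJ2 fC fA fK kg2 m n v.
have e := sugL_vir tr JJ fC fA fK kg m n v.
have cL p q w : cosetL p (sugL k g tr q w) = sugL k g tr q (cosetL p w).
  by apply: sugL_commute => a r x; exact: coset_J.
have c1 := cL m n v; have c2 := cL n m v.
set A1 := sugL k1 g tr1 in e1 c1 c2 *; set A2 := sugL k2 g tr2 in e2 c1 c2 *.
set A := sugL k g tr in e c1 c2 *.
have E p q : cosetL p (cosetL q v) = A1 p (A1 q v) + A2 p (A2 q v) + (A1 p (A2 q v) + A1 q (A2 p v))
    - A q (A1 p v + A2 p v - A p v) - A p (A1 q v + A2 q v).
  rewrite [cosetL q v]cosetLE linearB cL [cosetL p v]cosetLE -/A -/A1 -/A2.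
  rewrite [cosetL p _]cosetLE !linearD /= -/A -/A1 -/A2 -L1_L2 -/A1 -/A2.
  move: (A1 p (A1 q v)) (A1 p (A2 q v)) (A1 q (A2 p v)) (A2 p (A2 q v)) (A p (A1 q v)) (A p (A2 q v)).
  move: (A q _) => y x1 x2 x3 x4 x5 x6.
  by lmodule F.
rewrite !E !linearB !linearD /= cosetLE -/A -/A1 -/A2.
transitivity ((A1 m (A1 n v) - A1 n (A1 m v)) + (A2 m (A2 n v) - A2 n (A2 m v))
   - (A m (A n v) - A n (A m v))).
  move: (A1 m (A1 n v)) (A1 n (A1 m v)) (A2 m (A2 n v)) (A2 n (A2 m v)) (A m (A n v)) (A n (A m v))
   (A1 m (A2 n v)) (A1 n (A2 m v)) (A m (A1 n v)) (A m (A2 n v)) (A n (A1 m v)) (A n (A2 m v)).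
  by move=> x1 x2 x3 x4 x5 x6 x7 x8 x9 y1 y2 y3; lmodule F.
rewrite e1 e2 e; move: (A1 _ _) (A2 _ _) (A _ _) => x1 x2 x3.
by case: eqP => _; lmodule F.
Qed.

End Coset.

(** * The quaternion units as a real form of sl2 *)

Section Quaternions.

(* Left multiplication by i, j, k on the basis 1, i, j, k of the quaternions,
   which is labelled by (0,0), (1,0), (0,1), (1,1). *)
Definition quat (g : 'I_3) (y x : bool * bool) : int :=
  let s (b : bool) : int := if b then -1 else 1 in
  match val g with
  | 0 => if y == (~~ x.1, x.2) then s x.1 else 0
  | 1 => if y == (x.1, ~~ x.2) then s (x.1 (+) x.2) else 0
  | _ => if y == (~~ x.1, ~~ x.2) then s x.2 else 0
  end.

Definition eps3 (i j k : 'I_3) : int :=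
  if (val j == (i + 1) %% 3)%N && (val k == (i + 2) %% 3)%N then 1
  else if (val k == (i + 1) %% 3)%N && (val j == (i + 2) %% 3)%N then -1 else 0.

Lemma I3P (P : 'I_3 -> Prop) : P (inord 0) -> P (inord 1) -> P (inord 2) -> forall i, P i.
Proof.
move=> p0 p1 p2 i; have := ltn_ord i; case: (val i) (inord_val i) => [|[|[|]]] // <- //.
Qed.

Lemma sum_bool2 (V : nmodType) (G : bool * bool -> V) :
  \sum_z G z = G (false, false) + G (true, false) + (G (false, true) + G (true, true)).
Proof.
transitivity (\sum_z G (z.1, z.2)); first by apply: eq_bigr => -[].
rewrite -(pair_bigA _ (fun a b => G (a, b))) /= big_bool /= !big_bool /=.
by rewrite addrC [X in _ + X]addrC [X in X + _]addrC addrACA.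
Qed.

Lemma sum_I3 (V : nmodType) (G : 'I_3 -> V) :
  \sum_z G z = G (inord 0) + (G (inord 1) + G (inord 2)).
Proof.
rewrite !big_ord_recl big_ord0 addr0; congr (G _ + (G _ + G _)); apply: val_inj;
  by rewrite /= inordK.
Qed.

Ltac quat_cases := rewrite ?sum_bool2 ?sum_I3 /quat /eps3 /= ?inordK //=.

Lemma quat_anti g x y : quat g x y = - quat g y x.
Proof. by case: x y => [[] []] [[] []]; elim/I3P: g; quat_cases. Qed.

Lemma quat_comm i j x y : \sum_z (quat i x z * quat j z y - quat j x z * quat i z y) =
  2%:R * \sum_l eps3 i j l * quat l x y.
Proof. by case: x y => [[] []] [[] []]; elim/I3P: i; elim/I3P: j; quat_cases. Qed.

Lemma quat_trace i j : \sum_x \sum_z quat i x z * quat j z x = if i == j then -4%:R else 0.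
Proof.
rewrite sum_bool2; elim/I3P: i; elim/I3P: j; quat_cases; rewrite -val_eqE /= !inordK //.
Qed.

Lemma eps3C i j k : eps3 i j k = - eps3 j i k.
Proof. by elim/I3P: i; elim/I3P: j; elim/I3P: k; quat_cases. Qed.

Lemma eps3A i j k : eps3 i j k = - eps3 i k j.
Proof. by elim/I3P: i; elim/I3P: j; elim/I3P: k; quat_cases. Qed.

Lemma eps3K j l : \sum_i \sum_k eps3 i k j * eps3 i k l = if j == l then 2%:R else 0.
Proof.
by rewrite sum_I3 !(sum_I3 (fun k => eps3 _ k j * _)); elim/I3P: j; elim/I3P: l;
  rewrite -val_eqE; quat_cases.
Qed.

End Quaternions.

(** * Affine sl2 currents from 4N real fermions *)

Section Spin.
Variables (F : numClosedFieldType) (N : nat).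
Local Notation X := ('I_N * (bool * bool))%type.
Implicit Types (S T : {set 'I_N}).

(** Half the quaternion units satisfy [t_i, t_j] = eps_ijl t_l and are real antisymmetric; the four
    fermions of one copy carry level 1. The currents are anti-self-adjoint, so in this normalization
    the level N is the constant - N / 2 and the dual Coxeter number enters as g = -1. *)
Definition spin S (i : 'I_3) (a b : X) : F :=
  if (a.1 == b.1) && (a.1 \in S) then (quat i a.2 b.2)%:~R / 2%:R else 0.

Lemma spin_anti S i : antisym (spin S i).
Proof.
move=> a b; rewrite /spin; have [e|ne] := eqVneq a.1 b.1.
  by rewrite e quat_anti rmorphN /= mulNr; case: ifP => // _; rewrite oppr0.
by rewrite /= oppr0.
Qed.

Lemma spin_mxm S T i j a b : mxm (spin S i) (spin T j) a b =
  if (a.1 == b.1) && (a.1 \in S :&: T)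
  then (\sum_z quat i a.2 z * quat j z b.2)%:~R / 4%:R else 0.
Proof.
rewrite /mxm -(pair_bigA _ (fun x y => spin S i a (x, y) * spin T j (x, y) b)) /=.
rewrite (bigD1 a.1) //= [X in _ + X]big1 ?addr0; last first.
  move=> x nx; apply: big1 => y _; rewrite /spin /= eq_sym (negPf nx) mul0r //.
under eq_bigr do rewrite /spin /= eqxx /=.
rewrite inE; case: (a.1 \in S) => /=; last first.
  by rewrite andbF big1 // => y _; rewrite mul0r.
case: ifP => _; last by rewrite big1 // => y _; rewrite mulr0.
rewrite rmorph_sum mulr_suml; apply: eq_bigr => z _; rewrite rmorphM /=.
by field.
Qed.

Definition spinJ S i n := cur (spin S i) n.

Lemma spinJ_comm S T i j m n v : spinJ S i m (spinJ T j n v) - spinJ T j n (spinJ S i m v) =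
  (\sum_l (eps3 i j l)%:~R *: spinJ (S :&: T) l (m + n) v) +
  (if (m + n == 0) && (i == j) then m%:~R * (- (#|S :&: T|%:R / 2%:R)) else 0) *: v.
Proof.
rewrite cur_cur; try exact: spin_anti; congr (_ + _ *: v).
  transitivity (cur (fun a b => \sum_l (eps3 i j l)%:~R * spin (S :&: T) l a b) (m + n) v).
    apply: eq_cur => a b; rewrite !spin_mxm [T :&: S]setIC /spin.
    case: ifP => _; last by rewrite subrr big1 // => l _; rewrite mulr0.
    rewrite -mulrBl -rmorphB -sumrB quat_comm rmorphM rmorph_sum /= mulr_sumr mulr_suml.
    by apply: eq_bigr => l _; rewrite rmorphM /=; field.
  rewrite sum_I3 (eq_cur (M' := fun a b => (eps3 i j (inord 0))%:~R * spin (S :&: T) (inord 0) a b +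
    ((eps3 i j (inord 1))%:~R * spin (S :&: T) (inord 1) a b +
     ((eps3 i j (inord 2))%:~R * spin (S :&: T) (inord 2) a b + 0)))); last first.
    by move=> a b; rewrite sum_I3 addr0.
  by rewrite !cur_lin (cur_zero (M := fun _ _ => 0)) ?addr0.
case: eqP => //= _.
have -> : \sum_a mxm (spin S i) (spin T j) a a = if i == j then - #|S :&: T|%:R else 0.
  under eq_bigr do rewrite spin_mxm eqxx.
  rewrite -(pair_bigA _ (fun x y => if true && (x \in S :&: T) then
     (\sum_z quat i y z * quat j z y)%:~R / 4%:R else 0)) /=.
  transitivity (\sum_(x in S :&: T) (if i == j then -1 else 0 : F)).
    rewrite [RHS]big_mkcond; apply: eq_bigr => x _; case: ifP => _; last by rewrite big1.
    rewrite -mulr_suml -rmorph_sum quat_trace /=; case: eqP => _; last by rewrite mul0r.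
    by rewrite rmorphN /=; field.
  by rewrite sumr_const; case: eqP => _; rewrite ?mul0rn // mulNrn.
by case: eqP => _; rewrite ?mulr0 //; ring.
Qed.

Lemma spinJ_affine S : affine (fun i j k => (eps3 i j k)%:~R) (spinJ S) (- (#|S|%:R / 2%:R)).
Proof. by move=> i j m n v; rewrite spinJ_comm setIid. Qed.

Lemma spinJ_tr S i : truncated (spinJ S i).
Proof. exact: cur_truncated. Qed.

Lemma spinJ_adj S i n u v : ip (spinJ S i n u) v = -1 * ip u (spinJ S i (- n) v).
Proof.
rewrite mulN1r cur_adj //; first exact: spin_anti.
move=> a b; rewrite /spin; case: ifP => _; last by rewrite rmorph0.
by rewrite rmorphM /= rmorph_int fmorphV rmorph_nat.
Qed.

Lemma spinJ_vac S i (n : nat) : spinJ S i n 1 = 0.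
Proof.
apply: cur_vac => a; rewrite /spin eqxx; case: ifP => // _.
by have /eqP := quat_anti i a.2 a.2; rewrite -subr_eq0 opprK -mulr2n mulrn_eq0 /= => /eqP ->;
  rewrite mul0r.
Qed.

End Spin.

Theorem minimal_series_unitary (F : numClosedFieldType) (m : nat) : (2 <= m)%N ->
  exists L : int -> {linear {poly F} -> {poly F}},
  [/\ is_vir (1 - 6%:R / (m * m.+1)%:R) L, forall n : nat, L n 1 = 0
    & forall n u v, ip (L n u) v = ip u (L (- n) v)].
Proof.
case: m => [|[|k]] // _; pose N := k.+1.
(* Here m is k + 2. Of the k + 1 copies, one carries level 1 and the others level k; the coset by
   the diagonal currents of level k + 1 has charge 3k/(k+2) + 1 - 3(k+1)/(k+3) = 1 -
   6/((k+2)(k+3)). *)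
pose S2 : {set 'I_N} := [set ord_max]; pose S1 : {set 'I_N} := ~: S2.
pose J S := spinJ F (N := N) S; pose kk (S : {set 'I_N}) : F := - (#|S|%:R / 2%:R).
have kg S : kk S + -1 != 0.
  rewrite /kk (_ : _ + _ = - ((#|S| + 2)%N%:R / 2%:R)); last by rewrite natrD; field.
  by rewrite oppr_eq0 mulf_neq0 ?invr_eq0 ?pnatr_eq0 // addn2.
have c1 : #|S1| = k by have := cardsC S2; rewrite cards1 card_ord => /(congr1 predn).
have fC a b c : (eps3 a b c)%:~R = - (eps3 b a c)%:~R :> F by rewrite -rmorphN -eps3C.
have fA a b c : (eps3 a b c)%:~R = - (eps3 a c b)%:~R :> F by rewrite -rmorphN -eps3A.
have fK b d : \sum_a \sum_c (eps3 a c b)%:~R * (eps3 a c d)%:~R =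
    if b == d then - (2%:R * (-1)) else 0 :> F.
  under eq_bigr do (under eq_bigr do rewrite -rmorphM /=; rewrite -rmorph_sum).
  by rewrite -rmorph_sum eps3K /=; case: eqP => _ //; rewrite mulrN1 opprK.
have J12 a b p q v : J S1 a p (J S2 b q v) = J S2 b q (J S1 a p v).
  apply/eqP; rewrite -subr_eq0 spinJ_comm setIC setICr cards0 mul0r oppr0 mulr0 if_same scale0r addr0.
  apply/eqP; apply: big1 => l _; rewrite (_ : spinJ F set0 l _ v = 0) ?scaler0 //.
  by apply: cur_zero => x y; rewrite /spin inE andbF.
have JE a n v : J setT a n v = J S1 a n v + J S2 a n v.
  rewrite -[X in X + _]scale1r -cur_lin; apply: eq_cur => x y; rewrite /spin !inE mul1r.
  by case: (x.1 == y.1); case: (x.1 == ord_max); rewrite /= ?addr0 ?add0r.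
pose L := cosetL (-1) (kk S1) (kk S2) (kk setT) (@spinJ_tr F N S1) (@spinJ_tr F N S2) (@spinJ_tr F N setT).
exists L; split.
- have : is_vir (kk S1 * #|'I_3|%:R / (kk S1 + -1) + kk S2 * #|'I_3|%:R / (kk S2 + -1)
      - kk setT * #|'I_3|%:R / (kk setT + -1)) L.
    by apply: (coset_vir (f := fun i j k => (eps3 i j k)%:~R)) => //; exact: spinJ_affine.
  congr (is_vir _ _); rewrite /kk c1 cards1 cardsT !card_ord /N natrM.
  have h (i : nat) : (k%:R + i.+1%:R : F) != 0 by rewrite -natrD addnS pnatr_eq0.
  have -> : (k.+1%:R : F) = k%:R + 1%:R by rewrite -natrD addn1.
  have -> : (k.+2%:R : F) = k%:R + 2%:R by rewrite -natrD addn2.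
  have -> : (k.+3%:R : F) = k%:R + 3%:R by rewrite -natrD addn3.
  have h2 := h 1; have h3 := h 2.
  field; rewrite h3 h2 /= (_ : - (k%:R + 1) - 2%:R = - (k%:R + 3%:R)); last by ring.
  by rewrite (_ : - k%:R - 2%:R = - (k%:R + 2%:R)) ?oppr_eq0 ?h3 ?h2 //; ring.
- move=> n; rewrite cosetLE.
  have z S : sugL (kk S) (-1) (@spinJ_tr F N S) n 1 = 0.
    rewrite sugLE sugE !(eq_fsum (H := fun=> 0)) ?fsum0 ?addr0 ?scaler0 // => q hq;
      by apply: big1 => a _; have -> : q = `|q|%N%:Z :> int; [lia | rewrite spinJ_vac linear0].
  by rewrite !z addr0 subrr.
move=> n u v.
have ipD (x y z : {poly F}) : ip (x + y) z = ip x z + ip y z by rewrite -{1}[x]scale1r ip_lin mul1r.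
have ipDr (x y z : {poly F}) : ip z (x + y) = ip z x + ip z y by rewrite ip_conj ipD rmorphD /= -!ip_conj.
have ipZ c (x y : {poly F}) : ip (c *: x) y = c * ip x y.
  by rewrite -[c *: x]addr0 ip_lin (_ : ip 0 y = 0) ?addr0 // /ip size_poly0 big_ord0.
have ipZr c (x y : {poly F}) : ip y (c *: x) = c^* * ip y x by rewrite ip_conj ipZ rmorphM /= -ip_conj.
have ipN (x y : {poly F}) : ip (- x) y = - ip x y by rewrite -scaleN1r ipZ mulN1r.
have ipNr (x y : {poly F}) : ip y (- x) = - ip y x by rewrite -scaleN1r ipZr rmorphN rmorph1 mulN1r.
have z S : ip (sugL (kk S) (-1) (@spinJ_tr F N S) n u) v = ip u (sugL (kk S) (-1) (@spinJ_tr F N S) (- n) v).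
  rewrite !sugLE ipZ ipZr.
  have e1 : -1 * -1 = 1 :> F by rewrite mulrNN mulr1.
  rewrite (sug_adj (spinJ_tr S) (@spinJ_affine F N S) fC n u v ipD (fun x y z => ipDr y z x) e1 (@spinJ_adj F N S)).
  congr (_ * _); rewrite rmorphV ?unitfE ?mulf_neq0 ?pnatr_eq0 //=.
  congr (_^-1); rewrite conj_Creal // rpredM ?rpredD ?rpredN ?rpred1 ?rpred_nat //.
  by rewrite rpredM ?rpredV ?rpred_nat.
by rewrite !cosetLE ipD ipN ipDr ipNr ipD ipDr !z.
Qed.

(** * Gram matrices of Verma modules *)

(* The word w = m1 ... mr stands for the vector L_{-m1} ... L_{-mr} v of the Verma
   module of weight h and central charge 2 k; [act w n] is the list of coefficients
   and words of L_n applied to it, and [brk u w] is the contravariant form. *)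
Section Bracket.
Variables (A : comNzRingType) (k h : A).
Implicit Types (w u : seq nat) (n : int).

Fixpoint act w n : seq (A * seq nat) :=
  match w with
  | [::] => match n with
            | Posz 0 => [:: (h, [::])] | Posz _ => [::] | Negz p => [:: (1, [:: p.+1])]
            end
  | m :: w' => match n with
      | Negz p => [:: (1, p.+1 :: w)]
      | _ => [seq (x.1, m :: x.2) | x <- act w' n]
             ++ [seq ((n + m%:Z)%:~R * x.1, x.2) | x <- act w' (n - m%:Z)]
             ++ (if n == m%:Z then [:: ('C(m.+1, 3)%:R * k, w')] else [::])
      end
  end.

Fixpoint brk u w : A :=
  if u is n :: u' then \sum_(x <- act w n%:Z) x.1 * brk u' x.2 else (w == [::])%:R.

Lemma act_neg w p : act w (Negz p) = [:: (1, p.+1 :: w)].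
Proof. by case: w. Qed.

Lemma act_cons m w (n : nat) : act (m :: w) n =
  [seq (x.1, m :: x.2) | x <- act w n]
  ++ [seq ((n%:Z + m%:Z)%:~R * x.1, x.2) | x <- act w (n%:Z - m%:Z)]
  ++ (if n == m then [:: ('C(m.+1, 3)%:R * k, w)] else [::]).
Proof. by []. Qed.

Lemma act_level w n a z : (a, z) \in act w n -> (sumn z)%:Z = (sumn w)%:Z - n.
Proof.
elim: w n a z => [|m w IH] [n|p] a z; rewrite ?act_neg ?inE.
- by case: n => [|n] //; rewrite inE => /eqP[_ ->].
- by move=> /eqP[_ ->] /=; rewrite NegzE; lia.
- rewrite act_cons !mem_cat => /or3P[/mapP[[b t] yw [_ ->]]|/mapP[[b t] yw [_ ->]]|] /=.
  + by have := IH _ _ _ yw; lia.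
  + by have := IH _ _ _ yw; lia.
  + by case: eqP => // ->; rewrite inE => /eqP[_ ->] /=; lia.
- by move=> /eqP[_ ->] /=; rewrite NegzE; lia.
Qed.

Lemma act_pos w n a z : all (ltn 0) w -> (a, z) \in act w n -> all (ltn 0) z.
Proof.
elim: w n a z => [|m w IH] [n|p] a z; rewrite ?act_neg ?inE.
- by case: n => [|n] // _; rewrite inE => /eqP[_ ->].
- by move=> _ /eqP[_ ->].
- rewrite [all _ (_ :: _)]/= => /andP[m0 w0].
  rewrite act_cons !mem_cat => /or3P[/mapP[[b t] yw [_ ->]]|/mapP[[b t] yw [_ ->]]|] /=.
  + by rewrite m0 (IH _ _ _ w0 yw).
  + exact: IH w0 yw.
  + by case: eqP => // _; rewrite inE => /eqP[_ ->].
- by move=> w0 /eqP[_ ->].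
Qed.

Lemma brk_level u w : sumn u != sumn w -> brk u w = 0.
Proof.
elim: u w => [|n u IH] w /=; first by case: w => //= m w; rewrite ?mulr0n.
move=> ne; rewrite big_seq big1 // => -[a z] xw; rewrite IH ?mulr0 //=.
by apply/eqP => e; move/eqP: ne; have := act_level xw; lia.
Qed.

End Bracket.

Lemma act_morph (A B : comNzRingType) (f : {rmorphism A -> B}) k h w n :
  act (f k) (f h) w n = [seq (f x.1, x.2) | x <- act k h w n].
Proof.
elim: w n => [|m w IH] [n|p]; rewrite ?act_neg //=.
- by case: n.
- by rewrite rmorph1.
- rewrite !IH !map_cat -!map_comp; congr (_ ++ (_ ++ _)).
    by apply: eq_map => x /=; rewrite rmorphM rmorph_int.
  by case: eqP => //= _; rewrite rmorphM rmorph_nat.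
- by rewrite rmorph1.
Qed.

Lemma brk_morph (A B : comNzRingType) (f : {rmorphism A -> B}) k h u w :
  brk (f k) (f h) u w = f (brk k h u w).
Proof.
elim: u w => [|n u IH] w /=; first by rewrite rmorph_nat.
by rewrite act_morph big_map rmorph_sum; apply: eq_bigr => x _; rewrite rmorphM IH.
Qed.

Section Realization.
Variables (F : numFieldType) (V : lmodType F) (c h : F) (L : int -> {linear V -> V}) (v : V).
Hypothesis Lvir : is_vir c L.
Hypothesis Lv : forall n : nat, L n.+1 v = 0.
Hypothesis L0v : L 0 v = h *: v.

Definition lw (w : seq nat) (x : V) : V := foldr (fun m => L (- m%:Z)) x w.

Lemma lw_act w n : L n (lw w v) = \sum_(x <- act (c / 2%:R) h w n) x.1 *: lw x.2 v.
Proof.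
elim: w n => [|m w IH] [n|p]; rewrite ?act_neg ?big_seq1 ?scale1r ?NegzE //.
  by case: n => [|n] /=; rewrite ?big_seq1 ?big_nil ?Lv.
rewrite act_cons !big_cat !big_map /=.
have := Lvir n (- m%:Z) (lw w v); rewrite opprK => /(canRL (subrK _)) ->.
rewrite (IH n%:Z) (IH (n%:Z - m%:Z)) linear_sum [LHS]addrC; congr (_ + (_ + _)).
- by rewrite linear_sum; apply: eq_bigr => x _; rewrite linearZ.
- by apply: eq_bigr => x _; rewrite /= scalerA.
have -> : (n%:Z + - m%:Z == 0) = (n == m) by lia.
case: eqP => [->|_]; rewrite ?big_nil ?scale0r // big_seq1 /=; congr (_ *: _).
(* Parametrizing by half the central charge turns the cocycle (m^3 - m) c / 12 into an integral
   binomial times c / 2, so that [brk] needs no division. *)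
have -> : (m%:Z ^+ 3 - m%:Z)%:~R = 6%:R * 'C(m.+1, 3)%:R :> F; last by field.
rewrite -natrM pmulrn; congr (_%:~R); have := bin_ffact m.+1 3.
rewrite !ffactnS ffactn0 /= (_ : 3`! = 6)%N //.
by case: m => [|[|m]] /=; rewrite ?muln1 => e; lia.
Qed.

(** The bridge from the recursion to modules. Only a vacuum expectation is asked for, so it serves
    both the Fock spaces with background charge, where no contravariant form is at hand, and spaces
    with a Hermitian form, where [f] pairs with the vacuum. *)
Lemma lw_brk (f : {scalar V}) u w : f v = 1 -> (forall (n : nat) x, f (L (- n.+1%:Z) x) = 0) ->
  all (ltn 0) u -> all (ltn 0) w ->
  f (foldr (fun n x => L n%:Z x) (lw w v) (rev u)) = brk (c / 2%:R) h u w.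
Proof.
move=> fv fL; elim: u w => [|n u IH] w /=.
  by move=> _; case: w => [|[|m] w] //= w0; rewrite fL.
move=> /andP[n0 u0] w0; rewrite rev_cons foldr_rcons lw_act.
have ls z : foldr (fun n x => L n%:Z x) (\sum_(x <- z) x.1 *: lw x.2 v) (rev u) =
    \sum_(x <- z) x.1 *: foldr (fun n x => L n%:Z x) (lw x.2 v) (rev u).
  elim: (rev u) => [//|m t IHt] /=; rewrite IHt linear_sum.
  by apply: eq_bigr => x _; rewrite linearZ.
rewrite ls linear_sum; apply: eq_big_seq => -[a z] xw; rewrite linearZ /= IH //.
exact: act_pos w0 xw.
Qed.

End Realization.

(** * Degree in h of the contravariant form *)

Section Degree.
Variables (K : realFieldType) (k : K).
Local Notation kp := (k%:P).
Implicit Types (u w : seq nat) (n : nat).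

Let slack (n : int) : nat := if n is Posz _.+1 then 0 else 1.

(** A power of h is paid for with a letter: for n > 0 the degree of a coefficient plus the length of
    its word is at most the length of [w]. For n <= 0 one more is allowed, which is [slack]. *)
Lemma act_size w (n : int) a z : all (ltn 0) w -> (a, z) \in act kp 'X w n ->
  (size a <= 2)%N /\ (size a + size z <= slack n + (size w).+1)%N.
Proof.
elim: w n a z => [|m w IH] [n|p] a z; rewrite ?act_neg ?inE.
- by case: n => [|n] // _; rewrite inE => /eqP[-> ->] /=; rewrite size_polyX.
- by move=> _ /eqP[-> ->] /=; rewrite size_poly1.
- rewrite [all _ (_ :: _)]/= => /andP[m0 w0].
  have sl y : (slack y <= 1)%N by case: y => [[|]|].
  rewrite act_cons !mem_cat => /or3P[/mapP[[b t] yw [-> ->]]|/mapP[[b t] yw [-> ->]]|].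
  + have [h1 h2] := IH _ _ _ w0 yw; split => //.
    by rewrite [size (m :: t)]/= [size (m :: w)]/= addnS [X in (_ <= X)%N]addnS ltnS.
  + have [h1 h2] := IH _ _ _ w0 yw.
    have le : (size ((n%:Z + m%:Z)%:~R * (b : {poly K}))%R <= size b)%N.
      by rewrite -PoszD -pmulrn mulr_natl -scaler_nat size_scale_leq.
    split; first exact: leq_trans le h1.
    apply: (@leq_trans (size b + size t)); first by rewrite leq_add2r.
    apply: leq_trans h2 _; apply: leq_trans (leq_add (sl _) (leqnn _)) _.
    by rewrite add1n leq_addl.
  + case: eqP => // nm; rewrite inE => /eqP[-> ->] /=.
    have le : (size ('C(m.+1, 3)%:R * kp)%R <= 1)%N.
      by rewrite mulr_natl -polyCMn; exact: size_polyC_leq1.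
    split; first exact: leq_trans le _.
    by apply: (@leq_trans (1 + size w)); [rewrite leq_add2r | rewrite add1n; apply: leq_trans (leq_addl _ _)].
- by move=> w0 /eqP[-> ->] /=; rewrite size_poly1.
Qed.

Lemma act_size_pos w n a z : (0 < n)%N -> all (ltn 0) w -> (a, z) \in act kp 'X w n ->
  exists x y, [/\ size a = x, size z = y, (x <= 2)%N & (x + y <= (size w).+1)%N].
Proof.
by case: n => // n _ w0 xw; have [h1 h2] := act_size w0 xw; exists (size a), (size z).
Qed.

Lemma brk_size u w : all (ltn 0) u -> all (ltn 0) w ->
  (size (brk kp 'X u w) <= (minn (size u) (size w)).+1)%N.
Proof.
elim: u w => [|n u IH] w /=; first by case: eqP; rewrite ?size_poly1 ?size_poly0.
move=> /andP[n0 u0] w0; apply: (leq_trans (size_sum _ _ _)); apply/bigmax_leqP_seq => -[a z] xw _.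
have [x [y [ex ey h1 h2]]] := act_size_pos n0 w0 xw; have h3 := IH z u0 (act_pos w0 xw).
apply: (leq_trans (size_polyMleq _ _)) => /=; move: h3; rewrite ex ey.
move: (brk _ _ _ _) => b; move: (size (polyseq b)) (size u) (size w) h2 => p q r; lia.
Qed.

Fixpoint rems n w : seq (seq nat) :=
  if w is m :: w' then (if m == n then [:: w'] else [::]) ++ [seq m :: y | y <- rems n w'] else [::].

Lemma rems_cons n m w : rems n (m :: w) =
  (if m == n then [:: w] else [::]) ++ [seq m :: y | y <- rems n w].
Proof. by []. Qed.

Lemma rems_perm n w y : y \in rems n w -> perm_eq w (n :: y).
Proof.
elim: w y => [//|m w IH] y /=; rewrite mem_cat => /orP[|/mapP[z zw ->]].
  by case: eqP => // ->; rewrite inE => /eqP ->.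
rewrite (perm_trans (y := m :: n :: z)) ?perm_cons ?IH //.
by rewrite -cat1s -[n :: z]cat1s -[n :: _]cat1s -[m :: z]cat1s perm_catCA.
Qed.

Lemma rems_mem n w : n \in w -> rems n w != [::].
Proof.
elim: w => //= m w IH; rewrite inE eq_sym; case: eqP => //= _ nw.
by have := IH nw; case: (rems n w).
Qed.

Lemma act0_top (phi : seq nat -> K) w : all (ltn 0) w ->
  \sum_(x <- act kp 'X w 0) x.1`_1 * phi x.2 = phi w.
Proof.
elim: w phi => [|m w IH] phi /=; first by rewrite big_seq1 coefX mul1r.
move=> /andP[m0 w0]; rewrite !big_cat !big_map /= (IH (fun y => phi (m :: y))) //.
have -> : 0 - m%:Z = Negz m.-1 by rewrite NegzE; lia.
rewrite act_neg big_seq1 /= mulr1 add0r -pmulrn -[m%:R]polyCMn coefC mul0r add0r.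
by case: eqP => [e|_]; [lia|rewrite big_nil addr0].
Qed.

(** Only [L_n, L_{-n}] = 2 n L_0 produces a power of h at the cost of a single letter, once for each
    occurrence of n in [w]. *)
Lemma act_top (phi : seq nat -> K) w n : (0 < n)%N -> all (ltn 0) w ->
  (forall y, size y != (size w).-1 -> phi y = 0) ->
  \sum_(x <- act kp 'X w n) x.1`_1 * phi x.2 = (2 * n)%:R * \sum_(y <- rems n w) phi y.
Proof.
elim: w phi => [|m w IH] phi n0; first by case: n n0 => //= n; rewrite !big_nil mulr0.
rewrite [all _ (_ :: _)]/= => /andP[m0 w0] hphi.
rewrite act_cons rems_cons !big_cat !big_map /= mulrDr addrCA addrA.
have -> : \sum_(x <- if n == m then [:: ('C(m.+1, 3)%:R * kp, w)] else [::]) (x.1)`_1 * phi x.2 = 0.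
  by case: eqP => _; rewrite ?big_nil // big_seq1 /= mulr_natl -polyCMn coefC mul0r.
rewrite addr0; congr (_ + _); last first.
  case: w => [|m' w] in IH w0 hphi *.
    by case: n n0 {IH} => // n _; rewrite /= !big_nil mulr0.
  by rewrite (IH (fun y => phi (m :: y))) // => y ny; apply: hphi.
rewrite eq_sym; case: (ltngtP n m) => [lt|gt|->].
- have -> : n%:Z - m%:Z = Negz (m - n).-1 by rewrite NegzE; lia.
  by rewrite act_neg big_seq1 /= mulr1 -pmulrn -polyCMn coefC mul0r big_nil mulr0.
- rewrite big_nil mulr0 big_seq big1 // => -[a z] xw.
  have e : n%:Z - m%:Z = (n - m)%N by lia.
  rewrite e in xw; have [|x [y [ex ey h1 h2]]] := act_size_pos _ w0 xw; first by lia.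
  rewrite -PoszD -pmulrn mulr_natl coefMn /=.
  have [lt|ge] := ltnP x 2; first by rewrite nth_default ?mul0rn ?mul0r // ex; lia.
  by rewrite hphi ?mulr0 // ey; apply/eqP => /=; lia.
rewrite subrr big_seq1 -PoszD addnn -mul2n.
under eq_bigr do rewrite -pmulrn mulr_natl coefMn -mulr_natl -mulrA.
by rewrite -mulr_sumr act0_top.
Qed.

(** By [act_top] the top coefficient is a sum over the ways of matching equal letters of [u] and
    [w], each weighted by a product of numbers 2 n > 0. *)
Lemma brk_top u w : all (ltn 0) u -> all (ltn 0) w -> size u = size w ->
  (perm_eq u w -> 0 < (brk kp 'X u w)`_(size w)) /\
  (~~ perm_eq u w -> (brk kp 'X u w)`_(size w) = 0).
Proof.
elim: u w => [|n u IH] w; first by case: w => //= _ _ _; rewrite coef1 ltr01.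
move=> /= /andP[n0 u0] w0 sz.
pose phi (y : seq nat) : K := if size y == size u then (brk kp 'X u y)`_(size u) else 0.
have e : (\sum_(x <- act kp 'X w n) x.1 * brk kp 'X u x.2)`_(size w) =
   \sum_(x <- act kp 'X w n) x.1`_1 * phi x.2.
  rewrite coef_sum; apply: eq_big_seq => -[a z] xw /=.
  have [x [y [ex ey h1 h2]]] := act_size_pos n0 w0 xw; have xp := act_pos w0 xw.
  have h3 := brk_size u0 xp.
  rewrite /phi; set b := brk _ _ _ _ in h3 *.
  have {1}-> : a = (a`_0)%:P + a`_1 *: 'X.
    apply/polyP => -[|[|i]]; rewrite coefD coefC coefZ coefX /= ?mulr0 ?mulr1 ?addr0 ?add0r //.
    by rewrite nth_default // ex; lia.
  rewrite -sz mulrDl coefD coefCM [b`_(size u).+1]nth_default ?mulr0 ?add0r; last first.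
    by apply: leq_trans h3 _; rewrite ltnS geq_minl.
  rewrite -scalerAl coefZ coefXM /= ey; case: eqP => // ne; rewrite mulr0.
  have [lt|ge] := ltnP x 2; first by rewrite [a`_1]nth_default ?mul0r // ex; lia.
  rewrite [b`_ _]nth_default ?mulr0 //; apply: leq_trans h3 _; rewrite ey.
  by move: (size u) (size w) sz ne h2 => p q; lia.
rewrite e (act_top (phi := phi)) //; last by move=> y; rewrite /phi -sz /= => /negPf ->.
have t y : y \in rems n w -> (perm_eq (n :: u) w -> 0 < phi y) /\ (~~ perm_eq (n :: u) w -> phi y = 0).
  move=> yw; have pw := rems_perm yw; have sy : size y = size u.
    by have := perm_size pw; rewrite -sz /= => -[].
  rewrite /phi sy eqxx -sy.
  have y0 : all (ltn 0) y by move: w0; rewrite (perm_all _ pw) /= => /andP[].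
  by rewrite (permPr pw) perm_cons; apply: IH.
split=> p.
  have nw : n \in w by rewrite -(perm_mem p) mem_head.
  have := rems_mem nw; case E: (rems n w) => [//|y s] _.
  rewrite big_cons mulr_gt0 ?ltr0n ?muln_gt0 //.
  rewrite ltr_pwDl ?(t _ _).1 ?E ?mem_head // big_seq sumr_ge0 // => z zs.
  by rewrite ltW // (t _ _).1 // E inE zs orbT.
by rewrite big_seq big1 ?mulr0 // => y yw; exact: (t y yw).2.
Qed.

End Degree.

Section DetDegree.
Variables (K : realFieldType) (n : nat) (M : 'M[{poly K}]_n) (l : 'I_n -> nat).
Hypothesis Msize : forall i j, (size (M i j) <= (minn (l i) (l j)).+1)%N.
Hypothesis Mtop : forall i j, l i = l j -> i != j -> (M i j)`_(l i) = 0.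
Hypothesis Mdiag : forall i, 0 < (M i i)`_(l i).

Lemma coef_prod_top (I : finType) (p : I -> {poly K}) (d : I -> nat) :
  (forall i, (size (p i) <= (d i).+1)%N) ->
  (size (\prod_i p i)%R <= (\sum_i d i).+1)%N /\ (\prod_i p i)`_(\sum_i d i) = \prod_i (p i)`_(d i).
Proof.
move=> hp; elim/big_rec3: _ => [|i x b q _ [h1 h2]]; first by rewrite size_poly1 coef1.
have hi := hp i; split.
  by apply: (leq_trans (size_polyMleq _ _)); lia.
rewrite coefM (bigD1 (inord (d i))) //= inordK; last by lia.
rewrite addKn h2 big1 ?addr0 // => j; rewrite -val_eqE /= inordK; last by lia.
move=> nj; have [lt|ge] := ltnP j (d i).
  rewrite [q`_ _]nth_default ?mulr0 //; apply: leq_trans h1 _.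
  by move: (nat_of_ord j) lt => jj lt; move: (d i) lt => y lt; lia.
by rewrite [(p i)`_ _]nth_default ?mul0r //; apply: leq_trans hi _; rewrite ltn_neqAle eq_sym nj.
Qed.

(** A permutation s reaches the top degree only if l i <= l (s i) for all i. The two sums being
    equal, s preserves [l], and then [Mtop] leaves only the identity. *)
Lemma det_top : size (\det M) = (\sum_i l i).+1 /\ 0 < lead_coef (\det M).
Proof.
have le i (s : 'S_n) : (size (M i (s i)) <= (l i).+1)%N.
  by apply: leq_trans (Msize _ _) _; rewrite ltnS geq_minl.
have sz : (size (\det M) <= (\sum_i l i).+1)%N.
  apply: leq_trans (size_sum _ _ _) _; apply/bigmax_leqP => s _.
  have [h _] := coef_prod_top (fun i => le i s).
  by rewrite -signr_odd; case: (odd _); rewrite ?expr1 ?mulN1r ?size_polyN ?mul1r.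
have top : 0 < (\det M)`_(\sum_i l i).
  rewrite /determinant coef_sum (bigD1 (1%g : {perm 'I_n})) //= odd_perm1 expr0 mul1r.
  rewrite (_ : \prod_(i < n) M i ((1%g : {perm 'I_n}) i) = \prod_i M i i); last first.
    by apply: eq_bigr => i _; rewrite perm1.
  rewrite (coef_prod_top (fun i => leq_trans (Msize i i) _)).2; last by move=> i; rewrite minnn.
  rewrite [X in _ + X]big1 ?addr0 ?prodr_gt0 // => s ns.
  rewrite -signr_odd oddb; suff h : (\prod_i M i (s i))`_(\sum_i l i) = 0.
    by case: (s : bool); rewrite ?expr1 ?expr0 ?mulN1r ?mul1r ?coefN h ?oppr0.
  rewrite (coef_prod_top (fun i => le i s)).2; apply/eqP; rewrite prodf_seq_eq0.
  apply/hasP; apply: contrapT => h; case/negP: ns; apply/eqP.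
  have nz i : (M i (s i))`_(l i) != 0.
    by apply: contra_notN h => e; exists i; rewrite ?mem_index_enum.
  have lle i : (l i <= l (s i))%N.
    rewrite leqNgt; apply: contra (nz i) => lt; rewrite nth_default //.
    by apply: leq_trans (Msize _ _) _; rewrite (minn_idPr (ltnW lt)).
  have leq : (\sum_i l i == \sum_i l (s i))%N by rewrite [X in X == _](reindex_inj (@perm_inj _ s)).
  have := (@leqif_sum _ xpredT (fun i => l i == l (s i)) l (fun i => l (s i)) (fun i _ => leqif_eq (lle i))).2.
  rewrite leq => /esym/forallP eqs; apply/permP => i; rewrite perm1; apply/eqP.
  by rewrite eq_sym; apply: contraT => ne; have /eqP := nz i; rewrite Mtop //; apply/eqP; exact: eqs.
have sz2 : size (\det M) = (\sum_i l i).+1.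
  apply/eqP; rewrite eqn_leq sz ltnNge; apply/negP => h.
  by move: top; rewrite nth_default // ltxx.
by rewrite /lead_coef sz2.
Qed.
End DetDegree.

(** * Partitions *)

Section Partitions.
Local Open Scope nat_scope.
Implicit Types (w u : seq nat) (N r s : nat).

Fixpoint words_upto N l : seq (seq nat) :=
  [::] :: (if l is l'.+1 then [seq x :: t | x <- iota 1 N, t <- words_upto N l'] else [::]).

Definition parts N := [seq w <- undup (words_upto N N) | sorted geq w && (sumn w == N)].

Lemma mem_words_upto N l w : (w \in words_upto N l) = (size w <= l) && all (fun x => 0 < x <= N) w.
Proof.
elim: l w => [|l IH] [|x w] //=; rewrite inE //=.
apply/allpairsP/idP => [[[y t] [/= hy ht [-> ->]]]|/and3P[h1 /andP[h2 h3] h4]].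
  move: ht; rewrite IH => /andP[h1 h2]; move: hy; rewrite mem_iota add1n => /andP[h3 h4].
  by rewrite !ltnS in h1 h4 *; rewrite h1 h3 h4 h2.
by exists (x, w) => /=; split=> //; rewrite ?IH ?mem_iota ?add1n ?ltnS ?h2 ?h3 //; apply/andP.
Qed.

Lemma all_leq_sumn w : all (fun x => x <= sumn w) w.
Proof.
elim: w => //= x w IH; rewrite leq_addr /=; apply: sub_all IH => y le.
by rewrite (leq_trans le) ?leq_addl.
Qed.

Lemma size_leq_sumn w : all (ltn 0) w -> size w <= sumn w.
Proof. by elim: w => //= x w IH /andP[x0 /IH h]; move: (size w) (sumn w) h => a b; lia. Qed.

Lemma mem_parts N w : (w \in parts N) = [&& sorted geq w, all (ltn 0) w & sumn w == N].
Proof.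
rewrite mem_filter mem_undup mem_words_upto andbC; case: eqP => [e|]; last by rewrite !andbF.
rewrite !andbT; case: (sorted _ _); rewrite ?andbF //= andbT -e.
apply/andP/idP => [[_]|w0]; first by apply: sub_all => x /andP[].
split; first exact: size_leq_sumn.
by apply/allP => x xw; apply/andP; split; [exact: (allP w0) | exact: (allP (all_leq_sumn w))].
Qed.

Lemma parts_uniq N : uniq (parts N).
Proof. by rewrite filter_uniq // undup_uniq. Qed.

Lemma parts_pos N w : w \in parts N -> all (ltn 0) w.
Proof. by rewrite mem_parts => /and3P[]. Qed.

Lemma parts_sum N w : w \in parts N -> sumn w = N.
Proof. by rewrite mem_parts => /and3P[_ _ /eqP]. Qed.

Definition psort w := sort geq w.

Lemma perm_psort w : perm_eq (psort w) w.
Proof. by rewrite perm_sort. Qed.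

Lemma sorted_psort w : sorted geq (psort w).
Proof. by apply: sort_sorted => x y; exact: leq_total. Qed.

Lemma psort_parts w : all (ltn 0) w -> psort w \in parts (sumn w).
Proof.
move=> w0; rewrite mem_parts sorted_psort /= (perm_all _ (perm_psort w)) w0.
by apply/eqP; apply: perm_sumn; exact: perm_psort.
Qed.

Lemma geq_trans : transitive geq. Proof. by move=> x y z h1 h2; exact: leq_trans h2 h1. Qed.
Lemma geq_anti : antisymmetric geq. Proof. by move=> x y; rewrite andbC => /anti_leq. Qed.

Lemma parts_perm_eq N w N' w' : w \in parts N -> w' \in parts N' -> perm_eq w w' -> w = w'.
Proof.
rewrite !mem_parts => /andP[sw _] /andP[sw' _].
exact: (sorted_eq geq_trans geq_anti).
Qed.

(** Adding s parts equal to r is a bijection from the partitions of N - r s. *)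
Lemma count_parts N r s : 0 < r ->
  count (fun w => s <= count_mem r w) (parts N) = if r * s <= N then size (parts (N - r * s)) else 0.
Proof.
move=> r0; case: ifP => le; last first.
  apply/eqP; rewrite -leqn0 leqNgt -has_count; apply/hasPn => w wN; rewrite -ltnNge ltnNge.
  apply/negP => h; move/negP: le; apply; rewrite -(parts_sum wN).
  elim: w s h {wN} => [|x w IH] [|s] //=; rewrite ?muln0 // => h.
  case: eqP h => [->|_] /= h; last by rewrite add0n in h; apply: leq_trans (IH _ h) (leq_addl _ _).
  by rewrite add1n ltnS in h; have := IH _ h; rewrite mulnS leq_add2l.
pose add u := psort (nseq s r ++ u).
have padd u : perm_eq (add u) (nseq s r ++ u) by exact: perm_psort.
rewrite -size_filter -(size_map add (parts (N - r * s))); apply: perm_size; apply: uniq_perm.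
- by rewrite filter_uniq ?parts_uniq.
- rewrite map_inj_in_uniq ?parts_uniq // => u u' hu hu' e; apply: parts_perm_eq hu hu' _.
  by rewrite -(perm_cat2l (nseq s r)) -(permPl (padd u)) e padd.
move=> w; rewrite mem_filter; apply/andP/mapP => [[h wN]|[u uN ->]].
  have : exists u, perm_eq w (nseq s r ++ u).
    elim: s w h {wN le add padd} => [|s IH] w h; first by exists w.
    have rw : r \in w by rewrite -has_pred1 has_count (leq_ltn_trans _ h).
    have pw := perm_to_rem rw.
    have [|u hu] := IH (rem r w).
      by move: h; rewrite (seq.permP pw) /= eqxx add1n ltnS.
    by exists u; rewrite (perm_trans pw) //= perm_cons.
  case=> u pu; have w0 := parts_pos wN.
  have u0 : all (ltn 0) u by move: w0; rewrite (perm_all _ pu) all_cat => /andP[].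
  have su : sumn u = N - r * s.
    by rewrite -(parts_sum wN) (perm_sumn pu) sumn_cat sumn_nseq addKn.
  exists (psort u); first by rewrite -su psort_parts.
  have hs : psort w = w.
    apply: (sorted_eq geq_trans geq_anti) (sorted_psort w) _ (perm_psort w).
    by move: wN; rewrite mem_parts => /andP[].
  rewrite -hs; apply: (sorted_eq geq_trans geq_anti) (sorted_psort _) (sorted_psort _) _.
  rewrite (permPl (perm_psort _)) (permPl pu) perm_sym (permPl (perm_psort _)).
  by rewrite perm_cat2l perm_psort.
split; first by rewrite (seq.permP (padd u)) count_cat count_nseq /= eqxx mul1n leq_addr.
have -> : N = sumn (nseq s r ++ u).
  by rewrite sumn_cat sumn_nseq (parts_sum uN) subnKC.
by apply: psort_parts; rewrite all_cat (parts_pos uN) andbT all_nseq /= r0 orbT.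
Qed.

(** Counts the pairs of a part size r and a number s up to its multiplicity. The left side will be
    the degree of the determinant in h and the right side the number of roots found, with
    multiplicity. *)
Lemma sum_size_parts N :
  \sum_(w <- parts N) size w =
  \sum_(r < N) \sum_(s < N | r.+1 * s.+1 <= N) size (parts (N - r.+1 * s.+1)).
Proof.
transitivity (\sum_(w <- parts N) \sum_(r < N) \sum_(s < N) (s < count_mem r.+1 w : nat)).
  apply: eq_big_seq => w wN; have w0 := parts_pos wN; have sw := parts_sum wN.
  have le : all (fun x => 0 < x <= N) w.
    by apply/allP => x xw; rewrite -sw; apply/andP; split; [exact: (allP w0) | exact: (allP (all_leq_sumn w))].
  transitivity (\sum_(r < N) count_mem r.+1 w).
    elim: w le {wN w0 sw} => [|x w IH] /=; first by rewrite big1.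
    move=> /andP[/andP[x0 xN] /IH ->]; rewrite big_split /=.
    have lt : x.-1 < N by lia.
    rewrite -addn1 addnC; congr addn; rewrite (bigD1 (Ordinal lt)) //= prednK // eqxx big1 ?addn0 // => i ni.
    by apply/eqP; rewrite eqb0; apply: contra ni => /eqP e; apply/eqP/val_inj; rewrite /= e.
  apply: eq_bigr => r _; have : count_mem r.+1 w <= N.
    by apply: leq_trans (count_size _ _) _; rewrite -sw size_leq_sumn.
  move: (count_mem _ _) => c cN; rewrite -(big_mkord xpredT (fun s => (s < c : nat))).
  rewrite (big_cat_nat (n := c)) //= [X in _ = _ + X]big_nat_cond [X in _ = _ + X]big1; last first.
    by move=> i /andP[/andP[ci _] _]; rewrite ltnNge ci.
  rewrite addn0 big_nat_cond (eq_bigr (fun=> 1)) ?sum_nat_const_nat; last first.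
    by move=> i /andP[/andP[_ ->]].
  by rewrite -big_nat_cond sum_nat_const_nat subn0 muln1.
rewrite exchange_big; apply: eq_bigr => r _; rewrite exchange_big /= [RHS]big_mkcond.
by apply: eq_bigr => s _; rewrite -count_parts // -sumn_count sumnE big_map.
Qed.

End Partitions.

(** * Symmetric functions and antisymmetrization *)

Section Ward.
Variables (F : numFieldType) (r : nat).
Local Notation P := {mpoly F[r]}.
Implicit Types (f g : P) (i j : 'I_r) (a m : nat).

Definition psum a : P := \sum_i 'X_i ^+ a.

Section Newton.
Variable S : P -> Prop.
Hypothesis S_lin : forall (c : F) f g, S f -> S g -> S (c *: f + g).
Hypothesis S_psum : forall a f, S f -> S (psum a.+1 * f).

Let E : {poly P} := \prod_i (1 + 'X_i *: 'X).
Let E' i : {poly P} := \prod_(j | j != i) (1 + 'X_j *: 'X).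
(** The auxiliary sums of Newton's identities: x_i^a times the m-th elementary symmetric polynomial
    in the variables other than x_i. They interpolate between p_a e_m and (m + 1) e_{m+1}. *)
Let g m a : P := \sum_i 'X_i ^+ a * (E' i)`_m.

Let EE' i : E = (1 + 'X_i *: 'X) * E' i. Proof. by rewrite /E (bigD1 i). Qed.

Let g0 a : g 0 a = psum a.
Proof.
apply: eq_bigr => i _; rewrite -horner_coef0 horner_prod big1 ?mulr1 // => j _.
by rewrite hornerD hornerZ hornerX mulr0 addr0 hornerE.
Qed.

Let gS m a : g m.+1 a = psum a * E`_m.+1 - g m a.+1.
Proof.
rewrite mulr_suml -sumrB; apply: eq_bigr => i _.
by rewrite (EE' i) mulrDl mul1r -scalerAl coefD coefZ coefXM /= exprSr; ring.
Qed.

Let derivE : E^`() = \sum_i 'X_i *: E' i.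
Proof.
rewrite /E; have -> (s : seq 'I_r) : (\prod_(i <- s) (1 + 'X_i *: 'X))^`() =
    \sum_(i <- s) 'X_i *: (\prod_(j <- rem i s) (1 + 'X_j *: 'X : {poly P})).
  elim: s => [|i s IH]; first by rewrite !big_nil -polyC1 derivC.
  rewrite !big_cons derivM derivD derivZ derivX derivC add0r /= eqxx IH.
  rewrite mulrC -scalerAr mulr1; congr (_ + _).
  rewrite mulr_sumr; apply: eq_big_seq => j js; case: eqP => [->|_].
    by rewrite -scalerAr [in RHS](big_rem _ js).
  by rewrite big_cons -scalerAr.
apply: eq_bigr => i _; congr (_ *: _).
by rewrite /E' rem_filter ?index_enum_uniq // big_filter.
Qed.

Let eS m : m.+1%:R * E`_m.+1 = g m 1.
Proof.
rewrite mulr_natl -coef_deriv derivE coef_sum; apply: eq_bigr => i _.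
by rewrite coefZ expr1.
Qed.

Let S0 f : S f -> S 0.
Proof. by move=> h; have := S_lin (-1) h h; rewrite scaleN1r addNr. Qed.

Let SZ c f : S f -> S (c *: f).
Proof. by move=> h; rewrite -[X in S X]addr0; apply: S_lin => //; exact: S0 h. Qed.

Let S_esym m f : S f -> S (E`_m * f).
Proof.
elim/ltn_ind: m f => -[|m] IH f hf.
  suff -> : E`_0 = 1 by rewrite mul1r.
  rewrite -horner_coef0 horner_prod big1 // => j _.
  by rewrite hornerD hornerZ hornerX mulr0 addr0 hornerE.
have h (m' : nat) : (m' <= m)%N -> forall a f, S f -> S (g m' a.+1 * f).
  elim: m' => [|m' IHm] le a u hu; first by rewrite g0; exact: S_psum.
  rewrite gS mulrBl -mulrA addrC -scaleN1r; apply: S_lin; first by apply: IHm => //; exact: ltnW.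
  by apply: S_psum; apply: IH.
have nz : (m.+1%:R : F) != 0 by rewrite pnatr_eq0.
have -> : E`_m.+1 * f = (m.+1%:R : F)^-1 *: (g m 1 * f).
  by rewrite -eS -mulrA mulr_natl -scaler_nat scalerA mulVf ?scale1r.
by apply: SZ; apply: h.
Qed.

(** In characteristic 0 the elementary symmetric polynomials are polynomials in the power sums; the
    product of the variables is the last of them. This will show that the singular vectors do not
    vanish. *)
Lemma newton f : S f -> S ((\prod_i 'X_i) * f).
Proof.
suff -> : \prod_i 'X_i = E`_r by exact: S_esym.
have X0 (i : 'I_r) : ('X_i : P) != 0.
  by apply/eqP => /(congr1 (mcoeff U_(i))) /eqP; rewrite mcoeffXU eqxx mcoeff0 oner_eq0.
have sz i : size (1 + 'X_i *: 'X : {poly P}) = 2.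
  rewrite addrC size_polyDl size_scale ?X0 ?size_polyX // size_poly1 //.
have lc i : lead_coef (1 + 'X_i *: 'X : {poly P}) = 'X_i.
  by rewrite lead_coefE sz coefD coef1 coefZ coefX mulr1 add0r.
have : lead_coef E = \prod_i 'X_i by rewrite lead_coef_prod; apply: eq_bigr.
rewrite lead_coefE size_prod => [|i _]; last by rewrite -size_poly_eq0 sz.
rewrite (eq_bigr (fun=> 2)) // sum_nat_const muln2 -addnn card_ord.
by rewrite subSn ?leq_addl //= addnK.
Qed.

End Newton.

(** The Witt vector field of degree [a], the source of the Ward identities for the residue [ell]. *)
Definition DD a f : P := \sum_j 'X_j ^+ a.+1 * f^`M(j).

Lemma DD_lin a (c : F) f g : DD a (c *: f + g) = c *: DD a f + DD a g.
Proof.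
rewrite /DD scaler_sumr -big_split; apply: eq_bigr => j _ /=.
by rewrite mderivD mderivZ mulrDr -scalerAr.
Qed.

Lemma DDM a f g : DD a (f * g) = DD a f * g + f * DD a g.
Proof.
rewrite /DD mulr_suml mulr_sumr -big_split; apply: eq_bigr => j _ /=.
by rewrite mderivM; ring.
Qed.

Lemma DDB a f g : DD a (f - g) = DD a f - DD a g.
Proof. by rewrite addrC -scaleN1r DD_lin scaleN1r addrC. Qed.

Lemma DD1 a : DD a 1 = 0.
Proof. by rewrite /DD big1 // => j _; rewrite -mpolyC1 mderivC mulr0. Qed.

Lemma DDX a i : DD a 'X_i = 'X_i ^+ a.+1.
Proof.
rewrite /DD (bigD1 i) //= big1 ?addr0 => [|j nj]; rewrite mderivX mnm1E.
  rewrite eqxx scale1r (_ : (U_(i) - U_(i))%MM = 0%MM) ?mpolyX0 ?mulr1 //.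
  by apply/mnmP => j; rewrite mnmBE subnn mnm0E.
by rewrite eq_sym (negPf nj) scale0r mulr0.
Qed.

Lemma DD_eigen_exp a f q n : DD a f = q * f -> DD a (f ^+ n) = n%:R * q * f ^+ n.
Proof.
move=> h; elim: n => [|n IH]; first by rewrite expr0 DD1 !mul0r.
by rewrite exprS DDM IH h -[n.+1]addn1 natrD; ring.
Qed.

Lemma DD_eigen_prod a (T : finType) (Q : pred T) (f q : T -> P) :
  (forall x, DD a (f x) = q x * f x) ->
  DD a (\prod_(x | Q x) f x) = (\sum_(x | Q x) q x) * \prod_(x | Q x) f x.
Proof.
move=> h; elim/big_rec2: _ => [|x y z _ IH]; first by rewrite DD1 mul0r.
by rewrite DDM IH h; ring.
Qed.

Lemma DD_psum a m : DD a (psum m) = m%:R * psum (m + a).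
Proof.
rewrite /psum mulr_sumr (big_morph (DD a) (id1 := 0) (op1 := +%R)) => [|f g|]; last first.
- by rewrite -[X in DD a X](subrr 1) DDB subrr.
- by rewrite -[f]scale1r DD_lin !scale1r.
apply: eq_bigr => i _.
case: m => [|m]; first by rewrite expr0 DD1 mul0r.
rewrite (@DD_eigen_exp _ _ ('X_i ^+ a)); first by rewrite -mulrA -exprD addnC.
by rewrite DDX exprSr.
Qed.

Lemma sum_pairs (U : zmodType) (h : 'I_r -> 'I_r -> U) : (forall i j, h i j = h j i) ->
  (\sum_(x : 'I_r * 'I_r | (x.1 < x.2)%N) h x.1 x.2) *+ 2 = \sum_i \sum_j h i j - \sum_i h i i.
Proof.
move=> hC; rewrite pair_big /= [X in _ = X - _](bigID (fun x : 'I_r * 'I_r => x.1 == x.2)) /=.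
have -> : \sum_(x : 'I_r * 'I_r | x.1 == x.2) h x.1 x.2 = \sum_i h i i.
  rewrite -(pair_big_dep xpredT (fun i j => i == j) (fun i j => h i j)) /=.
  by apply: eq_bigr => i _; rewrite (big_pred1 i) // => j; rewrite eq_sym.
rewrite [X in X - _]addrC addrK [RHS](bigID (fun x : 'I_r * 'I_r => (x.1 < x.2)%N)) /= mulr2n.
congr (_ + _); first by apply: eq_bigl => x; rewrite -val_eqE /=; case: ltngtP.
rewrite (reindex_inj (h := fun x : 'I_r * 'I_r => (x.2, x.1))); last by move=> [a b] [c d] [-> ->].
apply: eq_big => [x|x _] /=; first by rewrite -val_eqE /=; case: ltngtP.
by rewrite hC.
Qed.

Definition vand : P := \prod_(x : 'I_r * 'I_r | (x.1 < x.2)%N) ('X_x.1 - 'X_x.2).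

(** The vector field multiplies each factor x_i - x_j by (x_i^(a+1) - x_j^(a+1)) / (x_i - x_j), so
    the logarithmic derivative is a sum over pairs. *)
Lemma DD1_vand : DD 1 vand = (r%:R - 1) * psum 1 * vand.
Proof.
rewrite (DD_eigen_prod _ (q := fun x : 'I_r * 'I_r => 'X_x.1 + 'X_x.2)) => [|x]; last first.
  by rewrite DDB !DDX; ring.
congr (_ * _); apply: (@scalerI _ _ (2%:R : F)); first by rewrite pnatr_eq0.
  rewrite !scaler_nat (sum_pairs (h := fun i j => 'X_i + 'X_j)) => [|i j]; last exact: addrC.
  under eq_bigr do rewrite big_split /= sumr_const card_ord.
  rewrite !big_split /= sumr_const card_ord sumrMnl /psum.
  under [\sum_i 'X_i ^+ 1]eq_bigr do rewrite expr1.
  by rewrite mulrBl mul1r mulr_natl mulrnBl !mulr2n.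
Qed.

Lemma DD2_vand : DD 2 vand = ((r%:R - 3%:R / 2%:R) *: psum 2 + 2%:R^-1 *: psum 1 ^+ 2) * vand.
Proof.
rewrite (DD_eigen_prod _ (q := fun x : 'I_r * 'I_r => 'X_x.1 ^+ 2 + 'X_x.1 * 'X_x.2 + 'X_x.2 ^+ 2)) => [|x]; last first.
  by rewrite DDB !DDX; ring.
congr (_ * _); apply: (@scalerI _ _ (2%:R : F)); first by rewrite pnatr_eq0.
rewrite scaler_nat (sum_pairs (h := fun i j => 'X_i ^+ 2 + 'X_i * 'X_j + 'X_j ^+ 2)) => [|i j]; last ring.
have -> : \sum_i \sum_j ('X_i ^+ 2 + 'X_i * 'X_j + 'X_j ^+ 2) = psum 2 *+ r + psum 1 ^+ 2 + psum 2 *+ r.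
  under eq_bigr do rewrite !big_split /= sumr_const card_ord -mulr_sumr.
  rewrite !big_split /= sumr_const card_ord sumrMnl -mulr_suml expr2 /psum.
  by have -> : \sum_i 'X_i ^+ 1 = \sum_i 'X_i :> P by apply: eq_bigr => i _; rewrite expr1.
have -> : \sum_i ('X_i ^+ 2 + 'X_i * 'X_i + 'X_i ^+ 2) = psum 2 *+ 3.
  by rewrite -sumrMnl; apply: eq_bigr => i _; ring.
rewrite scalerDr !scalerA mulfV ?pnatr_eq0 // scale1r.
have -> : (2%:R * (r%:R - 3%:R / 2%:R) = r%:R *+ 2 - 3%:R :> F) by field.
by rewrite scalerBl -mulrnA !scaler_nat muln2 -addnn mulrnDr [RHS]addrAC; congr (_ - _); rewrite addrAC.
Qed.

(** Integration by parts for the extraction of a coefficient whose exponents are all equal. *)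
Lemma coef_DD a (m : 'X_{1..r}) f (b : nat) : (forall j, m j = b) ->
  (DD a f)@_m = (b%:R - a%:R) * (psum a * f)@_m.
Proof.
move=> hm; rewrite /DD /psum mulr_suml !raddf_sum mulr_sumr; apply: eq_bigr => j _.
rewrite {1 2}(mpolyE f) linear_sum /= !mulr_sumr !raddf_sum mulr_sumr; apply: eq_bigr => m' _.
rewrite /= mderivZ mderivX -!scalerAr !mcoeffZ !mpolyXn -!mpolyXD !mcoeffX.
rewrite [RHS]mulrCA; congr (_ * _).
case: (posnP (m' j)) => [z|p].
  rewrite z mul0r; case: eqP => [e|_]; rewrite ?mulr0 //.
  have /mnmP /(_ j) := e; rewrite hm mnmDE mulmnE mnm1E eqxx z mul1n addn0 => ->.
  by rewrite subrr mul0r.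
have -> : (U_(j) *+ a.+1 + (m' - U_(j)))%MM = (U_(j) *+ a + m')%MM.
  apply/mnmP => i; rewrite !mnmDE !mulmnE mnmBE mnm1E; case: eqP => [<-|_]; last by lia.
  by rewrite !mul1n; lia.
case: eqP => [e|_]; rewrite ?mulr0 // !mulr1.
have /mnmP /(_ j) := e; rewrite hm mnmDE mulmnE mnm1E eqxx mul1n => <-.
by rewrite natrD addrC addKr.
Qed.

(** x^B g(1/x) = e g(x) with e^2 = 1 and real coefficients. The symmetry is recorded on an indexed
    family of terms, possibly with repetitions, so that it passes to products at once. *)
Definition pal (B : 'X_{1..r}) g := exists (T : finType) (c : T -> F) (m : T -> 'X_{1..r}) (nu : T -> T) (e : F),
  [/\ e * e = 1, involutive nu, forall t, c t \is Num.real & forall t, c (nu t) = e * c t] /\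
  (forall t, m (nu t) + m t = B)%MM /\ g = \sum_t c t *: 'X_[m t].

Lemma pal1 : pal 0 1.
Proof.
exists unit, (fun=> 1), (fun=> 0%MM), id, 1; split; last split.
- by split=> // *; rewrite ?mulr1 ?real1.
- by move=> _; rewrite addm0.
- by rewrite (big_pred1 tt) => [|[]] //; rewrite scale1r mpolyX0.
Qed.

Lemma palX i j : pal (U_(i) + U_(j)) ('X_i - 'X_j).
Proof.
exists bool, (fun b => if b then 1 else -1), (fun b => if b then U_(i) else U_(j))%MM, negb, (-1).
split; last split.
- split; [by rewrite mulrNN mulr1 | exact: negbK | by case; rewrite ?realN real1 |].
  by case; rewrite /= ?mulr1 ?mulrNN ?mulr1.
- by case=> //=; rewrite addmC.
- by rewrite big_bool scale1r scaleN1r.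
Qed.

Lemma palM B B' g g' : pal B g -> pal B' g' -> pal (B + B') (g * g').
Proof.
move=> [T [c [m [nu [e [[h1 h2 h3 h4] [h5 ->]]]]]]] [T' [c' [m' [nu' [e' [[k1 k2 k3 k4] [k5 ->]]]]]]].
exists (T * T')%type, (fun t => c t.1 * c' t.2), (fun t => m t.1 + m' t.2)%MM.
exists (fun t => (nu t.1, nu' t.2)), (e * e'); split; last split.
- split; first by rewrite mulrACA h1 k1 mulr1.
  + by move=> [x y] /=; rewrite h2 k2.
  + by move=> t; rewrite realM.
  + by move=> t /=; rewrite h4 k4 mulrACA.
- by move=> t /=; rewrite -(h5 t.1) -(k5 t.2) -!addmA; congr mnm_add; rewrite !addmA [X in mnm_add X _]addmC.
- rewrite big_distrlr pair_big; apply: eq_bigr => t _ /=.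
  by rewrite mpolyXD -scalerAl -scalerAr scalerA.
Qed.

(** By the symmetry, the coefficient of x^B in g^2 is e times the sum of the squares of the real
    coefficients of g. This replaces the evaluation of the Dyson constant term, of which only the
    nonvanishing matters. *)
Lemma pal_sqr B g : pal B g -> g != 0 -> (g ^+ 2)@_B != 0.
Proof.
move=> [T [c [m [nu [e [[h1 h2 h3 h4] [h5 gE]]]]]]] g0.
have gm x : g@_x = \sum_t c t * (m t == x)%:R.
  by rewrite gE raddf_sum; apply: eq_bigr => t _; rewrite /= mcoeffZ mcoeffX.
have -> : (g ^+ 2)@_B = e * \sum_(x <- msupp g) g@_x ^+ 2.
  rewrite expr2 {1 2}gE big_distrlr raddf_sum.
  transitivity (\sum_t c t * (e * g@_(m t))).
    apply: eq_bigr => t _; rewrite gm raddf_sum mulr_sumr mulr_sumr.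
    rewrite (reindex_inj (inv_inj h2)); apply: eq_bigr => t' _ /=.
    rewrite -scalerAl -scalerAr !mcoeffZ -mpolyXD mcoeffX h4; congr (_ * _).
    rewrite -mulrA; congr (_ * (_ * (nat_of_bool _)%:R)).
    by rewrite -(h5 t') [X in _ == X]addmC eqm_add2r eq_sym.
  rewrite mulr_sumr.
  transitivity (\sum_(x <- msupp g) \sum_t e * (g@_x * (c t * (m t == x)%:R))); last first.
    by apply: eq_bigr => x _; rewrite -mulr_sumr -mulr_sumr -gm expr2.
  rewrite exchange_big; apply: eq_bigr => t _ /=.
  have [mg|mg] := boolP (m t \in msupp g); last first.
    rewrite (memN_msupp_eq0 mg) !mulr0 big_seq big1 // => x xg.
    by case: eqP => [e1|]; [rewrite e1 xg in mg | rewrite !mulr0].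
  rewrite [RHS](bigD1_seq (m t)) ?msupp_uniq //= eqxx mulr1 big1 ?addr0 => [|x]; first by ring.
  by rewrite eq_sym => /negPf ->; rewrite !mulr0.
have e0 : e != 0 by apply: contra_eq_neq h1 => ->; rewrite mul0r eq_sym oner_eq0.
rewrite mulf_neq0 // gt_eqF //.
have gr x : g@_x \is Num.real.
  by rewrite gm rpred_sum // => t _; rewrite realM ?realn.
have : msupp g != [::] by rewrite msupp_eq0.
case E: (msupp g) => [//|x xs] _; rewrite big_cons ltr_pwDl //.
  rewrite lt0r real_exprn_even_ge0 // sqrf_eq0 andbT -mcoeff_msupp E mem_head //.
by rewrite sumr_ge0 // => y _; rewrite real_exprn_even_ge0.
Qed.

Lemma pal_exp B g n : pal B g -> pal (B *+ n) (g ^+ n).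
Proof.
by move=> h; elim: n => [|n IH]; [exact: pal1 | rewrite exprS mulmS; apply: palM].
Qed.

Lemma pal_vand : pal [multinom r.-1 | i < r] vand.
Proof.
have -> : [multinom r.-1 | i < r] = (\sum_(x : 'I_r * 'I_r | (x.1 < x.2)%N) (U_(x.1) + U_(x.2)))%MM.
  apply/mnmP => i; rewrite mnmE mnm_sumE; 
  have hC (a b : 'I_r) : ((a == i) + (b == i))%N%:Z = ((b == i) + (a == i))%N%:Z by rewrite addnC.
  have := sum_pairs hC.
  have h1 a : \sum_b ((a == i) + (b == i))%N%:Z = (a == i)%N%:Z *+ r + 1.
    under eq_bigr do rewrite PoszD.
    rewrite big_split sumr_const card_ord /=; congr (_ + _).
    by rewrite (bigD1 i) //= eqxx big1 ?addr0 // => b /negPf ->.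
  have h0 : \sum_a (a == i)%N%:Z = 1 by rewrite (bigD1 i) //= eqxx big1 ?addr0 // => b /negPf ->.
  under [X in _ = X - _]eq_bigr do rewrite h1.
  rewrite big_split sumrMnl h0 sumr_const card_ord.
  under [X in _ = _ - X]eq_bigr do rewrite PoszD.
  rewrite big_split /= h0 -(big_morph Posz PoszD (erefl _)).
  under [X in _ -> _ = X]eq_bigr do rewrite mnmDE !mnm1E.
  move: (\sum_(_ | _) _)%N (ltn_ord i) => S; lia.
rewrite /vand; elim/big_ind2: _ => [|B g B' g'|x _]; [exact: pal1|exact: palM|exact: palX].
Qed.

Lemma vand_neq0 : vand != 0.
Proof.
apply/prodf_neq0 => x lt; apply/eqP => /(congr1 (mcoeff U_(x.1))) /eqP.
by rewrite mcoeffB !mcoeffXU mcoeff0 eqxx -val_eqE gtn_eqF //= subr0 oner_eq0.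
Qed.

Section Ell.
Variables (k s : nat).
Definition top_exp := (s + k * r.-1)%N.
(** The r-fold screening integral as a residue: its kernel is the 2k-th power of the Vandermonde
    polynomial divided by a power of the product of the variables. *)
Definition ell f : F := ((vand ^+ k) ^+ 2 * f)@_[multinom top_exp | i < r].

Lemma ell_lin c f g : ell (c *: f + g) = c * ell f + ell g.
Proof. by rewrite /ell mulrDr -scalerAr mcoeffD mcoeffZ. Qed.

(** The Ward identity: the vector field is integrated by parts and its action on the Vandermonde
    power is moved to the other side. *)
Lemma ell_DD a f q : DD a vand = q * vand ->
  ell (DD a f) = (top_exp%:R - a%:R) * ell (psum a * f) - (2 * k)%:R * ell (q * f).
Proof.
move=> h; rewrite /ell.
have -> : (vand ^+ k) ^+ 2 * DD a f =
    (- (2 * k)%:R : F) *: ((vand ^+ k) ^+ 2 * (q * f)) + DD a ((vand ^+ k) ^+ 2 * f).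
  rewrite DDM -exprM (DD_eigen_exp _ h) [(k * 2)%N]mulnC scaleNr scaler_nat.
  rewrite [X in _ = - X + _](_ : _ = (2 * k)%:R * q * vand ^+ (2 * k) * f) ?addKr //.
  by rewrite -[LHS]mulr_natl -!mulrA; congr (_ * _); rewrite mulrCA.
rewrite mcoeffD mcoeffZ (coef_DD _ _ (b := top_exp)) => [|j]; last by rewrite mnmE.
by rewrite [psum a * _]mulrCA addrC mulNr.
Qed.

(** The factor cancels s in the exponent; what is left is the central coefficient of the square of
    the palindromic polynomial vand^k. *)
Lemma ell_prodX : ell ((\prod_i 'X_i) ^+ s) != 0.
Proof.
rewrite /ell; have -> : (\prod_i 'X_i) ^+ s = 'X_[[multinom s | i < r]] :> P.
  by rewrite mpolyXE_id -prodrXl; apply: eq_bigr => i _; rewrite mnmE.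
have -> : [multinom top_exp | i < r] = ([multinom s | i < r] + [multinom r.-1 | i < r] *+ k)%MM.
  by apply/mnmP => i; rewrite mnmDE mulmnE !mnmE mulnC.
rewrite mcoeffMX; apply: pal_sqr; first exact: pal_exp pal_vand.
by rewrite expf_neq0 // vand_neq0.
Qed.

End Ell.
End Ward.

(** * Bosonic Fock space *)

(** Bosonization: the current of two real fermions is a Heisenberg field. Its zero mode is replaced
    by the scalar [mu], which is compatible with the commutators because b_0 is central in them. *)
Lemma fock_exists (F : numClosedFieldType) (l mu : F) :
  exists (b : int -> {linear {poly F} -> {poly F}}) (f : {scalar {poly F}}) (om : {poly F}),
  [/\ truncated b, forall m n v, b m (b n v) - b n (b m v) = (if m + n == 0 then m%:~R * l else 0) *: v
    & forall v, b 0 v = mu *: v] /\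
  [/\ forall n : nat, b n.+1 om = 0, f om = 1 & forall (n : nat) x, f (b (- n.+1%:Z) x) = 0].
Proof.
pose A (x y : bool) : F := if x == y then 0 else if x then 1 else -1.
have Aa : antisym A by case=> [] []; rewrite /A /= ?oppr0 ?opprK.
have Ar x y : (A x y)^* = A x y by rewrite /A; case: eqP; case: x; rewrite ?rmorph0 ?rmorphN ?rmorph1.
(* The current of [A] itself has level - 1, the trace of A^2 being - 2; hence a square root of -
   l. *)
pose z := sqrtC (- l); have zz : z * z = - l by rewrite -expr2 sqrtCK.
have lin n : linear (fun v => if n == 0 then mu *: v else z *: cur A n v).
  move=> c u v; case: eqP => _; first by rewrite scalerDr !scalerA mulrC.
  by rewrite linearP scalerDr !scalerA mulrC.
have flin : linear (fun p : {poly F} => p`_0 : F^o) by move=> c p q; rewrite coefD coefZ.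
pose b n := linmk (lin n); pose f : {scalar {poly F}} := linmk flin.
have bE n v : b n v = if n == 0 then mu *: v else z *: cur A n v by rewrite /b linmkE.
have fE p : f p = p`_0 by rewrite /f linmkE.
exists b, f, 1; split; split.
- move=> v; have [N hN] := cur_truncated A v; exists (Num.max N 1) => i.
  by rewrite ge_max => /andP[h1 h2]; rewrite bE hN // scaler0; case: eqP => // e; lia.
- move=> m n v; rewrite !bE; case: (eqVneq m 0) => [->|m0]; case: (eqVneq n 0) => [->|n0];
    rewrite ?add0r ?addr0 ?(negPf m0) ?(negPf n0) ?eqxx ?mul0r ?if_same ?scale0r
            ?linearZ /= ?scalerA ?subrr // ?[mu * z]mulrC ?scalerN ?subrr //.
  rewrite -scalerBr cur_cur // cur_zero ?add0r => [|x y]; last by rewrite subrr.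
  rewrite scalerA; congr (_ *: _); case: eqP => _; rewrite ?mulr0 // zz.
  have -> : \sum_a mxm A A a a = - 2%:R.
    by rewrite big_bool /mxm !big_bool /A /=; ring.
  by field.
- by move=> v; rewrite bE.
- by move=> n; rewrite bE cur_vac ?scaler0 // => x; rewrite /A eqxx.
- by rewrite fE coef1.
- move=> n x; rewrite fE bE; have -> : (- n.+1%:Z == 0) = false by lia.
  by rewrite coefZ -ip1r cur_adj // opprK cur_vac => [|y]; rewrite ?[ip x 0]ip_conj ?/ip ?size_poly0 ?big_ord0 ?rmorph0 ?oppr0 ?mulr0 // /A eqxx.
Qed.

Lemma sum_triangle (U : nmodType) n (G : nat -> nat -> U) :
  \sum_(i < n) \sum_(j < n - i.+1) G i j = \sum_(j < n) \sum_(i < n - j.+1) G i j.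
Proof.
have e (H : nat -> nat -> U) : \sum_(i < n) \sum_(j < n - i.+1) H i j =
    \sum_(i < n) \sum_(j < n | (i + j.+1 < n)%N) H i j.
  apply: eq_bigr => i _; rewrite (big_ord_widen n (H i)) ?leq_subr //.
  by apply: eq_bigl => j; rewrite ltn_subRL addSnnS.
rewrite e (e (fun j i => G i j)) (exchange_big_dep xpredT) //=.
by apply: eq_bigr => j _; apply: eq_bigl => i; rewrite -addSnnS addnC.
Qed.

(** * Virasoro operators with background charge *)

Section Fock.
Variables (F : numFieldType) (V : lmodType F) (l gam mu : F) (b : int -> {linear V -> V}).
Hypotheses (l0 : l != 0) (btr : truncated b).
Hypothesis bb : forall m n v, b m (b n v) - b n (b m v) = (if m + n == 0 then m%:~R * l else 0) *: v.

(** The Heisenberg algebra is treated as the affine algebra of a one-dimensional Lie algebra, with f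
    = 0 and g = 0. *)
Let J (_ : unit) := b.
Let Jtr a : truncated (J a). Proof. exact: btr. Qed.
Let JJ (a a' : unit) m n v : J a m (J a' n v) - J a' n (J a m v) =
  (\sum_(c : unit) (0 : F) *: J c (m + n) v) + (if (m + n == 0) && (a == a') then m%:~R * l else 0) *: v.
Proof. by case: a a' => -[]; rewrite /J bb big1 ?add0r ?eqxx ?andbT //= => *; rewrite scale0r. Qed.
Let fC (a a' c : unit) : (0 : F) = - 0. Proof. by rewrite oppr0. Qed.
Let fK (a d : unit) : \sum_(a : unit) \sum_(c : unit) (0 * 0 : F) = if a == d then - (2%:R * 0) else 0.
Proof. rewrite big1 => [|*]; last by rewrite big1 // => *; rewrite mulr0.
by case: (a == d); rewrite ?mulr0 ?oppr0. Qed.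
Let lg : l + 0 != 0. Proof. by rewrite addr0 l0. Qed.

Let S := sugL l 0 Jtr.
Let T (n : int) v (q : int) := b (n - q) (b q v).

Let evT (n : int) v : evz (T n v).
Proof. by have [N hN] := btr v; exists N => i /hN e; rewrite /T e linear0. Qed.

Let SE (n : int) v : S n v = (2%:R * l)^-1 *: (fsum (T n v) 1 + fsum (T n v) n).
Proof.
rewrite /S sugLE sugE addr0; congr (_ *: (_ + _)); apply: eq_fsum => i _;
  by rewrite /sug_term (big_pred1 tt) // => -[].
Qed.

Let SJ n m v : S n (b m v) - b m (S n v) = - m%:~R *: b (n + m) v.
Proof. exact: (@sugL_J _ _ _ J (fun _ _ _ => 0) l 0 Jtr JJ fC fC fK lg n tt m v). Qed.

Let SV : is_vir 1 S.
Proof.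
have := @sugL_vir _ _ _ J (fun _ _ _ => 0) l 0 Jtr JJ fC fC fK lg.
by rewrite card_unit addr0 mulr1 divff ?l0.
Qed.

Let L_linear (n : int) : linear (fun v => S n v - (gam * (n + 1)%:~R) *: b n v).
Proof.
move=> a u v; rewrite [S n _]linearP [b n _]linearP /=.
by move: (S n u) (S n v) (b n u) (b n v) => x1 x2 x3 x4; lmodule F.
Qed.

(** The Feigin-Fuchs operators with background charge [gam]. Leaving the level l of b free allows l
    = 2 k later, with rational [gam] and integral [mu]. *)
Definition virL (n : int) : {linear V -> V} := linmk (L_linear n).

Lemma virLE (n : int) v : virL n v = S n v - (gam * (n + 1)%:~R) *: b n v.
Proof. exact: linmkE. Qed.

Lemma virL_fsum (n : int) v : virL n v =
  (2%:R * l)^-1 *: (fsum (fun q => b (n - q) (b q v)) 1 + fsum (fun q => b (n - q) (b q v)) n)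
  - (gam * (n + 1)%:~R) *: b n v.
Proof. by rewrite virLE SE. Qed.

Lemma virL_b n m v : virL n (b m v) - b m (virL n v) =
  - m%:~R *: b (n + m) v - (if n + m == 0 then gam * (n * (n + 1))%:~R * l else 0) *: v.
Proof.
have e1 := SJ n m v; have e2 := bb n m v.
rewrite !virLE [b m (_ - _)]linearB [b m (_ *: _)]linearZ /= -e1.
have -> : (if n + m == 0 then gam * (n * (n + 1))%:~R * l else 0) *: v =
  (gam * (n + 1)%:~R) *: (b n (b m v) - b m (b n v)).
  by rewrite e2 scalerA; congr (_ *: _); case: eqP => _; rewrite ?mulr0 // rmorphM; ring.
by move: (S n (b m v)) (b m (S n v)) (b n (b m v)) (b m (b n v)) => x1 x2 x3 x4; lmodule F.
Qed.

Lemma virL_vir : is_vir (1 - 12%:R * l * gam ^+ 2) virL.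
Proof.
move=> m n v.
have -> : virL m (virL n v) - virL n (virL m v) =
    (virL m (S n v) - S n (virL m v)) - (gam * (n + 1)%:~R) *: (virL m (b n v) - b n (virL m v)).
  rewrite (virLE n v) (virLE n (virL m v)) [virL m (_ - _)]linearB [virL m (_ *: _)]linearZ /=.
  by move: (virL m (S n v)) (S n (virL m v)) (virL m (b n v)) (b n (virL m v)) => x1 x2 x3 x4; lmodule F.
have -> : virL m (S n v) - S n (virL m v) =
    (S m (S n v) - S n (S m v)) + (gam * (m + 1)%:~R) *: (S n (b m v) - b m (S n v)).
  rewrite !virLE [S n (_ - _)]linearB [S n (_ *: _)]linearZ /=.
  by move: (S m (S n v)) (S n (S m v)) (b m (S n v)) (S n (b m v)) => x1 x2 x3 x4; lmodule F.
rewrite SV SJ virL_b virLE [n + m]addrC.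
case: (eqVneq (m + n) 0) => [e|_]; last first.
  rewrite !scale0r !addr0 subr0 !rmorphB !rmorphD /=.
  by move: (S _ _) (b _ _) (m%:~R) (n%:~R) => x1 x2 y1 y2; lmodule F.
have -> : n = - m by rewrite -[n](addKr m) e addr0.
rewrite !subrr add0r opprK !rmorphB /= rmorphXn /= rmorphM /= !rmorphD !rmorphN /= !mulr1z.
by move: (S _ _) (b _ _) (m%:~R) => x1 x2 y1; lmodule F; field.
Qed.

Lemma virL_adj (h : V -> V -> F) (n : int) u v : gam = 0 ->
  (forall x y z, h (x + y) z = h x z + h y z) -> (forall x y z, h x (y + z) = h x y + h x z) ->
  (forall x y, h ((2%:R * l)^-1 *: x) y = h x ((2%:R * l)^-1 *: y)) ->
  (forall (m : int) x y, h (b m x) y = h x (b (- m) y)) -> h (virL n u) v = h u (virL (- n) v).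
Proof.
move=> g0 hDl hDr hZ hb; rewrite !virLE g0 !mul0r !scale0r !subr0 /S !sugLE addr0 hZ.
have := @sug_adj _ _ _ J (fun _ _ _ => 0) l Jtr JJ fC h 1 n u (((2%:R * l)^-1) *: v) hDl hDr (mulr1 1).
by rewrite linearZ => -> // a p x y; rewrite mul1r.
Qed.

Section Vacuum.
Variable (om : V).
Hypothesis b0 : forall v, b 0 v = mu *: v.
Hypothesis bom : forall n : nat, b n.+1 om = 0.

Lemma virL_om (n : nat) : virL n.+1 om = 0.
Proof.
rewrite virLE SE bom scaler0 subr0 (eq_fsum (H := fun=> 0)) => [|[[|i]|i] h //]; last 1 first.
  by rewrite /T bom linear0.
rewrite (eq_fsum (H := fun=> 0)) => [|[[|i]|i] h //]; last by rewrite /T bom linear0.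
by rewrite !fsum0 addr0 scaler0.
Qed.

Lemma virL0_om : virL 0 om = (mu ^+ 2 / (2%:R * l) - gam * mu) *: om.
Proof.
have z : fsum (T 0 om) 1 = 0.
  rewrite (eq_fsum (H := fun=> 0)) ?fsum0 // => -[[|i]|i] h //; by rewrite /T bom linear0.
rewrite virLE SE (fsum_step 0 (evT 0 om)) add0r z add0r addr0 /T subrr !b0 !scalerA -scalerBl.
by congr (_ *: _); rewrite ?add0r; ring.
Qed.

Lemma virL_neg (n : nat) : virL (- n.+1%:Z) om =
  (2%:R * l)^-1 *: (\sum_(i < n.+2) b (- i%:Z) (b (- (n.+1 - i)%N%:Z) om)) + (gam * n%:R) *: b (- n.+1%:Z) om.
Proof.
rewrite virLE SE; congr (_ *: _ + _).
  rewrite (eq_fsum (x := 1) (H := fun=> 0)) => [|[[|i]|i] h //]; last by rewrite /T bom linear0.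
  rewrite fsum0 add0r (@fsumE _ n.+2) => [|i le]; last first.
    have -> : - n.+1%:Z + i%:Z = (i - n.+2).+1%:Z by rewrite -subSS subSS; lia.
    by rewrite /T bom linear0.
  apply: eq_bigr => i _; have lt := ltn_ord i; rewrite /T.
  have -> : - n.+1%:Z + i%:Z = - (n.+1 - i)%N%:Z by lia.
  by have -> : - n.+1%:Z - - (n.+1 - i)%N%:Z = - i%:Z by lia.
rewrite -scaleNr -mulrN; congr ((_ * _) *: _).
by rewrite -rmorphN /= (_ : - (- n.+1%:Z + 1) = n%:Z) //; lia.
Qed.

Variable f : {scalar V}.
Hypothesis fb : forall (n : nat) x, f (b (- n.+1%:Z) x) = 0.

Let f_fsum (G : int -> V) y : evz G -> f (fsum G y) = fsum (fun i => f (G i)) y.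
Proof. exact: fsum_additive. Qed.

Lemma f_virL0 x : f (virL 0 x) = (mu ^+ 2 / (2%:R * l) - gam * mu) * f x.
Proof.
have z : f (fsum (T 0 x) 1) = 0.
  rewrite f_fsum // (eq_fsum (H := fun=> 0)) ?fsum0 // => -[[|i]|i] h //.
  by rewrite /T sub0r fb.
rewrite virLE SE (fsum_step 0 (evT 0 x)) add0r /T subrr !b0 scalerA.
rewrite linearB !linearZ /= !linearD !linearZ /= z.
by ring.
Qed.

Lemma f_virL (n : nat) x : f (virL (- n.+1%:Z) x) = 0.
Proof.
rewrite virLE SE linearB !linearZ /= linearD !f_fsum // fb.
rewrite (eq_fsum (x := 1) (H := fun=> 0)) => [|[[|i]|i] h //]; last 1 first.
  by rewrite /T (_ : - n.+1%:Z - i.+1%:Z = - (n.+1 + i).+1%:Z) ?fb //; rewrite -opprD; congr (- _); rewrite -PoszD addnS.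
rewrite (eq_fsum (H := fun=> 0)) ?fsum0 ?addr0 ?mulr0 ?subr0 // => i h.
rewrite /T; case: (ltrP i 0) => hi.
  case: (eqVneq (- n.+1%:Z - i) 0) => [->|ne].
    rewrite b0 linearZ /= (_ : i = - (`|i|.-1).+1%:Z); last by lia.
    by rewrite fb mulr0.
  have := bb (- n.+1%:Z - i) i x; have -> : (- n.+1%:Z - i + i == 0) = false by lia.
  rewrite scale0r => /eqP; rewrite subr_eq0 => /eqP ->.
  by rewrite (_ : i = - (`|i|.-1).+1%:Z) ?fb //; lia.
by rewrite (_ : - n.+1%:Z - i = - (n + `|i|).+1%:Z) ?fb //; lia.
Qed.

Lemma virL_pos (n : nat) x :
  virL n.+1 x = (2%:R * l)^-1 *: (\sum_(i < n) b (n - i)%N (b i.+1 x))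
    + l^-1 *: (mu *: b n.+1 x + fsum (fun q : int => b (n.+1%:Z - q) (b q x)) n.+2) - (gam * (n.+2)%:R) *: b n.+1 x.
Proof.
rewrite virLE SE -PoszD addn1 -/(T n.+1 x); congr (_ - _).
have -> : fsum (T n.+1 x) n.+1 = mu *: b n.+1 x + fsum (T n.+1 x) (n.+2).
  by rewrite (fsum_step n.+1 (evT _ _)) /T subrr b0 -PoszD addn1.
have -> : fsum (T n.+1 x) 1 = \sum_(i < n) b (n - i)%N (b i.+1 x) + fsum (T n.+1 x) n.+1.
  have e m : (m <= n)%N -> fsum (T n.+1 x) 1 = \sum_(i < m) b (n - i)%N (b i.+1 x) + fsum (T n.+1 x) m.+1.
    elim: m => [|m IH] le; first by rewrite big_ord0 add0r.
    rewrite IH ?(ltnW le) // (fsum_step m.+1 (evT _ _)) big_ord_recr /= addrA -PoszD addn1.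
    by rewrite /T (_ : n.+1%:Z - m.+1%:Z = (n - m)%N%:Z) //; lia.
  by rewrite (e n).
rewrite (fsum_step n.+1 (evT _ _)) /T subrr b0 -PoszD addn1.
move: (\sum_(_ < _) _) (b _ _) (fsum _ _) => x1 x2 x3; lmodule F; field; rewrite ?l0 //.
Qed.

End Vacuum.
End Fock.

(** * Singular vectors *)

Section Theta.
Variables (F : numFieldType) (V : lmodType F) (l : F) (b : int -> {linear V -> V}) (om : V).
Hypothesis bb : forall m n v, b m (b n v) - b n (b m v) = (if m + n == 0 then m%:~R * l else 0) *: v.
Hypothesis bom : forall n : nat, b n.+1 om = 0.
Variable r : nat.
Local Notation P := {mpoly F[r]}.
Local Notation p := (@psum F r).
Implicit Types (lf : P -> F) (g : P) (n m : nat).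

Fixpoint theta_rec lf d n g : V :=
  if d is d'.+1 then
    if n is n'.+1 then
      (n%:R : F)^-1 *: \sum_(i < n) b (- i.+1%:Z) (theta_rec lf d' (n' - i) (p i.+1 * g))
    else lf g *: om
  else 0.

Lemma theta_recS lf d n g : theta_rec lf d.+1 n.+1 g =
  (n.+1%:R : F)^-1 *: \sum_(i < n.+1) b (- i.+1%:Z) (theta_rec lf d (n - i) (p i.+1 * g)).
Proof. by []. Qed.

(* The coefficient of degree n of lf (exp (\sum_m b_{-m} p_m / m) g) om. *)
Definition theta := locked (fun lf n g => theta_rec lf n.+1 n g).

Let thetaE lf n g : theta lf n g = theta_rec lf n.+1 n g.
Proof. by rewrite /theta -lock. Qed.

Lemma theta_recE lf d n g : (n < d)%N -> theta_rec lf d n g = theta lf n g.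
Proof.
rewrite thetaE; elim/ltn_ind: n d g => -[|n] IH [|d] g // lt; rewrite !theta_recS; congr (_ *: _).
apply: eq_bigr => i _; have lti := ltn_ord i; rewrite IH; [|lia..].
by rewrite [in RHS]IH; [|lia..].
Qed.

Lemma theta0 lf g : theta lf 0 g = lf g *: om. Proof. by rewrite thetaE. Qed.

Lemma thetaS lf n g :
  n.+1%:R *: theta lf n.+1 g = \sum_(i < n.+1) b (- i.+1%:Z) (theta lf (n - i) (p i.+1 * g)).
Proof.
rewrite [in LHS]thetaE theta_recS scalerA divff ?pnatr_eq0 // scale1r.
by apply: eq_bigr => i _; rewrite theta_recE // ltnS leq_subr.
Qed.

Lemma scale_natI n (x y : V) : n.+1%:R *: x = n.+1%:R *: y -> x = y.
Proof. by apply: scalerI; rewrite pnatr_eq0. Qed.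

Lemma theta_lin lf n c g g' : (forall c g g', lf (c *: g + g') = c * lf g + lf g') ->
  theta lf n (c *: g + g') = c *: theta lf n g + theta lf n g'.
Proof.
move=> lin; elim/ltn_ind: n c g g' => -[|n] IH c g g'.
  by rewrite !theta0 lin scalerDl scalerA.
apply: (@scale_natI n); rewrite scalerDr scalerA [_%:R * c]mulrC -scalerA !thetaS scaler_sumr -big_split.
apply: eq_bigr => i _ /=; rewrite mulrDr -scalerAr IH ?linearP //; have := ltn_ord i; lia.
Qed.

Lemma theta_mul lf n g g' : theta (fun x => lf (g * x)) n g' = theta lf n (g * g').
Proof.
elim/ltn_ind: n g' => -[|n] IH g'; first by rewrite !theta0.
apply: (@scale_natI n); rewrite !thetaS; apply: eq_bigr => i _.
by rewrite IH; [rewrite mulrCA | have := ltn_ord i; lia].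
Qed.

Lemma theta_comb lf lf' c n g :
  theta (fun x => c * lf x + lf' x) n g = c *: theta lf n g + theta lf' n g.
Proof.
elim/ltn_ind: n g => -[|n] IH g; first by rewrite !theta0 scalerDl scalerA.
apply: (@scale_natI n); rewrite scalerDr scalerA [_%:R * c]mulrC -scalerA !thetaS scaler_sumr -big_split.
apply: eq_bigr => i _ /=; rewrite IH ?linearP //; have := ltn_ord i; lia.
Qed.

Lemma eq_theta lf lf' n g : (forall x, lf x = lf' x) -> theta lf n g = theta lf' n g.
Proof. by move=> /funext ->. Qed.

Lemma theta_fun0 n g : theta (fun=> 0) n g = 0.
Proof.
elim/ltn_ind: n g => -[|n] IH g; first by rewrite theta0 scale0r.
apply: (@scale_natI n); rewrite thetaS scaler0 big1 // => i _.
by rewrite IH ?linear0 //; have := ltn_ord i; lia.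
Qed.

Lemma theta_scale lf c n g : theta (fun x => c * lf x) n g = c *: theta lf n g.
Proof.
rewrite -[RHS]addr0 -(theta_fun0 n g) -theta_comb.
by apply: eq_theta => x; rewrite addr0.
Qed.

Lemma theta_arg0 lf n : (forall c g g', lf (c *: g + g') = c * lf g + lf g') -> theta lf n 0 = 0.
Proof. by move=> lin; have := theta_lin n (-1) 1 1 lin; rewrite scaleN1r addNr scaleN1r addNr. Qed.

Lemma sum_ord_guard m n (G : nat -> V) : (m <= n)%N ->
  \sum_(i < n.+1) (if (m <= n - i)%N then G i else 0) = \sum_(i < (n - m).+1) G i.
Proof.
move=> le; rewrite (big_ord_widen n.+1 G) ?ltnS ?leq_subr // [RHS]big_mkcond.
by apply: eq_bigr => i _; have := ltn_ord i => h; rewrite (_ : (i < (n - m).+1)%N = (m <= n - i)%N) //; lia.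
Qed.

(** On exp (\sum_m b_{-m} p_m / m) applied to the vacuum, b_m acts as multiplication by l p_m. *)
Lemma b_theta lf m n g : b m.+1 (theta lf n g) =
  if (m < n)%N then l *: theta lf (n - m.+1) (p m.+1 * g) else 0.
Proof.
elim/ltn_ind: n g => -[|n] IH g; first by rewrite theta0 linearZ /= bom scaler0.
apply: (@scale_natI n); rewrite -linearZ thetaS linear_sum /=.
transitivity (\sum_(i < n.+1) (if (m.+1 <= n - i)%N then
      l *: b (- i.+1%:Z) (theta lf (n - i - m.+1) (p m.+1 * (p i.+1 * g))) else 0)
    + \sum_(i < n.+1) (if i == m :> nat then (m.+1%:R * l) *: theta lf (n - m) (p m.+1 * g) else 0)).
  rewrite -big_split; apply: eq_bigr => i _ /=; have lt := ltn_ord i.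
  have := bb m.+1 (- i.+1%:Z) (theta lf (n - i) (p i.+1 * g)) => /(canRL (subrK _)) ->.
  rewrite IH; last by lia.
  rewrite [LHS]addrC; congr (_ + _); first by case: ifP => _; rewrite ?linear0 ?linearZ.
  have -> : (m.+1%:Z + - i.+1%:Z == 0) = (i == m :> nat) by lia.
  by case: eqP => [->|_]; rewrite ?scale0r.
have -> : \sum_(i < n.+1) (if i == m :> nat then (m.+1%:R * l) *: theta lf (n - m) (p m.+1 * g) else 0) =
   if (m < n.+1)%N then (m.+1%:R * l) *: theta lf (n - m) (p m.+1 * g) else 0.
  case: ifP => lt.
    rewrite (bigD1 (Ordinal lt)) //= eqxx big1 ?addr0 // => i; rewrite -val_eqE /=.
    by move=> /negPf ->.
  rewrite big1 // => i _; case: eqP => // e; have := ltn_ord i; lia.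
rewrite ltnS subSS; case: ltngtP => [lt|gt|eq].
- rewrite (sum_ord_guard (fun i => l *: b (- i.+1%:Z) (theta lf (n - i - m.+1) (p m.+1 * (p i.+1 * g))))) //.
  have -> : \sum_(i < (n - m.+1).+1) l *: b (- i.+1%:Z) (theta lf (n - i - m.+1) (p m.+1 * (p i.+1 * g)))
     = l *: ((n - m)%N%:R *: theta lf (n - m) (p m.+1 * g)).
    rewrite -scaler_sumr; congr (_ *: _); rewrite (_ : (n - m = (n - m.+1).+1)%N); last by lia.
    rewrite thetaS; apply: eq_bigr => i _; congr (b _ (theta _ _ _)); last by rewrite mulrCA.
    by lia.
  rewrite !scalerA -scalerDl; congr (_ *: _).
  by rewrite mulrC -mulrDl -natrD; congr (_%:R * _); lia.
- by rewrite big1 ?scaler0 ?addr0 // => i _; case: ifP => // h; exfalso; lia.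
- rewrite eq subnn scalerA big1 ?add0r // => i _; case: ifP => // h; exfalso; lia.
Qed.

(** Differentiating the exponential: [DD a] sends p_i to i p_{i+a}, hence brings down the sum of the
    b_{-i} p_{i+a}. *)
Lemma theta_DD lf a n g : (forall c g g', lf (c *: g + g') = c * lf g + lf g') ->
  theta (fun x => lf (DD a x)) n g =
  theta lf n (DD a g) + \sum_(i < n) b (- i.+1%:Z) (theta lf (n - i.+1) (p (i.+1 + a) * g)).
Proof.
move=> lin; elim/ltn_ind: n g => -[|n] IH g; first by rewrite big_ord0 addr0 !theta0.
apply: (@scale_natI n); rewrite scalerDr !thetaS.
pose B i := b (- (i.+1%:Z)); pose H i j := theta lf (n - i - j.+1) (p (j.+1 + a) * (p i.+1 * g)).
transitivity (\sum_(i < n.+1) (B i (theta lf (n - i) (p i.+1 * DD a g))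
    + i.+1%:R *: B i (theta lf (n - i) (p (i.+1 + a) * g))
    + \sum_(j < n.+1 - i.+1) B i (B j (H i j)))).
  apply: eq_bigr => i _; rewrite IH; last by have := ltn_ord i; lia.
  rewrite linearD linear_sum DDM DD_psum; congr (_ + _).
  rewrite -mulrA mulr_natl -scaler_nat theta_lin // linearP addrC //.
rewrite !big_split /= (sum_triangle n.+1 (fun i j => B i (B j (H i j)))) -addrA; congr (_ + _).
rewrite scaler_sumr -big_split; apply: eq_bigr => i _ /=; have lt := ltn_ord i.
have -> : n.+1%:R = i.+1%:R + (n - i)%:R :> F by rewrite -natrD; congr (_%:R); lia.
rewrite scalerDl subSS; congr (_ + _); rewrite -linearZ /=.
have : (n - i = 0)%N \/ exists m, (n - i = m.+1)%N by case: (n - i)%N => [|m]; [left|right; exists m].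
case=> [->|[m em]]; first by rewrite big_ord0 scale0r linear0.
rewrite em thetaS linear_sum; apply: eq_bigr => j _ /=.
have := bb (- j.+1%:Z) (- i.+1%:Z) (H j i) => /eqP.
have -> : (- j.+1%:Z + - i.+1%:Z == 0) = false by lia.
rewrite scale0r subr_eq0 => /eqP ->; congr (b _ (b _ _)); rewrite /H.
by rewrite mulrCA; congr (theta _ _ _); lia.
Qed.

Section Singular.
Variables (k s : nat) (mu gam : F).
Hypotheses (k0 : (0 < k)%N) (r0 : (0 < r)%N) (s0 : (0 < s)%N) (btr : truncated b).
Hypothesis lE : l = (2 * k)%:R.
Hypothesis b0 : forall v, b 0 v = mu *: v.
Hypothesis muE : mu = (k * r.+1)%:R - s.+1%:R.
Hypothesis gamE : gam = (k%:R - 1) / l.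
Local Notation lf := (@ell F r k s).

Let l0 : l != 0. Proof. by rewrite lE pnatr_eq0; lia. Qed.
Let lin := @ell_lin F r k s.

Let L := virL l gam btr.

Let fsum_theta (i n : nat) g : fsum (fun q : int => b (i.+1%:Z - q) (b q (theta lf n g))) i.+2 =
  l *: \sum_(m < n - i.+1) b (- m.+1%:Z) (theta lf (n - i.+1 - m.+1) (p (m.+1 + i.+1) * g)).
Proof.
rewrite (@fsumE _ (n - i.+1)) => [|j le]; last first.
  have -> : i.+2%:Z + j%:Z = (i.+1 + j).+1%:Z by rewrite -PoszD.
  by rewrite b_theta ifF ?linear0 //; lia.
rewrite scaler_sumr; apply: eq_bigr => m _; have lt := ltn_ord m.
have -> : i.+2%:Z + m%:Z = (i.+1 + m).+1%:Z by rewrite -PoszD.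
rewrite b_theta ifT; last by lia.
rewrite linearZ /=; congr (_ *: b _ (theta _ _ (p _ * _))); lia.
Qed.

Let TR (n : nat) : V := theta lf n 1.
Let W i n : V := theta lf n (p i).

Let ellZ c g : lf (c *: g) = c * lf g.
Proof.
have z : lf 0 = 0 by have := lin (-1) 1 1; rewrite scaleN1r addNr => ->; rewrite mulN1r addNr.
by rewrite -[c *: g]addr0 lin z addr0.
Qed.

Let ward1 n : \sum_(m < n) b (- m.+1%:Z) (theta lf (n - m.+1) (p (m.+1 + 1) * 1)) =
  ((top_exp r k s)%:R - 1 - (2 * k)%:R * (r%:R - 1)) *: W 1 n.
Proof.
have := @theta_DD lf 1 n 1 lin; rewrite DD1 (theta_arg0 n lin) add0r => <-.
have -> : W 1 n = theta (fun x => lf (p 1 * x)) n 1 by rewrite theta_mul mulr1.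
rewrite -theta_scale; apply: eq_theta => x.
rewrite (ell_DD _ _ _ (DD1_vand _ _)).
have -> : (r%:R - 1) * p 1 * x = (r%:R - 1) *: (p 1 * x).
  by rewrite -mulrA mulrBl scalerBl mul1r scale1r scaler_nat mulr_natl.
by rewrite ellZ; ring.
Qed.

Let ward2 n : \sum_(m < n) b (- m.+1%:Z) (theta lf (n - m.+1) (p (m.+1 + 2) * 1)) =
  ((top_exp r k s)%:R - 2%:R - (2 * k)%:R * (r%:R - 3%:R / 2%:R)) *: W 2 n
  - k%:R *: theta lf n (p 1 ^+ 2).
Proof.
have := @theta_DD lf 2 n 1 lin; rewrite DD1 (theta_arg0 n lin) add0r => <-.
have -> : W 2 n = theta (fun x => lf (p 2 * x)) n 1 by rewrite theta_mul mulr1.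
have -> : theta lf n (p 1 ^+ 2) = theta (fun x => lf (p 1 ^+ 2 * x)) n 1 by rewrite theta_mul mulr1.
rewrite -scaleNr -[X in _ + X]theta_scale -theta_comb; apply: eq_theta => x.
rewrite (ell_DD _ _ _ (DD2_vand _ _)).
have e a c : (a *: p 2 + c *: p 1 ^+ 2) * x = a *: (p 2 * x) + c *: (p 1 ^+ 2 * x) by rewrite mulrDl -!scalerAl.
rewrite e lin ellZ natrM mulNr.
by field.
Qed.

Let topE : (top_exp r k s)%:R = s%:R + k%:R * (r%:R - 1) :> F.
Proof. by rewrite /top_exp natrD natrM -subn1 natrB. Qed.

Let kF : k%:R != 0 :> F. Proof. by rewrite pnatr_eq0 -lt0n. Qed.

(** The coefficient of [W 1] in L_1 of the residue, with contributions of b_0, of [ward1] and of the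
    background charge. The values of [mu] and [gam] are those that make it vanish. *)
Let coef1 : l^-1 * (mu * l + l * ((top_exp r k s)%:R - 1 - (2 * k)%:R * (r%:R - 1))) - gam * 2%:R * l = 0.
Proof.
rewrite gamE muE topE lE; have -> : (k * r.+1)%:R = k%:R * (r%:R + 1) :> F by rewrite natrM -natr1.
have -> : s.+1%:R = s%:R + 1 :> F by rewrite -natr1.
by rewrite (natrM F 2 k); field.
Qed.

Let sing1 n : L 1 (TR n) = 0.
Proof.
rewrite (virL_pos _ l0 _ b0) big_ord0 scaler0 add0r (fsum_theta 0) b_theta.
case: n => [|n]; first by rewrite /= !scaler0 big_ord0 !scaler0 addr0 subr0 scaler0.
rewrite /= subSS subn0 ward1 mulr1 -/(W 1 n).
rewrite !scalerA -scalerDl !scalerA -scalerBl [X in X *: _](_ : _ = 0) ?scale0r //; exact: coef1.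
Qed.

Let sing2 n : L 2 (TR n) = 0.
Proof.
rewrite (virL_pos _ l0 _ b0) big_ord1 (fsum_theta 1) !b_theta.
case: n => [|[|n]].
- rewrite /=.
  by rewrite big_ord0 linear0 !(scaler0, addr0, subr0).
- by rewrite /= linearZ /= b_theta /= big_ord0 !(scaler0, addr0, subr0).
rewrite /= linearZ /= b_theta /= !subSS !subn0 ward2 !mulr1 -/(W 2 n) -expr2.
move: (W 2 n) (theta _ _ _) => x y.
rewrite gamE muE topE lE; have -> : (k * r.+1)%:R = k%:R * (r%:R + 1) :> F by rewrite natrM -natr1.
have -> : s.+1%:R = s%:R + 1 :> F by rewrite -natr1.
by rewrite (natrM F 2 k); lmodule F; field.
Qed.

Let Lvir := virL_vir gam l0 btr bb.

(** L_1 and L_2 suffice, as [L_m, L_1] = (m - 1) L_{m+1}. They kill the residue by the Ward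
    identities of the vector fields of degree 1 and 2. *)
Lemma theta_singular n m : L m.+1 (TR n) = 0.
Proof.
have [->|] := eqVneq m 0%N; first exact: sing1.
rewrite -lt0n; elim: m => // m IH _; have [->|m0] := eqVneq m 0%N; first exact: sing2.
have := Lvir m.+1 1 (TR n); rewrite -/L sing1 IH ?lt0n // [L 1 0]linear0 [L m.+1 0]linear0 subrr.
have -> : (m.+1%:Z + 1 == 0) = false by lia.
rewrite scale0r addr0 => /esym/eqP; rewrite scaler_eq0 intr_eq0.
have -> : (m.+1%:Z - 1 == 0) = false by lia.
by rewrite /= -PoszD addn1 => /eqP.
Qed.

(** Homogeneity: the Euler field [DD 0] acts on the residue as r s and on the component of degree n
    as n. *)
Let degree n : n != (r * s)%N -> theta lf n 1 = 0.
Proof.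
move=> ne; have D0 : DD 0 (vand F r) = (\sum_(x : 'I_r * 'I_r | (x.1 < x.2)%N) 1) * vand F r.
  by apply: DD_eigen_prod => x; rewrite DDB !DDX !expr1 mul1r.
have e : forall x, lf (DD 0 x) = (r * s)%:R * lf x.
  move=> x; rewrite (ell_DD _ _ _ D0).
  have -> : p 0 * x = r%:R *: x.
    rewrite /p; under eq_bigr do rewrite expr0.
    by rewrite sumr_const card_ord scaler_nat mulr_natl.
  have -> : (\sum_(x : 'I_r * 'I_r | (x.1 < x.2)%N) 1) * x = ((r%:R ^+ 2 - r%:R) / 2%:R) *: x.
    rewrite sumr_const mulr_natl -scaler_nat; congr (_ *: _).
    have := @sum_pairs r F (fun _ _ => 1) (fun _ _ => erefl).
    rewrite sumr_const; under [X in _ = X - _]eq_bigr do rewrite sumr_const.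
    rewrite !sumr_const card_ord -[r%:R *+ r]mulr_natr -expr2; move: (#|_|%:R) (_ - _) => c d <-.
    by rewrite -mulr_natr; field.
  by rewrite !ellZ topE !natrM; field.
have := @theta_DD lf 0 n 1 lin; rewrite DD1 (theta_arg0 n lin) add0r.
rewrite (eq_theta _ _ e) theta_scale.
case: n ne => [|n] ne; first by rewrite big_ord0 => /eqP; rewrite scaler_eq0 pnatr_eq0 eq_sym (negPf ne) => /eqP.
under eq_bigr do rewrite addn0 subSS.
rewrite -thetaS => /eqP; rewrite -subr_eq0 -scalerBl scaler_eq0 subr_eq0 eqr_nat eq_sym (negPf ne).
by move/eqP.
Qed.

(** If the vector were 0, all [theta lf n 1] would vanish. The polynomials g with [theta lf n g] = 0
    for all n are stable under the power sums, by applying the b_m, hence under the product of the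
    variables; but the residue of its s-th power is not 0. *)
Lemma theta_neq0 : om != 0 -> theta lf (r * s) 1 != 0.
Proof.
move=> om0; apply/eqP => z.
pose S g := forall n, theta lf n g = 0.
have S1 : S 1 by move=> n; have [->|/degree] := eqVneq n (r * s)%N.
have SX : S ((\prod_i 'X_i) ^+ s).
  elim: s => // m; rewrite exprS; apply: newton => [c f g hf hg n|a f hf n].
    by rewrite theta_lin // hf hg scaler0 addr0.
  have := b_theta lf a (n + a.+1) f; rewrite hf linear0 ifT ?addnK; last by lia.
  by move/esym/eqP; rewrite scaler_eq0 (negPf l0) => /eqP.
have /eqP := SX 0%N; rewrite theta0 scaler_eq0 (negPf om0) orbF.
by rewrite (negPf (ell_prodX F r k s)).
Qed.

End Singular.
End Theta.

(** * Straightening *)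

Definition part (N : nat) (i : 'I_(size (parts N))) : seq nat := nth [::] (parts N) i.

Lemma part_mem N (i : 'I_(size (parts N))) : part i \in parts N.
Proof. exact: mem_nth. Qed.

Lemma part_inj N : injective (@part N).
Proof. by move=> i j /eqP; rewrite nth_uniq ?parts_uniq // => /eqP/val_inj. Qed.

Lemma part_surj N w : w \in parts N -> exists i : 'I_(size (parts N)), part i = w.
Proof. by move=> wN; have lt := wN; rewrite -index_mem in lt; exists (Ordinal lt); rewrite /part nth_index. Qed.

Lemma sum_parts (U : nmodType) N (G : seq nat -> U) :
  \sum_(w <- parts N) G w = \sum_(i < size (parts N)) G (part i).
Proof. by rewrite (big_nth [::]) big_mkord. Qed.

Lemma psort_perm w w' : perm_eq w w' -> psort w = psort w'.
Proof.
move=> pw; apply: (sorted_eq geq_trans geq_anti); rewrite ?sorted_psort //.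
by rewrite (permPl (perm_psort w)) (permPl pw) perm_sym perm_psort.
Qed.

Lemma size_psort w : size (psort w) = size w.
Proof. by apply: perm_size; exact: perm_psort. Qed.

Section Monomials.
Variables (F : numFieldType) (n : nat).

Definition mon (w : seq nat) : 'X_{1..n} := [multinom count_mem i.+1 w | i < n].

Lemma mon_cat w v : mon (w ++ v) = (mon w + mon v)%MM.
Proof. by apply/mnmP => i; rewrite mnmDE !mnmE count_cat. Qed.

Lemma mon_perm w v : perm_eq w v -> mon w = mon v.
Proof. by move=> /seq.permP pw; apply/mnmP => i; rewrite !mnmE pw. Qed.

Lemma mon_inj N w v : (N <= n)%N -> w \in parts N -> v \in parts N -> mon w = mon v -> w = v.
Proof.
move=> le wN vN e; apply: (parts_perm_eq wN vN); apply/allP => x xwv.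
have /andP[x0 xn] : (0 < x <= n)%N.
  move: xwv; rewrite mem_cat => /orP[] xw.
    apply/andP; split; first exact: (allP (parts_pos wN)).
    by apply: leq_trans le; rewrite -(parts_sum wN); exact: (allP (all_leq_sumn w)).
  apply/andP; split; first exact: (allP (parts_pos vN)).
  by apply: leq_trans le; rewrite -(parts_sum vN); exact: (allP (all_leq_sumn v)).
have lt : (x.-1 < n)%N by rewrite prednK.
by have := congr1 (fun m : 'X_{1..n} => m (Ordinal lt)) e; rewrite !mnmE /= prednK // => ->.
Qed.

Definition monp N (a : seq nat -> F) : {mpoly F[n]} := \sum_(w <- parts N) a w *: 'X_[mon w].

Lemma coef_monp N a w : (N <= n)%N -> w \in parts N -> (monp N a)@_(mon w) = a w.
Proof.
move=> le wN; rewrite /monp raddf_sum (bigD1_seq w) ?parts_uniq //= mcoeffZ mcoeffX eqxx mulr1.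
rewrite big_seq_cond big1 ?addr0 // => v /andP[vN nv].
rewrite mcoeffZ mcoeffX; case: eqP => [/(mon_inj le vN wN) e|]; last by rewrite mulr0.
by rewrite e eqxx in nv.
Qed.

(* The product of the leading forms of two elements of the enveloping algebra of the
   negative part does not vanish. *)
Lemma lead_product M N (a b : seq nat -> F) d e : (M <= n)%N -> (N <= n)%N ->
  (forall l, l \in parts (M + N) -> size l = (d + e)%N ->
     \sum_(w <- parts M) \sum_(v <- parts N) a w * b v * (l == psort (w ++ v))%:R = 0) ->
  (forall w, w \in parts M -> (d < size w)%N -> a w = 0) ->
  (forall v, v \in parts N -> (e < size v)%N -> b v = 0) ->
  (forall w, w \in parts M -> size w = d -> a w = 0) \/ (forall v, v \in parts N -> size v = e -> b v = 0).
Proof.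
move=> leM leN h ha hb.
pose a' w := if size w == d then a w else 0; pose b' v := if size v == e then b v else 0.
have : monp M a' * monp N b' = 0.
  have -> : monp M a' * monp N b' = \sum_(l <- parts (M + N))
     (\sum_(w <- parts M) \sum_(v <- parts N) a' w * b' v * (l == psort (w ++ v))%:R) *: 'X_[mon l].
    rewrite big_distrlr /=; under [RHS]eq_bigr do (rewrite scaler_suml; under eq_bigr do rewrite scaler_suml).
    rewrite [RHS]exchange_big /=; apply: eq_big_seq => w wM; rewrite [RHS]exchange_big /=; apply: eq_big_seq => v vN.
    have wvP : psort (w ++ v) \in parts (M + N).
      rewrite -(parts_sum wM) -(parts_sum vN) -sumn_cat psort_parts //.
      by rewrite all_cat (parts_pos wM) (parts_pos vN).
    rewrite (bigD1_seq _ wvP) ?parts_uniq //= eqxx mulr1 big1 ?addr0 => [|l /negPf ->]; last first.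
      by rewrite mulr0 scale0r.
    by rewrite -scalerAl -scalerAr scalerA -mpolyXD -mon_cat (mon_perm (perm_psort _)).
  rewrite big_seq big1 // => l lP.
  have t w v : w \in parts M -> v \in parts N -> a' w * b' v * (l == psort (w ++ v))%:R =
      if size l == (d + e)%N then a w * b v * (l == psort (w ++ v))%:R else 0.
    move=> wM vN; case: (eqVneq l (psort (w ++ v))) => [e1|]; last by rewrite !mulr0 if_same.
    rewrite !mulr1 {1}e1 size_psort size_cat /a' /b'.
    case: (ltngtP (size w) d) => [lt|gt|->].
    - rewrite mul0r; case: eqP => // es; rewrite hb ?mulr0 //.
      by move: (size w) (size v) lt es => x y; lia.
    - by rewrite mul0r ha // mul0r if_same.
    by rewrite eqn_add2l; case: eqP => _; rewrite ?mulr0.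
  case: (eqVneq (size l) (d + e)%N) => [sl|ns]; last first.
    rewrite big_seq big1 ?scale0r // => w wM; rewrite big_seq big1 // => v vN.
    by rewrite t // (negPf ns).
  rewrite -[X in X *: _](_ : 0 = _) ?scale0r // -[LHS](h l lP sl).
  by apply: eq_big_seq => w wM; apply: eq_big_seq => v vN; rewrite t // sl eqxx.
move/eqP; rewrite mulf_eq0 => /orP[] /eqP z; [left|right] => w wM sw.
  by have := coef_monp a' leM wM; rewrite z mcoeff0 /a' sw eqxx.
by have := coef_monp b' leN wM; rewrite z mcoeff0 /b' sw eqxx.
Qed.

End Monomials.

Section Straightening.
Variables (F : numFieldType) (V : lmodType F) (c h : F) (L : int -> {linear V -> V}) (om : V).
Hypothesis Lvir : is_vir c L.

Definition straight (u : seq nat) := all (ltn 0%N) u -> exists C : seq nat -> F,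
  lw L u om = \sum_(w <- parts (sumn u)) C w *: lw L w om /\
  forall w, w \in parts (sumn u) -> (size u <= size w)%N -> C w = (w == psort u)%:R.

Lemma lw_cat u w x : lw L (u ++ w) x = lw L u (lw L w x).
Proof. by rewrite /lw foldr_cat. Qed.

Lemma lwP u : linear (lw L u).
Proof. by elim: u => [|n u IH] a x y //=; rewrite IH linearP. Qed.

(** Exchanging the neighbours a and b costs a multiple of the shorter word with the single letter a
    + b, which cannot affect the coefficients of words at least as long as [u]. *)
Lemma straighten u : straight u.
Proof.
apply: (word_ind (good := straight)) => {u} [w1 a b w2 short good_ab|w _]; last first.
  exists (psort w); first by rewrite perm_sym perm_psort.
  move=> w0; exists (fun v => (v == psort w)%:R); split; last first.
    by move=> v _ _; rewrite (psort_perm (perm_psort w)).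
  have wP : psort w \in parts (sumn (psort w)).
    by rewrite (perm_sumn (perm_psort w)) psort_parts // -(perm_all _ (perm_psort w)).
  rewrite (bigD1_seq _ wP) ?parts_uniq //= eqxx scale1r big1 ?addr0 // => v /negPf ->.
  by rewrite scale0r.
move=> w0; have /good_ab [C [hC1 hC2]] : all (ltn 0%N) (w1 ++ a :: b :: w2).
  by move: w0; rewrite !all_cat /= => /and4P[-> -> ->].
have ab : (0 < a + b)%N by move: w0; rewrite all_cat /= => /and4P[_ b0 a0 _]; lia.
have [||D [hD1 hD2]] := short (w1 ++ (a + b)%N :: w2).
- by rewrite !size_cat /= !addnS.
- by move: w0; rewrite !all_cat /= ab => /and4P[-> _ _ ->].
have s1 : sumn (w1 ++ b :: a :: w2) = sumn (w1 ++ a :: b :: w2) by rewrite !sumn_cat /=; lia.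
have s2 : sumn (w1 ++ (a + b)%N :: w2) = sumn (w1 ++ a :: b :: w2) by rewrite !sumn_cat /=; lia.
exists (fun w => (a%:Z - b%:Z)%:~R * D w + C w); split.
  rewrite s1; under eq_bigr do rewrite scalerDl -scalerA.
  rewrite big_split /= -hC1 -scaler_sumr -{1}s2 -hD1 !lw_cat /= -lwP; congr (lw L w1 _).
  have := Lvir (- b%:Z) (- a%:Z) (lw L w2 om) => /(canRL (subrK _)) ->.
  have -> : (- b%:Z + - a%:Z == 0) = false by lia.
  rewrite scale0r addr0; congr (_ *: L _ _ + _); first by rewrite opprK addrC.
  by rewrite -opprD PoszD addrC.
move=> w wP le; rewrite s1 in wP.
rewrite hC2 //; last by move: le; rewrite !size_cat.
rewrite hD2 ?s2 //; last by move: le; rewrite !size_cat /= !addnS => /ltnW.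
have -> : psort (w1 ++ b :: a :: w2) = psort (w1 ++ a :: b :: w2).
  by apply: psort_perm; rewrite perm_cat2l -cat1s -[a :: b :: w2]cat1s -[b :: w2]cat1s -[a :: w2]cat1s perm_catCA.
case: (eqVneq w (psort (w1 ++ (a + b)%N :: w2))) => [e|]; last by rewrite mulr0 add0r.
move: le; rewrite e size_psort !size_cat /= !addnS.
by move: (size w1 + size w2)%N => x; rewrite ltnn.
Qed.

End Straightening.

(** * Corank of the Gram matrices *)

Definition gram (A : comNzRingType) (k h : A) N : 'M[A]_(size (parts N)) :=
  \matrix_(i, j) brk k h (part i) (part j).

Definition vecf (F : nmodType) N (v : 'rV[F]_(size (parts N))) (w : seq nat) : F :=
  if insub (index w (parts N)) is Some i then v 0 i else 0.

Lemma vecf_part (F : nmodType) N (v : 'rV[F]_(size (parts N))) i : vecf v (part i) = v 0 i.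
Proof.
rewrite /vecf /part index_uniq ?parts_uniq //; case: insubP => [j _ e|]; last by rewrite ltn_ord.
by congr (v _ _); apply: val_inj.
Qed.

Lemma top_size (F : nmodType) N (v : 'rV[F]_(size (parts N))) : v != 0 ->
  exists d, (exists2 i, v 0 i != 0 & size (part i) = d) /\ forall i, (d < size (part i))%N -> v 0 i = 0.
Proof.
move=> v0; have /existsP[i0 h0] : [exists i, v 0 i != 0].
  apply: contraR v0 => /existsPn h; apply/eqP/rowP => i; rewrite mxE; apply/eqP.
  by have := h i; rewrite negbK.
case: (@arg_maxnP _ i0 (fun i => v 0 i != 0) (fun i => size (part i)) h0) => i hi max; exists (size (part i)); split; first by exists i.
by move=> j lt; apply/eqP; apply: contraLR lt => nz; rewrite -leqNgt; exact: max.
Qed.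

Section Corank.
Variables (F : numFieldType) (V : lmodType F) (c h : F) (L : int -> {linear V -> V}) (om : V) (f : {scalar V}).
Hypothesis Lvir : is_vir c L.
Hypothesis Lom : forall n : nat, L n.+1 om = 0.
Hypothesis L0om : L 0 om = h *: om.
Hypothesis fom : f om = 1.
Hypothesis fL : forall (n : nat) x, f (L (- n.+1%:Z) x) = 0.
Hypothesis fL0 : forall x, f (L 0 x) = h * f x.

Let G := gram (c / 2%:R) h.

Definition zw (z : seq int) (x : V) : V := foldr (fun n => L n) x z.

Lemma zw_cat z z' x : zw (z ++ z') x = zw z (zw z' x).
Proof. by rewrite /zw foldr_cat. Qed.

Lemma zwP z : linear (zw z).
Proof. by elim: z => [|n z IH] a x y //=; rewrite IH linearP. Qed.

Lemma zw0 z : zw z 0 = 0.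
Proof. by have := zwP z (-1) 0 0; rewrite scaleN1r addNr scaleN1r addNr. Qed.

Lemma zw_sum z (T : Type) (s : seq T) (a : T -> F) (x : T -> V) :
  zw z (\sum_(i <- s) a i *: x i) = \sum_(i <- s) a i *: zw z (x i).
Proof.
elim: s => [|i s IH]; first by rewrite !big_nil zw0.
by rewrite !big_cons zwP IH.
Qed.

Lemma zw_lw w x : zw [seq - m%:Z | m <- w] x = lw L w x.
Proof. by elim: w => //= m w ->. Qed.

Lemma zw_pos u x : zw [seq m%:Z | m <- u] x = foldr (fun n x => L n%:Z x) x u.
Proof. by elim: u => //= m w ->. Qed.

Lemma f_zw_pos u N (a : seq nat -> F) : all (ltn 0%N) u ->
  f (zw [seq m%:Z | m <- rev u] (\sum_(w <- parts N) a w *: lw L w om)) =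
  \sum_(w <- parts N) brk (c / 2%:R) h u w * a w.
Proof.
move=> u0; rewrite zw_sum linear_sum; apply: eq_big_seq => w wN; rewrite linearZ /= mulrC; congr (_ * _).
by rewrite zw_pos (lw_brk Lvir Lom L0om) // (parts_pos wN).
Qed.

(** Up to shorter words, a negative or zero letter can be moved to the left end, where [f] kills it
    or makes it a scalar. Words of positive letters are handled by the hypothesis at level N and by
    the grading at the other levels. *)
Lemma rad_word N (y : V) (a : seq nat -> F) : y = \sum_(w <- parts N) a w *: lw L w om ->
  (forall u, u \in parts N -> f (zw [seq m%:Z | m <- rev u] y) = 0) -> forall z, f (zw z y) = 0.
Proof.
move=> yE hy; apply: word_ind => [w1 m n w2 short|z short].
  rewrite !zw_cat /= => g; have := Lvir n m (zw w2 y) => /(canRL (subrK _)) ->.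
  rewrite -addrA zwP linearP /= zwP linearP /= g.
  have := short (w1 ++ (n + m) :: w2); rewrite zw_cat /= => ->; last by rewrite !size_cat /= !addnS.
  have := short (w1 ++ w2); rewrite zw_cat => ->; last by rewrite !size_cat /= !addnS ltnS ltnW.
  by rewrite !mulr0 !addr0.
have [/hasP[n nz n0]|hn] := boolP (has (fun n : int => n < 0) z).
  exists (n :: rem n z); first exact: perm_to_rem.
  by rewrite /= (_ : n = - (`|n|.-1).+1%:Z) ?fL //; lia.
have [zz|nz] := boolP (0 \in z).
  exists (0 :: rem 0 z); first exact: perm_to_rem.
  rewrite /= fL0 short ?mulr0 // size_rem //; by case: z zz {short hn}.
exists (if sumn [seq `|n|%N | n <- z] == N then [seq m%:Z | m <- rev (psort [seq `|n|%N | n <- z])] else z).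
  case: eqP => // _.
  have {1}-> : z = [seq m%:Z | m <- [seq `|n|%N | n <- z]].
    rewrite -map_comp -[LHS]map_id; apply/eq_in_map => n nz' /=.
    by have := hasPn hn n nz'; lia.
  by rewrite perm_map // perm_sym perm_rev perm_psort.
have pz : all (ltn 0%N) [seq `|n|%N | n <- z].
  rewrite all_map; apply/allP => n nz' /=; rewrite absz_gt0.
  by apply: contra nz => /eqP <-.
case: eqP => [e|ne]; first by rewrite hy // -e psort_parts.
have -> : z = [seq m%:Z | m <- rev (rev [seq `|n|%N | n <- z])].
  rewrite revK -map_comp -[LHS]map_id; apply/eq_in_map => n nz' /=.
  by have := hasPn hn n nz'; lia.
rewrite yE f_zw_pos ?all_rev // big_seq big1 // => w wN; rewrite brk_level ?mul0r //.
by rewrite (parts_sum wN) sumn_rev; apply/eqP.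
Qed.

(** A radical vector of level N0 has one descendant of level N for each partition of N - N0, all of
    them radical. Their rows [Y] of coefficients are independent because leading forms multiply in a
    polynomial ring, which is a domain. *)
Lemma corank_gram N0 N : (N0 <= N)%N -> \det (G N0) = 0 ->
  (\rank (G N) + size (parts (N - N0)) <= size (parts N))%N.
Proof.
move=> le /eqP; rewrite -det_tr => /det0P[v v0 vG].
pose a := vecf v; pose y := \sum_(w <- parts N0) a w *: lw L w om.
have radz : forall z, f (zw z y) = 0.
  apply: (rad_word (erefl y)) => u uN; rewrite f_zw_pos ?(parts_pos uN) // sum_parts.
  have [i <-] := part_surj uN.
  have := congr1 (fun M : 'rV[F]_ _ => M 0 i) vG; rewrite !mxE => e; rewrite -[RHS]e.
  by apply: eq_bigr => j _; rewrite !mxE /a vecf_part mulrC.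
have /choice[C hC] : forall u, exists C : seq nat -> F, all (ltn 0%N) u ->
    lw L u om = \sum_(w <- parts (sumn u)) C w *: lw L w om /\
    forall w, w \in parts (sumn u) -> (size u <= size w)%N -> C w = (w == psort u)%:R.
  move=> u; have [u0|_] := boolP (all (ltn 0%N) u); last by exists (fun=> 0).
  by have [D hD] := straighten om Lvir u0; exists D.
have cat0 (i : 'I_(size (parts (N - N0)))) w : w \in parts N0 ->
    all (ltn 0%N) (part i ++ w) /\ sumn (part i ++ w) = N.
  move=> wN; rewrite all_cat sumn_cat (parts_pos wN) (parts_pos (part_mem i)).
  by rewrite (parts_sum wN) (parts_sum (part_mem i)) subnK.
pose Y : 'M_(size (parts (N - N0)), size (parts N)) :=
  \matrix_(i, j) \sum_(w <- parts N0) a w * C (part i ++ w) (part j).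
have YG : Y *m (G N)^T = 0.
  apply/matrixP => i u; rewrite !mxE.
  have := radz ([seq m%:Z | m <- rev (part u)] ++ [seq - m%:Z | m <- part i]).
  rewrite zw_cat zw_lw; have -> : lw L (part i) y = \sum_(l <- parts N) (vecf (row i Y) l) *: lw L l om.
    rewrite sum_parts -zw_lw zw_sum.
    under [RHS]eq_bigr do rewrite vecf_part !mxE scaler_suml.
    rewrite exchange_big; apply: eq_big_seq => w wN /=; rewrite zw_lw -lw_cat.
    have [p0 ps] := cat0 i w wN; have [-> _] := hC _ p0; rewrite ps sum_parts scaler_sumr.
    by apply: eq_bigr => j _; rewrite scalerA.
  rewrite f_zw_pos ?(parts_pos (part_mem u)) // sum_parts => {2}<-.
  by apply: eq_bigr => j _; rewrite vecf_part !mxE mulrC.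
have /eqP rY : \rank Y == size (parts (N - N0)).
  apply: inj_row_free => b bY; apply/eqP; apply: contraT => b0.
  have [d [[i bi si] hb]] := top_size b0; have [e [[j vj sj] hv]] := top_size v0.
  have hs l : l \in parts (N - N0 + N0) -> size l = (d + e)%N ->
     \sum_(w <- parts (N - N0)) \sum_(x <- parts N0) vecf b w * a x * (l == psort (w ++ x))%:R = 0.
    rewrite subnK // => lN sl; have [k lk] := part_surj lN.
    have := congr1 (fun M : 'rV[F]_ _ => M 0 k) bY; rewrite !mxE => e1; rewrite -[RHS]e1 sum_parts.
    apply: eq_bigr => w _; rewrite mxE mulr_sumr vecf_part; apply: eq_big_seq => x xN.
    rewrite mulrA lk; have [q qx] := part_surj xN.
    have [lt|ge] := ltnP d (size (part w)); first by rewrite hb // !mul0r.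
    have [lt|ge'] := ltnP e (size x); first by rewrite -qx /a vecf_part hv ?qx // mulr0 !mul0r.
    have [p0 ps] := cat0 w x xN; have [_ h2] := hC _ p0; rewrite h2 ?ps //.
    by rewrite sl size_cat leq_add.
  have hb' w : w \in parts (N - N0) -> (d < size w)%N -> vecf b w = 0.
    by move=> /part_surj[q <-] lt; rewrite vecf_part hb.
  have hv' w : w \in parts N0 -> (e < size w)%N -> a w = 0.
    by move=> /part_surj[q <-] lt; rewrite /a vecf_part hv.
  case: (lead_product (leq_subr N0 N) le hs hb' hv') => z.
    by rewrite -(vecf_part b) z ?part_mem ?eqxx in bi.
  by rewrite -(vecf_part v) -/a z ?part_mem ?eqxx in vj.
by rewrite addnC -rY -[X in (_ + X)%N]mxrank_tr mulmx0_rank_max.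
Qed.
End Corank.

Section FockLevels.
Variables (F : numFieldType) (V : lmodType F) (l gam mu : F) (b : int -> {linear V -> V}) (om : V).
Hypotheses (l0 : l != 0) (btr : truncated b).
Hypothesis bb : forall m n v, b m (b n v) - b n (b m v) = (if m + n == 0 then m%:~R * l else 0) *: v.
Hypothesis b0 : forall v, b 0 v = mu *: v.
Hypothesis bom : forall n : nat, b n.+1 om = 0.
Let L := virL l gam btr.

Definition bw (w : seq nat) : V := foldr (fun m => b (- m%:Z)) om w.

Definition lev n x := exists a : seq nat -> F, x = \sum_(w <- parts n) a w *: bw w.

Lemma lev0 n : lev n 0.
Proof. by exists (fun=> 0); rewrite big1 // => w _; rewrite scale0r. Qed.

Lemma lev_lin n a x y : lev n x -> lev n y -> lev n (a *: x + y).
Proof.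
move=> [c ->] [d ->]; exists (fun w => a * c w + d w).
by rewrite scaler_sumr -big_split; apply: eq_bigr => w _; rewrite /= scalerDl scalerA.
Qed.

Lemma lev_scale n a x : lev n x -> lev n (a *: x).
Proof. by move=> hx; rewrite -[a *: x]addr0; apply: lev_lin => //; exact: lev0. Qed.

Lemma lev_sum n (I : eqType) (s : seq I) (x : I -> V) : (forall i, i \in s -> lev n (x i)) -> lev n (\sum_(i <- s) x i).
Proof.
elim: s => [|i s IH] h; first by rewrite big_nil; exact: lev0.
rewrite big_cons -[x i]scale1r; apply: lev_lin; first by apply: h; rewrite mem_head.
by apply: IH => j js; apply: h; rewrite inE js orbT.
Qed.

Lemma bw_perm w w' : perm_eq w w' -> bw w = bw w'.
Proof.
move=> pw; have := @good_perm nat (fun z => size z = size w -> bw w = bw z) _ [::] w w'.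
apply=> // [w1 x y w2 _ h sz|z lt e|]; last by rewrite (perm_size pw).
- rewrite h; last by rewrite -sz !size_cat.
  rewrite /bw !foldr_cat /=; congr foldr; have := bb (- x%:Z) (- y%:Z) (bw w2).
  rewrite (_ : (if _ then _ else _) = 0) ?scale0r; last first.
    case: eqP => // e; have -> : x = 0%N by lia.
    by rewrite oppr0 mul0r.
  by move/eqP; rewrite subr_eq0 => /eqP.
- by move: lt; rewrite e ltnn.
Qed.

Lemma lev_bw w : all (ltn 0%N) w -> lev (sumn w) (bw w).
Proof.
move=> w0; exists (fun v => (v == psort w)%:R).
rewrite (bigD1_seq (psort w)) ?parts_uniq ?psort_parts //= eqxx scale1r big1 ?addr0 => [|v /negPf ->].
  by apply: bw_perm; rewrite perm_sym perm_psort.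
by rewrite scale0r.
Qed.

Lemma lev_b n m x : (0 < m)%N -> lev n x -> lev (m + n) (b (- m%:Z) x).
Proof.
move=> m0 [a ->]; rewrite linear_sum; apply: lev_sum => w wn; rewrite linearZ; apply: lev_scale.
rewrite -(parts_sum wn); apply: (@lev_bw (m :: w)); rewrite /= m0; exact: parts_pos wn.
Qed.

Lemma lev_L n m x : lev n x -> lev (m.+1 + n) (L (- m.+1%:Z) x).
Proof.
move=> [a ->]; rewrite linear_sum; apply: lev_sum => w wn; rewrite linearZ; apply: lev_scale.
rewrite -(parts_sum wn); move: (parts_pos wn) => {wn}; elim: w => [_|p w IH].
  rewrite addn0 /= /L (virL_neg _ l0 _ bom).
  apply: lev_lin; last first.
    by apply: lev_scale; have := @lev_bw [:: m.+1]; rewrite /= addn0; apply.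
  apply: lev_sum => i _; have lt := ltn_ord i.
  have [->|i0] := posnP i; first by rewrite oppr0 b0 subn0; apply: lev_scale; have := @lev_bw [:: m.+1]; rewrite /= addn0; apply.
  have [e|ne] := eqVneq (nat_of_ord i) m.+1.
    by rewrite e subnn oppr0 b0 linearZ; apply: lev_scale; have := @lev_bw [:: m.+1]; rewrite /= addn0; apply.
  have := @lev_bw [:: nat_of_ord i; (m.+1 - i)%N]; rewrite /= addn0 subnKC; last by lia.
  by apply; rewrite i0 /=; lia.
move=> /= /andP[p0 w0]; have := virL_b gam l0 btr bb (- m.+1%:Z) (- p%:Z) (bw w).
have -> : (- m.+1%:Z + - p%:Z == 0) = false by lia.
rewrite scale0r subr0 -/L => /(canRL (subrK _)) ->.
apply: lev_lin.
  by rewrite -opprD -PoszD addnA; apply: (@lev_bw ((m.+1 + p)%N :: w)).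
by rewrite addnCA; apply: lev_b => //; apply: IH.
Qed.

Lemma lev_lw w : all (ltn 0%N) w -> lev (sumn w) (lw L w om).
Proof.
elim: w => [_|[//|m] w IH] /=; first exact: (@lev_bw [::]).
by move=> w0; apply: lev_L; apply: IH.
Qed.

Lemma lev_theta r (lf : {mpoly F[r]} -> F) n g : lev n (theta b om lf n g).
Proof.
elim/ltn_ind: n g => -[|n] IH g; first by rewrite theta0; apply: lev_scale; exact: (@lev_bw [::]).
rewrite -[theta _ _ _ _ _]scale1r -(@mulVf _ n.+1%:R) ?pnatr_eq0 // -scalerA thetaS.
apply: lev_scale; apply: lev_sum => i _; have lt := ltn_ord i.
have -> : lev n.+1 = lev (i.+1 + (n - i)) by congr lev; lia.
by apply: lev_b => //; apply: IH; lia.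
Qed.

Variable f : {scalar V}.
Hypothesis fom : f om = 1.
Hypothesis fb : forall (n : nat) x, f (b (- n.+1%:Z) x) = 0.
Let c := 1 - 12%:R * l * gam ^+ 2.
Let h := mu ^+ 2 / (2%:R * l) - gam * mu.

(** It is not assumed that x is a combination of L-words. The Gram matrix factors through the matrix
    [Q] of L-words against oscillator words, square since both are indexed by the partitions of N;
    the oscillator coordinates of x lie in the kernel of [Q]. *)
Lemma det_gram_singular N x : (0 < N)%N -> lev N x -> x != 0 -> (forall n : nat, L n.+1 x = 0) ->
  \det (gram (c / 2%:R) h N) = 0.
Proof.
move=> N0 [t xE] x0 Lx.
have [P hP] : exists P : 'M[F]_(size (parts N)), forall i, lw L (part i) om = \sum_j P i j *: bw (part j).
  have /choice[P hP] : forall i : 'I_(size (parts N)), exists p : seq nat -> F,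
      lw L (part i) om = \sum_(w <- parts N) p w *: bw w.
    move=> i; have [p] := lev_lw (parts_pos (part_mem i)).
    by rewrite (parts_sum (part_mem i)) => hp; exists p.
  by exists (\matrix_(i, j) P i (part j)) => i; rewrite hP sum_parts; apply: eq_bigr => j _; rewrite mxE.
pose Q : 'M[F]_(size (parts N)) := \matrix_(u, j) f (zw L [seq m%:Z | m <- rev (part u)] (bw (part j))).
have -> : gram (c / 2%:R) h N = Q *m P^T.
  apply/matrixP => u i; rewrite !mxE.
  have := lw_brk (virL_vir gam l0 btr bb) (virL_om l gam btr bom) (virL0_om l gam btr b0 bom).
  move=> /(_ f _ _ fom (f_virL gam l0 btr bb b0 fb) (parts_pos (part_mem u)) (parts_pos (part_mem i))) <-.
  rewrite -zw_pos -/L hP zw_sum linear_sum; apply: eq_bigr => j _.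
  by rewrite linearZ /= !mxE mulrC.
rewrite det_mulmx; suff -> : \det Q = 0 by rewrite mul0r.
apply/eqP; rewrite -det_tr; apply/det0P.
exists (\row_j t (part j)).
  apply: contra_neq x0 => z; rewrite xE sum_parts big1 // => j _.
  by have := congr1 (fun M : 'rV[F]_ _ => M 0 j) z; rewrite !mxE => ->; rewrite scale0r.
apply/rowP => u; rewrite !mxE.
transitivity (f (zw L [seq m%:Z | m <- rev (part u)] x)).
  rewrite xE sum_parts zw_sum linear_sum; apply: eq_bigr => j _.
  by rewrite linearZ /= !mxE.
have := parts_pos (part_mem u); have := parts_sum (part_mem u).
case: (part u) => [|n w] /=; first by lia.
move=> _ /andP[n0 _]; rewrite rev_cons map_rcons -cats1 zw_cat /=.
by rewrite -[n]prednK // Lx zw0 linear0.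
Qed.

End FockLevels.

Section KacSingular.
Variables (F : numClosedFieldType) (k r s : nat).
Hypotheses (k0 : (0 < k)%N) (r0 : (0 < r)%N) (s0 : (0 < s)%N).

Definition ck : F := 1 - 6%:R * (k%:R - 1) ^+ 2 / k%:R.
(** The Kac weight h_{r,s} at the central charge 13 - 6 k - 6 / k. *)
Definition hk : F := ((k * r)%:R - s%:R) ^+ 2 / (4 * k)%:R - (k%:R - 1) ^+ 2 / (4 * k)%:R.

Lemma kac_corank N : (r * s <= N)%N ->
  (\rank (gram (ck / 2%:R) hk N) + size (parts (N - r * s)) <= size (parts N))%N.
Proof.
pose l : F := (2 * k)%:R; pose mu : F := (k * r.+1)%:R - s.+1%:R; pose gam : F := (k%:R - 1) / l.
have kF : k%:R != 0 :> F by rewrite pnatr_eq0 -lt0n.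
have l0 : l != 0 by rewrite pnatr_eq0; lia.
have [b [f [om [[btr bb b0] [bom fom fb]]]]] := fock_exists l mu.
have om0 : om != 0 by apply: contra_eq_neq fom => ->; rewrite linear0 eq_sym oner_eq0.
have ckE : ck = 1 - 12%:R * l * gam ^+ 2 by rewrite /ck /gam /l natrM; field.
have hkE : hk = mu ^+ 2 / (2%:R * l) - gam * mu.
  rewrite /hk /mu /gam /l !natrM.
  have -> : r.+1%:R = r%:R + 1 :> F by rewrite -natr1.
  have -> : s.+1%:R = s%:R + 1 :> F by rewrite -natr1.
  by field.
move=> le; rewrite ckE hkE.
apply: (corank_gram (virL_vir gam l0 btr bb) (virL_om l gam btr bom) (virL0_om l gam btr b0 bom) fom
  (f_virL gam l0 btr bb b0 fb) (f_virL0 l gam btr b0 fb) le).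
apply: (@det_gram_singular _ _ _ gam _ _ _ l0 btr bb b0 bom f fom fb _ (theta b om (ell k s) (r * s) (1 : {mpoly F[r]}))).
- by rewrite muln_gt0 r0.
- exact: (lev_theta om l0 bb).
- exact: theta_neq0.
by move=> n; apply: theta_singular.
Qed.

End KacSingular.

(** * The Kac determinant *)

Lemma gram_morph (A B : comNzRingType) (f : {rmorphism A -> B}) k h N :
  map_mx f (gram k h N) = gram (f k) (f h) N.
Proof. by apply/matrixP => i j; rewrite !mxE brk_morph. Qed.

(** After a constant invertible row operation, the rows beyond the rank vanish at [a], so each of
    them is divisible by X - a. *)
Lemma dvdp_det_corank (K : fieldType) n (M : 'M[{poly K}]_n) a d :
  (\rank (map_mx (horner_eval a) M) + d <= n)%N -> ('X - a%:P) ^+ d %| \det M.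
Proof.
set A := map_mx _ M => le; set r := \rank A.
pose Z := map_mx polyC (invmx (col_ebase A)); pose B := Z *m M.
have uZ : \det Z = (\det (invmx (col_ebase A)))%:P by rewrite /Z det_map_mx.
have dz : \det (invmx (col_ebase A)) != 0.
  by rewrite -unitfE -unitmxE unitmx_inv col_ebase_unit.
have rowB (i j : 'I_n) : (r <= i)%N -> ('X - a%:P) %| B i j.
  move=> ri; rewrite dvdp_XsubCl; apply/rootP.
  have -> : (B i j).[a] = (map_mx (horner_eval a) B) i j by rewrite [RHS]mxE.
  rewrite /B map_mxM /Z -map_mx_comp.
  have -> : map_mx (horner_eval a \o polyC) (invmx (col_ebase A)) = invmx (col_ebase A).
    by apply/matrixP => x y; rewrite !mxE /= /horner_eval hornerC.
  rewrite -/A -{2}[A]mulmx_ebase -!mulmxA mulKmx ?col_ebase_unit // mxE big1 // => x _.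
  by rewrite mxE ltnNge ri /= andbF mul0r.
have : ('X - a%:P) ^+ d %| \det B.
  rewrite /determinant; apply: (big_ind (fun p => _ %| p)) => [|p q|s _]; [exact: dvdp0|exact: dvdp_add|].
  apply: dvdp_mull.
  rewrite (bigID (fun i : 'I_n => (r <= i)%N)) /=; apply: dvdp_mulr.
  have : ('X - a%:P) ^+ #|[pred i : 'I_n | (r <= i)%N]| %| \prod_(i < n | (r <= i)%N) B i (s i).
    rewrite -prodr_const; elim/big_rec2: _ => [|i p q ri]; first by rewrite dvdpp.
    by apply: dvdp_mul; exact: rowB.
  apply: dvdp_trans; apply: dvdp_exp2l.
  have -> : #|[pred i : 'I_n | (r <= i)%N]| = (n - r)%N.
    rewrite -sum1_card -(big_mkord (fun i => r <= i)%N (fun=> 1%N)) (big_cat_nat (n := r)) //=; last by lia.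
    rewrite [X in (X + _)%N]big_nat_cond big_pred0 ?add0n => [|i]; last by case: ltnP; rewrite ?andbF.
    rewrite big_nat_cond (eq_bigl (fun i => (r <= i < n)%N && true)) => [|i]; last by case: (r <= i)%N; rewrite ?andbF ?andbT.
    by rewrite -big_nat_cond sum_nat_const_nat muln1.
  by lia.
by rewrite /B det_mulmx uZ mul_polyC dvdpZr.
Qed.

Lemma dvdp_prod_XsubC (K : fieldType) (I : finType) (a : I -> K) (m : I -> nat) (p : {poly K}) :
  {in [pred i | m i != 0%N] &, injective a} -> (forall i, ('X - (a i)%:P) ^+ m i %| p) ->
  \prod_i ('X - (a i)%:P) ^+ m i %| p.
Proof.
move=> inj dv; have := index_enum_uniq I.
elim: (index_enum I) => [|i s IH] /=; first by rewrite big_nil dvd1p.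
case/andP=> ns us; rewrite big_cons.
have [mi|mi] := eqVneq (m i) 0%N; first by rewrite mi expr0 mul1r IH.
rewrite Gauss_dvdp ?dv ?IH // big_seq; apply: (big_ind (coprimep _)) => [|p1 p2|j js].
- exact: coprimep1.
- by rewrite coprimepMr => -> ->.
have [mj|mj] := eqVneq (m j) 0%N; first by rewrite mj expr0 coprimep1.
apply: coprimep_expl; apply: coprimep_expr; rewrite coprimep_XsubC root_XsubC.
by apply: contra ns => /eqP e; rewrite (inj i j) ?inE.
Qed.

Section KacDet.
Variable R : rcfType.
Implicit Types (k r s N : nat) (c : R).

Definition ckR k : R := 1 - 6%:R * (k%:R - 1) ^+ 2 / k%:R.
Definition hkR k r s : R := ((k * r)%:R - s%:R) ^+ 2 / (4 * k)%:R - (k%:R - 1) ^+ 2 / (4 * k)%:R.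
Definition mult N r s : nat := if (r * s <= N)%N then size (parts (N - r * s)) else 0.

Definition gdet (c : R) N : {poly R} := \det (gram ((c / 2%:R)%:P) 'X N).

Lemma gdet_size c N : size (gdet c N) = (\sum_(i < N) \sum_(j < N) mult N i.+1 j.+1).+1
  /\ 0 < lead_coef (gdet c N).
Proof.
have -> : (\sum_(i < N) \sum_(j < N) mult N i.+1 j.+1 = \sum_(i < size (parts N)) size (part i))%N.
  rewrite -(@sum_parts nat N (fun w => size w)) sum_size_parts; apply: eq_bigr => i _.
  by rewrite [RHS]big_mkcond.
apply: det_top => [i j|i j lij ne|i]; rewrite mxE.
- by apply: brk_size; exact: parts_pos (part_mem _).
- have [_ h] := brk_top (c / 2%:R) (parts_pos (part_mem i)) (parts_pos (part_mem j)) lij.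
  rewrite lij h //; apply: contra ne => pe; apply/eqP; apply: part_inj.
  exact: parts_perm_eq (part_mem i) (part_mem j) pe.
by have [h _] := brk_top (c / 2%:R) (parts_pos (part_mem i)) (parts_pos (part_mem i)) erefl; apply: h.
Qed.

Lemma gdet_dvd k r s N : (0 < k)%N -> (0 < r)%N -> (0 < s)%N -> ('X - (hkR k r s)%:P) ^+ mult N r s %| gdet (ckR k) N.
Proof.
move=> k0 r0 s0; rewrite /mult; case: ifP => [le|_]; last by rewrite expr0 dvd1p.
apply: dvdp_det_corank; rewrite gram_morph /=.
have -> : horner_eval (hkR k r s) (ckR k / 2%:R)%:P = ckR k / 2%:R by rewrite /horner_eval hornerC.
have -> : horner_eval (hkR k r s) 'X = hkR k r s by rewrite /horner_eval hornerX.
(* The Fock space needs a square root of - l, so the corank is found over the complex extension;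
   ranks do not change under field extension. *)
have := @kac_corank (R[i] : numClosedFieldType) k r s k0 r0 s0 N le.
have -> : ck R[i] k / 2%:R = real_complex R (ckR k / 2%:R).
  by rewrite fmorph_div rmorphB fmorph_div rmorphM rmorphXn rmorphB /= !rmorph_nat rmorph1.
have -> : hk R[i] k r s = real_complex R (hkR k r s).
  by rewrite rmorphB !fmorph_div !rmorphXn !rmorphB /= !rmorph_nat rmorph1.
by rewrite -gram_morph mxrank_map.
Qed.

Lemma hkR_inj N k r s r' s' : (2 * N < k)%N -> (0 < r)%N -> (0 < s)%N -> (0 < r')%N -> (0 < s')%N ->
  (r * s <= N)%N -> (r' * s' <= N)%N -> hkR k r s = hkR k r' s' -> (r, s) = (r', s').
Proof.
move=> lk r0 s0 r0' s0' le le' /addIr /(mulIf _) e.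
have k0 : (4 * k)%:R^-1 != 0 :> R by rewrite invr_eq0 pnatr_eq0; lia.
have {}e := e k0; have sN : (s <= N)%N by apply: leq_trans le; rewrite leq_pmull.
have sN' : (s' <= N)%N by apply: leq_trans le'; rewrite leq_pmull.
have /eqP : ((k * r)%:Z - s%:Z) ^+ 2 = ((k * r')%:Z - s'%:Z) ^+ 2.
  apply: (@intr_inj R); rewrite !rmorphXn !rmorphB /=; exact: e.
(* Both k r - s and k r' - s' are positive since s, s' <= N < k, which excludes opposite signs; then
   |s - s'| < k forces r = r'. *)
rewrite eqf_sqr => /orP[] /eqP e'; last by exfalso; nia.
have rr : r = r' by nia.
by rewrite rr in e' *; congr (_, _); lia.
Qed.

Lemma gdet_ck k N : (2 * N < k)%N -> gdet (ckR k) N = lead_coef (gdet (ckR k) N) *: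
  \prod_(x : 'I_N * 'I_N) ('X - (hkR k x.1.+1 x.2.+1)%:P) ^+ mult N x.1.+1 x.2.+1.
Proof.
move=> lk; set D := gdet _ _; set Q := \prod_x _.
have dv : Q %| D.
  apply: dvdp_prod_XsubC => [x y|x]; last by apply: gdet_dvd => //; lia.
  rewrite !inE /mult; case: ifP => // le1 _; case: ifP => // le2 _ e.
  case: x y e le1 le2 => [a b] [a' b'] /= e le1 le2.
  have [ea eb] := hkR_inj lk (ltn0Sn a) (ltn0Sn b) (ltn0Sn a') (ltn0Sn b') le1 le2 e.
  by congr (_, _); apply: val_inj.
have mQ : Q \is monic by apply: monic_prod => x _; rewrite monic_exp // monicXsubC.
have [sD _] := gdet_size (ckR k) N.
have sQ : size Q = size D.
  rewrite sD -/D /Q size_prod => [|x _]; last by rewrite monic_neq0 // monic_exp // monicXsubC.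
  under eq_bigr do rewrite size_exp_XsubC -add1n.
  rewrite big_split /= sum1_card -(pair_bigA _ (fun i j : 'I_N => mult N i.+1 j.+1)) /= subSn ?leq_addr //; congr (_.+1).
  by rewrite [X in (X + _)%N](_ : _ = #|{: 'I_N * 'I_N}|) // addKn.
have /dvdpP[p pE] := dv; have Q0 : Q != 0 by rewrite monic_neq0.
have D0 : D != 0 by rewrite -size_poly_eq0 sD.
have p0 : p != 0 by apply: contra_neq D0 => z; rewrite pE z mul0r.
have sp : size p = 1%N.
  have := size_mul p0 Q0; rewrite -pE sQ => e.
  have sp0 : (0 < size p)%N by rewrite size_poly_gt0.
  have : (0 < size D)%N by rewrite size_poly_gt0.
  move: (size p) (size D) e sp0 => x y e; lia.
have /size_poly1P[a a0 pa] : size p == 1%N by rewrite sp.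
by rewrite pE pa mul_polyC lead_coefZ (monicP mQ) mulr1.
Qed.

(** For r = s this is h - h_{r,r}, otherwise (h - h_{r,s}) (h - h_{s,r}). Both are invariant under k
    -> 1 / k, hence polynomial in T = k + 1 / k = (13 - c) / 6. The argument q stands for 1/4, so
    that the formula makes sense over polynomial rings. *)
Definition kfac (A : comNzRingType) (q T h : A) r s : A :=
  if r == s then h - q * (r%:R ^+ 2 - 1) * (T - 2%:R)
  else h ^+ 2 - (q * ((r%:R ^+ 2 + s%:R ^+ 2 - 2%:R) * T) - (r%:R * s%:R - 1)) * h
    + q ^+ 2 * ((r%:R ^+ 2 - 1) * (s%:R ^+ 2 - 1) * T ^+ 2 + (r%:R ^+ 2 - s%:R ^+ 2) ^+ 2
      - 2%:R * (r%:R * s%:R - 1) * (r%:R ^+ 2 + s%:R ^+ 2 - 2%:R) * T + (2%:R * (r%:R * s%:R - 1)) ^+ 2).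

Definition kacprod (A : comNzRingType) N (q T h : A) : A :=
  \prod_(x : 'I_N * 'I_N | (x.1 <= x.2)%N) kfac q T h x.1.+1 x.2.+1 ^+ mult N x.1.+1 x.2.+1.

Lemma kfac_morph (A B : comNzRingType) (f : {rmorphism A -> B}) (q T h : A) r s :
  kfac (f q) (f T) (f h) r s = f (kfac q T h r s).
Proof.
by rewrite /kfac; case: ifP => _;
  rewrite !(rmorphB, rmorphD, rmorphM, rmorphXn, rmorph_nat, rmorph1).
Qed.

Lemma kacprod_morph (A B : comNzRingType) (f : {rmorphism A -> B}) N (q T h : A) :
  kacprod N (f q) (f T) (f h) = f (kacprod N q T h).
Proof. by rewrite /kacprod rmorph_prod; apply: eq_bigr => x _; rewrite kfac_morph rmorphXn. Qed.

Definition Tc c : R := (13%:R - c) / 6%:R.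

Lemma kacprod_ck k N (h : R) : (0 < k)%N -> kacprod N 4%:R^-1 (Tc (ckR k)) h =
  \prod_(x : 'I_N * 'I_N) (h - hkR k x.1.+1 x.2.+1) ^+ mult N x.1.+1 x.2.+1.
Proof.
move=> k0; have kR : k%:R != 0 :> R by rewrite pnatr_eq0 -lt0n.
have diag r : kfac 4%:R^-1 (Tc (ckR k)) h r r = h - hkR k r r.
  by rewrite /kfac eqxx /Tc /ckR /hkR !natrM; field.
have off r s : r != s -> kfac 4%:R^-1 (Tc (ckR k)) h r s = (h - hkR k r s) * (h - hkR k s r).
  by rewrite /kfac => /negPf ->; rewrite /Tc /ckR /hkR !natrM; field.
rewrite [RHS](bigID (fun x : 'I_N * 'I_N => (x.1 <= x.2)%N)) /=.
rewrite [X in _ = _ * X](reindex_inj (h := fun x : 'I_N * 'I_N => (x.2, x.1))) /=; last first.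
  by move=> [a b] [c d] [-> ->].
rewrite [X in _ = _ * X](eq_bigl (fun x : 'I_N * 'I_N => (x.1 <= x.2)%N && (x.1 != x.2))); last first.
  by move=> x; rewrite -ltnNge ltn_neqAle andbC -val_eqE.
rewrite [X in _ = _ * X]big_mkcondr -big_split; apply: eq_bigr => x _ /=.
case: eqP => [e|/eqP ne] /=; first by rewrite e diag mulr1.
rewrite off; last by rewrite eqSS val_eqE.
by rewrite exprMn; congr (_ * _ ^+ _); rewrite /mult mulnC.
Qed.

Lemma ckR_inj k k' : (1 < k)%N -> (1 < k')%N -> ckR k = ckR k' -> k = k'.
Proof.
move=> k0 k0' e; have kR : k%:R != 0 :> R by rewrite pnatr_eq0; lia.
have kR' : k'%:R != 0 :> R by rewrite pnatr_eq0; lia.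
have : 6%:R * (k%:R - k'%:R) * (k%:R * k'%:R - 1) / (k%:R * k'%:R) = 0 :> R.
  by rewrite -[RHS](subrr (ckR k')) -{2}e /ckR; field; rewrite kR kR'.
move/eqP; rewrite !mulf_eq0 pnatr_eq0 /= invr_eq0 mulf_eq0 (negPf kR) (negPf kR') !orbF.
rewrite !subr_eq0 eqr_nat -natrM -[1]/(1%:R) eqr_nat => /orP[/eqP //|/eqP]; nia.
Qed.

Lemma poly_ck_eq n (p p' : {poly R}) : (forall k, (n < k)%N -> p.[ckR k] = p'.[ckR k]) -> p = p'.
Proof.
move=> h; apply/eqP; rewrite -subr_eq0; apply/eqP.
apply: (@roots_geq_poly_eq0 _ _ [seq ckR (k + n.+2) | k <- iota 0 (size (p - p'))]).
- by apply/allP => x /mapP[k _ ->]; rewrite /root hornerD hornerN h ?subrr ?eqxx //; lia.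
- rewrite map_inj_uniq ?iota_uniq // => k k' /ckR_inj e; have := e _ _; lia.
by rewrite size_map size_iota.
Qed.

(** [K] is the coefficient of the highest power of h in the determinant over R[c][h]. For each c it
    is the leading coefficient of [gdet], hence positive. Both sides are polynomials in c that agree
    at the central charges with k > 2 N. *)
Theorem kac_det N : exists2 K : {poly R}, (forall c, 0 < K.[c]) &
  forall c h, \det (gram (c / 2%:R) h N) = K.[c] * kacprod N 4%:R^-1 (Tc c) h.
Proof.
pose D : {poly {poly R}} := \det (gram (2%:R^-1 *: 'X : {poly R})%:P 'X N).
pose W := (\sum_(i < N) \sum_(j < N) mult N i.+1 j.+1)%N.
have DE c : map_poly (horner_eval c) D = gdet c N.
  rewrite /D /gdet -det_map_mx gram_morph /= map_polyC map_polyX /=.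
  by rewrite /horner_eval hornerZ hornerX mulrC.
have lc c : lead_coef (gdet c N) = (D`_W).[c].
  by have [sz _] := gdet_size c N; rewrite lead_coefE sz -DE coef_map.
exists D`_W => c; first by rewrite -lc; have [] := gdet_size c N.
move=> h; have gE a : \det (gram (a / 2%:R) h N) = (gdet a N).[h].
  rewrite /gdet -[_.[h]]/(horner_eval h _) -det_map_mx gram_morph /=.
  by rewrite /horner_eval hornerC hornerX.
pose p : {poly R} := \det (gram (2%:R^-1 *: 'X : {poly R}) h%:P N).
pose p' : {poly R} := D`_W * kacprod N (4%:R^-1)%:P (6%:R^-1 *: (13%:R%:P - 'X)) h%:P.
have pE a : p.[a] = \det (gram (a / 2%:R) h N).
  rewrite -[_.[a]]/(horner_eval a _) -det_map_mx gram_morph /=.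
  by rewrite /horner_eval hornerC hornerZ hornerX mulrC.
have pE' a : p'.[a] = (D`_W).[a] * kacprod N 4%:R^-1 (Tc a) h.
  rewrite hornerM; congr (_ * _); rewrite -[_.[a]]/(horner_eval a _) -kacprod_morph /=.
  by rewrite /horner_eval !hornerE /Tc mulrC.
rewrite -pE -pE'; congr _.[c]; apply: (@poly_ck_eq (2 * N)) => k lk.
rewrite pE pE' gE (gdet_ck lk) lc hornerZ kacprod_ck; last by lia.
congr (_ * _); rewrite horner_prod; apply: eq_bigr => x _.
by rewrite horner_exp hornerXsubC.
Qed.

End KacDet.

(** * Positive semidefinite matrices *)

Section Psd.
Variable R : rcfType.
Implicit Types (n : nat).

Definition qf n (M : 'M[R]_n) (v : 'rV[R]_n) : R := (v *m M *m v^T) 0 0.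
Definition psd n (M : 'M[R]_n) := forall v, 0 <= qf M v.
Definition pd n (M : 'M[R]_n) := forall v, v != 0 -> 0 < qf M v.

Lemma pd_psd n (M : 'M[R]_n) : pd M -> psd M.
Proof.
move=> h v; have [->|/h/ltW //] := eqVneq v 0.
by rewrite /qf !mul0mx mxE.
Qed.

Lemma qfE n (M : 'M[R]_n) v : qf M v = \sum_i \sum_j v 0 i * v 0 j * M i j.
Proof.
rewrite /qf mxE exchange_big; apply: eq_bigr => j _.
by rewrite !mxE mulr_suml; apply: eq_bigr => i _; ring.
Qed.

Lemma q11 (t a : 'M[R]_1) : (a *m t *m a^T) 0 0 = t 0 0 * a 0 0 ^+ 2.
Proof. by rewrite mxE big_ord1 mxE big_ord1 mxE; ring. Qed.

Lemma qf_dr n (M : 'M[R]_(1 + n)) w : qf M (row_mx 0 w) = qf (drsubmx M) w.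
Proof.
rewrite /qf -{1}[M]submxK mul_row_block !mul0mx !add0r tr_row_mx mul_row_col trmx0 mulmx0 add0r.
by [].
Qed.

(** The Schur complement [t] of the lower right block, as a congruence of the matrix with a block
    diagonal one. *)
Lemma block_factor n (M : 'M[R]_(1 + n)) (D := drsubmx M) (u := ursubmx M *m invmx D)
    (t := ulsubmx M - u *m dlsubmx M) : M^T = M -> D \in unitmx ->
  M = block_mx 1%:M u 0 1%:M *m block_mx t 0 0 D *m (block_mx 1%:M u 0 1%:M)^T.
Proof.
move=> sM uD; have tb : (ursubmx M)^T = dlsubmx M by rewrite trmx_ursub sM.
have tD : D^T = D by rewrite /D trmx_drsub sM.
have tu : u^T = invmx D *m dlsubmx M by rewrite /u trmx_mul tb trmx_inv tD.
rewrite tr_block_mx !mulmx_block !(mul1mx, mul0mx, mulmx0, mulmx1, trmx1, trmx0, addr0, add0r) tu.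
rewrite (mulKVmx uD).
rewrite (_ : u *m D *m (invmx D *m dlsubmx M) = u *m dlsubmx M); last by rewrite -mulmxA mulKVmx.
by rewrite subrK /u mulmxKV // -[LHS]submxK.
Qed.

Lemma det_block_factor n (M : 'M[R]_(1 + n)) (D := drsubmx M) (u := ursubmx M *m invmx D)
    (t := ulsubmx M - u *m dlsubmx M) : M^T = M -> D \in unitmx -> \det M = t 0 0 * \det D.
Proof.
move=> sM uD; rewrite {1}(block_factor sM uD) !det_mulmx det_tr.
by rewrite det_ublock det_ublock !det1 !mul1r !mulr1 det_mx11.
Qed.

Lemma qf_block_factor n (M : 'M[R]_(1 + n)) (D := drsubmx M) (u := ursubmx M *m invmx D)
    (t := ulsubmx M - u *m dlsubmx M) (a : 'rV_1) (w : 'rV_n) : M^T = M -> D \in unitmx ->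
  qf M (row_mx a w) = t 0 0 * a 0 0 ^+ 2 + qf D (a *m u + w).
Proof.
move=> sM uD; rewrite /qf {1}(block_factor sM uD) !mulmxA -mulmxA -trmx_mul.
rewrite mul_row_block mulmx0 addr0 !mulmx1 mul_row_block !mulmx0 addr0 add0r tr_row_mx mul_row_col mxE.
by rewrite q11 !mulmxA.
Qed.

Fixpoint minors (A : comNzRingType) n : 'M[A]_n -> seq A :=
  if n is n'.+1 then fun M => \det M :: minors (drsubmx (M : 'M_(1 + n'))) else fun=> [::].

Lemma minors_map (A B : comNzRingType) (f : {rmorphism A -> B}) n (M : 'M[A]_n) :
  minors (map_mx f M) = map f (minors M).
Proof. by elim: n M => //= n IH M; rewrite det_map_mx -map_drsubmx IH. Qed.

(** Sylvester's criterion: the Schur complement is the quotient of two consecutive trailing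
    minors. *)
Lemma minors_pd n (M : 'M[R]_n) : M^T = M -> all (fun x => 0 < x) (minors M) -> pd M.
Proof.
elim: n M => [|n IH] M sM /=; first by move=> _ v; rewrite [v]thinmx0 eqxx.
case/andP=> d0 ms; have sD : (drsubmx (M : 'M_(1 + n)))^T = drsubmx (M : 'M_(1 + n)) by rewrite trmx_drsub sM.
have pD := IH _ sD ms.
have uD : drsubmx (M : 'M_(1 + n)) \in unitmx.
  rewrite unitmxE unitfE gt_eqF //; case: (n) (drsubmx (M : 'M_(1 + n))) ms => [|n'] D; last by case/andP.
  by rewrite det_mx00 ltr01.
have dD : 0 < \det (drsubmx (M : 'M_(1 + n))).
  case: (n) (drsubmx (M : 'M_(1 + n))) ms => [|n'] D; last by case/andP.
  by rewrite det_mx00 ltr01.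
move: d0; rewrite (det_block_factor sM uD) pmulr_lgt0 // => t0 v v0.
rewrite -[v](hsubmxK (v : 'rV_(1 + n))) qf_block_factor //.
set a := lsubmx _; set w := rsubmx _.
have [a0|a0] := eqVneq (a 0 0) 0.
  have az : a = 0 by apply/matrixP => i j; rewrite !ord1 a0 mxE.
  rewrite a0 expr0n mulr0 add0r az mul0mx add0r; apply: pD; rewrite -/w.
  by apply: contra_neq v0 => wz; rewrite -[v](hsubmxK (v : 'rV_(1 + n))) -/a -/w az wz row_mx0.
apply: ltr_pwDl; first by rewrite mulr_gt0 // exprn_even_gt0.
exact: pd_psd.
Qed.

Lemma pd_minors n (M : 'M[R]_n) : M^T = M -> pd M -> all (fun x => 0 < x) (minors M).
Proof.
elim: n M => [//|n IH] M sM pM /=.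
have sD : (drsubmx (M : 'M_(1 + n)))^T = drsubmx (M : 'M_(1 + n)) by rewrite trmx_drsub sM.
have pD : pd (drsubmx (M : 'M_(1 + n))).
  move=> w w0; have := pM (row_mx 0 w : 'rV_(1 + n)).
  rewrite (qf_dr (M : 'M_(1 + n))).
  apply; apply: contra_neq w0 => e; have := congr1 (fun x : 'rV_(1 + n) => rsubmx x) e; rewrite row_mxKr => ->.
  by apply/matrixP => i j; rewrite !mxE.
have ms := IH _ sD pD; rewrite ms andbT.
have dD : 0 < \det (drsubmx (M : 'M_(1 + n))).
  case: (n) (drsubmx (M : 'M_(1 + n))) ms => [|n'] D; last by case/andP.
  by rewrite det_mx00 ltr01.
have uD : drsubmx (M : 'M_(1 + n)) \in unitmx by rewrite unitmxE unitfE gt_eqF.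
rewrite (det_block_factor sM uD) pmulr_lgt0 //.
have := pM (row_mx 1%:M (- (ursubmx (M : 'M_(1 + n)) *m invmx (drsubmx (M : 'M_(1 + n)))))).
rewrite qf_block_factor // mul1mx subrr /qf !mul0mx [X in _ + X]mxE addr0 [1%:M 0 0]mxE eqxx expr1n mulr1; apply.
apply/eqP => e; have := congr1 (fun v : 'rV_(1 + n) => lsubmx v 0 0) e; rewrite row_mxKl !mxE => /eqP.
by rewrite oner_eq0.
Qed.

Lemma pd_det n (M : 'M[R]_n) : M^T = M -> pd M -> 0 < \det M.
Proof.
move=> sM /(pd_minors sM); case: n M sM => [|n] M sM; last by case/andP.
by rewrite det_mx00 ltr01.
Qed.

Lemma rv_sq0 n (v : 'rV[R]_n) : (v *m v^T) 0 0 = 0 -> v = 0.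
Proof.
move/eqP; rewrite mxE psumr_eq0 => [|i _]; last by rewrite mxE -expr2 sqr_ge0.
move/allP => h; apply/rowP => i; have := h i (mem_index_enum _).
by rewrite /= mxE -expr2 sqrf_eq0 => /eqP ->; rewrite mxE.
Qed.

(** An isotropic vector of a semidefinite form lies in its radical, which is 0 when the determinant
    is not. *)
Lemma psd_unit n (M : 'M[R]_n) : M^T = M -> psd M -> \det M != 0 -> pd M.
Proof.
move=> sM pM dM v v0; rewrite lt0r pM andbT; apply: contra_neq v0 => q0.
have qD (a : R) (x y : 'rV_n) : qf M (x + a *: y) = qf M x + a *+ 2 * (x *m M *m y^T) 0 0 + a ^+ 2 * qf M y.
  have c : (y *m M *m x^T) 0 0 = (x *m M *m y^T) 0 0.
    by rewrite -[RHS](mxE trmx_key (fun i j => (x *m M *m y^T) j i)) -/(trmx _) !trmx_mul trmxK sM mulmxA.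
  have -> : qf M (x + a *: y) = (x *m M *m x^T + a *: (x *m M *m y^T) + (a *: (y *m M *m x^T) + (a * a) *: (y *m M *m y^T))) 0 0.
    rewrite /qf linearD linearZ /= !mulmxDl !mulmxDr -!scalemxAl -!scalemxAr scalerA.
    by [].
  rewrite [LHS]mxE [X in X + _]mxE [X in _ + X]mxE [X in _ + X + _]mxE [X in _ + (X + _)]mxE.
  by rewrite [X in _ + (_ + X)]mxE c /qf; ring.
have B0 (y : 'rV_n) : (v *m M *m y^T) 0 0 = 0.
  set B := _ 0 0; apply/eqP/negPn/negP => B0; have q1 : 0 < qf M y + 1 by rewrite ltr_wpDl.
  (* The multiple of y makes the value negative if B is not 0; the 1 in the denominator avoids a
     case distinction on the vanishing of [qf M y]. *)
  have := pM (v + (- B / (qf M y + 1)) *: y); rewrite qD q0 add0r -/B.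
  have -> : - B / (qf M y + 1) *+ 2 * B + (- B / (qf M y + 1)) ^+ 2 * qf M y =
    - (B ^+ 2 * (qf M y + 2%:R) / (qf M y + 1) ^+ 2) by field; rewrite gt_eqF.
  rewrite oppr_ge0 leNgt divr_gt0 ?exprn_gt0 // mulr_gt0 ?exprn_even_gt0 //.
  by rewrite ltr_wpDl.
suff vM : v *m M = 0.
  by rewrite -[v]mulmx1 -(@mulmxV _ _ M) ?unitmxE ?unitfE // mulmxA vM mul0mx.
by apply: rv_sq0; rewrite B0.
Qed.

(** Continuity from the right through the intermediate value theorem, applied at half of a supposed
    negative value. *)
Lemma poly_ge0_right (p : {poly R}) a : (forall x, a < x -> 0 <= p.[x]) -> 0 <= p.[a].
Proof.
move=> h; rewrite leNgt; apply/negP => pa.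
have a1 : a <= a + 1 by rewrite lerDl.
have aS : a < a + 1 by rewrite ltrDl.
have e x : (p - (p.[a] / 2%:R)%:P).[x] = p.[x] - p.[a] / 2%:R by rewrite hornerD hornerN hornerC.
have [|x /andP[ax _] /eqP] := @Num.Theory.poly_ivt _ (p - (p.[a] / 2%:R)%:P) _ _ a1.
  by rewrite !e; have := h _ aS; lra.
rewrite e; have [->|ne] := eqVneq x a; first by lra.
have lax : a < x by rewrite lt_neqAle eq_sym ne.
by have := h x lax; lra.
Qed.

(** M + e is definite for every e > 0, and its determinant is a polynomial in e. *)
Lemma psd_det n (M : 'M[R]_n) : M^T = M -> psd M -> 0 <= \det M.
Proof.
move=> sM pM; pose D : {poly R} := \det (map_mx polyC M + 'X%:M).
have DE e : D.[e] = \det (M + e%:M).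
  rewrite /D -[_.[e]]/(horner_eval e _) -det_map_mx; congr (\det _); apply/matrixP => i j.
  by rewrite !mxE /= /horner_eval hornerD hornerC hornerMn hornerX.
have Dp e : 0 < e -> 0 < D.[e].
  move=> e0; rewrite DE; apply: pd_det => [|v v0].
    by rewrite linearD /= sM tr_scalar_mx.
  rewrite /qf mulmxDr mulmxDl mxE ltr_wpDl //; first exact: pM.
  rewrite mul_mx_scalar -scalemxAl mxE mulr_gt0 // lt0r; apply/andP; split.
    by apply: contra_neq v0 => /rv_sq0.
  by rewrite mxE sumr_ge0 // => i _; rewrite mxE -expr2 sqr_ge0.
have -> : \det M = D.[0] by rewrite DE raddf0 addr0.
by apply: poly_ge0_right => x /Dp/ltW.
Qed.

Lemma qf_poly n (M : 'M[{poly R}]_n) v : exists Q : {poly R}, forall y, Q.[y] = qf (map_mx (horner_eval y) M) v.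
Proof.
exists (\sum_i \sum_j (v 0 i * v 0 j)%:P * M i j) => y; rewrite qfE horner_sum; apply: eq_bigr => i _.
by rewrite horner_sum; apply: eq_bigr => j _; rewrite mxE hornerM hornerC.
Qed.

(* For large argument all trailing minors are positive; to the right of the largest
   root of their product the matrix is positive definite, and at this root it is
   positive semidefinite by continuity, hence definite if the determinant is nonzero. *)
Lemma pd_poly n (M : 'M[{poly R}]_n) a : M^T = M -> all (fun p => 0 < lead_coef p) (minors M) ->
  (forall x, a < x -> (\det M).[x] != 0) -> forall x, a < x -> pd (map_mx (horner_eval x) M).
Proof.
move=> sM lM dM x ax.
have sMx y : (map_mx (horner_eval y) M)^T = map_mx (horner_eval y) M by rewrite map_trmx sM.
have mE y : minors (map_mx (horner_eval y) M) = [seq p.[y] | p <- minors M] by rewrite minors_map.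
apply: minors_pd => //; rewrite mE all_map; apply/allP => p pM /=; rewrite ltNge; apply/negP => px.
pose P := \prod_(q <- minors M) q.
have P0 : P != 0.
  rewrite prodf_seq_neq0; apply: sub_all lM => q /= lq; apply: contraTneq lq => ->.
  by rewrite lead_coef0 ltxx.
have gt_root q y : q \in minors M -> q.[y] <= 0 -> exists2 z, y <= z & q.[z] = 0.
  move=> qM qy; have lq := allP lM q qM; have [b hb] := poly_pinfty_gt_lc lq.
  have yb : y <= Num.max y b by rewrite le_max lexx.
  have [|z /andP[yz _] /eqP qz] := @Num.Theory.poly_ivt _ q _ _ yb; last by exists z.
  by rewrite qy /= ltW // (lt_le_trans lq) // hb // le_max lexx orbT.
have root_P q y : q \in minors M -> q.[y] = 0 -> P.[y] = 0.
  by move=> qM qy; rewrite /P (big_rem q) //= hornerM qy mul0r.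
have [z0 xz0 pz0] := gt_root p x pM px.
have [m [xm Pm hm]] : exists m, [/\ x <= m, P.[m] = 0 & forall y, m < y -> P.[y] != 0].
  have inr y : (y \in [seq y <- rootsR P | x <= y]) = (x <= y) && (P.[y] == 0).
    by rewrite mem_filter -(roots_on_rootsR P0) in_itv.
  have : z0 \in [seq y <- rootsR P | x <= y] by rewrite inr xz0 (root_P p) ?eqxx.
  have hmax : forall s : seq R, s != [::] -> exists2 m, m \in s & forall y, y \in s -> y <= m.
    elim=> // y [_ _|y' s /(_ isT) [m mi mm] _]; first by exists y => [|w]; rewrite inE // => /eqP ->.
    exists (Num.max y m); first by case: leP => _; rewrite in_cons ?eqxx ?mi ?orbT.
    by move=> w; rewrite in_cons le_max => /orP[/eqP -> | /mm ->]; rewrite ?lexx ?orbT.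
  move=> zin; have [|m] := hmax [seq y <- rootsR P | x <= y]; first by apply: contraTneq zin => ->.
  rewrite inr => /andP[xm /eqP Pm] mm; exists m; split=> // y my; apply/eqP => Py.
  have := mm y; rewrite inr Py eqxx andbT (le_trans xm (ltW my)) => /(_ isT).
  by rewrite leNgt my.
have pdr y : m < y -> pd (map_mx (horner_eval y) M).
  move=> my; apply: minors_pd => //; rewrite mE all_map; apply/allP => q qM /=; rewrite ltNge; apply/negP => qy.
  have [w yw qw] := gt_root q y qM qy.
  by have := hm w (lt_le_trans my yw); rewrite (root_P q) ?eqxx.
have psdm : psd (map_mx (horner_eval m) M).
  move=> v; have [Q QE] := qf_poly M v.
  rewrite -QE; apply: poly_ge0_right => y my; rewrite QE.
  exact: pd_psd (pdr y my) v.
have am : a < m by exact: lt_le_trans xm.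
have : pd (map_mx (horner_eval m) M).
  by apply: psd_unit => //; rewrite det_map_mx; exact: dM.
move/(pd_minors (sMx m)); rewrite mE all_map => /allP h.
move: Pm => /eqP; rewrite /P horner_prod prodf_seq_eq0 => /hasP[q qM /= /eqP qm].
by have := h q qM; rewrite /= qm ltxx.
Qed.

End Psd.

(** * Positivity of the vacuum module *)

Section Flip.
Variables (F : numFieldType) (V : lmodType F) (c h : F) (L : int -> {linear V -> V}) (om : V) (f : {scalar V}).
Hypothesis Lvir : is_vir c L.
Hypothesis Lom : forall n : nat, L n.+1 om = 0.
Hypothesis L0om : L 0 om = h *: om.
Hypothesis fom : f om = 1.
Hypothesis fL : forall (n : nat) x, f (L (- n.+1%:Z) x) = 0.

Definition flip (z : seq int) := rev [seq - n | n <- z].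

(** The vacuum expectation is invariant under the anti-involution L_n -> L_{-n}. This yields the
    symmetry of [brk], which its recursion does not show. *)
Lemma f_flip z : f (zw L (flip z) om) = f (zw L z om).
Proof.
move: z; apply: word_ind => [w1 a b w2 short|z short].
  have e1 (x y : int) w w' : f (zw L (w ++ x :: y :: w') om) = f (zw L (w ++ y :: x :: w') om)
      + (x - y)%:~R * f (zw L (w ++ (x + y) :: w') om)
      + (if x + y == 0 then ((x ^+ 3 - x)%:~R / 12%:R) * c else 0) * f (zw L (w ++ w') om).
    rewrite !zw_cat /=; have := Lvir x y (zw L w' om) => /(canRL (subrK _)) ->.
    by rewrite -addrA zwP linearP /= zwP linearP /=; ring.
  have flip_cat w w' : flip (w ++ w') = flip w' ++ flip w by rewrite /flip map_cat rev_cat.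
  have flipE x y w w' : flip (w ++ x :: y :: w') = flip w' ++ - y :: - x :: flip w.
    by rewrite flip_cat /flip /= !rev_cons -!cats1 -!catA.
  have flipE1 x w w' : flip (w ++ x :: w') = flip w' ++ - x :: flip w.
    by rewrite flip_cat /flip /= rev_cons -!cats1 -!catA.
  have s1 := short (w1 ++ (a + b) :: w2); have s2 := short (w1 ++ w2).
  rewrite flipE1 flip_cat in s1 s2.
  have ba : - b + - a = - (a + b) by rewrite opprD addrC.
  rewrite !flipE (e1 a b) (e1 (- b) (- a)) ba s1; last by rewrite !size_cat /= !addnS.
  rewrite s2; last by rewrite !size_cat /= !addnS ltnS ltnW.
  rewrite oppr_eq0 opprK [- b + a]addrC.
  case: (eqVneq (a + b) 0) => [ab|_]; last by rewrite !mul0r !addr0 => /addIr.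
  have -> : ((- b) ^+ 3 - - b)%:~R = (a ^+ 3 - a)%:~R :> F by congr (_%:~R); rewrite (_ : - b = a) //; lia.
  by move=> /addIr /addIr.
have [/hasP[n nz n0]|hn] := boolP (has (fun n : int => n < 0) z).
  exists (n :: rem n z); first exact: perm_to_rem.
  have -> : n = - (`|n|.-1).+1%:Z by lia.
  by rewrite /= fL /flip /= rev_cons -cats1 zw_cat /= opprK Lom zw0 linear0.
have [/hasP[n nz n0]|hp] := boolP (has (fun n : int => 0 < n) z).
  exists (rem n z ++ [:: n]); first by rewrite perm_sym perm_catC perm_sym perm_to_rem.
  have -> : n = (`|n|.-1).+1%:Z by lia.
  by rewrite zw_cat /= Lom zw0 linear0 /flip map_cat rev_cat /= fL.
exists z => //; have -> : z = nseq (size z) 0.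
  apply/all_pred1P/allP => n nz /=; have := hasPn hn n nz; have := hasPn hp n nz.
  by rewrite -!leNgt; case: ltgtP.
by rewrite /flip map_nseq oppr0 rev_nseq.
Qed.

Lemma lw_brk_sym u w : all (ltn 0%N) u -> all (ltn 0%N) w -> brk (c / 2%:R) h u w = brk (c / 2%:R) h w u.
Proof.
move=> u0 w0; rewrite -!(lw_brk Lvir Lom L0om fom fL) // -!zw_pos -!zw_lw -!zw_cat -f_flip.
congr (f (zw L _ om)); rewrite /flip map_cat rev_cat -!map_comp -!map_rev.
by rewrite revK; congr (_ ++ _); apply: eq_map => x /=; rewrite ?opprK.
Qed.

End Flip.

Lemma brk_symC (F : numClosedFieldType) (k h : F) u w : all (ltn 0%N) u -> all (ltn 0%N) w -> brk k h u w = brk k h w u.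
Proof.
(* [gam] and [mu] solve c = 1 - 12 gam^2 and h = mu^2 / 2 - gam mu: over an algebraically closed
   field every pair (c, h) occurs in a Fock space of level 1. *)
pose c := 2%:R * k; pose gam := sqrtC ((1 - c) / 12%:R); pose mu := gam + sqrtC (gam ^+ 2 + 2%:R * h).
have [b [f [om [[btr bb b0] [bom fom fb]]]]] := fock_exists 1 mu.
have l0 : 1 != 0 :> F by exact: oner_neq0.
have cE : c = 1 - 12%:R * 1 * gam ^+ 2 by rewrite /gam sqrtCK; field.
have hE : h = mu ^+ 2 / (2%:R * 1) - gam * mu.
  have := sqrtCK (gam ^+ 2 + 2%:R * h); rewrite /mu; move: (sqrtC (gam ^+ 2 + _)) => z zz.
  have -> : h = (z ^+ 2 - gam ^+ 2) / 2%:R by rewrite zz; field.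
  by field.
have -> : k = c / 2%:R by rewrite /c; field.
rewrite cE hE.
exact: (lw_brk_sym (virL_vir gam l0 btr bb) (virL_om 1 gam btr bom) (virL0_om 1 gam btr b0 bom) fom (f_virL gam l0 btr bb b0 fb)).
Qed.

Section Real.
Variable R : rcfType.
Implicit Types (c h k : R).

Lemma brk_symR k h u w : all (ltn 0%N) u -> all (ltn 0%N) w -> brk k h u w = brk k h w u.
Proof.
move=> u0 w0; apply: (fmorph_inj (real_complex R)); rewrite -!brk_morph.
exact: (@brk_symC (R[i] : numClosedFieldType)).
Qed.

Lemma horner_ext (p q : {poly R}) : (forall x, p.[x] = q.[x]) -> p = q.
Proof.
move=> h; apply/eqP; rewrite -subr_eq0; apply/eqP.
apply: (@roots_geq_poly_eq0 _ _ [seq (k%:R : R) | k : nat <- iota 0 (size (p - q))]).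
- by apply/allP => x /mapP[k _ ->]; rewrite /root hornerD hornerN h subrr.
- by rewrite map_inj_uniq ?iota_uniq // => a b /eqP; rewrite eqr_nat => /eqP.
by rewrite size_map size_iota.
Qed.

Lemma gram_eval k x N : map_mx (horner_eval x) (gram k%:P 'X N) = gram k x N.
Proof. by rewrite gram_morph /= /horner_eval hornerC hornerX. Qed.

Lemma brk_symP k u w : all (ltn 0%N) u -> all (ltn 0%N) w -> brk k%:P 'X u w = brk k%:P 'X w u.
Proof.
move=> u0 w0; apply: horner_ext => x; rewrite -![_.[x]]/(horner_eval x _) -!brk_morph.
by rewrite /= /horner_eval hornerC hornerX brk_symR.
Qed.

Lemma minors_top n (M : 'M[{poly R}]_n) (l : 'I_n -> nat) :
  (forall i j, (size (M i j) <= (minn (l i) (l j)).+1)%N) ->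
  (forall i j, l i = l j -> i != j -> (M i j)`_(l i) = 0) -> (forall i, 0 < (M i i)`_(l i)) ->
  all (fun p => 0 < lead_coef p) (minors M).
Proof.
elim: n M l => //= n IH M l h1 h2 h3; have [_ ->] := det_top h1 h2 h3.
apply: (IH _ (fun i => l (rshift 1 i))) => [i j|i j lij ne|i]; rewrite !mxE //.
by apply: h2 => //; apply: contra ne => /eqP /rshift_inj ->.
Qed.

Lemma Tc_lt2 c : (Tc c < 2%:R) = (1 < c).
Proof. by rewrite /Tc ltr_pdivrMr ?ltr0n //; apply/idP/idP => h; lra. Qed.

(** c > 1 means T < 2. For r <> s and 0 < T < 2 the discriminant of the quadratic in h is a negative
    multiple of (r^2 - s^2)^2 (4 - T^2); for T <= 0 no coefficient is negative and the constant one
    is positive. *)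
Lemma kfac_gt0 c h r s : 1 < c -> 0 < h -> (0 < r)%N -> (0 < s)%N -> 0 < kfac 4%:R^-1 (Tc c) h r s.
Proof.
rewrite -Tc_lt2 /kfac => T2 h0 r0 s0; move: (Tc c) T2 => T T2.
have r1 : 1 <= r%:R :> R by rewrite ler1n.
have s1 : 1 <= s%:R :> R by rewrite ler1n.
case: eqP => [_|/eqP rs].
  have : 0 <= (r%:R ^+ 2 - 1) * (2%:R - T).
    apply: mulr_ge0; last by rewrite subr_ge0 ltW.
    by rewrite subr_ge0 exprn_ege1.
  by lra.
have rs' : r%:R != s%:R :> R by rewrite eqr_nat.
move: (r%:R : R) (s%:R : R) r1 s1 rs' => x y x1 y1 xy.
set A := x ^+ 2 - 1; set B := y ^+ 2 - 1.
have A0 : 0 <= A by rewrite subr_ge0 exprn_ege1.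
have B0 : 0 <= B by rewrite subr_ge0 exprn_ege1.
have e0 : 0 <= x * y - 1 by rewrite subr_ge0 mulr_ege1.
have AB : 0 < (A - B) ^+ 2.
  rewrite exprn_even_gt0 //= /A /B; have -> : x ^+ 2 - 1 - (y ^+ 2 - 1) = (x - y) * (x + y) by ring.
  by rewrite mulf_neq0 // ?subr_eq0 // gt_eqF //; lra.
have -> : x ^+ 2 - y ^+ 2 = A - B by rewrite /A /B; ring.
have -> : x ^+ 2 + y ^+ 2 - 2%:R = A + B by rewrite /A /B; ring.
move: (x * y - 1) e0 => e e0; clearbody A B; case: (lerP T 0) => hT; last first.
  have q : 0 < (A - B) ^+ 2 * (4%:R - T ^+ 2) by apply: mulr_gt0 => //; nra.
  have : 0 <= (2%:R * h - (4%:R^-1 * ((A + B) * T) - e)) ^+ 2 by exact: sqr_ge0.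
  by lra.
have q1 : 0 <= (A + B) * (- T) by apply: mulr_ge0; lra.
have q2 : 0 <= (A + B) * (- T) * h by apply: mulr_ge0 => //; exact: ltW.
have q3 : 0 <= e * h by apply: mulr_ge0 => //; exact: ltW.
have q4 : 0 <= A * B * T ^+ 2 by rewrite mulr_ge0 ?sqr_ge0 // mulr_ge0.
have q5 : 0 <= e * ((A + B) * (- T)) by apply: mulr_ge0.
have q6 : 0 <= h ^+ 2 by exact: sqr_ge0.
have q7 : 0 <= e ^+ 2 by exact: sqr_ge0.
by lra.
Qed.

Lemma gram_pd c h N : 1 < c -> 0 < h -> pd (gram (c / 2%:R) h N).
Proof.
move=> c1 h0; rewrite -gram_eval; apply: (@pd_poly _ _ _ 0) => // [||x x0].
- by apply/matrixP => i j; rewrite !mxE brk_symP // (parts_pos (part_mem _)).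
- apply: (@minors_top _ _ (fun i => size (part i))) => [i j|i j lij ne|i]; rewrite mxE.
  + by apply: brk_size; exact: parts_pos (part_mem _).
  + have [_ q] := brk_top (c / 2%:R) (parts_pos (part_mem i)) (parts_pos (part_mem j)) lij.
    rewrite lij q //; apply: contra ne => pe; apply/eqP; apply: part_inj.
    exact: parts_perm_eq (part_mem i) (part_mem j) pe.
  by have [q _] := brk_top (c / 2%:R) (parts_pos (part_mem i)) (parts_pos (part_mem i)) erefl; apply: q.
rewrite -[_.[x]]/(horner_eval x _) -det_map_mx gram_eval.
have [K K0 ->] := kac_det R N; rewrite gt_eqF // mulr_gt0 // prodr_gt0 // => y _.
by rewrite exprn_gt0 // kfac_gt0.
Qed.

Lemma gram_psd_ge1 c N : 1 <= c -> psd (gram (c / 2%:R) 0 N).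
Proof.
have h1 (b : R) : 1 < b -> psd (gram (b / 2%:R) 0 N).
  move=> b1 v; have [Q QE] := qf_poly (gram (b / 2%:R)%:P 'X N) v.
  rewrite -gram_eval -QE; apply: poly_ge0_right => x x0.
  by rewrite QE gram_eval; apply: pd_psd; exact: gram_pd.
rewrite le_eqVlt => /predU1P[<- v|]; last exact: h1.
have e x : map_mx (horner_eval x) (gram (2%:R^-1 *: 'X : {poly R}) 0 N) = gram (x / 2%:R) 0 N.
  by rewrite gram_morph /= /horner_eval hornerZ hornerX horner0 mulrC.
have [Q QE] := qf_poly (gram (2%:R^-1 *: 'X) 0 N) v.
rewrite -e -QE; apply: poly_ge0_right => x x0.
by rewrite QE e; exact: h1.
Qed.

End Real.

Section Hermitian.
Variables (R : rcfType) (r : R) (V : lmodType R[i]).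
Let C := (R[i] : numClosedFieldType).
Variables (L : int -> {linear V -> V}) (om : V) (h : V -> V -> C).
Hypothesis Lvir : @is_vir C V (real_complex R r) L.
Hypothesis Lom : forall n : nat, L n%:Z om = 0.
Hypothesis hl : forall a u u' v, h (a *: u + u') v = a * h u v + h u' v.
Hypothesis hc : forall u v, h v u = (h u v)^*.
Hypothesis h_om : h om om = 1.
Hypothesis hL : forall (n : int) u v, h (L n u) v = h u (L (- n) v).

Lemma herm0l v : h 0 v = 0.
Proof. by have := hl (-1) 0 0 v; rewrite scaler0 addr0 mulN1r addNr. Qed.

Lemma herm0r v : h v 0 = 0.
Proof. by rewrite hc herm0l rmorph0. Qed.

Lemma hermDr u v w : h w (u + v) = h w u + h w v.
Proof. by rewrite (hc u w) (hc v w) -rmorphD hc -[in LHS](scale1r u) hl mul1r. Qed.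

Lemma hermZr a u w : h w (a *: u) = a^* * h w u.
Proof. by rewrite (hc u w) -rmorphM hc -[a *: u]addr0 hl herm0l addr0. Qed.

Lemma herm_suml (I : Type) (s : seq I) (P : pred I) (a : I -> C) (x : I -> V) v :
  h (\sum_(i <- s | P i) a i *: x i) v = \sum_(i <- s | P i) a i * h (x i) v.
Proof. by elim/big_rec2: _ => [|i y z _ <-]; [exact: herm0l | rewrite hl]. Qed.

Lemma herm_sumr (I : Type) (s : seq I) (P : pred I) (a : I -> C) (x : I -> V) v :
  h v (\sum_(i <- s | P i) a i *: x i) = \sum_(i <- s | P i) (a i)^* * h v (x i).
Proof.
by rewrite hc herm_suml rmorph_sum; apply: eq_bigr => i _; rewrite rmorphM /= (hc (x i) v).
Qed.

Lemma herm_brk u w : all (ltn 0%N) u -> all (ltn 0%N) w ->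
  h (lw L u om) (lw L w om) = real_complex R (brk (r / 2%:R) 0 u w).
Proof.
move=> u0 w0; have flin : linear (fun x : V => h x om : C^o) by move=> a x y; exact: hl.
pose f : {scalar V} := linmk flin; have fE x : f x = h x om by rewrite /f linmkE.
have fL (n : nat) x : f (L (- n.+1%:Z) x) = 0 by rewrite fE hL opprK Lom herm0r.
have adj x y : h (foldr (fun n z => L n%:Z z) x (rev w)) y = h x (lw L w y).
  elim: w x y {w0} => // n w IH x y; rewrite rev_cons -cats1 foldr_cat IH /=.
  by rewrite hL.
have L0 : L 0 om = 0 *: om by rewrite scale0r (Lom 0%N).
have f1 : f om = 1 by rewrite fE.
rewrite -adj -fE (lw_brk Lvir (fun n => Lom n.+1) L0 f1 fL w0 u0) -(rmorph0 (real_complex R)).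
have -> : real_complex R r / 2%:R = real_complex R (r / 2%:R) by rewrite fmorph_div rmorph_nat.
by rewrite brk_morph brk_symR.
Qed.

Lemma herm_qf N (v : 'rV_(size (parts N))) :
  h (\sum_i real_complex R (v 0 i) *: lw L (part i) om) (\sum_i real_complex R (v 0 i) *: lw L (part i) om)
  = real_complex R (qf (gram (r / 2%:R) 0 N) v).
Proof.
rewrite herm_suml qfE rmorph_sum; apply: eq_bigr => i _.
rewrite herm_sumr mulr_sumr rmorph_sum; apply: eq_bigr => j _.
have -> : ((real_complex R (v 0 j) : C)^* = real_complex R (v 0 j))%R by exact: conjc_real.
by rewrite herm_brk ?mxE ?rmorphM /= ?mulrA // (parts_pos (part_mem _)).
Qed.

Lemma psd_of_herm : (forall v, 0 <= h v v) -> forall N, psd (gram (r / 2%:R) 0 N).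
Proof. by move=> p N v; rewrite -lecR -herm_qf. Qed.

Definition posspan v := exists2 s : seq (C * seq nat), all (fun x => all (ltn 0%N) x.2) s &
  v = \sum_(x <- s) x.1 *: lw L x.2 om.

Lemma posspan_lin a u v : posspan u -> posspan v -> posspan (a *: u + v).
Proof.
move=> [s sp ->] [t tp ->]; exists ([seq (a * x.1, x.2) | x <- s] ++ t).
  by rewrite all_cat all_map tp andbT; apply: sub_all sp.
by rewrite big_cat big_map scaler_sumr /=; congr (_ + _); apply: eq_bigr => x _; rewrite scalerA.
Qed.

Lemma posspan0 : posspan 0. Proof. by exists [::]; rewrite ?big_nil. Qed.

Lemma posspan_om : posspan om.
Proof. by exists [:: (1, [::])]; rewrite ?big_seq1 ?scale1r. Qed.

Lemma posspan_sum (I : Type) (s : seq I) (P : pred I) (a : I -> C) (x : I -> V) :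
  (forall i, P i -> posspan (x i)) -> posspan (\sum_(i <- s | P i) a i *: x i).
Proof.
move=> p; elim/big_rec: _ => [|i y /p]; [exact: posspan0 | exact: posspan_lin].
Qed.

Lemma posspan_L n v : posspan v -> posspan (L n v).
Proof.
move=> [s sp ->]; rewrite linear_sum; have -> : \sum_(x <- s) L n (x.1 *: lw L x.2 om) =
    \sum_(x <- s | all (ltn 0%N) x.2) x.1 *: L n (lw L x.2 om).
  rewrite big_seq_cond [RHS]big_seq_cond; apply: eq_big => [x|x _]; last by rewrite linearZ.
  by case: (boolP (x \in s)) => // xs; rewrite (allP sp).
apply: posspan_sum => -[a w] /= w0.
have L0 : L 0 om = 0 *: om by rewrite scale0r (Lom 0%N).
rewrite (lw_act Lvir (fun n => Lom n.+1) L0); eexists; last by [].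
by apply/allP => -[b z] /(act_pos w0).
Qed.

Lemma posspan_parts v : posspan v -> exists M0 (a : seq nat -> C), forall M, (M0 <= M)%N ->
  v = \sum_(N < M) \sum_(i < size (parts N)) a (part i) *: lw L (part i) om.
Proof.
case=> s sp ->; elim: s sp => [|[b u] s IH] /=.
  by exists 0%N, (fun=> 0) => M _; rewrite big_nil big1 // => N _; rewrite big1 // => i _; rewrite scale0r.
case/andP=> u0 /IH[M0 [a e]]; have [D [DE _]] := @straighten _ _ _ L om Lvir u u0.
exists (maxn (sumn u).+1 M0), (fun w => (if sumn w == sumn u then b * D w else 0) + a w) => M.
rewrite geq_max => /andP[uM M0M]; rewrite big_cons (e _ M0M).
under [RHS]eq_bigr do (under eq_bigr do rewrite scalerDl; rewrite big_split /=).
rewrite big_split /=; congr (_ + _); rewrite (bigD1 (Ordinal uM)) //= [X in _ = _ + X]big1 ?addr0 => [|N ne]; last first.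
  apply: big1 => i _; rewrite (parts_sum (part_mem i)) ifF ?scale0r //.
  by apply: contraNF ne => /eqP e'; apply/eqP/val_inj.
rewrite DE sum_parts scaler_sumr; apply: eq_bigr => i _.
by rewrite (parts_sum (part_mem i)) eqxx scalerA.
Qed.

(** The Gram matrices are real and symmetric, so for complex coefficients the cross terms of real
    and imaginary part cancel; different levels are orthogonal. *)
Lemma herm_of_psd : (forall N, psd (gram (r / 2%:R) 0 N)) -> forall v, posspan v -> 0 <= h v v.
Proof.
move=> p v /posspan_parts[M [a /(_ _ (leqnn M)) ->]].
pose x N := \sum_(i < size (parts N)) a (part i) *: lw L (part i) om.
have xx N : 0 <= h (x N) (x N).
  pose re := \row_(i < size (parts N)) complex.Re (a (part i)).
  pose im := \row_(i < size (parts N)) complex.Im (a (part i)).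
  pose y (q : 'rV_(size (parts N))) := \sum_i real_complex R (q 0 i) *: lw L (part i) om.
  have xE : x N = 'i *: y im + y re.
    rewrite /x /y scaler_sumr -big_split; apply: eq_bigr => i _ /=.
    rewrite scalerA -scalerDl !mxE; congr (_ *: _); rewrite addrC; exact: complexE.
  have yy : h (y im) (y re) = h (y re) (y im).
    rewrite [RHS]hc; apply/esym/CrealP; rewrite /y herm_suml; apply: rpred_sum => i _.
    rewrite herm_sumr; apply: rpredM; first by apply/CrealP; exact: conjc_real.
    apply: rpred_sum => j _; rewrite herm_brk ?(parts_pos (part_mem _)) //.
    have cr (z : R) : (real_complex R z : C) \is Num.real by apply/CrealP; exact: conjc_real.
    by rewrite conj_Creal ?rpredM // cr.
  rewrite xE hl !hermDr !hermZr yy conjCi !mulrDr !mulrA; set A := h (y re) (y im).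
  have -> : 'i * - 'i * h (y im) (y im) + 'i * A + (- 'i * A + h (y re) (y re)) =
    h (y im) (y im) + h (y re) (y re) by rewrite mulrN -expr2 sqrCi; ring.
  by rewrite !herm_qf; apply: addr_ge0; rewrite lecR; apply: p.
have -> : \sum_(N < M) \sum_(i < size (parts N)) a (part i) *: lw L (part i) om = \sum_(N < M) 1 *: x N.
  by apply: eq_bigr => N _; rewrite scale1r.
rewrite herm_suml sumr_ge0 // => N _; rewrite mul1r herm_sumr (bigD1 N) //= rmorph1 mul1r big1 ?addr0 //.
move=> N' ne; rewrite mul1r /x herm_suml big1 // => i _; rewrite herm_sumr big1 ?mulr0 // => j _.
rewrite herm_brk ?(parts_pos (part_mem _)) // brk_level ?rmorph0 ?mulr0 //.
by rewrite !(parts_sum (part_mem _)); apply: contra ne => /eqP e; apply/eqP/val_inj.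
Qed.

End Hermitian.

Lemma gram_psd_min (R : rcfType) m N : (2 <= m)%N -> psd (gram ((1 - 6%:R / (m * m.+1)%:R) / 2%:R) (0 : R) N).
Proof.
move=> m2; pose C := (R[i] : numClosedFieldType).
have [L [Lvir L1 Ladj]] := @minimal_series_unitary C m m2.
have Lvir' : @is_vir C _ (real_complex R (1 - 6%:R / (m * m.+1)%:R)) L.
  by rewrite rmorphB fmorph_div !rmorph_nat rmorph1.
apply: (psd_of_herm Lvir' L1 (h := @ip C)) => [a u u' v|u v||n u v|v].
- exact: ip_lin.
- exact: ip_conj.
- by rewrite ip1r coef1.
- exact: Ladj.
- exact: ip_ge0.
Qed.

(** * The gaps of the discrete series *)

Lemma det_reindex (A : comNzRingType) (T : Type) (phi : T -> T -> A) n m (t : 'I_n -> T) (t' : 'I_m -> T) :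
  injective t -> injective t' -> (forall i, exists j, t' j = t i) -> (forall j, exists i, t i = t' j) ->
  \det (\matrix_(i, j) phi (t i) (t j)) = \det (\matrix_(i, j) phi (t' i) (t' j)).
Proof.
move=> ti ti' /fin_all_exists[f fE] /fin_all_exists[g gE].
have fi : injective f by move=> a b e; apply: ti; rewrite -!fE e.
have gi : injective g by move=> a b e; apply: ti'; rewrite -!gE e.
have nm : n = m.
  by apply/eqP; rewrite eqn_leq; have := leq_card f fi; have := leq_card g gi; rewrite !card_ord => -> ->.
subst m; pose s := perm fi.
have -> : \matrix_(i, j) phi (t i) (t j) = row_perm s (col_perm s (\matrix_(i, j) phi (t' i) (t' j))).
  by apply/matrixP => i j; rewrite !mxE !permE !fE.
rewrite row_permE col_permE !det_mulmx !det_perm odd_permV mulrA -mulrA mulrCA [X in _ = X]/=.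
by rewrite -expr2 sqrr_sign mulr1.
Qed.

Section LevelOne.
Variables (A : comNzRingType) (k h : A).
Implicit Types (u w : seq nat) (n : int).

(** Modulo h, L_{-1} om is a singular vector of weight h + 1, since L_1 L_{-1} om = 2 h om. [corr]
    collects the corrections, all of them multiples of h. *)
Lemma act_one w n : all (ltn 0%N) w -> exists2 corr : seq (A * seq nat),
  all (fun x => all (ltn 0%N) x.2) corr &
  forall phi : seq nat -> A, \sum_(x <- act k h (rcons w 1%N) n) x.1 * phi x.2 =
    \sum_(x <- act k (h + 1) w n) x.1 * phi (rcons x.2 1%N) + h * \sum_(x <- corr) x.1 * phi x.2.
Proof.
elim: w n => [|m w IH] [n|p].
- move=> _; rewrite [rcons _ _]/= act_cons; case: n => [|[|n]].
  + exists [::] => // phi; rewrite /= !big_cons !big_nil /=; ring.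
  + exists [:: (2%:R, [::])] => // phi; rewrite /= !big_cons !big_nil /= mul0r mul0r (_ : (1%Z + 1%Z)%:~R = 2%:R) //; ring.
  + by exists [::] => // phi; rewrite (_ : n.+2%:Z - 1 = n.+1) ?subzSS ?subr0 //= !big_nil mulr0 addr0.
- by move=> _; exists [::] => // phi; rewrite !act_neg !big_cons !big_nil mulr0 !addr0 /=.
- move=> /= /andP[m0 w0].
  have [c1 p1 e1] := IH n w0; have [c2 p2 e2] := IH (n%:Z - m%:Z) w0.
  exists ([seq (x.1, m :: x.2) | x <- c1] ++ [seq ((n%:Z + m%:Z)%:~R * x.1, x.2) | x <- c2]).
    rewrite all_cat !all_map; apply/andP; split; last exact: p2.
    by apply: sub_all p1 => x /= ->; rewrite m0.
  move=> phi; rewrite !big_cat !big_map /= (e1 (fun z => phi (m :: z))).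
  have sz (r : seq (A * seq nat)) (a : A) (g : seq nat -> A) :
      \sum_(x <- r) a * x.1 * g x.2 = a * \sum_(x <- r) x.1 * g x.2.
    by rewrite mulr_sumr; apply: eq_bigr => x _; rewrite mulrA.
  rewrite !sz (sz _ _ (fun z => phi (rcons z 1%N))) (e2 phi).
  case: eqP => _; rewrite ?big_cons ?big_nil /=; ring.
- by move=> _; exists [::] => // phi; rewrite !act_neg !big_cons !big_nil mulr0 !addr0 /=.
Qed.

Lemma brk_one u w : all (ltn 0%N) w -> exists e, brk k h u (rcons w 1%N) = h * e.
Proof.
elim: u w => [|n u IH] w w0; first by exists 0; rewrite /= mulr0; case: w w0.
rewrite [brk _ _ _ _]/=; have [corr _ ->] := act_one n w0.
suff [e ->] : exists e, \sum_(x <- act k (h + 1) w n) x.1 * brk k h u (rcons x.2 1%N) = h * e.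
  by rewrite -mulrDr; eexists.
have : all (fun x => all (ltn 0%N) x.2) (act k (h + 1) w n) by apply/allP => -[a z] /(act_pos w0).
elim: (act _ _ _ _) => [|x r IHr] /=; first by exists 0; rewrite big_nil mulr0.
case/andP=> /IH[e1 e1E] /IHr[e2 e2E]; exists (x.1 * e1 + e2).
by rewrite big_cons e1E e2E mulrDr mulrCA.
Qed.

End LevelOne.

Section VacuumDet.
Variable R : rcfType.
Implicit Types (c h k : R).

(** The norm of L_{-1} om is 2 h, and to first order in h the words on it pair as in the Verma
    module of weight h + 1. *)
Lemma brk_one_one k u w : all (ltn 0%N) u -> all (ltn 0%N) w ->
  exists e, brk k%:P 'X (rcons u 1%N) (rcons w 1%N) = 'X * (2%:R * brk k%:P ('X + 1) u w + 'X * e).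
Proof.
elim: u w => [|n u IH] w.
  case: w => [|m w] _ w0.
    exists 0; rewrite /= !big_cons !big_nil /= mul0r mul0r.
    by rewrite (_ : (1%Z + 1%Z)%:~R = 2%:R) //; ring.
  exists 0; rewrite brk_level /=; first by rewrite !mulr0 addr0 mulr0.
  by move/andP: w0; rewrite sumn_rcons; case; case: m => // m; lia.
move=> /= /andP[n0 u0] w0; have [corr cp ->] := act_one k%:P 'X n w0.
have [e1 ->] : exists e, \sum_(x <- corr) x.1 * brk k%:P 'X (rcons u 1%N) x.2 = 'X * e.
  elim: corr cp => [|x r IHr] /=; first by exists 0; rewrite big_nil mulr0.
  case/andP=> x0 /IHr[e2 e2E]; have [e3 e3E] := brk_one k%:P 'X x.2 u0.
  exists (x.1 * e3 + e2); rewrite big_cons e2E brk_symP ?all_rcons // e3E mulrDr mulrCA //.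
suff [e2 ->] : exists e, \sum_(x <- act k%:P ('X + 1) w n) x.1 * brk k%:P 'X (rcons u 1%N) (rcons x.2 1%N) =
   'X * (2%:R * \sum_(x <- act k%:P ('X + 1) w n) x.1 * brk k%:P ('X + 1) u x.2 + 'X * e).
  by exists (e1 + e2); rewrite mulrA; ring.
have : all (fun x => all (ltn 0%N) x.2) (act k%:P ('X + 1) w n) by apply/allP => -[a z] /(act_pos w0).
elim: (act _ _ _ _) => [|x r IHr] /=; first by exists 0; rewrite !big_nil !mulr0 addr0 mulr0.
case/andP=> /(IH _ u0)[e3 e3E] /IHr[e4 e4E]; exists (x.1 * e3 + e4).
by rewrite !big_cons e3E e4E; ring.
Qed.

(** In a sorted word a letter 1 acts first on the vacuum, where L_{-1} om = 0; these are the words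
    that remain. *)
Definition vparts N := [seq w <- parts N | 1%N \notin w].
Definition vpart N (i : 'I_(size (vparts N))) := nth [::] (vparts N) i.
Definition vgram (k h : R) N := \matrix_(i, j) brk k h (@vpart N i) (@vpart N j).

Lemma vpart_mem N (i : 'I_(size (vparts N))) : vpart i \in vparts N.
Proof. exact: mem_nth. Qed.

Lemma vpart_pos N (i : 'I_(size (vparts N))) : all (ltn 0%N) (vpart i).
Proof. by have := vpart_mem i; rewrite mem_filter => /andP[_ /parts_pos]. Qed.

Lemma vpart_inj N : injective (@vpart N).
Proof. by move=> i j /eqP; rewrite nth_uniq ?(filter_uniq _ (parts_uniq N)) // => /eqP/val_inj. Qed.

Lemma rcons_parts w N : (rcons w 1%N \in parts N.+1) = (w \in parts N).
Proof.
rewrite !mem_parts all_rcons sumn_rcons /= addn1 eqSS andbA [RHS]andbA; congr (_ && _).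
have [w0|] := boolP (all (ltn 0%N) w); rewrite ?andbF //= !andbT.
by case: w w0 => //= m w /andP[m0 w0]; rewrite rcons_path; rewrite /= (_ : (0 < last m w)%N) ?andbT // -[last m w]/(last m w); move: (mem_last m w); rewrite inE => /orP[/eqP -> //|/(allP w0)].
Qed.

Lemma parts_rcons w N : w \in parts N.+1 -> 1%N \in w -> exists2 z, z \in parts N & w = rcons z 1%N.
Proof.
case/lastP: w => // z x wN; rewrite mem_rcons inE => h.
suff x1 : x = 1%N by exists z; [rewrite -rcons_parts -x1 | rewrite x1].
have := parts_pos wN; rewrite all_rcons => /andP[x0 _]; case/orP: h => [/eqP //|h].
have := wN; rewrite mem_parts => /andP[]; rewrite (sorted_pairwise geq_trans) pairwise_rcons.
by case/andP=> /allP/(_ _ h) /= x1 _ _; apply/eqP; rewrite eqn_leq x1.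
Qed.

(** The Kac product at h = 0 and level N + 1 without the pair (1, 1), whose factor is h itself, with
    the number of partitions of N as exponent. *)
Definition vprod N c := \prod_(x : 'I_N.+1 * 'I_N.+1 | (x.1 <= x.2)%N && (x != (ord0, ord0)))
  kfac 4%:R^-1 (Tc c) 0 x.1.+1 x.2.+1 ^+ mult N.+1 x.1.+1 x.2.+1.

(* At h = 0 the rows and columns through L_{-1} vanish; dividing the rows by h
   leaves a block triangular matrix, with second diagonal block 2 gram_N(h = 1). *)
Lemma vac_det N : exists2 K : {poly R}, (forall c, 0 < K.[c]) & forall c,
  \det (vgram (c / 2%:R) 0 N.+1) * (2%:R ^+ size (parts N) * \det (gram (c / 2%:R) 1 N)) = K.[c] * vprod N c.
Proof.
have [K K0 KE] := kac_det R N.+1; exists K => // c; set k := c / 2%:R.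
pose t (i : 'I_(size (vparts N.+1) + size (parts N))) :=
  match split i with inl a => vpart a | inr b => rcons (part b) 1%N end.
have tl a : t (lshift _ a) = vpart a by rewrite /t (unsplitK (inl _ a)).
have tr b : t (rshift _ b) = rcons (part b) 1%N by rewrite /t (unsplitK (inr _ b)).
have v1 a : 1%N \notin @vpart N.+1 a by have := vpart_mem a; rewrite mem_filter => /andP[].
have ti : injective t.
  move=> i j; case: (split_ordP i) => a ->; case: (split_ordP j) => b ->; rewrite ?tl ?tr.
  - by move/vpart_inj ->.
  - by move=> e; have := v1 a; rewrite e mem_rcons inE eqxx.
  - by move=> e; have := v1 b; rewrite -e mem_rcons inE eqxx.
  - by move/rcons_inj=> [/part_inj ->].
have ts i : exists j, @part N.+1 j = t i.
  apply: part_surj; case: (split_ordP i) => a ->; rewrite ?tl ?tr.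
    by have := vpart_mem a; rewrite mem_filter => /andP[].
  by rewrite rcons_parts part_mem.
have st j : exists i, t i = @part N.+1 j.
  have [j1|j1] := boolP (1%N \in part j).
    have [z zN ->] := parts_rcons (part_mem j) j1; have [b <-] := part_surj zN.
    by exists (rshift _ b); rewrite tr.
  have jv : part j \in vparts N.+1 by rewrite mem_filter j1 part_mem.
  have lt := jv; rewrite -index_mem in lt; exists (lshift _ (Ordinal lt)).
  by rewrite tl /vpart nth_index.
have dE := det_reindex (brk k%:P 'X) ti (@part_inj N.+1) ts st.
have /fin_all_exists[B BE] : forall ab : 'I_(size (vparts N.+1)) * 'I_(size (parts N)), exists e,
    brk k%:P 'X (vpart ab.1) (rcons (part ab.2) 1%N) = 'X * e.
  by move=> ab; apply: brk_one; exact: parts_pos (part_mem _).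
have /fin_all_exists[D DE] : forall ab : 'I_(size (parts N)) * 'I_(size (parts N)), exists e,
    brk k%:P 'X (rcons (part ab.1) 1%N) (rcons (part ab.2) 1%N) =
      'X * (2%:R * brk k%:P ('X + 1) (part ab.1) (part ab.2) + 'X * e).
  by move=> ab; apply: brk_one_one; exact: parts_pos (part_mem _).
pose Q := block_mx (\matrix_(a, b) brk k%:P 'X (@vpart N.+1 a) (@vpart N.+1 b)) (\matrix_(a, b) ('X * B (a, b)))
  (\matrix_(b, a) B (a, b)) (\matrix_(a, b) (2%:R * brk k%:P ('X + 1) (part a) (part b) + 'X * D (a, b))).
have PE : \matrix_(i, j) brk k%:P 'X (t i) (t j) = block_mx 1%:M 0 0 'X%:M *m Q.
  rewrite mulmx_block !mul1mx !mul0mx !addr0 !add0r !mul_scalar_mx.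
  apply/matrixP => i j; case: (split_ordP i) => a ->; case: (split_ordP j) => b ->.
  - by rewrite block_mxEul !mxE !tl.
  - by rewrite block_mxEur !mxE tl tr (BE (a, b)).
  - by rewrite block_mxEdl !mxE tl tr -(BE (b, a)) brk_symP ?vpart_pos // all_rcons (parts_pos (part_mem _)).
  - by rewrite block_mxEdr !mxE !tr (DE (a, b)).
have detQ : \det Q = K.[c] *: \prod_(x : 'I_N.+1 * 'I_N.+1 | (x.1 <= x.2)%N && (x != (ord0, ord0)))
    kfac (4%:R^-1)%:P (Tc c)%:P 'X x.1.+1 x.2.+1 ^+ mult N.+1 x.1.+1 x.2.+1.
  apply: (mulfI (x := 'X ^+ size (parts N))); first by rewrite expf_neq0 // polyX_eq0.
  have -> : 'X ^+ size (parts N) * \det Q = \det (gram k%:P 'X N.+1).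
    by rewrite -[RHS]dE PE det_mulmx det_ublock det1 mul1r det_scalar.
  have -> : \det (gram k%:P 'X N.+1) = K.[c] *: kacprod N.+1 (4%:R^-1)%:P (Tc c)%:P 'X.
    apply: horner_ext => x; rewrite hornerZ -[(kacprod _ _ _ _).[x]]/(horner_eval x _) -kacprod_morph.
    rewrite -[(\det _).[x]]/(horner_eval x _) -det_map_mx gram_eval KE /= /horner_eval !hornerC hornerX //.
  rewrite -scalerAr; congr (_ *: _); rewrite /kacprod (bigD1 (ord0, ord0)) //=; congr (_ * _).
  rewrite /kfac eqxx /mult mul1n subSS subn0 /=; congr (_ ^+ _); ring.
have := congr1 (horner_eval 0) detQ; rewrite -det_map_mx map_block_mx.
have -> : map_mx (horner_eval 0) (\matrix_(a, b) ('X * B (a, b))) = 0 :> 'M[R]_(_, _).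
  by apply/matrixP => a b; rewrite !mxE /= /horner_eval hornerM hornerX mul0r.
rewrite det_lblock /= /horner_eval hornerZ horner_prod => E.
suff -> : vprod N c = \prod_(x : 'I_N.+1 * 'I_N.+1 | (x.1 <= x.2)%N && (x != (ord0, ord0)))
    (kfac (4%:R^-1)%:P (Tc c)%:P 'X x.1.+1 x.2.+1 ^+ mult N.+1 x.1.+1 x.2.+1).[0].
  rewrite -E; congr (\det _ * _).
    by apply/matrixP => a b; rewrite !mxE -[RHS]/(horner_eval 0 _) -brk_morph /= /horner_eval hornerC hornerX.
  rewrite -detZ; congr (\det _); apply/matrixP => a b; rewrite !mxE hornerD hornerM (hornerM 'X) hornerX mul0r addr0.
  congr (_ * _); first by rewrite -polyC_natr hornerC.
  by rewrite -[RHS]/(horner_eval 0 _) -brk_morph /= /horner_eval hornerC hornerD hornerX hornerC add0r.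
apply: eq_bigr => x _; rewrite -[RHS]/(horner_eval 0 _) rmorphXn -kfac_morph /= /horner_eval !hornerC hornerX //.
Qed.

Lemma vgram_psd k N : psd (gram k 0 N) -> psd (vgram k 0 N).
Proof.
have /fin_all_exists[f fE] : forall i, exists j, @part N j = @vpart N i.
  by move=> i; apply: part_surj; have := vpart_mem i; rewrite mem_filter => /andP[].
move=> p v; have := p (\row_j \sum_i v 0 i * (f i == j)%:R); rewrite qfE.
have sumf (g : 'I_(size (parts N)) -> R) : \sum_j (\sum_i v 0 i * (f i == j)%:R) * g j = \sum_i v 0 i * g (f i).
  under eq_bigr do rewrite mulr_suml; rewrite exchange_big; apply: eq_bigr => i _.
  rewrite (bigD1 (f i)) //= eqxx mulr1 big1 ?addr0 // => j; rewrite eq_sym => /negPf ->.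
  by rewrite mulr0 mul0r.
rewrite qfE; congr (0 <= _).
under eq_bigr do under eq_bigr do rewrite mxE [X in _ * X * _]mxE -mulrA.
under eq_bigr do rewrite -mulr_sumr sumf; rewrite sumf; apply: eq_bigr => i _.
by rewrite mulr_sumr; apply: eq_bigr => j _; rewrite !mxE !fE mulrA.
Qed.

Lemma vgram_sym k h N : (vgram k h N)^T = vgram k h N.
Proof. by apply/matrixP => i j; rewrite !mxE brk_symR // vpart_pos. Qed.

End VacuumDet.

Section Signs.
Variable R : rcfType.
Implicit Types (y : R) (r d s M N : nat).

Lemma pos_of y (a b N : nat) : 0 < y -> y * N%:R < 1 -> (a <= b * N)%N -> (0 < b)%N -> 0 < b%:R - y * a%:R.
Proof.
move=> y0 yN ab b0; rewrite subr_gt0; apply: (@le_lt_trans _ _ (y * (b * N)%:R)).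
  by rewrite ler_pM2l // ler_nat.
by rewrite natrM mulrCA -[ltRHS]mulr1 ltr_pM2l ?ltr0n.
Qed.

(** In the variable y of c = 1 - 6 y, where c_m is y = 1 / (m (m + 1)), the factors at h = 0 split
    into linear factors with integral coefficients; their signs reduce to inequalities between
    integers. *)
Lemma kfac0 y r d : (0 < d)%N -> kfac 4%:R^-1 (Tc (1 - 6%:R * y)) 0 r.+1 (r + d).+1 =
  (((d ^ 2)%N%:R - y * (r.+2 * (r + d).+2)%:R) * ((d ^ 2)%N%:R - y * (r * (r + d))%:R)) / 16%:R.
Proof.
move=> d0; rewrite /kfac /Tc ifF; last by apply/eqP; lia.
by rewrite !natrM ?natrX -!natr1 !natrD; field.
Qed.

Lemma kfac1 y r d : (0 < d)%N -> kfac 4%:R^-1 (Tc (1 - 6%:R * y)) 1 r.+1 (r + d).+1 =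
  ((((d + 2) ^ 2)%N%:R - y * (r * (r + d).+2)%:R) * ((d%:R - 2%:R) ^+ 2 - y * (r.+2 * (r + d))%:R)) / 16%:R.
Proof.
move=> d0; rewrite /kfac /Tc ifF; last by apply/eqP; lia.
by rewrite !natrM ?natrX -!natr1 !natrD; field.
Qed.

Lemma kfac_diag y h r : kfac 4%:R^-1 (Tc (1 - 6%:R * y)) h r r = h - (r%:R ^+ 2 - 1) * y / 4%:R.
Proof. by rewrite /kfac eqxx /Tc; field. Qed.

Lemma leqE r s : (r <= s)%N -> r = s \/ exists2 d, (0 < d)%N & s = (r + d)%N.
Proof. by case: ltngtP => // [lt|->] _; [right; exists (s - r)%N; lia | left]. Qed.

Lemma kfac1_sign y y' M r s : 0 < y -> 0 < y' -> y * (M * M.+1)%:R < 1 -> y' * (M * M.+1)%:R < 1 ->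
  (r <= s)%N -> (r.+1 * s.+1 < M * M.+1)%N ->
  0 < kfac 4%:R^-1 (Tc (1 - 6%:R * y)) 1 r.+1 s.+1 * kfac 4%:R^-1 (Tc (1 - 6%:R * y')) 1 r.+1 s.+1.
Proof.
move=> y0 y0' yM yM' /leqE[<- rs|[d d0 ->] rs].
  have diag (z : R) : 0 < z -> z * (M * M.+1)%:R < 1 -> 0 < kfac 4%:R^-1 (Tc (1 - 6%:R * z)) 1 r.+1 r.+1.
    move=> z0 zM; have := @pos_of z (r.+1 * r.+1) 1 (M * M.+1) z0 zM; rewrite mul1n => /(_ (ltnW rs) isT).
    by rewrite kfac_diag natrM; lra.
  by rewrite mulr_gt0 ?diag.
have p1 (z : R) : 0 < z -> z * (M * M.+1)%:R < 1 -> 0 < ((d + 2) ^ 2)%N%:R - z * (r * (r + d).+2)%:R.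
  by move=> z0 zM; apply: (pos_of z0 zM); [nia | rewrite expn_gt0 addn2].
rewrite !kfac1 //.
suff : 0 < ((d%:R - 2%:R) ^+ 2 - y * (r.+2 * (r + d))%:R) * ((d%:R - 2%:R) ^+ 2 - y' * (r.+2 * (r + d))%:R).
  move: (p1 y y0 yM) (p1 y' y0' yM'); set a := (_ - _); set b := (_ - _); set e := (_ - _); set e' := (_ - _) => a0 b0 ee.
  have -> : a * e / 16%:R * (b * e' / 16%:R) = (a * b) * (e * e') / 256%:R by field.
  by rewrite divr_gt0 ?ltr0n //; apply: mulr_gt0 ee; exact: mulr_gt0.
(* For d = 2 the constant term vanishes and the factor is negative at both parameters; for all other
   d it is positive at both. *)
have [->|d2] := eqVneq d 2%N.
  have p2 (z : R) : 0 < z -> (2%:R - 2%:R) ^+ 2 - z * (r.+2 * (r + 2))%:R < 0 :> R.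
    by move=> z0; rewrite subrr expr0n sub0r oppr_lt0 mulr_gt0 // ltr0n addn2.
  by rewrite nmulr_rgt0 p2.
have e : (d%:R - 2%:R) ^+ 2 = (if d == 1 then 1 else (d - 2) ^ 2)%N%:R :> R.
  case: eqP => [->|/eqP d1]; first by rewrite mulr1n; ring.
  by rewrite natrX natrB //; lia.
have p2 (z : R) : 0 < z -> z * (M * M.+1)%:R < 1 -> 0 < (d%:R - 2%:R) ^+ 2 - z * (r.+2 * (r + d))%:R.
  move=> z0 zM; rewrite e; apply: (pos_of z0 zM); last first.
    by case: eqP => // /eqP d1; rewrite expn_gt0 subn_gt0; lia.
  case: eqP => [d1|/eqP d1]; first by rewrite d1 in rs *; nia.
  (* For d = 3 the square is again 1, so (r + 2)(r + 3) <= M (M + 1) is required; it follows from r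
     + 1 < M. *)
  have [d3|d3] := eqVneq d 3%N; first rewrite d3 in rs *.
    have : (r.+1 < M)%N by rewrite ltnNge; apply/negP => ?; nia.
    by rewrite (_ : (3 - 2) ^ 2 = 1)%N // mul1n; nia.
  have [f [f0 df]] : exists f, (2 <= f)%N /\ d = f.+2 by exists (d - 2)%N; lia.
  rewrite df in rs *; rewrite (_ : f.+2 - 2 = f)%N; last by lia.
  by move: (M * M.+1)%N rs => N rs; nia.
by rewrite mulr_gt0 ?p2.
Qed.

Lemma kfac0_sign y y' M r s : 0 < y -> 0 < y' -> y * (M * M.+1)%:R < 1 -> y' * (M * M.+1)%:R < 1 ->
  (r <= s)%N -> (0 < s)%N -> (r.+1 * s.+1 <= M * M.+1)%N -> r.+1 != M \/ s != M ->
  0 < kfac 4%:R^-1 (Tc (1 - 6%:R * y)) 0 r.+1 s.+1 * kfac 4%:R^-1 (Tc (1 - 6%:R * y')) 0 r.+1 s.+1.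
Proof.
move=> y0 y0' yM yM' /leqE[<- r0 rs _|[d d0 ->] _ rs ne].
  rewrite !kfac_diag !sub0r mulrNN; have r1 : 0 < (r.+1%:R ^+ 2 - 1 : R).
    by rewrite subr_gt0 exprn_egt1 // ltr1n.
  by rewrite mulr_gt0 // divr_gt0 // mulr_gt0.
have p (z : R) : 0 < z -> z * (M * M.+1)%:R < 1 -> 0 < kfac 4%:R^-1 (Tc (1 - 6%:R * z)) 0 r.+1 (r + d).+1.
  have dd : (0 < d ^ 2)%N by rewrite expn_gt0 d0.
  move=> z0 zM; rewrite kfac0 // divr_gt0 // mulr_gt0 //; apply: (pos_of z0 zM) => //; last by nia.
  (* Neighbouring indices are the tight case: the level bound gives r + 1 <= M, the excluded pair is
     r + 1 = M, and r + 2 <= M is exactly what positivity requires. *)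
  have [d1|d1] := eqVneq d 1%N; last by have d2 : (2 <= d)%N by [lia]; have : (4 <= d ^ 2)%N by [nia]; nia.
  rewrite d1 in rs ne *; have rM : (r.+1 <= M)%N by nia.
  have : r.+1 != M by case: ne => //; rewrite addn1.
  by move=> /eqP; nia.
by rewrite mulr_gt0 ?p.
Qed.

(** This pair contains the factor 1 - y (M + 1)(M + 2), whose zero is the upper end of the gap. *)
Lemma kfac0_flip y y' M : (0 < M)%N -> 0 < y -> 0 < y' -> y * (M * M.+1)%:R < 1 -> 1 < y * (M.+1 * M.+2)%:R ->
  y' * (M.+1 * M.+2)%:R < 1 ->
  kfac 4%:R^-1 (Tc (1 - 6%:R * y)) 0 M M.+1 * kfac 4%:R^-1 (Tc (1 - 6%:R * y')) 0 M M.+1 < 0.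
Proof.
case: M => // M _ y0 y0' yM yM1 yM1'; have := kfac0 y M (ltn0Sn 0); have := kfac0 y' M (ltn0Sn 0).
rewrite addn1 exp1n => -> ->.
have p1 : 1 - y * (M.+2 * M.+3)%:R < 0 by lra.
have p2 : 0 < 1 - y * (M * M.+1)%:R by apply: (pos_of (b := 1) y0 yM) => //; nia.
have p3 : 0 < 1 - y' * (M.+2 * M.+3)%:R by lra.
have p4 : 0 < 1 - y' * (M * M.+1)%:R by apply: (pos_of (b := 1) y0' yM1') => //; nia.
rewrite mulr1n pmulr_llt0; last by rewrite divr_gt0 // mulr_gt0.
by rewrite pmulr_llt0 ?invr_gt0 // pmulr_llt0.
Qed.

Lemma prod_sign (I : finType) (P : pred I) (a b : I -> R) (m : I -> nat) :
  (forall x, P x -> (0 < m x)%N -> 0 < a x * b x) ->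
  0 < (\prod_(x | P x) a x ^+ m x) * \prod_(x | P x) b x ^+ m x.
Proof.
move=> h; rewrite -big_split; apply: prodr_gt0 => x Px; rewrite /= -exprMn.
by have := h x Px; case: (m x) => // n /(_ isT); exact: exprn_gt0.
Qed.

Lemma mult_gt0 N r s : (0 < mult N r s)%N -> (r * s <= N)%N.
Proof. by rewrite /mult; case: ifP. Qed.

(* Between two consecutive discrete series values only the factor of (M, M + 1) of
   the determinant at h = 0 changes sign, and no factor at h = 1 does. *)
Lemma vac_gap y y' M : (0 < M)%N -> 0 < y -> 0 < y' -> y * (M * M.+1)%:R < 1 -> 1 < y * (M.+1 * M.+2)%:R ->
  y' * (M.+1 * M.+2)%:R < 1 ->
  \det (vgram ((1 - 6%:R * y) / 2%:R) 0 (M * M.+1)) * \det (vgram ((1 - 6%:R * y') / 2%:R) 0 (M * M.+1)) < 0.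
Proof.
move=> M0 y0 y0' yM yM1 yM1'; have yM' : y' * (M * M.+1)%:R < 1.
  by apply: le_lt_trans yM1'; rewrite ler_pM2l // ler_nat; nia.
have [N NE] : exists N, (M * M.+1 = N.+1)%N by exists (M * M.+1).-1; lia.
rewrite NE; have [K K0 KE] := vac_det R N.
have [K1 K10 K1E] := kac_det R N.
set c := 1 - 6%:R * y; set c' := 1 - 6%:R * y'.
have g : 0 < \det (gram (c / 2%:R) 1 N) * \det (gram (c' / 2%:R) 1 N).
  rewrite !K1E mulrACA; apply: mulr_gt0; first by rewrite mulr_gt0.
  rewrite /kacprod; apply: prod_sign => -[r s] /= rs /mult_gt0 le.
  by apply: (kfac1_sign (M := M)) => //; rewrite NE ltnS.
have v : vprod N c * vprod N c' < 0.
  have M1 : (M.-1 < N.+1)%N by nia.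
  have M2 : (M < N.+1)%N by nia.
  pose x0 : 'I_N.+1 * 'I_N.+1 := (Ordinal M1, Ordinal M2).
  have Px : (x0.1 <= x0.2)%N && (x0 != (ord0, ord0)).
    rewrite /= leq_pred; apply/eqP => -[_ M00]; by move: M0; rewrite M00.
  rewrite /vprod !(bigD1 x0 Px) /= mulrACA prednK //.
  rewrite /mult NE leqnn subnn !expr1 pmulr_llt0; first exact: kfac0_flip.
  apply: prod_sign => -[r s] /= /andP[/andP[rs n0] nx] /mult_gt0 le.
  apply: (kfac0_sign (M := M)) => //; rewrite ?NE //.
    rewrite lt0n; apply/negP => /eqP s0; case/eqP: n0; congr (_, _); apply: val_inj => //=.
    by apply/eqP; rewrite -leqn0 -s0.
  case: (eqVneq r.+1 M) => [rM|_]; last by left.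
  case: (eqVneq (s : nat) M) => [sM|_]; last by right.
  by case/eqP: nx; rewrite /x0; congr (_, _); apply: val_inj => //=; rewrite -rM.
have k2 : 0 < (2%:R ^+ size (parts N) : R) by rewrite exprn_gt0.
have E := congr2 *%R (KE c) (KE c'); rewrite mulrACA [RHS]mulrACA [X in _ * X = _]mulrACA in E.
rewrite -(pmulr_llt0 _ (mulr_gt0 (mulr_gt0 k2 k2) g)) E pmulr_rlt0 //.
exact: mulr_gt0.
Qed.

End Signs.

Theorem vac_psd_nec (R : realType) (c : R) : (forall N, psd (gram (c / 2%:R) 0 N)) ->
  1 <= c \/ exists m : nat, (2 <= m)%N /\ c = 1 - 6%:R / (m * m.+1)%:R.
Proof.
move=> p; have [c1|c1] := lerP 1 c; [by left | right].
have c0 : 0 <= c.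
  (* The norm of L_{-2} om is c / 2. *)
  have [i iE] := part_surj (isT : [:: 2] \in parts 2).
  have := p 2%N (delta_mx 0 i); rewrite /qf -rowE trmx_delta -colE !mxE iE /= !big_cons !big_nil /=.
  by rewrite mulr0 mul0r add0r addr0 mulr1 mul1r; lra.
pose y := (1 - c) / 6%:R; have y0 : 0 < y by rewrite divr_gt0 // subr_gt0.
have cE : c = 1 - 6%:R * y by rewrite /y; field.
have y6 : y * 6%:R <= 1 by rewrite /y divfK //; lra.
have ex : exists M, y * (M * M.+1)%:R <= 1 by exists 2.
(* The archimedean property bounds the index M, since 1 / y does. *)
have bnd M : y * (M * M.+1)%:R <= 1 -> (M <= Num.bound y^-1)%N.
  move=> h; rewrite leqNgt; apply/negP => lt.
  have := archi_boundP (ltW (_ : 0 < y^-1)); rewrite invr_gt0 => /(_ y0) b.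
  have : 1 < y * M%:R.
    rewrite -ltr_pdivrMl // mulr1; apply: lt_trans b _; by rewrite ltr_nat.
  have : y * M%:R <= y * (M * M.+1)%:R by rewrite ler_pM2l // ler_nat; nia.
  lra.
(* With M maximal, equality y M (M + 1) = 1 means c = c_M; otherwise c lies strictly between c_M and
   c_(M+1). *)
pose M := ex_maxn ex bnd.
case: (ex_maxnP ex bnd) => M' yM Mmax; rewrite {M}; move: M' yM Mmax => M yM Mmax.
have M2 : (2 <= M)%N by apply: Mmax.
move: yM; rewrite le_eqVlt => /orP[/eqP e|yM].
  exists M; split=> //; rewrite {1}cE; congr (1 - _ * _).
  by apply: (mulIf (x := (M * M.+1)%:R)); rewrite ?mulVf // pnatr_eq0; nia.
have yM1 : 1 < y * (M.+1 * M.+2)%:R.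
  by rewrite ltNge; apply/negP => /Mmax; rewrite ltnn.
(* This is the parameter of c_(M+2). Both forms are semidefinite, so both determinants are
   nonnegative, whereas [vac_gap] makes their product negative. *)
exfalso; pose y' : R := (M.+2 * M.+3)%:R^-1.
have y'0 : 0 < y' by rewrite invr_gt0 ltr0n.
have y'M : y' * (M.+1 * M.+2)%:R < 1.
  by rewrite mulrC ltr_pdivrMr ?ltr0n // mul1r ltr_nat; nia.
have := vac_gap (ltnW M2) y0 y'0 yM yM1 y'M; apply/negP; rewrite -leNgt; apply: mulr_ge0; apply: psd_det.
- exact: vgram_sym.
- by apply: vgram_psd; rewrite -cE.
- exact: vgram_sym.
- by apply: vgram_psd; apply: (@gram_psd_min _ M.+2).
Qed.

(** * The Heisenberg coset *)

Section HeisenbergCoset.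
Variables (F : numFieldType) (V : lmodType F) (c l : F) (L b : int -> {linear V -> V}).
Hypotheses (l0 : l != 0) (btr : truncated b) (Lvir : is_vir c L).
Hypothesis bb : forall m n v, b m (b n v) - b n (b m v) = (if m + n == 0 then m%:~R * l else 0) *: v.
Hypothesis Lb : forall m n v, L m (b n v) - b n (L m v) = - n%:~R *: b (m + n) v.

Let S := virL l 0 btr.

Let Sb (m n : int) v : S m (b n v) - b n (S m v) = - n%:~R *: b (m + n) v.
Proof. by rewrite (virL_b 0 l0 btr bb) !mul0r; case: ifP => _; rewrite scale0r subr0. Qed.

Lemma hcoset_linear (n : int) : linear (fun v => L n v - S n v).
Proof.
move=> a u v; rewrite [L n _]linearP [S n _]linearP.
by move: (L n u) (L n v) (S n u) (S n v) => x1 x2 x3 x4; lmodule F.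
Qed.

Definition hcoset (n : int) : {linear V -> V} := linmk (hcoset_linear n).

Lemma hcosetE (n : int) v : hcoset n v = L n v - S n v.
Proof. exact: linmkE. Qed.

Lemma hcoset_b (m n : int) v : hcoset m (b n v) = b n (hcoset m v).
Proof.
apply/eqP; rewrite -subr_eq0 !hcosetE linearB; apply/eqP.
have := Lb m n v; rewrite -(Sb m n v).
move: (L m (b n v)) (S m (b n v)) (b n (L m v)) (b n (S m v)) => x1 x2 x3 x4 e.
have -> : x1 = (x2 - x4) + x3 by rewrite -e subrK.
by lmodule F.
Qed.

Lemma hcoset_S (m n : int) v : hcoset m (S n v) = S n (hcoset m v).
Proof.
have e x : fsum (fun q => b (n - q) (b q (hcoset m v))) x = hcoset m (fsum (fun q => b (n - q) (b q v)) x).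
  have ev : evz (fun q => b (n - q) (b q v)).
    by have [N hN] := btr v; exists N => i /hN ei; rewrite ei linear0.
  rewrite (fsum_additive (hcoset m) x ev); apply: eq_fsum => q _.
  by rewrite -!hcoset_b.
by rewrite /S !virL_fsum !mul0r !scale0r !subr0 !e -linearD -linearZ.
Qed.

Lemma hcoset_vir : is_vir (c - 1) hcoset.
Proof.
have Svir : is_vir 1 S by have := virL_vir 0 l0 btr bb; rewrite expr0n mulr0 subr0.
move=> m n v; have e1 := Lvir m n v; have e2 := Svir m n v.
have E p q : hcoset p (hcoset q v) = L p (L q v) - S p (L q v) - S q (L p v) + S q (S p v).
  by rewrite [hcoset q v]hcosetE linearB hcoset_S !hcosetE linearB opprD opprK addrA.
rewrite !E [hcoset (m + n) v]hcosetE.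
transitivity ((L m (L n v) - L n (L m v)) - (S m (S n v) - S n (S m v))).
  move: (L m (L n v)) (L n (L m v)) (S m (S n v)) (S n (S m v)) (S m (L n v)) (S n (L m v)).
  by move=> x1 x2 x3 x4 x5 x6; lmodule F.
rewrite e1 e2; move: (L _ _) (S _ _) => x1 x2.
by case: eqP => _; lmodule F.
Qed.

End HeisenbergCoset.

Section ModewisePositivity.
Variables (F : numClosedFieldType) (V : lmodType F) (l : F) (b : int -> {linear V -> V}) (h : V -> V -> F).
Hypotheses (l0 : 0 < l) (btr : truncated b).
Hypothesis bb : forall m n v, b m (b n v) - b n (b m v) = (if m + n == 0 then m%:~R * l else 0) *: v.
Hypothesis nilp : forall (n : nat) v, exists d, iter d (b n.+1) v = 0.
Hypothesis hl : forall a u u' v, h (a *: u + u') v = a * h u v + h u' v.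
Hypothesis hc : forall u v, h v u = (h u v)^*.
Hypothesis hb : forall (n : int) u v, h (b n u) v = h u (b (- n) v).

Let bN (n : nat) d v : iter d (b n.+1) (b (- n.+1%:Z) v) =
  b (- n.+1%:Z) (iter d (b n.+1) v) + (d%:R * (n.+1%:R * l)) *: iter d.-1 (b n.+1) v.
Proof.
elim: d => [|d IH]; first by rewrite mul0r scale0r addr0.
have := bb n.+1 (- n.+1%:Z) (iter d (b n.+1) v); rewrite subrr eqxx => /(canRL (subrK _)).
rewrite iterS IH linearD linearZ => -> /=.
case: d {IH} => [|d] /=; first by rewrite mul0r scale0r addr0 addrC mul1r.
rewrite -[in RHS]natr1 /=; move: (b n.+1 _) (b (- n.+1%:Z) _) => x y.
by rewrite (_ : n.+1%:~R = n.+1%:R) //; lmodule F.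
Qed.

(* Every v killed by b_m for m > N + 1 is a sum of b_{-N-1}^d w_d with b_{N+1} w_d = 0,
   and these summands are mutually orthogonal. *)
Lemma modewise_step N : (forall v, (forall m : nat, (N < m)%N -> b m v = 0) -> 0 <= h v v) ->
  forall v, (forall m : nat, (N.+1 < m)%N -> b m v = 0) -> 0 <= h v v.
Proof.
move=> IHN; set n := N; pose a : V -> V := b n.+1; pose a' : V -> V := b (- n.+1%:Z).
have hD u u' v : h (u + u') v = h u v + h u' v by rewrite -[in LHS](scale1r u) hl mul1r.
have hD' u v v' : h u (v + v') = h u v + h u v' by rewrite (hc v) (hc v') -rmorphD -hD hc.
have h0 v : h v 0 = 0 by apply: (addrI (h v 0)); rewrite -hD' !addr0.
have aa' u v : h (a u) v = h u (a' v) by exact: hb.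
have aa'r u v : h (a' u) v = h u (a v) by rewrite /a' hb opprK.
have itera d u v : h (iter d a' u) v = h u (iter d a v).
  by elim: d v => //= d IH v; rewrite aa'r IH -iterSr.
have comm (m : nat) d v : (N < m)%N -> m != n.+1 -> b m (iter d a' v) = iter d a' (b m v).
  move=> Nm mn; elim: d => //= d IH; have := bb m (- n.+1%:Z) (iter d a' v).
  rewrite subr_eq0 eqz_nat (negPf mn) scale0r => /eqP; rewrite subr_eq0 => /eqP ->.
  by rewrite IH.
have comm' (m : nat) d v : b m (iter d a v) = iter d a (b m v).
  elim: d => //= d IH; have := bb m n.+1 (iter d a v); rewrite ifF ?scale0r; [move=> /eqP | by apply/eqP; lia].
  by rewrite subr_eq0 => /eqP ->; rewrite IH.
have zero d : iter d a 0 = 0 by elim: d => //= d ->; rewrite /a linear0.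
have zero' d : iter d a' 0 = 0 by elim: d => //= d ->; rewrite /a' linear0.
have lower d : exists2 k : F, 0 < k & forall w, a w = 0 -> iter d a (iter d a' w) = k *: w.
  elim: d => [|d [k k0 e]]; first by exists 1 => // w _; rewrite scale1r.
  exists (k * (d.+1%:R * (n.+1%:R * l))) => [|w aw]; first by rewrite !mulr_gt0 // ltr0n.
  have aZ z x : a (z *: x) = z *: a x by rewrite /a linearZ.
  have := bN n d.+1 (iter d a' w); rewrite -/a -/a' [iter d.+1 a (iter d _ _)]iterS (e w aw) aZ aw scaler0.
  rewrite [iter d.+1 a' w]iterS => ->; rewrite /a' linear0 add0r.
  by rewrite scalerA mulrC.
move=> v vN; have [d dE] := nilp n v; rewrite -/a in dE.
elim: d v vN dE => [|d IH] v vN dE; first by rewrite /= in dE; rewrite dE h0.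
(* [w] is the coefficient of the highest power of b_{-n-1} in v; subtracting that term lowers by one
   the power of b_{n+1} that kills v. *)
have [k k0 kE] := lower d; set w := k^-1 *: iter d a v.
have kw : k *: w = iter d a v by rewrite scalerA divff ?scale1r // gt_eqF.
have aw : a w = 0 by rewrite /w /a linearZ /= -[b n.+1 _]/(iter d.+1 a v) dE scaler0.
have itB d' x y : iter d' a (x - y) = iter d' a x - iter d' a y.
  by elim: d' => //= d' ->; rewrite /a linearB.
pose v' := v - iter d a' w.
have dv' : iter d a v' = 0 by rewrite itB kE // kw subrr.
have wN (m : nat) : (N < m)%N -> b m w = 0.
  rewrite leq_eqVlt => /orP[/eqP <- //|Nm].
  by rewrite /w linearZ /= comm' vN // zero scaler0.
have vE : v = v' + iter d a' w by rewrite subrK.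
have c1 : h (iter d a' w) v' = 0 by rewrite itera dv' h0.
have c2 : h v' (iter d a' w) = 0 by rewrite hc c1 rmorph0.
have vN' (m : nat) : (N.+1 < m)%N -> b m v' = 0.
  move=> Nm; rewrite linearB vN // comm ?(ltnW Nm) ?gtn_eqF //.
  by rewrite wN ?(ltnW Nm) // zero' subrr.
clearbody v' w; rewrite vE hD (hD' v') (hD' (iter _ _ _)) c1 c2 addr0 add0r.
apply: addr_ge0; first exact: IH vN' dv'.
have hZ x : h x (k *: x) = k * h x x.
  have hxx : (h x x)^* = h x x by rewrite -hc.
  rewrite (hc (k *: x)) -[k *: x]addr0 hl (hc x 0) h0 rmorph0 addr0 rmorphM /= hxx.
  by rewrite (conj_Creal (gtr0_real k0)).
by rewrite itera kE // hZ mulr_ge0 ?(ltW k0) // IHN.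
Qed.

Lemma modewise_psd : (forall v, (forall m : nat, b m.+1 v = 0) -> 0 <= h v v) -> forall v, 0 <= h v v.
Proof.
move=> K v; have [M hM] := btr v.
suff H : forall N v, (forall m : nat, (N < m)%N -> b m v = 0) -> 0 <= h v v.
  by apply: (H `|M|%N) => m lt; apply: hM; lia.
by elim=> [|N IH] u uN; [apply: K => m; exact: uN | exact: (modewise_step IH)].
Qed.

End ModewisePositivity.

(** * The vertex algebra *)

Section Voa.
Variables (R : realType) (l1 l2 l3 : R[i]) (V : lmodType R[i]).
Variables (Y : V -> int -> V -> V) (one om I : V).
Let C := (R[i] : numClosedFieldType).
Hypothesis LL : is_LL Y l1 l2 l3 one om I.

Lemma Y_linear u n : linear (Y u n).
Proof. by case: LL => [[[[[_ h] _ _ _] _] _ _] _] a x y; exact: h. Qed.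

Definition Lo (n : int) : {linear V -> V} := linmk (Y_linear om (n + 1)).
Definition Jo (n : int) : {linear V -> V} := linmk (Y_linear I n).

Lemma LoE n v : Lo n v = Lop Y om n v. Proof. exact: linmkE. Qed.
Lemma JoE n v : Jo n v = Iop Y I n v. Proof. exact: linmkE. Qed.

Lemma Lo_vir : @is_vir C V l1 Lo.
Proof. by case: LL => [[[_ [h _ _]] _ _] _] m n v; rewrite !LoE. Qed.

Lemma J_J m n v : Jo m (Jo n v) - Jo n (Jo m v) = (if m + n == 0 then m%:~R * l3 else 0) *: v.
Proof. by case: LL => [_ [_ h _ _]]; rewrite !JoE; exact: h. Qed.

Lemma Lo_one (n : int) : -1 <= n -> Lo n one = 0.
Proof. by case: LL => [[[[_ _ [_ [_ h]] _] _] _ _] _] n1; rewrite LoE /Lop h //; lia. Qed.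

Lemma Jo_one (n : int) : 0 <= n -> Jo n one = 0.
Proof. by case: LL => [[[[_ _ [_ [_ h]] _] _] _ _] _] n1; rewrite JoE /Iop h. Qed.

Lemma Lo_om : Lo (-2) one = om.
Proof. by case: LL => [[[[_ _ [_ [h _]] _] _] _ _] _]; rewrite LoE /Lop h. Qed.

Lemma one_neq0 : one <> 0. Proof. by case: LL => [[]]. Qed.

Definition lsub (W : V -> Prop) := [/\ W 0, forall a u v, W u -> W v -> W (a *: u + v),
  forall n v, W v -> W (Lo n v) & forall n v, W v -> W (Jo n v)].

Lemma lsubP W : lsub W -> is_L_submodule Y om I W.
Proof.
by case=> h1 h2 h3 h4; split=> // n v Wv; [rewrite -LoE; apply: h3 | rewrite -JoE; apply: h4].
Qed.

Lemma generated W : lsub W -> W one -> forall v, W v.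
Proof. by case: LL => [_ [_ _ h _]] /lsubP; exact: h. Qed.

Lemma irreducible W : lsub W -> forall w, W w -> w <> 0 -> forall v, W v.
Proof. by case: LL => [_ [_ _ _ h]] /lsubP sW w Ww w0; apply: h => //; exists w. Qed.

Section Weights.

(** The product of the L_0 - k over k in [K], applied to v. These polynomials in L_0 separate weight
    components without projections. *)
Fixpoint wtop (K : seq int) (v : V) : V := if K is k :: K' then Lo 0 (wtop K' v) - k%:~R *: wtop K' v else v.

Lemma wtop_cat K K' v : wtop (K ++ K') v = wtop K (wtop K' v).
Proof. by elim: K => //= k K ->. Qed.

Lemma wtop_lin K a u v : wtop K (a *: u + v) = a *: wtop K u + wtop K v.
Proof.
elim: K => //= k K ->; rewrite linearP /=.
by move: (Lo 0 (wtop K u)) (Lo 0 (wtop K v)) (wtop K u) (wtop K v) => x1 x2 x3 x4; lmodule C.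
Qed.

Lemma wtop0 K : wtop K 0 = 0.
Proof. by elim: K => //= k K ->; rewrite linear0 scaler0 subrr. Qed.

Lemma wtopC K K' v : wtop K (wtop K' v) = wtop K' (wtop K v).
Proof.
have L0 K1 x : wtop K1 (Lo 0 x) = Lo 0 (wtop K1 x).
  by elim: K1 => //= k K1 ->; rewrite [RHS]linearB [X in _ = _ - X]linearZ.
elim: K => //= k K ->; rewrite -L0 -scaleN1r -[_ *: wtop K' _]addr0 -(wtop0 K') -wtop_lin addr0.
by rewrite addrC -wtop_lin scaleN1r addrC.
Qed.

Lemma wtop_wt K k v : has_weight Y om k v -> wtop K v = (\prod_(j <- K) (k - j)%:~R) *: v.
Proof.
rewrite /has_weight -LoE => kv; elim: K => [|j K IH] /=; first by rewrite big_nil scale1r.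
by rewrite IH linearZ /= kv big_cons !scalerA -scalerBl; congr (_ *: _); rewrite rmorphB; ring.
Qed.

Lemma weight_L k (n : int) v : has_weight Y om k v -> has_weight Y om (k - n) (Lo n v).
Proof.
rewrite /has_weight -!LoE => kv; have := Lo_vir 0 n v; rewrite kv linearZ /= => /(canRL (subrK _)) ->.
have -> : ((0 : int) ^+ 3 - 0)%:~R = 0 :> C by rewrite subr0 expr0n.
by rewrite !mul0r if_same scale0r addr0 !add0r -scalerDl -rmorphD addrC.
Qed.

Lemma weight_J k (n : int) v : l2 = 0 -> has_weight Y om k v -> has_weight Y om (k - n) (Jo n v).
Proof.
rewrite /has_weight -!LoE => l20 kv; have [_ [/(_ 0 n v) h _ _ _]] := LL; move: h.
rewrite -!LoE -!JoE kv l20 mulr0 if_same scale0r subr0 linearZ /= => /(canRL (subrK _)) ->.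
by rewrite add0r -scalerDl -rmorphN -rmorphD addrC.
Qed.

Lemma weight_one : has_weight Y om 0 one.
Proof. by rewrite /has_weight -LoE Lo_one // scale0r. Qed.

Lemma weight_neg k v : k < 0 -> has_weight Y om k v -> v = 0.
Proof. by case: LL => [[_ [h _] _] _]; exact: h. Qed.

Lemma weight_ind (P : V -> Prop) : (forall u v, P u -> P v -> P (u + v)) -> P 0 ->
  (forall k : nat, forall v, has_weight Y om k%:Z v -> P v) -> forall v, P v.
Proof.
move=> PD P0 Pk v; have [[[_ [_ _ [h _ _]]] _ _] _] := LL.
have [s [k [w [kw ->]]]] := h v; apply: (big_ind P) => // i _.
have := kw i; case: (k i) => [n /Pk //|n kwi]; rewrite (@weight_neg (Negz n) (w i)) //.
Qed.

Definition posw v := exists2 K : seq int, all (fun k => 0 < k) K & wtop K v = 0.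

Lemma posw_lin a u v : posw u -> posw v -> posw (a *: u + v).
Proof.
case=> K Kp e [K' Kp' e']; exists (K ++ K'); first by rewrite all_cat Kp.
by rewrite wtop_cat wtop_lin e' addr0 -[_ *: _]addr0 wtop_lin wtopC e !wtop0 scaler0 addr0.
Qed.

Lemma posw_wt (k : int) v : 0 < k -> has_weight Y om k v -> posw v.
Proof. by move=> k0 kv; exists [:: k]; rewrite /= ?k0 // LoE kv subrr. Qed.

Lemma posw_one a : posw (a *: one) -> a = 0.
Proof.
case=> K Kp; rewrite -[_ *: _]addr0 wtop_lin wtop0 addr0 (wtop_wt K weight_one) scalerA => /eqP.
rewrite scaler_eq0 => /orP[|/eqP /one_neq0 //]; rewrite mulf_eq0 => /orP[/eqP //|].
rewrite prodf_seq_eq0 => /hasP[k kK] /=; rewrite sub0r intr_eq0 oppr_eq0 => /eqP k0.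
by have := allP Kp k kK; rewrite k0.
Qed.

(** The coefficient of the vacuum: [f v] is the only a with v - a one in the sum of the positive
    weight spaces. It exists because V is graded of CFT type, and negative modes only produce
    positive weights. *)
Lemma vacuum_functional : l2 = 0 -> exists f : {scalar V}, [/\ f one = 1,
  forall (n : nat) x, f (Lo (- n.+1%:Z) x) = 0 & forall (n : nat) x, f (Jo (- n.+1%:Z) x) = 0].
Proof.
move=> l20; have posw0 : posw 0 by exists [::].
have poswD u v : posw u -> posw v -> posw (u + v) by rewrite -{2}[u]scale1r; exact: posw_lin.
have /choice[g gP] : forall v, exists a : C, posw (v - a *: one).
  apply: weight_ind => [u v [a ua] [b vb]||[|k] v kv].
  - by exists (a + b); rewrite scalerDl opprD addrACA; exact: poswD.
  - by exists 0; rewrite scale0r subrr.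
  - case: LL => [[_ [_ /(_ v kv)[a ->]] _] _]; exists a; by rewrite subrr.
  - by exists 0; rewrite scale0r subr0; apply: posw_wt kv.
have gE v a : posw (v - a *: one) -> g v = a.
  move=> va; apply/eqP; rewrite -subr_eq0; apply/eqP/posw_one.
  by have := posw_lin (-1) (gP v) va; congr posw; lmodule C.
have glin : linear (g : V -> C^o).
  move=> a u v; apply: gE; have := posw_lin a (gP u) (gP v); congr posw.
  by rewrite -[a *: (g u : C^o)]/(a * g u); lmodule C.
pose f : {scalar V} := linmk glin; have fE v : f v = g v by rewrite /f linmkE.
exists f; split=> [|n|n].
- by rewrite fE; apply: gE; rewrite scale1r subrr.
- apply: weight_ind => [u v e e'||k v kv]; first by rewrite !linearD /= e e' addr0.
    by rewrite !linear0.
  rewrite fE; apply: gE; rewrite scale0r subr0; apply: (@posw_wt (k%:Z - - n.+1%:Z)); first by lia.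
  exact: weight_L.
- apply: weight_ind => [u v e e'||k v kv]; first by rewrite !linearD /= e e' addr0.
    by rewrite !linear0.
  rewrite fE; apply: gE; rewrite scale0r subr0; apply: (@posw_wt (k%:Z - - n.+1%:Z)); first by lia.
  exact: weight_J.
Qed.

End Weights.

Lemma lo_nilp (n : nat) v : exists d, iter d (Lo n.+1) v = 0.
Proof.
have iD d u w : iter d (Lo n.+1) (u + w) = iter d (Lo n.+1) u + iter d (Lo n.+1) w.
  by elim: d => //= d ->; rewrite linearD.
have i0 d : iter d (Lo n.+1) 0 = 0 by elim: d => //= d ->; rewrite linear0.
move: v; apply: weight_ind => [u v [d e] [d' e']||k v kv].
- by exists (d + d')%N; rewrite iD {1}addnC !iterD e e' !i0 addr0.
- by exists 0%N.
- exists k.+1; apply: (@weight_neg (k%:Z - (k.+1 * n.+1)%:Z)); first by lia.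
  elim: k.+1 => [|d IH] //=; first by rewrite mul0n subr0.
  by have := @weight_L _ n.+1 _ IH; congr has_weight; lia.
Qed.

Section Words.
Definition letter : Type := bool * int.
Implicit Types (x y : letter) (w z : seq letter).

Definition op x : {linear V -> V} := if x.1 then Jo x.2 else Lo x.2.
Definition zap w v : V := foldr (fun x u => op x u) v w.
Definition wspan v := exists s : seq (C * seq letter), v = \sum_(x <- s) x.1 *: zap x.2 one.

Lemma zap_cat w z v : zap (w ++ z) v = zap w (zap z v).
Proof. by rewrite /zap foldr_cat. Qed.

Lemma zapP w : linear (zap w).
Proof. by elim: w => //= x w IH a u v; rewrite /zap /= -!/(zap w _) IH linearP. Qed.

Lemma zap0 w : zap w 0 = 0.
Proof. by elim: w => //= x w ->; rewrite linear0. Qed.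

Lemma zap_sum w (T : Type) (s : seq T) (a : T -> C) (u : T -> V) :
  zap w (\sum_(i <- s) a i *: u i) = \sum_(i <- s) a i *: zap w (u i).
Proof. by elim/big_rec2: _ => [|i x y _ <-]; [exact: zap0 | rewrite zapP]. Qed.

Lemma wspan_op x v : wspan v -> wspan (op x v).
Proof.
case=> s ->; exists [seq (p.1, x :: p.2) | p <- s].
by rewrite big_map linear_sum; apply: eq_bigr => y _; rewrite linearZ.
Qed.

Lemma all_wspan v : wspan v.
Proof.
move: v; apply: generated; last by exists [:: (1, [::])]; rewrite big_seq1 scale1r.
split.
- by exists [::]; rewrite big_nil.
- move=> a u v [s ->] [t ->]; exists ([seq (a * p.1, p.2) | p <- s] ++ t).
  by rewrite big_cat big_map scaler_sumr /=; congr (_ + _); apply: eq_bigr => p _; rewrite scalerA.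
- by move=> n v; exact: (@wspan_op (false, n)).
- by move=> n v; exact: (@wspan_op (true, n)).
Qed.

Hypothesis l20 : l2 = 0.

Lemma L_J (m n : int) v : Lo m (Jo n v) - Jo n (Lo m v) = - n%:~R *: Jo (m + n) v.
Proof.
have [_ [/(_ m n v) h _ _ _]] := LL; move: h.
by rewrite -!LoE -!JoE l20 mulr0 if_same scale0r subr0.
Qed.

Definition brl x y : letter := (x.1 || y.1, x.2 + y.2).
Definition bra x y : int := if x.1 then (if y.1 then 0 else x.2) else if y.1 then - y.2 else x.2 - y.2.
Definition brc x y : C :=
  if (x.2 + y.2 == 0) && (x.1 == y.1) then (if x.1 then x.2%:~R * l3 else (x.2 ^+ 3 - x.2)%:~R / 12%:R * l1) else 0.

Lemma op_swap x y v : op x (op y v) = op y (op x v) + (bra x y)%:~R *: op (brl x y) v + brc x y *: v.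
Proof.
rewrite -addrA addrC; apply: (canRL (subrK _)).
case: x y => [[] m] [[] n]; rewrite /op /brl /bra /brc /= ?eqxx ?andbT ?andbF ?mulr0z ?scale0r ?add0r ?addr0.
- exact: J_J.
- by rewrite -opprB L_J addrC scaleNr opprK.
- by rewrite L_J rmorphN.
- exact: Lo_vir.
Qed.

Lemma zapD w u v : zap w (u + v) = zap w u + zap w v.
Proof. by rewrite -[in LHS](scale1r u) zapP scale1r. Qed.

Lemma zapZ w a v : zap w (a *: v) = a *: zap w v.
Proof. by rewrite -[a *: v]addr0 zapP zap0 addr0. Qed.

Lemma zap_swap w1 x y w2 v : zap (w1 ++ x :: y :: w2) v = zap (w1 ++ y :: x :: w2) v
  + (bra x y)%:~R *: zap (w1 ++ brl x y :: w2) v + brc x y *: zap (w1 ++ w2) v.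
Proof. by rewrite !zap_cat /= op_swap !zapD !zapZ. Qed.

Definition nJ w := count fst w.
Definition dag w : seq letter := rev [seq (x.1, - x.2) | x <- w].

Lemma dag_cat w z : dag (w ++ z) = dag z ++ dag w.
Proof. by rewrite /dag map_cat rev_cat. Qed.

Lemma dagK : involutive dag.
Proof.
move=> w; rewrite /dag map_rev revK -map_comp -[RHS]map_id.
by apply: eq_map => -[b n] /=; rewrite opprK.
Qed.

Definition ann x := if x.1 then 0 <= x.2 else -1 <= x.2.

Lemma ann_one x : ann x -> op x one = 0.
Proof. by case: x => [[] n]; [exact: Jo_one | exact: Lo_one]. Qed.

Lemma zap_ann w x : ann x -> zap (rcons w x) one = 0.
Proof. by move=> /ann_one xo; rewrite -cats1 zap_cat /= xo zap0. Qed.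

(* A word is a permutation of a word ending in an annihilator of the vacuum, or of a
   sorted creation monomial, and moving letters around only creates shorter words. *)
Lemma monomial_ind (good : seq letter -> Prop) :
  (forall w1 x y w2, (forall w, (size w < size (w1 ++ x :: y :: w2))%N -> good w) ->
    good (w1 ++ x :: y :: w2) -> good (w1 ++ y :: x :: w2)) ->
  (forall w x, ann x -> good (rcons w x)) ->
  (forall ks ms, sorted geq ks -> all (fun k => 0 < k)%N ks -> sorted geq ms -> all (fun m => 1 < m)%N ms ->
    good ([seq (true, - k%:Z) | k <- ks] ++ [seq (false, - m%:Z) | m <- ms])) -> forall w, good w.
Proof.
move=> sw ga gm; apply: word_ind => // w _.
have [/hasP[x xw ax]|] := boolP (has ann w).
  exists (rcons (rem x w) x); last exact: ga.
  by rewrite perm_sym perm_rcons perm_sym perm_to_rem.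
rewrite -all_predC => /allP na.
pose ks := sort geq [seq `|x.2|%N | x <- w & x.1]; pose ms := sort geq [seq `|x.2|%N | x <- w & ~~ x.1].
have st (s : seq nat) : sorted geq (sort geq s) by apply: sort_sorted => a b; exact: leq_total.
have pk (b : bool) (s : seq letter) : {subset s <= w} -> all (fun x => x.1 == b) s ->
    perm_eq s [seq (b, - m%:Z) | m <- sort geq [seq `|x.2|%N | x <- s]].
  move=> sub /allP sb; rewrite perm_sym; apply: (perm_trans (perm_map _ (permEl (perm_sort _ _)))).
  rewrite -map_comp (eq_in_map _ id _).1 ?map_id // => -[c n] xs /=.
  by have /= /eqP <- := sb _ xs; have := na _ (sub _ xs); rewrite /= /ann; case: c {xs} => /= h; congr (_, _); lia.
exists ([seq (true, - k%:Z) | k <- ks] ++ [seq (false, - m%:Z) | m <- ms]).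
  have /permPr <- : perm_eq (filter fst w ++ filter (predC fst) w)
      ([seq (true, - k%:Z) | k <- ks] ++ [seq (false, - m%:Z) | m <- ms]).
    apply: perm_cat; apply: pk => [x|]; rewrite ?mem_filter; try by case/andP.
    + by apply/allP => x; rewrite mem_filter => /andP[-> _].
    + by apply/allP => x; rewrite mem_filter => /andP[/negPf /= -> _].
  by rewrite perm_sym perm_filterC.
apply: gm; rewrite ?/ks ?/ms ?st // all_sort; apply/allP => n /mapP[[b k]]; rewrite mem_filter => /andP[/= bb xw] ->;
  by have := na _ xw; rewrite /= /ann; case: b bb {xw} => //= _; lia.
Qed.

Lemma parity_brl x y w1 w2 : bra x y != 0 -> nJ (w1 ++ x :: y :: w2) = nJ (w1 ++ brl x y :: w2).
Proof. by case: x y => [[] m] [[] n] //; rewrite /nJ !count_cat. Qed.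

Lemma parity_brc x y w1 w2 : brc x y != 0 -> odd (nJ (w1 ++ x :: y :: w2)) = odd (nJ (w1 ++ w2)).
Proof.
rewrite /brc; case: ifP => [/andP[_ /eqP e] _|]; last by rewrite eqxx.
by rewrite /nJ !count_cat /= e !oddD; case: y.1; rewrite /= ?addbT ?addbN ?negbK.
Qed.

Definition G (b : bool) : V := if b then I else om.

Lemma Y_one n v : Y one n v = if n == -1 then v else 0.
Proof. by case: LL => [[[[_ _ [h _] _] _] _ _] _]; exact: h. Qed.

Lemma Yl n a u u' v : Y (a *: u + u') n v = a *: Y u n v + Y u' n v.
Proof. by case: LL => [[[[[h _] _ _ _] _] _ _] _]; exact: h. Qed.

Lemma Y0 n v : Y 0 n v = 0.
Proof. by have := Yl n (-1) 0 0 v; rewrite scaler0 addr0 scaleN1r addNr. Qed.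

Lemma YZl n a u v : Y (a *: u) n v = a *: Y u n v.
Proof. by rewrite -[a *: u]addr0 Yl Y0 addr0. Qed.

Lemma Y0r u n : Y u n 0 = 0.
Proof. by have := Y_linear u n (-1) 0 0; rewrite scaler0 addr0 scaleN1r addNr. Qed.

Lemma YZr n a u v : Y u n (a *: v) = a *: Y u n v.
Proof. by rewrite -[a *: v]addr0 Y_linear Y0r addr0. Qed.

Lemma Y_trunc u v (n : int) : exists N, forall i : nat, (N <= i)%N -> Y u (n + i%:Z) v = 0.
Proof.
case: LL => [[[[_ /(_ u v)[M hM] _ _] _] _ _] _]; exists `|M - n|%N => i le; apply: hM; lia.
Qed.

Lemma borcherds a b c (p q r : int) : exists N0, forall N, (N0 <= N)%N ->
  \sum_(i < N) binC R p i *: Y (Y a (r + i%:Z) b) (p + q - i%:Z) c =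
  \sum_(i < N) ((-1) ^+ i * binC R r i) *:
    (Y a (p + r - i%:Z) (Y b (q + i%:Z) c) - (-1) ^+ `|r|%N *: Y b (q + r - i%:Z) (Y a (p + i%:Z) c)).
Proof.
have [N1 h1] := Y_trunc a b r; have [N2 h2] := Y_trunc b c q; have [N3 h3] := Y_trunc a c p.
exists (N1 + N2 + N3)%N => N le; case: LL => [[[[_ _ _ h] _] _ _] _]; apply: h => i Ni.
by split; [apply: h1 | apply: h2 | apply: h3]; lia.
Qed.

Lemma binC0 i : binC R 0 i = (i == 0%N)%:R.
Proof.
by case: i => [|i]; rewrite /binC ?big_ord0 ?divr1 // big_ord_recl mulr0z subrr !mul0r.
Qed.

Lemma conj_binC r i : (binC R r i)^* = binC R r i.
Proof.
rewrite /binC fmorph_div rmorph_nat rmorph_prod; congr (_ / _); apply: eq_bigr => j _.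
by rewrite rmorphB rmorph_int rmorph_nat.
Qed.

(** The Borcherds identity at p = 0, where the binomials leave only the term i = 0 on the left. *)
Lemma iterate b r u q v : exists N0, forall N, (N0 <= N)%N -> Y (Y (G b) r u) q v =
  \sum_(i < N) ((-1) ^+ i * binC R r i) *:
    (Y (G b) (r - i%:Z) (Y u (q + i%:Z) v) - (-1) ^+ `|r|%N *: Y u (q + r - i%:Z) (Y (G b) i%:Z v)).
Proof.
have [N0 h] := borcherds (G b) u v 0 q r; exists N0.+1 => -[//|N] /ltnW le.
transitivity (\sum_(i < N.+1) binC R 0 i *: Y (Y (G b) (r + i%:Z) u) (0 + q - i%:Z) v).
  rewrite big_ord_recl binC0 scale1r big1 ?addr0 => [|i _]; last by rewrite binC0 scale0r.
  by rewrite add0r.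
by rewrite h //; apply: eq_bigr => i _; rewrite !add0r.
Qed.

Section Form.
Hypotheses (l1r : l1^* = l1) (l3r : l3^* = l3).

Lemma conj_bra x y : ((bra x y)%:~R : C)^* = (bra x y)%:~R.
Proof. by rewrite rmorph_int. Qed.

Lemma conj_brc x y : (brc x y)^* = brc x y.
Proof.
rewrite /brc; case: ifP => _; last by rewrite rmorph0.
by case: ifP => _; rewrite rmorphM /= ?rmorphM ?rmorph_int ?l1r ?l3r //= fmorphV rmorph_nat.
Qed.

Definition neg x : letter := (x.1, - x.2).

Lemma bra_neg x y : bra (neg y) (neg x) = bra x y.
Proof. by case: x y => [[] m] [[] n]; rewrite /bra /= ?opprK // addrC. Qed.

Lemma brl_neg x y : brl (neg y) (neg x) = neg (brl x y).
Proof. by rewrite /brl /neg /= orbC opprD addrC. Qed.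

Lemma brc_neg x y : brc (neg y) (neg x) = brc x y.
Proof.
rewrite /brc /= -opprD oppr_eq0 [y.2 + _]addrC [y.1 == _]eq_sym; case: ifP => // /andP[/eqP e /eqP ->].
by rewrite (_ : - y.2 = x.2) //; lia.
Qed.

(** The Hermitian symmetry of the form to come. As l1 and l3 are real, reversing a word and negating
    its modes respects all brackets, and a letter of nonzero mode can be moved to an end where both
    sides vanish. *)
Lemma functional_dag (f : {scalar V}) :
  (forall (n : nat) v, f (Lo (- n.+1%:Z) v) = 0) -> (forall (n : nat) v, f (Jo (- n.+1%:Z) v) = 0) ->
  f one = 1 -> forall w, f (zap (dag w) one) = (f (zap w one))^*.
Proof.
move=> fL fJ f1; have fneg x v : x.2 < 0 -> f (op x v) = 0.
  case: x => b n /= n0; have -> : n = - (`|n|.-1).+1%:Z by lia.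
  by case: b; [exact: fJ | exact: fL].
have kill x : 0 <= x.2 -> op x one = 0.
  by move=> x0; apply: ann_one; rewrite /ann; case: x.1 => //; lia.
have d1 w1 x w2 : dag (w1 ++ x :: w2) = dag w2 ++ neg x :: dag w1.
  by rewrite dag_cat /dag /= rev_cons -cats1 -catA.
have d2 w1 x y w2 : dag (w1 ++ x :: y :: w2) = dag w2 ++ neg y :: neg x :: dag w1.
  by rewrite dag_cat /dag /= !rev_cons -!cats1 -!catA.
apply: word_ind => [w1 x y w2 short good_xy|w _].
  have s1 := short (w1 ++ brl x y :: w2); have s2 := short (w1 ++ w2).
  have fE w1' x' y' w2' : f (zap (w1' ++ x' :: y' :: w2') one) = f (zap (w1' ++ y' :: x' :: w2') one) +
      (bra x' y')%:~R * f (zap (w1' ++ brl x' y' :: w2') one) + brc x' y' * f (zap (w1' ++ w2') one).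
    by rewrite zap_swap !linearD !linearZ.
  move: good_xy; rewrite !d2 fE (fE w1) bra_neg brl_neg brc_neg -d1 -dag_cat s1; last first.
    by rewrite !size_cat /= !addnS.
  rewrite s2; last by rewrite !size_cat /= !addnS ltnS ltnW.
  by rewrite !rmorphD !rmorphM /= conj_bra conj_brc => /addIr /addIr.
have [/hasP[x xw x0]|hn] := boolP (has (fun x => x.2 < 0) w).
  exists (x :: rem x w); first exact: perm_to_rem.
  rewrite [X in X^*]fneg // rmorph0 -[x :: _]cat0s d1 zap_cat /= kill ?zap0 ?linear0 //=.
  by rewrite oppr_ge0 ltW.
have [/hasP[x xw x0]|hp] := boolP (has (fun x => 0 < x.2) w).
  exists (rcons (rem x w) x); first by rewrite perm_sym perm_rcons perm_sym perm_to_rem.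
  rewrite -cats1 d1 /= zap_cat /= fneg /= ?oppr_lt0 // kill ?(ltW x0) // zap0.
  by rewrite linear0 rmorph0.
exists w => //; have w0 x : x \in w -> x.2 = 0.
  by move=> xw; have := hasPn hn x xw; have := hasPn hp x xw; rewrite -!leNgt; case: ltgtP.
have dw : dag w = rev w.
  rewrite /dag; congr rev; rewrite -[RHS]map_id; apply/eq_in_map => x /w0 e.
  by rewrite e oppr0; case: (x) e => b n /= ->.
rewrite dw; case: (w) w0 => [|x w'] w0; first by rewrite /= f1 rmorph1.
have zz z : (forall y, y \in z -> y.2 = 0) -> z != [::] -> zap z one = 0.
  case/lastP: z => // z y zy _; rewrite -cats1 zap_cat /= kill ?zap0 //.
  by rewrite zy // mem_rcons inE eqxx.
rewrite !zz ?linear0 ?rmorph0 // => [y|]; last by rewrite -size_eq0 size_rev.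
by rewrite mem_rev; exact: w0.
Qed.

(** The form is h u (w one) = f (dag w u), with v replaced by a chosen combination [rep v] of words.
    The symmetry [Sc] shows that the value does not depend on the choice, so no quotient is taken
    and contravariance can be checked on words. *)
Theorem form_exists : exists h : V -> V -> C,
  [/\ forall a u u' v, h (a *: u + u') v = a * h u v + h u' v, forall u v, h v u = (h u v)^*,
      h one one = 1, forall (n : int) u v, h (Lo n u) v = h u (Lo (- n) v) &
      forall (n : int) u v, h (Jo n u) v = h u (Jo (- n) v)].
Proof.
have [f [f1 fL fJ]] := vacuum_functional l20; have fd := functional_dag fL fJ f1.
have /choice[rep repE] := all_wspan.
pose S (s : seq (C * seq letter)) u := \sum_(p <- s) p.1^* * f (zap (dag p.2) u).
pose val (s : seq (C * seq letter)) := \sum_(p <- s) p.1 *: zap p.2 one.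
have SE s t : S s (val t) = \sum_(p <- s) \sum_(q <- t) p.1^* * (q.1 * f (zap (dag p.2 ++ q.2) one)).
  apply: eq_bigr => p _; rewrite /val zap_sum linear_sum mulr_sumr; apply: eq_bigr => q _.
  by rewrite linearZ /= zap_cat.
have Sc s t : S s (val t) = (S t (val s))^*.
  rewrite !SE exchange_big rmorph_sum; apply: eq_bigr => q _; rewrite rmorph_sum; apply: eq_bigr => p _.
  by rewrite !rmorphM /= conjCK -fd dag_cat dagK; ring.
have Sl s a u u' : S s (a *: u + u') = a * S s u + S s u'.
  rewrite /S mulr_sumr -big_split; apply: eq_bigr => p _ /=.
  by rewrite zapP linearP /=; ring.
pose h u v := S (rep v) u.
have hl a u u' v : h (a *: u + u') v = a * h u v + h u' v by exact: Sl.
have hc u v : h v u = (h u v)^* by rewrite /h {1}[v]repE {2}[u]repE -/(val _) -/(val _) Sc.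
have hz u w : h u (zap w one) = f (zap (dag w) u).
  have e : zap w one = val [:: (1, w)] by rewrite /val big_seq1 scale1r.
  by rewrite hc /h {1}e {2}[u]repE -/(val _) -Sc /S big_seq1 rmorph1 mul1r -[val _]repE.
have hop x u v : h (op x u) v = h u (op (neg x) v).
  rewrite [v]repE linear_sum; under [in RHS]eq_bigr do rewrite linearZ.
  rewrite !(herm_sumr hl hc); apply: eq_bigr => p _; congr (_ * _).
  rewrite hz -[op (neg x) _]/(zap (neg x :: p.2) one) hz -[neg x :: _]cat0s.
  rewrite /dag /= rev_cons -cats1 zap_cat /= /neg /= opprK; by case: (x).
exists h; split=> // [|n u v|n u v].
- by have := hz one [::] => /= ->.
- exact: (hop (false, n)).
- exact: (hop (true, n)).
Qed.

End Form.

Section Phi.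
Variable phi : V -> V.
Hypothesis ph : is_phi Y one om I phi.
Hypotheses (l1r : l1^* = l1) (l3r : l3^* = l3).

Lemma phi_lin a u v : phi (a *: u + v) = a^* *: phi u + phi v. Proof. by case: ph. Qed.
Lemma phi0 : phi 0 = 0.
Proof. by have := phi_lin (-1) 0 0; rewrite scaler0 addr0 rmorphN1 scaleN1r addNr. Qed.
Lemma phiD u v : phi (u + v) = phi u + phi v.
Proof. by rewrite -[in LHS](scale1r u) phi_lin rmorph1 scale1r. Qed.
Lemma phiZ a v : phi (a *: v) = a^* *: phi v.
Proof. by rewrite -[a *: v]addr0 phi_lin phi0 addr0. Qed.

Lemma phiN v : phi (- v) = - phi v.
Proof. by rewrite -[in LHS]scaleN1r phiZ rmorphN1 scaleN1r. Qed.

(** [phi] is prescribed on sorted monomials only. The sign extends to all words because the parity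
    of the number of letters I is preserved by the brackets: [L, I] keeps one I, and the central
    term of [I, I] removes two. *)
Lemma phi_zap w : phi (zap w one) = (-1) ^+ nJ w *: zap w one.
Proof.
move: w; apply: monomial_ind => [w1 x y w2 short good_xy|w x ax|ks ms k1 k2 m1 m2].
- have E := zap_swap w1 x y w2 one; have Ep := congr1 phi E.
  rewrite !phiD !phiZ conj_bra (conj_brc l1r l3r) good_xy E in Ep.
  have s1 := short (w1 ++ brl x y :: w2); have s2 := short (w1 ++ w2).
  have -> : nJ (w1 ++ y :: x :: w2) = nJ (w1 ++ x :: y :: w2).
    by rewrite /nJ !count_cat /=; congr addn; rewrite addnCA.
  rewrite s1 in Ep; last by rewrite !size_cat /= !addnS.
  rewrite s2 in Ep; last by rewrite !size_cat /= !addnS ltnS ltnW.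
  have e1 : (bra x y)%:~R *: ((-1) ^+ nJ (w1 ++ brl x y :: w2) *: zap (w1 ++ brl x y :: w2) one) =
     (-1) ^+ nJ (w1 ++ x :: y :: w2) *: ((bra x y)%:~R *: zap (w1 ++ brl x y :: w2) one).
    have [->|b0] := eqVneq (bra x y) 0; first by rewrite mulr0z !scale0r scaler0.
    by rewrite (parity_brl _ _ b0) !scalerA mulrC.
  have e2 : brc x y *: ((-1) ^+ nJ (w1 ++ w2) *: zap (w1 ++ w2) one) =
     (-1) ^+ nJ (w1 ++ x :: y :: w2) *: (brc x y *: zap (w1 ++ w2) one).
    have [->|b0] := eqVneq (brc x y) 0; first by rewrite !scale0r scaler0.
    by rewrite -[in LHS]signr_odd -[in RHS]signr_odd (parity_brc _ _ b0) !scalerA mulrC.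
  rewrite e1 e2 !scalerDr in Ep.
  by apply/esym; move: Ep => /addIr /addIr.
- by rewrite zap_ann // phi0 scaler0.
- case: ph => _ /(_ ks ms k1 k2 m1 m2).
  have -> : mono Y one om I ks ms = zap ([seq (true, - k%:Z) | k <- ks] ++ [seq (false, - m%:Z) | m <- ms]) one.
    rewrite zap_cat /mono; have -> : foldr (fun m => [eta Lop Y om (- m%:Z)]) one ms = zap [seq (false, - m%:Z) | m <- ms] one.
      by elim: (ms) => //= m s ->; rewrite /op /= LoE.
    by elim: (ks) => //= k s ->; rewrite /op /= JoE.
  move=> ->; congr (_ ^+ _ *: _); rewrite /nJ count_cat !count_map.
  rewrite (eq_count (a2 := xpredT)) // count_predT (eq_count (a2 := pred0)) // count_pred0 addn0 //.
Qed.

Lemma phi_op x v : phi (op x v) = (-1) ^+ x.1 *: op x (phi v).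
Proof.
have [s ->] := all_wspan v.
have ps (t : seq (C * seq letter)) : phi (\sum_(p <- t) p.1 *: zap p.2 one) = \sum_(p <- t) p.1^* *: ((-1) ^+ nJ p.2 *: zap p.2 one).
  by elim/big_rec2: _ => [|p u u' _ <-]; [exact: phi0 | rewrite phi_lin phi_zap].
rewrite ps linear_sum /= [in RHS]linear_sum scaler_sumr.
transitivity (phi (\sum_(p <- [seq (p.1, x :: p.2) | p <- s]) p.1 *: zap p.2 one)).
  by rewrite big_map; congr phi; apply: eq_bigr => p _; rewrite linearZ.
rewrite ps big_map; apply: eq_bigr => p _; rewrite !linearZ /= /nJ /= exprD !scalerA /zap /=.
by congr (_ *: _); ring.
Qed.

Lemma phi_one : phi one = one.
Proof. by rewrite -[one]/(zap [::] one) phi_zap scale1r. Qed.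

Lemma phi_om : phi om = om.
Proof. by rewrite -{1}Lo_om -[Lo _ _]/(op (false, -2) one) phi_op phi_one scale1r /op /= Lo_om. Qed.

Lemma phiK v : phi (phi v) = v.
Proof.
move: v; apply: generated; last by rewrite !phi_one.
split=> [|a u v e e'|n v e|n v e]; first by rewrite !phi0.
- by rewrite !phi_lin e e' conjCK.
- by have := phi_op (false, n) v; rewrite /op /= expr0 scale1r => ->; have := phi_op (false, n) (phi v);
   rewrite /op /= expr0 scale1r e => ->.
have := phi_op (true, n) v; rewrite /op /= expr1 scaleN1r => ->; have := phi_op (true, n) (phi v).
by rewrite /op /= expr1 scaleN1r e phiN => ->; rewrite opprK.
Qed.

Lemma phi_sum (T : Type) (s : seq T) (a : T -> C) (u : T -> V) :
  phi (\sum_(p <- s) a p *: u p) = \sum_(p <- s) (a p)^* *: phi (u p).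
Proof. by elim/big_rec2: _ => [|p x y _ <-]; [exact: phi0 | exact: phi_lin]. Qed.

Lemma phi_G b r v : phi (Y (G b) r v) = (-1) ^+ b *: Y (G b) r (phi v).
Proof.
case: b => /=; first by have := phi_op (true, r) v; rewrite /op /= !JoE.
by have := phi_op (false, r - 1) v; rewrite /op /= !LoE /Lop subrK.
Qed.

(** By [iterate] the modes of x_r u are combinations, with real coefficients, of compositions of the
    modes of x and u; compatibility with [phi] thus passes from the generators to all states. *)
Lemma phi_Y u n v : phi (Y u n v) = Y (phi u) n (phi v).
Proof.
move: u n v; suff H b r u : (forall n v, phi (Y u n v) = Y (phi u) n (phi v)) ->
    forall n v, phi (Y (Y (G b) r u) n v) = Y (phi (Y (G b) r u)) n (phi v).
  apply: generated; last by move=> n v; rewrite phi_one !Y_one; case: eqP => // _; exact: phi0.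
  split=> [n v|a u u' hu hu' n v|n u hu|n u hu].
  - by rewrite Y0 phi0 Y0.
  - by rewrite Yl phi_lin hu hu' phi_lin Yl.
  - by rewrite LoE; exact: (@H false (n + 1)).
  - by rewrite JoE; exact: (@H true n).
move=> hu n v; have [N0 h0] := iterate b r u n v; have [N1 h1] := iterate b r (phi u) n (phi v).
rewrite phi_G YZl (h0 (N0 + N1)%N (leq_addr _ _)) (h1 (N0 + N1)%N (leq_addl _ _)) phi_sum scaler_sumr.
apply: eq_bigr => i _; rewrite rmorphM rmorphXn rmorphN1 /= conj_binC !scalerA [(-1) ^+ b * _]mulrC -!scalerA.
congr (_ *: _); rewrite phiD phiN phiZ rmorphXn rmorphN1 phi_G !hu phi_G YZr.
by rewrite scalerBr !scalerA [(-1) ^+ b * _]mulrC.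
Qed.

End Phi.

End Words.

End Voa.

(** * Invariance of the form *)

Lemma sum_antidiagonal (U : nmodType) n (F : nat -> nat -> U) :
  \sum_(j < n) \sum_(l < j.+1) F (j - l)%N l = \sum_(j < n) \sum_(l < n - j) F j l.
Proof.
elim: n => [|n IH]; first by rewrite !big_ord0.
rewrite big_ord_recr IH [RHS]big_ord_recr /= subSnn big_ord1.
rewrite [X in _ = X + _](eq_bigr (fun j : 'I_n => \sum_(l < n - j) F j l + F j (n - j)%N)); last first.
  by move=> j _; rewrite subSn ?big_ord_recr // ltnW.
rewrite big_split -addrA; congr (_ + _); rewrite (reindex_inj rev_ord_inj) big_ord_recr /= subnn.
congr (_ + _); first by apply: eq_bigr => j _; rewrite subSS subKn // ltnW.
by rewrite subn0.
Qed.

Lemma sum_trunc (U : nmodType) n m (F : nat -> U) : (n <= m)%N -> (forall i, (n <= i)%N -> F i = 0) ->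
  \sum_(i < m) F i = \sum_(i < n) F i.
Proof.
move=> le z; rewrite (big_ord_widen m F le) [LHS](bigID (fun i : 'I_m => (i < n)%N)) /=.
by rewrite [X in _ + X]big1 ?addr0 // => i; rewrite -leqNgt => /z.
Qed.

Lemma sum_antidiagonal_rect (U : nmodType) n m (F : nat -> nat -> U) :
  (n <= m)%N -> (forall j l, (n <= j + l)%N -> F j l = 0) ->
  \sum_(j < n) \sum_(l < j.+1) F (j - l)%N l = \sum_(j < n) \sum_(l < m) F j l.
Proof.
move=> nm z; rewrite sum_antidiagonal; apply: eq_bigr => j _; symmetry; apply: sum_trunc => [|l le].
  exact: leq_trans (leq_subr _ _) nm.
by apply: z; rewrite -leq_subLR.
Qed.

Lemma sign_absz (F : pzRingType) (x y : int) : (-1) ^+ `|(x + y)%R|%N = (-1) ^+ `|x|%N * (-1) ^+ `|y|%N :> F.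
Proof. by rewrite -signr_odd -[in RHS]signr_odd -[X in _ * X]signr_odd -signr_addb; congr (_ ^+ nat_of_bool _); lia. Qed.

Section Invariance.
Variables (R : realType) (l1 l2 l3 : R[i]) (V : lmodType R[i]).
Variables (Y : V -> int -> V -> V) (one om I : V).
Let C := (R[i] : numClosedFieldType).
Hypothesis LL : is_LL Y l1 l2 l3 one om I.
Hypothesis l20 : l2 = 0.
Variable phi : V -> V.
Hypothesis ph : is_phi Y one om I phi.
Hypotheses (l1r : (l1 : C)^* = l1) (l3r : (l3 : C)^* = l3).
Variable h : V -> V -> C.
Hypothesis hl : forall a u u' v, h (a *: u + u') v = a * h u v + h u' v.
Hypothesis hc : forall u v, h v u = (h u v)^*.
Hypothesis hL : forall (n : int) u v, h (Lo LL n u) v = h u (Lo LL (- n) v).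
Hypothesis hJ : forall (n : int) u v, h (Jo LL n u) v = h u (Jo LL (- n) v).

Local Notation Gm b := (Y (G om I b)).
Let L1 : {linear V -> V} := Lo LL 1.
(* For the weight d of the generator, [dd] is d - 1. *)
Let dd (b : bool) : int := if b then 0 else 1.

Lemma G_adj b m u v : h (Gm b m u) v = h u (Gm b (2 * dd b - m) v).
Proof.
case: b; rewrite /dd /=; first by have := hJ m u v; rewrite !JoE /Iop mulr0 add0r.
have := hL (m - 1) u v; rewrite !LoE /Lop subrK => ->; congr (h u (Y _ _ _)); ring.
Qed.

Lemma L1_G b r v : L1 (Gm b r v) = Gm b r (L1 v) + (2 * dd b - r)%:~R *: Gm b (r + 1) v.
Proof.
case: b; rewrite /dd /=.
  have := L_J LL l20 1 r v; rewrite !JoE /Iop => /(canRL (subrK _)) ->.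
  by rewrite addrC mulr0 add0r rmorphN [1 + r]addrC.
have := Lo_vir LL 1 (r - 1) v; rewrite [Lo _ (r - 1) _]LoE [Lo _ (r - 1) _]LoE /Lop subrK => /(canRL (subrK _)) ->.
rewrite addrC expr1n subrr mul0r mul0r if_same scale0r addr0 [Lo LL (1 + _) _]LoE LoE /Lop.
have -> : 1 + (r - 1) + 1 = r + 1 by ring.
by have -> : 1 - (r - 1) = 2 * 1 - r by ring.
Qed.

Definition L1d j v : V := (j`!%:R)^-1 *: iter j L1 v.

Lemma L1dS j v : L1 (L1d j v) = j.+1%:R *: L1d j.+1 v.
Proof.
rewrite /L1d linearZ /= scalerA factS natrM invfM mulrA divff ?mul1r //.
by rewrite pnatr_eq0.
Qed.

Lemma L1d_lin j a u v : L1d j (a *: u + v) = a *: L1d j u + L1d j v.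
Proof.
rewrite /L1d; have -> : iter j L1 (a *: u + v) = a *: iter j L1 u + iter j L1 v by elim: j => //= j ->; rewrite linearP.
by rewrite scalerDr !scalerA mulrC.
Qed.

Lemma binCS (e : int) l : binC R e l * (e%:~R - l%:R) = l.+1%:R * binC R e l.+1.
Proof.
rewrite /binC big_ord_recr factS natrM invfM /= !mulrA [_ * l.+1%:R^-1]mulrC !mulrA mulVf ?pnatr_eq0 // mul1r.
by rewrite mulrAC.
Qed.

(** The Leibniz rule for the divided powers of L_1: the commutator with the r-th mode of a generator
    is 2 (d - 1) - r times the next mode, and the successive factors build a binomial
    coefficient. *)
Lemma L1d_G b r j v : L1d j (Gm b r v) =
  \sum_(l < j.+1) binC R (2 * dd b - r) l *: Gm b (r + l%:Z) (L1d (j - l) v).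
Proof.
set e := 2 * dd b - r; elim: j => [|j IH].
  by rewrite big_ord1 /L1d /= addr0 invr1 scale1r {1}/binC big_ord0 divr1 !scale1r.
pose T l := binC R e l *: Gm b (r + l%:Z) (L1d (j.+1 - l) v).
apply: (scalerI (a := j.+1%:R)); first by rewrite pnatr_eq0.
rewrite -L1dS IH linear_sum; transitivity (\sum_(l < j.+2) ((j.+1 - l)%N%:R *: T l + l%:R *: T l)); last first.
  rewrite scaler_sumr; apply: eq_bigr => l _; rewrite -scalerDl -natrD subnK //.
  by rewrite -ltnS.
rewrite big_split /= [X in _ = X + _]big_ord_recr /= subnn mulr0n scale0r addr0 [X in _ = _ + X]big_ord_recl /= mulr0n scale0r add0r -big_split.
apply: eq_bigr => l _; rewrite linearZ /= L1_G scalerDr L1dS /= (YZr LL); congr (_ + _).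
  by rewrite /T subSn ?scalerA 1?mulrC // -ltnS.
rewrite /T /bump leq0n add1n subSS !scalerA -binCS -/e; congr (_ *: Y _ _ _); last by lia.
by rewrite rmorphB /e; congr (_ * _); rewrite !rmorphB /=; ring.
Qed.

(** Up to the sign (-1)^k, the m-th mode of the opposite vertex operator Y(e^{zL(1)}
    (-z^{-2})^{L(0)} a, z^{-1}), for a of weight k. *)
Definition opp k a m u N := \sum_(j < N) Y (L1d j a) (2 * k - j%:Z - m - 2) u.
(** Here k is a free parameter, not a proved weight. One bound N0 serves all m, u and v, so that the
    identity for a can be used inside sums. *)
Definition good k a := exists N0, forall N, (N0 <= N)%N -> forall m u v,
  h u (Y (phi a) m v) = (-1) ^+ `|k|%N * h (opp k a m u N) v.

Let hDl u u' v : h (u + u') v = h u v + h u' v.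
Proof. by rewrite -[in LHS](scale1r u) hl mul1r. Qed.
Let h0l v : h 0 v = 0. Proof. exact: (herm0l hl). Qed.
Let h0r v : h v 0 = 0. Proof. exact: (herm0r hl hc). Qed.
Let hZl a u v : h (a *: u) v = a * h u v.
Proof. by rewrite -[a *: u]addr0 hl h0l addr0. Qed.
Let hNl u v : h (- u) v = - h u v.
Proof. by rewrite -scaleN1r hZl mulN1r. Qed.
Let hZr a u v : h v (a *: u) = a^* * h v u. Proof. exact: (hermZr hl hc). Qed.
Let hDr u u' v : h v (u + u') = h v u + h v u'. Proof. exact: (hermDr hl hc). Qed.
Let hs n (F : 'I_n -> V) v : h (\sum_i F i) v = \sum_i h (F i) v.
Proof. by elim/big_rec2: _ => [|i x y _ <-]; rewrite ?h0l ?hDl. Qed.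

Lemma L1d_nilp a : exists J, forall j, (J <= j)%N -> L1d j a = 0.
Proof.
have [J e] := lo_nilp LL 0 a; exists J => j /subnK <-; rewrite /L1d iterD e.
by rewrite (_ : iter _ _ 0 = 0) ?scaler0 //; elim: (j - J)%N => //= i ->; rewrite linear0.
Qed.

Lemma good_one : good 0 one.
Proof.
exists 1%N => -[//|N] _ m u v; rewrite (phi_one LL l20 ph l1r l3r) expr0 mul1r /opp big_ord_recl big1 => [|j _].
  rewrite addr0 /L1d /= invr1 scale1r !(Y_one LL) (_ : (2 * 0 - 0 - m - 2 == -1) = (m == -1)); last by lia.
  by case: eqP; rewrite ?h0l ?h0r.
rewrite /L1d iterSr (_ : L1 one = 0) ?(Lo_one LL) //.
rewrite (_ : iter _ _ 0 = 0) ?scaler0 ?(Y0 LL) //; elim: (nat_of_ord j) => //= i ->; exact: linear0.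
Qed.

Lemma good_lin k c a a' : good k a -> good k a' -> good k (c *: a + a').
Proof.
move=> [N0 h0] [N1 h1]; exists (N0 + N1)%N => N le m u v; rewrite (phi_lin ph) (Yl LL) hDr hZr conjCK.
rewrite (h0 N) ?(h1 N); [|lia|lia]; rewrite /opp !hs !mulr_sumr -big_split; apply: eq_bigr => j _ /=.
by rewrite L1d_lin (Yl LL) hl; ring.
Qed.

Lemma good_zero k : good k 0.
Proof.
exists 0%N => N _ m u v; rewrite (phi0 ph) (Y0 LL) h0r /opp big1 ?h0l ?mulr0 // => j _.
by have := L1d_lin j (-1) 0 0; rewrite scaler0 addr0 scaleN1r addNr => ->; rewrite (Y0 LL).
Qed.

Lemma sign_step b (k r : int) :
  (-1) ^+ `|(k + dd b - r)%R|%N = (-1) ^+ b * (-1) ^+ `|k|%N * - (-1) ^+ `|r|%N :> C.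
Proof. by rewrite !sign_absz abszN; case: b; rewrite /dd /= ?expr1 ?expr0; ring. Qed.

(* Both sides of the invariance identity for [Gm b r a] reduce to the one for [a]
   through the Borcherds identity, with p = 0 and with p = 2 (d - 1) - r. *)
Lemma good_step b r k a : good k a -> good (k + dd b - r) (Gm b r a).
Proof.
move=> [N0 ga]; have [J Jz] := L1d_nilp a; set e := 2 * dd b - r.
have /fin_all_exists[T Tz] : forall j : 'I_J, exists T, forall i : nat, (T <= i)%N -> Gm b (r + i%:Z) (L1d j a) = 0.
  by move=> j; exact: (Y_trunc LL).
pose T0 := (\sum_j T j)%N; exists (N0 + J + T0)%N => N le m u v.
(* A bound independent of m, u and v: the L_1^j a vanish for j >= J, and for each smaller j the mode
   kills the vector when l >= T0. Hence the antidiagonal double sum may be rearranged into a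
   rectangle. *)
have z j l : (N <= j + l)%N -> Gm b (r + l%:Z) (L1d j a) = 0.
  move=> Njl; have [jJ|/Jz ->] := ltnP j J; last exact: (Y0r LL).
  by apply: (Tz (Ordinal jJ)); have : (T (Ordinal jJ) <= T0)%N by [rewrite /T0 (bigD1 (Ordinal jJ)) //= leq_addr]; lia.
pose q (j : nat) := 2 * k - r - j%:Z - m - 2.
have [M0 it] := iterate LL b r (phi a) m v.
have /fin_all_exists[M Mb] := fun j : 'I_N => borcherds LL (G om I b) (L1d j a) u e (q j) r.
pose M1 := (M0 + N + \sum_j M j)%N.
pose F (j l : nat) := binC R e l * h (Y (Gm b (r + l%:Z) (L1d j a)) (2 * (k + dd b - r) - (j + l)%N%:Z - m - 2) u) v.
have RHSE : h (opp (k + dd b - r) (Gm b r a) m u N) v = \sum_(j < N) \sum_(l < j.+1) F (j - l)%N l.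
  rewrite /opp hs; apply: eq_bigr => j _; rewrite L1d_G.
  have -> (n : int) : Y (\sum_(l < j.+1) binC R (2 * dd b - r) l *: Gm b (r + l%:Z) (L1d (j - l) a)) n u =
      \sum_(l < j.+1) binC R e l *: Y (Gm b (r + l%:Z) (L1d (j - l) a)) n u.
    by elim/big_rec2: _ => [|l x y _ <-]; rewrite ?(Y0 LL) ?(Yl LL).
  rewrite hs; apply: eq_bigr => l _; rewrite hZl /F subnK // -ltnS //.
rewrite RHSE (sum_antidiagonal_rect (m := M1)); [|lia|]; last by move=> j l /z e0; rewrite /F e0 (Y0 LL) h0l mulr0.
rewrite (phi_G LL l20 ph l1r l3r) (YZl LL) hZr (it M1); last by lia.
pose s : C := (-1) ^+ `|r|%N; have ss : s * s = 1 by rewrite /s -expr2 sqrr_sign.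
have srN : (- s)^* = - s by rewrite rmorphN /s rmorphXn rmorphN1.
pose c (i : nat) : C := (-1) ^+ i * binC R r i.
have cr i : (c i)^* = c i by rewrite /c rmorphM rmorphXn rmorphN1 /= conj_binC.
transitivity ((-1) ^+ b * \sum_(i < M1) c i *
   ((-1) ^+ `|k|%N * (h (opp k a (m + i%:Z) (Gm b (e + i%:Z) u) N) v
    - s * h (Gm b (2 * dd b - i%:Z) (opp k a (m + r - i%:Z) u N)) v))).
  rewrite rmorphXn rmorphN1; congr (_ * _); rewrite (herm_sumr hl hc); apply: eq_bigr => i _; rewrite -/(c i) cr; congr (_ * _).
  rewrite -scaleNr hDr hZr -/s srN mulrBr [(-1) ^+ `|k|%N * (s * _)]mulrCA.
  have -> x : h u (Gm b (r - i%:Z) x) = h (Gm b (e + i%:Z) u) x.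
    by rewrite G_adj; congr (h u (Gm b _ _)); rewrite /e; ring.
  have -> x : h (Gm b (2 * dd b - i%:Z) x) v = h x (Gm b i%:Z v).
    by rewrite G_adj; congr (h x (Gm b _ _)); ring.
  by rewrite -!(ga N) ?mulNr //; lia.
have Gsum n (x : 'I_N -> V) : Gm b n (\sum_j x j) = \sum_j Gm b n (x j).
  by rewrite -(linmkE (Y_linear LL (G om I b) n)) linear_sum; apply: eq_bigr => j _; rewrite linmkE.
transitivity ((-1) ^+ b * (-1) ^+ `|k|%N * - s * \sum_(j < N) \sum_(i < M1)
   c i * h (Gm b (e + r - i%:Z) (Y (L1d j a) (q j + i%:Z) u) - s *: Y (L1d j a) (q j + r - i%:Z) (Gm b (e + i%:Z) u)) v).
  rewrite -!mulrA; congr (_ * _); rewrite exchange_big !mulr_sumr; apply: eq_bigr => i _.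
  rewrite mulrCA; congr (_ * _); rewrite -!mulr_sumr mulrCA; congr (_ * _).
  rewrite /opp Gsum !hs mulr_sumr -sumrB mulr_sumr; apply: eq_bigr => j _.
  rewrite hDl hNl hZl (_ : e + r = 2 * dd b); last by rewrite /e; ring.
  rewrite (_ : 2 * k - j%:Z - (m + i%:Z) - 2 = q j + r - i%:Z); last by rewrite /q; ring.
  rewrite (_ : 2 * k - j%:Z - (m + r - i%:Z) - 2 = q j + i%:Z); last by rewrite /q; ring.
  move: (h _ v) (h (Y _ _ _) v) => x1 x2; transitivity ((s * s) * x2 - s * x1); [by rewrite ss mul1r | ring].
rewrite sign_step -/s; congr (_ * _); apply: eq_bigr => j _; have Mj : (M j <= M1)%N by rewrite /M1 (bigD1 j) //=; lia.
have := congr1 (h^~ v) (Mb j M1 Mj); rewrite !hs => Eb; apply: etrans (etrans (esym Eb) _).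
  by apply: eq_bigr => i _; rewrite hZl.
apply: eq_bigr => i _; rewrite hZl /F; congr (_ * h (Y _ _ _) v); rewrite /q /e PoszD; ring.
Qed.

Definition wt (w : seq letter) : int := - \sum_(x <- w) x.2.

Lemma good_zap w : good (wt w) (zap LL w one).
Proof.
elim: w => [|[b n] w IH]; first by rewrite /wt big_nil oppr0; exact: good_one.
rewrite /= /wt big_cons opprD addrC -/(wt w) /op; case: b => /=.
  by rewrite JoE; have := @good_step true n _ _ IH; rewrite /dd addr0.
by rewrite LoE /Lop; have := @good_step false (n + 1) _ _ IH; rewrite /dd opprD addrACA subrr addr0 // addrA addrK.
Qed.

Lemma weight_zap w : has_weight Y om (wt w) (zap LL w one).
Proof.
elim: w => [|[b n] w IH]; first by rewrite /wt big_nil oppr0; exact: (weight_one LL).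
rewrite /= /wt big_cons opprD addrC -/(wt w) /op; case: b => /=; [exact: weight_J | exact: weight_L].
Qed.

(** In an expression of a by words, those of weight other than k may be dropped: their sum has
    weight k and is killed by a product of L_0 - j with all j different from k, so it is 0. *)
Lemma good_weight k a : has_weight Y om k a -> good k a.
Proof.
move=> ka; have [s sE] := all_wspan LL a.
pose x := \sum_(p <- s | wt p.2 == k) p.1 *: zap LL p.2 one.
have xk : has_weight Y om k x.
  rewrite /has_weight -(LoE LL) /x linear_sum scaler_sumr; apply: eq_bigr => p /eqP <-.
  by rewrite linearZ /= (LoE LL) (weight_zap p.2) !scalerA mulrC.
suff -> : a = x.
  rewrite /x; elim/big_rec: _ => [|p y /eqP <- gy]; first exact: good_zero.
  by apply: good_lin gy; exact: good_zap.
pose K := [seq wt p.2 | p <- s & wt p.2 != k].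
have bk : has_weight Y om k (a - x).
  by move: ka xk; rewrite /has_weight -!(LoE LL) linearB => -> ->; rewrite scalerBr.
have : wtop LL K (a - x) = 0.
  rewrite sE (bigID (fun p => wt p.2 == k)) /= addrAC subrr add0r.
  rewrite big_seq_cond; elim/big_rec: _ => [|p y /andP[ps pk] e]; first exact: wtop0.
  rewrite wtop_lin e addr0 (wtop_wt LL K (weight_zap p.2)).
  have pK : wt p.2 \in K by apply/mapP; exists p; rewrite // mem_filter pk.
  by rewrite (big_rem _ pK) /= subrr mul0r scale0r scaler0.
rewrite (wtop_wt LL K bk) => /eqP; rewrite scaler_eq0 prodf_seq_eq0 => /orP[/hasP[j]|].
  by move=> /mapP[p]; rewrite mem_filter => /andP[pk _] -> /=; rewrite intr_eq0 subr_eq0 eq_sym (negPf pk).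
by rewrite subr_eq0 => /eqP.
Qed.

Lemma herm_invariant : invariant_form Y om phi h.
Proof.
move=> a k ka N Nz m u v; have [N0 /(_ (N0 + N)%N (leq_addr _ _) m u v) ->] := good_weight ka.
have itE j x : iter j (Lop Y om 1) x = iter j L1 x by elim: j => //= j ->; rewrite /L1 LoE.
rewrite itE in Nz; rewrite /opp (sum_trunc (n := N) (F := fun j : nat => Y (L1d j a) (2 * k - j%:Z - m - 2) u)) ?leq_addl // => [|j /subnK <-]; last first.
  rewrite /L1d iterD Nz (_ : iter _ _ 0 = 0) ?scaler0 ?(Y0 LL) //.
  by elim: (_ - _)%N => //= i ->; rewrite linear0.
rewrite hs mulr_sumr; apply: eq_bigr => j _; rewrite /L1d (YZl LL) hZl itE.
by rewrite mulrA; congr (_ * h (Y _ _ _) _); ring.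
Qed.

End Invariance.

(** * Unitarity *)

Lemma conj_fixed_Re (R : rcfType) (x : R[i]) : x^* = x -> real_complex R (complex.Re x) = x.
Proof. by move=> xr; apply: RRe_real; apply/CrealP. Qed.

Section Unitarity.
Variables (R : realType) (l1 l2 l3 : R[i]) (V : lmodType R[i]).
Variables (Y : V -> int -> V -> V) (one om I : V).
Let C := (R[i] : numClosedFieldType).
Hypothesis LL : is_LL Y l1 l2 l3 one om I.
Hypothesis l20 : l2 = 0.

Lemma Jo_truncated : @truncated C V (Jo LL).
Proof.
have [[[[_ h _ _] _] _ _] _] := LL; move=> v; have [N hN] := h I v; by exists N => i le; rewrite JoE; exact: hN.
Qed.

(** When l2 = 0, I_0 commutes with all modes of L and I, and it kills the vacuum. *)
Lemma Jo0 v : Jo LL 0 v = 0.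
Proof.
move: v; apply: (generated (LL := LL)); last by rewrite Jo_one.
split=> [|a u v e e'|n v e|n v e]; first by rewrite linear0.
- by rewrite linearP e e' scaler0 addr0.
- have := L_J LL l20 n 0 v; rewrite e linear0 mulr0z oppr0 scale0r => /esym /eqP.
  by rewrite sub0r eq_sym oppr_eq0 => /eqP.
- have := J_J LL 0 n v; rewrite e linear0 subr0 mulr0z mul0r if_same scale0r.
  by [].
Qed.

Lemma jo_nilp (n : nat) v : exists d, iter d (Jo LL n.+1) v = 0.
Proof.
have iD d u w : iter d (Jo LL n.+1) (u + w) = iter d (Jo LL n.+1) u + iter d (Jo LL n.+1) w.
  by elim: d => //= d ->; rewrite linearD.
have i0 d : iter d (Jo LL n.+1) 0 = 0 by elim: d => //= d ->; rewrite linear0.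
move: v; apply: (weight_ind LL) => [u v [d e] [d' e']||k v kv].
- by exists (d + d')%N; rewrite iD {1}addnC !iterD e e' !i0 addr0.
- by exists 0%N.
- exists k.+1; apply: (@weight_neg _ _ _ _ _ _ _ _ _ LL (k%:Z - (k.+1 * n.+1)%:Z)); first by lia.
  elim: k.+1 => [|d IH] //=; first by rewrite mul0n subr0.
  by have := @weight_J _ _ _ _ _ _ _ _ _ LL _ n.+1 _ l20 IH; congr has_weight; lia.
Qed.

Section WithForm.
Hypotheses (l1r : (l1 : C)^* = l1) (l3r : (l3 : C)^* = l3).
Variable h : V -> V -> C.
Hypothesis hl : forall a u u' v, h (a *: u + u') v = a * h u v + h u' v.
Hypothesis hc : forall u v, h v u = (h u v)^*.
Hypothesis h1 : h one one = 1.
Hypothesis hL : forall (n : int) u v, h (Lo LL n u) v = h u (Lo LL (- n) v).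
Hypothesis hJ : forall (n : int) u v, h (Jo LL n u) v = h u (Jo LL (- n) v).

Let hDl u u' v : h (u + u') v = h u v + h u' v.
Proof. by rewrite -[in LHS](scale1r u) hl mul1r. Qed.
Let h0l v : h 0 v = 0. Proof. exact: (herm0l hl). Qed.
Let h0r v : h v 0 = 0. Proof. exact: (herm0r hl hc). Qed.
Let hZl a u v : h (a *: u) v = a * h u v.
Proof. by rewrite -[a *: u]addr0 hl h0l addr0. Qed.
Let hZr a u v : h v (a *: u) = a^* * h v u. Proof. exact: (hermZr hl hc). Qed.
Let hDr u u' v : h v (u + u') = h v u + h v u'. Proof. exact: (hermDr hl hc). Qed.

Section Coset.
Hypothesis l3p : 0 < (l3 : C).
Let l30 : (l3 : C) != 0. Proof. by rewrite gt_eqF. Qed.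
Let H := hcoset l3 (Lo LL) Jo_truncated.

Lemma H_vir : @is_vir C V (l1 - 1) H.
Proof. exact: (hcoset_vir l30 Jo_truncated (Lo_vir LL) (J_J LL) (L_J LL l20)). Qed.

Lemma H_J (m n : int) v : H m (Jo LL n v) = Jo LL n (H m v).
Proof. exact: (hcoset_b l30 Jo_truncated (J_J LL) (L_J LL l20)). Qed.

Lemma H_one (n : nat) : H n one = 0.
Proof.
have Jom (m : nat) : Jo LL m.+1 one = 0 by rewrite Jo_one.
rewrite hcosetE Lo_one // sub0r; apply/eqP; rewrite oppr_eq0; apply/eqP; case: n => [|n].
  rewrite (@virL0_om _ _ l3 0 0 _ Jo_truncated one) //; last by move=> v; rewrite scale0r Jo0.
  by rewrite expr0n mul0r mul0r subr0 scale0r.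
by rewrite (virL_om l3 0 Jo_truncated Jom).
Qed.

Lemma H_adj (n : int) u v : h (H n u) v = h u (H (- n) v).
Proof.
have hN x y : h (- x) y = - h x y by rewrite -scaleN1r hZl mulN1r.
have hNr x y : h y (- x) = - h y x by rewrite -scaleN1r hZr rmorphN1 mulN1r.
rewrite !hcosetE hDl hDr hN hNr hL; congr (_ - _); apply: (virL_adj Jo_truncated (J_J LL)) => //.
by move=> x y; rewrite hZl hZr fmorphV rmorphM rmorph_nat /= l3r.
Qed.

Let U := posspan H one.

Inductive fockspan : V -> Prop :=
| fock_base u : U u -> fockspan u
| fock_lin a u v : fockspan u -> fockspan v -> fockspan (a *: u + v)
| fock_J (n : nat) u : fockspan u -> fockspan (Jo LL (- n.+1%:Z) u).

Let U0 : U 0. Proof. exact: posspan0. Qed.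

Lemma J_U (n : nat) u : U u -> Jo LL n u = 0.
Proof.
case=> s _ ->; rewrite linear_sum big1 // => -[a w] _; rewrite linearZ /=.
suff -> : Jo LL n (lw H w one) = 0 by rewrite scaler0.
by elim: w => /= [|m w IH]; [rewrite Jo_one | rewrite -H_J IH linear0].
Qed.

Lemma fockspan_J (n : int) u : fockspan u -> fockspan (Jo LL n u).
Proof.
case: n => n; last by rewrite NegzE; exact: fock_J.
elim=> {u} [u Uu|a u v _ IHu _ IHv|m u fu IHu].
- by rewrite J_U //; exact: fock_base.
- by rewrite linearP; exact: fock_lin.
- have := J_J LL n (- m.+1%:Z) u => /(canRL (subrK _)) ->.
  by apply: fock_lin; [exact: fu | exact: fock_J].
Qed.

Lemma fockspan_H (n : int) u : fockspan u -> fockspan (H n u).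
Proof.
elim=> {u} [u Uu|a u v _ IHu _ IHv|m u fu IHu].
- apply: fock_base; have := H_vir; rewrite -(@conj_fixed_Re R (l1 - 1)) => [Hv|]; last by rewrite rmorphB rmorph1 /= l1r.
  exact: (posspan_L Hv H_one).
- by rewrite linearP; exact: fock_lin.
- by rewrite H_J; exact: fock_J.
Qed.

Lemma fockspan_all v : fockspan v.
Proof.
have f0 : fockspan 0 by exact: fock_base.
have fD u w : fockspan u -> fockspan w -> fockspan (u + w) by rewrite -{2}[u]scale1r; exact: fock_lin.
have fZ a u : fockspan u -> fockspan (a *: u) by rewrite -[a *: u]addr0 => /fock_lin; exact.
move: v; apply: (generated (LL := LL)); last by apply: fock_base; exact: posspan_om.
split=> // [a u v|n v fv|n v]; [exact: fock_lin | | exact: fockspan_J].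
have -> : Lo LL n v = H n v + virL l3 0 Jo_truncated n v by rewrite hcosetE subrK.
apply: (fD _ _); first exact: fockspan_H.
have [N hN] := Jo_truncated v.
have ev : evz (fun q => Jo LL (n - q) (Jo LL q v)) by exists N => i /hN ->; rewrite linear0.
have fs x : fockspan (fsum (fun q => Jo LL (n - q) (Jo LL q v)) x).
  have [M hM] := evz_nat x ev; rewrite (fsumE hM); apply: (big_ind fockspan) => [//|u w|i _]; first exact: (fD).
  by do 2 apply: fockspan_J.
by rewrite virL_fsum mul0r scale0r subr0; apply: fZ; apply: fD.
Qed.

(** A vector v killed by all positive modes need not be shown to lie in [U]. It is u0 + w with u0 in
    [U] and w a combination of images of negative modes, so w is orthogonal to every vector of that
    kind, including v and u0, and h v v = h u0 u0. *)
Lemma psd_coset : (forall v, U v -> 0 <= h v v) -> forall v, 0 <= h v v.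
Proof.
move=> hU; apply: (modewise_psd l3p Jo_truncated (J_J LL) jo_nilp hl hc hJ) => v vK.
pose W w := forall x, (forall m : nat, Jo LL m.+1 x = 0) -> h x w = 0.
have [u0 Uu0 [w Ww vE]] : exists2 u0, U u0 & exists2 w, W w & v = u0 + w.
  elim: (fockspan_all v) => [u Uu|a u u' _ [u0 Uu0 [w Ww ->]] _ [u0' Uu0' [w' Ww' ->]]|n u _ _].
  - by exists u => //; exists 0; rewrite ?addr0 // => x _; rewrite h0r.
  - exists (a *: u0 + u0'); first exact: posspan_lin.
    exists (a *: w + w'); last by rewrite scalerDr addrACA.
    by move=> x xK; rewrite hDr hZr Ww // Ww' // mulr0 addr0.
  - by exists 0 => //; exists (Jo LL (- n.+1%:Z) u); rewrite ?add0r // => x xK; rewrite -hJ xK h0l.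
have u0K (m : nat) : Jo LL m.+1 u0 = 0 by exact: J_U.
rewrite {2}vE hDr (Ww v vK) addr0 vE hDl [h w u0]hc (Ww u0 u0K) rmorph0 addr0.
exact: hU.
Qed.

End Coset.

(** If l3 = 0 the letters I commute with each other, so in a word containing one it can be moved to
    an end where the vacuum expectation vanishes. The span of such words is a submodule without the
    vacuum, hence 0 by irreducibility, and I acts by 0. *)
Lemma psd_central0 : l3 = 0 -> (forall v, posspan (Lo LL) one v -> 0 <= h v v) -> forall v, 0 <= h v v.
Proof.
move=> l30 hU; have [f [f1 fL fJ]] := vacuum_functional LL l20.
have Jword w : has fst w -> f (zap LL w one) = 0.
  move: w; apply: word_ind => [w1 x y w2 short good_xy hyx|w _].
    have hxy : has fst (w1 ++ x :: y :: w2) by move: hyx; rewrite !has_cat /= [y.1 || _]orbCA.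
    have := congr1 f (zap_swap LL l20 w1 x y w2 one); rewrite (good_xy hxy) !linearD !linearZ /=.
    rewrite (short (w1 ++ brl x y :: w2)); last 2 first.
    - by rewrite !size_cat /= !addnS.
    - by move: hxy; rewrite !has_cat /= -orbA.
    rewrite mulr0 addr0; have [->|b0] := eqVneq (brc l1 l3 x y) 0; first by rewrite mul0r addr0 => <-.
    rewrite (short (w1 ++ w2)) ?mulr0 ?addr0 => [<- //||]; first by rewrite !size_cat /= !addnS ltnS ltnW.
    move: b0 hxy; rewrite /brc !has_cat /=; case: ifP => [/andP[_ /eqP <-]|]; last by rewrite eqxx.
    by case: x.1; rewrite // l30 mulr0 eqxx.
  have [/hasP[[b n] xw /= bt]|hw] := boolP (has fst w); last by exists w => // hw'; rewrite hw' in hw.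
  rewrite bt in xw; have [n0|n0] := lerP 0 n.
    exists (rcons (rem (true, n) w) (true, n)); last by move=> _; rewrite zap_ann ?linear0.
    by rewrite perm_sym perm_rcons perm_sym perm_to_rem.
  exists ((true, n) :: rem (true, n) w) => [|_]; first exact: perm_to_rem.
  by rewrite /= (_ : n = - (`|n|.-1).+1%:Z) ?fJ //; lia.
pose W v := exists2 s : seq (C * seq letter), all (fun p => has fst p.2) s &
  v = \sum_(p <- s) p.1 *: zap LL p.2 one.
have Wop x v : W v -> W (op LL x v).
  case=> s sp ->; exists [seq (p.1, x :: p.2) | p <- s].
    by rewrite all_map; apply: sub_all sp => p /= ->; rewrite orbT.
  by rewrite big_map linear_sum; apply: eq_bigr => p _; rewrite linearZ.
have J0 n v : Jo LL n v = 0.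
  apply/eqP/negPn/negP => /eqP Jv; have [s sE] := all_wspan LL v.
  have WJ : W (Jo LL n v).
    exists [seq (p.1, (true, n) :: p.2) | p <- s]; first by rewrite all_map; apply/allP => p _.
    by rewrite sE big_map linear_sum; apply: eq_bigr => p _; rewrite linearZ.
  have [|s' s'p oneE] := irreducible (LL := LL) (W := W) _ WJ Jv one.
    split=> [|a u u' [t tp ->] [t' t'p ->]|m u|m u]; first by exists [::]; rewrite ?big_nil.
    - exists ([seq (a * p.1, p.2) | p <- t] ++ t'); first by rewrite all_cat all_map t'p andbT; apply: sub_all tp.
      by rewrite big_cat big_map scaler_sumr /=; congr (_ + _); apply: eq_bigr => p _; rewrite scalerA.
    - exact: (Wop (false, m)).
    - exact: (Wop (true, m)).
  have : f one = 0.
    rewrite oneE linear_sum big_seq big1 // => p ps; rewrite linearZ /= Jword ?mulr0 //.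
    exact: (allP s'p).
  by rewrite f1 => /eqP; rewrite oner_eq0.
move=> v; apply: hU; move: v; apply: (generated (LL := LL)); last exact: posspan_om.
have Hv : @is_vir C V (real_complex R (complex.Re l1)) (Lo LL) by rewrite (conj_fixed_Re l1r); exact: Lo_vir.
split=> [|a u v|n v|n v _]; [exact: posspan0|exact: posspan_lin| |by rewrite J0; exact: posspan0].
by apply: (posspan_L Hv) => m; rewrite Lo_one.
Qed.

Hypothesis psd : forall v, 0 <= h v v.

Lemma herm_cs v : h v v = 0 -> forall u, h u v = 0.
Proof.
move=> hv u; apply/eqP/negPn/negP => huv.
(* With this [s] the value of the form at u - s z v is - h u u - 2, negative whatever h u u >= 0
   is. *)
pose z := h u v; pose s : C := (h u u + 1) / (z * z^*).
have zz : 0 < z * z^* by rewrite mul_conjC_gt0.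
have s0 : 0 <= s by rewrite divr_ge0 ?(ltW zz) // addr_ge0 ?ler01.
have := psd (u + (- (s * z)) *: v); rewrite hDl !hDr !hZl !hZr hv !mulr0 addr0 [h v u]hc -/z.
have zr : (z * z^*)^* = z * z^* by rewrite rmorphM /= conjCK mulrC.
have sr : s^* = s by rewrite conj_Creal // ger0_real.
rewrite rmorphN rmorphM /= sr.
have -> : h u u + - (s * z^*) * z + - (s * z) * z^* = h u u - s * (z * z^*) *+ 2 by ring.
rewrite /s divfK ?gt_eqF // => hh.
have := addr_ge0 hh (psd u); rewrite (_ : _ + _ = - 2%:R); last by ring.
by rewrite oppr_ge0 lern0.
Qed.

(** The isotropic vectors form the radical, a submodule that omits [one]; irreducibility makes it
    0. *)
Lemma herm_pd : positive_definite h.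
Proof.
move=> v v0; rewrite lt0r psd andbT; apply/eqP => /herm_cs rv.
have : forall w, (forall u, h u w = 0).
  apply: (irreducible (LL := LL) _ rv v0); split=> [u|a w w' e e' u|n w e u|n w e u].
  - exact: h0r.
  - by rewrite hDr hZr e e' mulr0 addr0.
  - by have := hL (- n) u w; rewrite opprK e => <-.
  - by have := hJ (- n) u w; rewrite opprK e => <-.
by move=> /(_ one one) /eqP; rewrite h1 oner_eq0.
Qed.

End WithForm.

End Unitarity.

Lemma cmin_real (R : realType) m : cmin R m = real_complex R (1 - 6%:R / (m * m.+1)%:R).
Proof. by rewrite /cmin rmorphB fmorph_div !rmorph_nat rmorph1. Qed.

Definition unitary_charge (R : realType) (c : R[i]) := 1 <= c \/ exists m : nat, (2 <= m)%N /\ c = cmin R m.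

Lemma unitary_charge_real (R : realType) (c : R[i]) : unitary_charge c ->
  exists2 r : R, c = real_complex R r & forall N, psd (gram (r / 2%:R) 0 N).
Proof.
case=> [c1|[m [m2 ->]]]; last by exists (1 - 6%:R / (m * m.+1)%:R); [exact: cmin_real|move=> N; exact: gram_psd_min].
have cr : c \is Num.real by exact: ger0_real (le_trans ler01 c1).
exists (complex.Re c); first by rewrite RRe_real.
by move=> N; apply: gram_psd_ge1; rewrite -lecR rmorph1 (RRe_real cr).
Qed.

Lemma unitary_charge_of_psd (R : realType) (r : R) : (forall N, psd (gram (r / 2%:R) 0 N)) ->
  unitary_charge (real_complex R r).
Proof.
move=> /vac_psd_nec[r1|[m [m2 ->]]]; first by left; rewrite -(rmorph1 (real_complex R)) lecR.
by right; exists m; rewrite cmin_real.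
Qed.

Lemma unitarity_conditionE (R : realType) (l1 l2 l3 : R[i]) : unitarity_condition l1 l2 l3 <->
  l2 = 0 /\ ((l3 = 0 /\ unitary_charge l1) \/ (0 < l3 /\ unitary_charge (l1 - 1))).
Proof.
have e (m : nat) : l1 = 1 + cmin R m <-> l1 - 1 = cmin R m.
  by split=> [->|<-]; [rewrite addrC addKr | rewrite addrC subrK].
have e2 : (2%:R <= l1) = (1 <= l1 - 1) by rewrite lerBrDr.
rewrite /unitarity_condition e2; split.
  by case=> [[h1 [h2 h3]]|[h1 [h2 [h3|[m [m2 /e h3]]]]]]; split=> //; [left | right | right]; split=> //;
    [left | right; exists m].
by case=> h1 [[h2 h3]|[h2 [h3|[m [m2 /e h3]]]]]; [left | right | right]; do 2 split=> //; [left | right; exists m].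
Qed.

Theorem theorem3p27 (R : realType) (l1 l2 l3 : R[i]) (V : lmodType R[i])
    (Y : V -> int -> V -> V) (one om I : V) (phi : V -> V) :
  is_LL Y l1 l2 l3 one om I ->
  is_phi Y one om I phi ->
  (unitary_wrt_sigma Y l1 l2 l3 one om I phi <-> unitarity_condition l1 l2 l3).
Proof.
move=> LL ph; rewrite unitarity_conditionE; pose C := (R[i] : numClosedFieldType); split.
  case=> _ [h [[hl hc] pd _ h1 [hL hI hl1 _ hl3]]].
  have hZr a u v : h v (a *: u) = a^* * h v u by exact: (hermZr hl hc).
  have h0l v : h 0 v = 0 by exact: (herm0l hl).
  have hZl a u v : h (a *: u) v = a * h u v by rewrite -[a *: u]addr0 hl h0l addr0.
  (* I_0 kills the vacuum, so contravariance of I_0 at [one] reads 0 = - 2 times the conjugate of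
     l2. *)
  have l20 : l2 = 0.
    have := hI 0 one one; rewrite oppr0 eqxx -(JoE LL) (Jo_one LL) // h0l sub0r -scaleNr hZr h1 mulr1.
    by move/esym/eqP; rewrite conjC_eq0 oppr_eq0 mulf_eq0 pnatr_eq0 => /eqP.
  have hL' (n : int) u v : h (Lo LL n u) v = h u (Lo LL (- n) v) by rewrite !LoE hL.
  have hJ' (n : int) u v : h (Jo LL n u) v = h u (Jo LL (- n) v).
    by rewrite !JoE hI l20 mulr0 if_same scale0r subr0.
  have l1r : l1^* = l1 by have := hl1 one one; rewrite hZl hZr h1 !mulr1.
  have l3r : l3^* = l3 by have := hl3 one one; rewrite hZl hZr h1 !mulr1.
  have p v : 0 <= h v v by have [->|/eqP /pd /ltW //] := eqVneq v 0; rewrite h0l.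
  have l3p : 0 <= l3.
    have := p (Jo LL (-1) one); rewrite hJ' opprK.
    have := J_J LL 1 (-1) one; rewrite [Jo LL 1 one]Jo_one // linear0 subr0 subrr eqxx mulr1z mul1r => ->.
    by rewrite hZr h1 mulr1 l3r.
  split=> //; move: l3p; rewrite le_eqVlt eq_sym => /orP[/eqP l30|l3p]; [left | right]; split=> //.
    have Hv : @is_vir C V (real_complex R (complex.Re l1)) (Lo LL) by rewrite (conj_fixed_Re l1r); exact: Lo_vir.
    rewrite -(conj_fixed_Re l1r); apply: unitary_charge_of_psd => N.
    by apply: (psd_of_herm Hv _ hl hc h1 hL' p) => n; rewrite Lo_one.
  have l1r' : (l1 - 1)^* = l1 - 1 by rewrite rmorphB rmorph1 /= l1r.
  have Hv : @is_vir C V (real_complex R (complex.Re (l1 - 1))) (hcoset l3 (Lo LL) (Jo_truncated LL)).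
    by rewrite (conj_fixed_Re l1r'); exact: H_vir.
  rewrite -(conj_fixed_Re l1r'); apply: unitary_charge_of_psd => N.
  apply: (psd_of_herm Hv _ hl hc h1 _ p) => [n|n u v]; first exact: H_one.
  by apply: H_adj.
case=> l20 cond; have [l1r l3r] : l1^* = l1 /\ l3^* = l3.
  case: cond => -[l3E /unitary_charge_real[r rE _]].
    by rewrite l3E rmorph0 rE; split=> //; exact: conjc_real.
  split; last by rewrite conj_Creal // gtr0_real.
  by rewrite -[l1](subrK 1) rE rmorphD rmorph1; congr (_ + _); exact: conjc_real.
have [h [hl hc h1 hL hJ]] := form_exists LL l20 l1r l3r.
have p : forall v, 0 <= h v v.
  case: cond => -[l3E /unitary_charge_real[r rE pr]].
    have Hv : @is_vir C V (real_complex R r) (Lo LL) by rewrite -rE; exact: Lo_vir.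
    apply: (psd_central0 (LL := LL) l20 l1r l3E).
    by apply: (herm_of_psd Hv _ hl hc h1 hL pr) => n; rewrite Lo_one.
  have Hv : @is_vir C V (real_complex R r) (hcoset l3 (Lo LL) (Jo_truncated LL)) by rewrite -rE; exact: H_vir.
  apply: (psd_coset (LL := LL) l20 l1r hl hc hJ l3E).
  apply: (herm_of_psd Hv _ hl hc h1 _ pr) => [n|n u v]; first exact: H_one.
  by apply: H_adj.
have hZr a u v : h v (a *: u) = a^* * h v u by exact: (hermZr hl hc).
have hZl a u v : h (a *: u) v = a * h u v by rewrite -[a *: u]addr0 hl (herm0l hl) addr0.
split.
  split; [by case: ph | exact: (phi_one LL l20 ph l1r l3r) | exact: (phi_om LL l20 ph l1r l3r) | |].
  - exact: (phi_Y LL l20 ph l1r l3r).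
  - exact: (phiK LL l20 ph l1r l3r).
exists h; split=> //.
- exact: (herm_pd hl hc h1 hL hJ p).
- by apply: (herm_invariant (LL := LL)).
split=> [n u v|n u v|u v|u v|u v].
- by rewrite -!(LoE LL).
- by rewrite l20 mulr0 if_same scale0r subr0 -!(JoE LL).
- by rewrite hZl hZr l1r.
- by rewrite hZl hZr l20 oppr0 rmorph0 !mul0r.
- by rewrite hZl hZr l3r.
Qed.
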